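(* Let $0<s<n/2$, $s=m+\gamma$ with $m\in\{0,1,2,\dots\}$, $\gamma\in[0,1)$, and let $f:\mathbb{R}^n\times[0,+\infty)\to[0,+\infty)$ be of class $C^{0,\varepsilon}_{loc}$ for some $\varepsilon\in(0,1)$. Let $c_{n,s}=\frac{\Gamma(\frac n2-s)}{\pi^{n/2}2^{2s}\Gamma(s)}$. Then: (i) any $v\in\mathcal L_s\cap C^{2m+\lfloor2\gamma\rfloor,\,2\gamma-\lfloor2\gamma\rfloor+\varepsilon}_{loc}(\mathbb{R}^n)$ solving $v(x)=c_{n,s}\int_{\mathbb{R}^n}\frac{f(y,v(y))}{|x-y|^{n-2s}}dy$ for all $x\in\mathbb{R}^n$ is a strong solution of $(-\Delta)^sv=f(x,v)$ in $\mathbb{R}^n$; (ii) let $v\in\mathcal L_s$ be a nonnegative strong solution of $(-\Delta)^sv=f(x,v)$ in $\mathbb{R}^n$. If either $f(x,t)$ is nondecreasing in $t\ge0$ and $\inf_{x\in\mathbb{R}^n}f(x,t)>0$ for every $t>0$, or $\lim_{|x|\to\infty}v(x)=0$, then $v$ is a nonnegative solution of $v(x)=c_{n,s}\int_{\mathbb{R}^n}\frac{f(y,v(y))}{|x-y|^{n-2s}}dy$, $x\in\mathbb{R}^n$.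
   Context: $(-\Delta)^\gamma$ ($0<\gamma<1$) is the fractional Laplacian with Fourier symbol $|\xi|^{2\gamma}$ (pointwise, up to a constant, $\mathrm{P.V.}\int\frac{v(x)-v(y)}{|x-y|^{n+2\gamma}}dy$); $(-\Delta)^0$ is the identity. $\mathcal L_s=\{v:\int_{\mathbb{R}^n}\frac{|v(x)|}{1+|x|^{n+2\gamma}}dx<\infty\}$. $v\in\mathcal L_s$ is a strong solution of $(-\Delta)^sv=F$ if $v\in C^{2m+\lfloor2\gamma\rfloor,2\gamma-\lfloor2\gamma\rfloor+\varepsilon'}_{loc}$ for some $\varepsilon'>0$ and $(-\Delta)^m(-\Delta)^\gamma v$ is pointwise defined, continuous, and equal to $F$. *)

(* Defs.v *)
From HB Require Import structures.
From mathcomp Require Import all_boot all_order all_algebra.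
From mathcomp Require Import all_classical all_reals all_analysis.
Set Implicit Arguments. Unset Strict Implicit. Unset Printing Implicit Defensive.
Import Order.TTheory GRing.Theory Num.Theory.
Import numFieldNormedType.Exports.
Local Open Scope classical_set_scope.
Local Open Scope ring_scope.

Section Defs.
Variable R : realType.

Definition enorm (n : nat) (x : 'rV[R]_n) : R := Num.sqrt (\sum_(i < n) x ord0 i ^+ 2).

Definition ebase (n : nat) (i : 'I_n) : 'rV[R]_n := delta_mx ord0 i.

(* Lebesgue integral over R^n, realized as the iterated one-dimensional Lebesgue
   integral (by Tonelli/Fubini this is the n-dimensional Lebesgue integral for
   nonnegative measurable or absolutely integrable integrands). *)
Fixpoint intRn (n : nat) : ('rV[R]_n -> \bar R) -> \bar R :=
  match n return ('rV[R]_n -> \bar R) -> \bar R with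
  | 0 => fun F => F 0
  | n'.+1 => fun F =>
      (\int[@lebesgue_measure R]_t intRn (fun w : 'rV[R]_n' =>
                                     F (row_mx (const_mx t : 'rV[R]_1) w)))%E
  end.

Definition Gamma (a : R) : R :=
  let h := fun t : R => (powR t (a - 1) * expR (- t))%R in
  fine (\int[@lebesgue_measure R]_(t in [set t : R | (0 < t)%R]) (h t)%:E)%E.

Definition cns (n : nat) (s : R) : R :=
  Gamma (n%:R / 2 - s) / (pi `^ (n%:R / 2) * 2 `^ (2 * s) * Gamma s).

(* normalising constant of (-Delta)^g, 0<g<1, so that its Fourier symbol is |xi|^{2g}:
   C_{n,g} = 4^g Gamma(n/2+g) / (pi^{n/2} |Gamma(-g)|),  |Gamma(-g)| = Gamma(1-g)/g *)
Definition Cfl (n : nat) (g : R) : R :=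
  g * 4 `^ g * Gamma (n%:R / 2 + g) / (pi `^ (n%:R / 2) * Gamma (1 - g)).

Definition Ls (n : nat) (g : R) (v : 'rV[R]_n -> R) : Prop :=
  (intRn (fun x => (`|v x| / (1 + enorm x `^ (n%:R + 2 * g)))%:E) < +oo)%E.

Definition pd (n : nat) (i : 'I_n) (u : 'rV[R]_n -> R) : 'rV[R]_n -> R :=
  fun x => 'D_(ebase i) u x.

Definition hoelder_loc (n : nat) (a : R) (u : 'rV[R]_n -> R) : Prop :=
  forall r : R, 0 < r -> exists C : R, forall x y : 'rV[R]_n,
    enorm x <= r -> enorm y <= r -> `|u x - u y| <= C * enorm (x - y) `^ a.

Fixpoint Ckloc (n : nat) (k : nat) (a : R) (u : 'rV[R]_n -> R) : Prop :=
  match k with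
  | 0 => continuous u /\ hoelder_loc a u
  | k'.+1 => (forall x i, derivable u x (ebase i)) /\ forall i, Ckloc k' a (pd i u)
  end.

Definition neg_lap (n : nat) (u w : 'rV[R]_n -> R) : Prop :=
  forall x, (forall i, derivable u x (ebase i) /\ derivable (pd i u) x (ebase i)) /\
            w x = - \sum_(i < n) pd i (pd i u) x.

Fixpoint iter_neg_lap (n : nat) (k : nat) (w F : 'rV[R]_n -> R) : Prop :=
  match k with
  | 0 => F = w
  | k'.+1 => exists g, neg_lap w g /\ iter_neg_lap k' g F
  end.

Definition fl_trunc (n : nat) (g : R) (v : 'rV[R]_n -> R) (x : 'rV[R]_n) (e : R) : \bar R :=
  intRn (fun y => (if e < enorm (x - y) then
                     (v x - v y) / enorm (x - y) `^ (n%:R + 2 * g) else 0)%:E).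

Definition frac_lap (n : nat) (g : R) (v w : 'rV[R]_n -> R) : Prop :=
  (g = 0 -> w = v) /\
  (g <> 0 -> forall x,
     (\forall e \near 0^'+, fl_trunc g v x e \is a fin_num) /\
     ((fun e => Cfl n g * fine (fl_trunc g v x e)) @ 0^'+ --> w x)).

Definition strong_sol (n m : nat) (g : R) (v F : 'rV[R]_n -> R) : Prop :=
  Ls g v /\
  (exists e' : R, 0 < e' /\
     Ckloc (2 * m + Num.truncn (2 * g))%N (2 * g - (Num.truncn (2 * g))%:R + e') v) /\
  exists w, frac_lap g v w /\ iter_neg_lap m w F /\ continuous F.

Definition integral_eq (n : nat) (s : R) (f : 'rV[R]_n -> R -> R) (v : 'rV[R]_n -> R) : Prop :=
  forall x, ((v x)%:E = (cns n s)%:E *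
      intRn (fun y => (f y (v y) / enorm (x - y) `^ (n%:R - 2 * s))%:E))%E.

Definition hoelder_loc_f (n : nat) (e : R) (f : 'rV[R]_n -> R -> R) : Prop :=
  forall r : R, 0 < r -> exists C : R, forall (x y : 'rV[R]_n) (t u : R),
    enorm x <= r -> enorm y <= r -> 0 <= t <= r -> 0 <= u <= r ->
    `|f x t - f y u| <= C * (enorm (x - y) ^+ 2 + (t - u) ^+ 2) `^ (e / 2).

End Defs.

(* Main.v *)
(* Both parts compare v with the heat flow of F(x) = f(x,v(x)). Writing P_t for
   the heat semigroup, subordination turns the Riesz potential of F into
   J^s q(0), where q(t) = P_t F(x) and J^a is the fractional integral
   (1/Gamma(a)) int_0^oo tau^(a-1) q(t+tau) dtau, and turns (-Delta)^g u into
   kappa int_0^oo tau^(-g-1) (u - P_tau u) dtau. Part (i) is then the inversion of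
   J^g at t = 0 followed by m applications of the generator of the semigroup.
   For part (ii), Green's formula against cut-off Gaussians shows that q is the
   Marchaud derivative of order g of H_m, where H_j(t) = (-Delta)^j P_t v (x);
   inverting it on truncated intervals and integrating m times from infinity gives
   P_t v = K + J^s q(t) with K >= 0. Letting t -> 0, K is a function fixed by the
   heat semigroup, so the Harnack inequality bounds K(x) by a multiple of K(x')
   independent of the points, and either alternative on v forces K = 0. *)
Require Import Defs.
From HB Require Import structures.
From mathcomp Require Import all_boot all_order all_algebra.
From mathcomp Require Import all_classical all_reals all_analysis.
From mathcomp Require Import measurable_realfun.
From mathcomp Require Import ring lra.
Set Implicit Arguments. Unset Strict Implicit. Unset Printing Implicit Defensive.
Import Order.TTheory GRing.Theory Num.Theory.
Import numFieldNormedType.Exports.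
Local Open Scope classical_set_scope.
Local Open Scope ring_scope.

Local Notation msble := (measurable_fun setT).
Local Notation intgr mu f := (mu.-integrable setT (EFin \o f)).

(** No Fourier transform is used: $|z|^{-n-2g}$ and $|z|^{2s-n}$ are both time mixtures of
    Gaussians, so for fixed $x$ the problem is about functions of $t>0$ with $H_j' = -H_{j+1}$, and
    most interchanges are Tonelli. [intRn] being an iterated integral, a measure on $\mathbb{R}^n$
    is built with which it agrees. The obstacle in (ii) is the behaviour at infinity. The two terms
    of the Marchaud integral of $H_m$ are not separately integrable near $0$, and $H_0$ need not
    tend to $0$. On $(0,M)$, however, the inversion is an identity between nonnegative quantities
    whose remainder sees $H$ only beyond $M$; hence two functions that agree at infinity have the
    same defect. Membership in [Ls] gives $H_j = O(t^{g-j})$, which vanishes at infinity for $j \ge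
    1$, so $H_m$ is compared with $0$ when $m \ge 1$. For $m = 0$ the function $H_0$ only varies
    slowly, and it is compared with its own time shift: this is where a constant $K$ can survive. In
    (ii) nothing bounds the growth of $F$. Its integrability against Gaussians is itself a
    conclusion, drawn by monotone convergence along increasing compactly supported cut-offs of the
    heat kernel. *)

Lemma eq_leW d (T : porderType d) (x y : T) : x = y -> (x <= y)%O.
Proof. by move=> ->. Qed.

(** * Lebesgue measure on ['rV[R]_n] and its agreement with the iterated integral *)

Section coordinate_sigma_algebra.
Context {R : realType} {n : nat}.

(** Generating by the coordinates makes a map into ['rV[R]_n] measurable as soon as its coordinates
    are, and matches the product structure behind the iterated integral. *)
Definition coord_gen : set (set 'rV[R]_n) :=
 [set A | exists (i : 'I_n) (B : set R), measurable B /\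
   A = (fun x : 'rV[R]_n => x ord0 i) @^-1` B].

Definition rV_display : measure_display. Proof. exact: default_measure_display. Qed.

HB.instance Definition _ := @isMeasurable.Build rV_display
 'rV[R]_n <<s coord_gen >> (@sigma_algebra0 _ setT coord_gen)
 (@sigma_algebraC _ coord_gen) (@sigma_algebra_bigcup _ setT coord_gen).

End coordinate_sigma_algebra.

Section rV_measurable.
Context {R : realType}.

Lemma msble_coord n (i : 'I_n) :
 msble (fun x : 'rV[R]_n => x ord0 i).
Proof.
move=> _ B mB; rewrite setTI; apply: sub_sigma_algebra.
by exists i, B.
Qed.

Lemma msble_to_rV d (T : measurableType d) n (f : T -> 'rV[R]_n) :
 (forall i, msble (fun t => f t ord0 i)) -> msble f.
Proof.
move=> mf; apply: measurability => // _ -[_ [i [B [mB ->]]] <-].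
exact: (mf i).
Qed.

(** The same gluing of a coordinate and a row as in [intRn], so that the iterated integral unfolds
    to an integral over a product space. *)
Definition rcons1 n (p : R * 'rV[R]_n) : 'rV[R]_(n.+1) :=
 row_mx (const_mx p.1 : 'rV[R]_1) p.2.
Definition uncons1 n (x : 'rV[R]_(n.+1)) : R * 'rV[R]_n :=
 (x ord0 ord0, @rsubmx R 1 1 n x).

Lemma rcons1_0 n p : @rcons1 n p ord0 ord0 = p.1.
Proof.
have -> : (ord0 : 'I_n.+1) = lshift n (ord0 : 'I_1) by exact/val_inj.
by rewrite /rcons1; etransitivity; [exact: (@row_mxEl _ 1 1 n)|rewrite mxE].
Qed.

Lemma rcons1_S n p i : @rcons1 n p ord0 (lift ord0 i) = p.2 ord0 i.
Proof.
have -> : lift ord0 i = rshift 1 i by exact/val_inj.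
exact: (@row_mxEr _ 1 1 n).
Qed.

Lemma rcons1K n : cancel (@rcons1 n) (@uncons1 n).
Proof.
move=> [t w]; rewrite /uncons1 rcons1_0 /=; congr (_, _).
by rewrite /rcons1 row_mxKr.
Qed.

Lemma msble_rcons1 n : msble (@rcons1 n).
Proof.
apply: msble_to_rV => i; case: (unliftP ord0 i) => [j ->|->].
 under eq_fun do rewrite rcons1_S.
 exact: (measurableT_comp (msble_coord j) measurable_snd).
by under eq_fun do rewrite rcons1_0; exact: measurable_fst.
Qed.

Lemma msble_uncons1 n : msble (@uncons1 n).
Proof.
apply/measurable_fun_pairP; split.
 exact: msble_coord.
apply: msble_to_rV => i /=.
rewrite (_ : (fun _ => _) = (fun x : 'rV_n.+1 => x ord0 (lift ord0 i))).
 exact: msble_coord.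
by apply/funext => x /=; rewrite mxE; congr (x _ _); exact/val_inj.
Qed.

(* [R] and [measurableTypeR R] carry the same sigma-algebra under different
  displays; [leb1] is Lebesgue measure on the former. *)
Definition leb1 : set R -> \bar R := fun A => @lebesgue_measure R A.

Let leb1_0 : leb1 set0 = 0%E. Proof. exact: measure0. Qed.
Let leb1_ge0 A : (0 <= leb1 A)%E. Proof. exact: (measure_ge0 (@lebesgue_measure R)). Qed.
Let leb1_sigma_additive : semi_sigma_additive leb1.
Proof.
move=> F mF tF mUF.
exact: (@measure_semi_sigma_additive _ _ _ (@lebesgue_measure R) F mF tF mUF).
Qed.
HB.instance Definition _ := isMeasure.Build _ _ _ leb1
 leb1_0 leb1_ge0 leb1_sigma_additive.

Let leb1_sigma_finite : sigma_finite setT leb1.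
Proof. by have [F TF mF] := sigma_finiteT (@lebesgue_measure R); exists F. Qed.
HB.instance Definition _ := Measure_isSigmaFinite.Build _ _ _ leb1
 leb1_sigma_finite.

Local Open Scope ereal_scope.
Lemma ge0_integral_leb1 (D : set R) (f : R -> \bar R) : measurable D ->
 measurable_fun D f -> (forall x, D x -> 0 <= f x) ->
 \int[leb1]_(x in D) f x = \int[@lebesgue_measure R]_(x in D) f x.
Proof.
move=> mD mf f0.
have mid : measurable_fun [set: measurableTypeR R] (id : measurableTypeR R -> R).
 by move=> _ B mB; rewrite setTI.
have := @ge0_integral_pushforward _ _ (measurableTypeR R) R R id mid
 (@lebesgue_measure R) D f mD mf.
by rewrite preimage_id => <- // y /set_mem; exact: f0.
Qed.

Lemma integral_leb1 (D : set R) (f : R -> \bar R) : measurable D ->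
 measurable_fun D f ->
 \int[leb1]_(x in D) f x = \int[@lebesgue_measure R]_(x in D) f x.
Proof.
move=> mD mf; rewrite integralE [RHS]integralE; congr (_ - _).
 by rewrite ge0_integral_leb1//; exact: measurable_funepos.
by rewrite ge0_integral_leb1//; exact: measurable_funeneg.
Qed.
Local Close Scope ereal_scope.

Section succ_measure.
Variables (n : nat) (m : {sigma_finite_measure set 'rV[R]_n -> \bar R}).

Definition leb_succ : set 'rV[R]_n.+1 -> \bar R :=
 pushforward (leb1 \x m)%E (@rcons1 n).

Let leb_succ0 : leb_succ set0 = 0%E.
Proof. by rewrite /leb_succ /pushforward preimage_set0 measure0. Qed.

Let leb_succ_ge0 A : (0 <= leb_succ A)%E.
Proof. by rewrite /leb_succ /pushforward; apply: (measure_ge0 (leb1 \x m)%E). Qed.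

Let leb_succ_sigma_additive : semi_sigma_additive leb_succ.
Proof.
have mf := @msble_rcons1 n.
move=> F mF tF mUF; rewrite /leb_succ /pushforward preimage_bigcup.
apply: measure_semi_sigma_additive.
- by move=> k; rewrite -[X in measurable X]setTI; exact: mf.
- apply/trivIsetP => /= i j _ _ ij; rewrite -preimage_setI.
 by move/trivIsetP : tF => /(_ _ _ _ _ ij) ->//; rewrite preimage_set0.
- by rewrite -preimage_bigcup -[X in measurable X]setTI; exact: mf.
Qed.

HB.instance Definition _ := isMeasure.Build _ _ _ leb_succ
 leb_succ0 leb_succ_ge0 leb_succ_sigma_additive.

Let leb_succ_sigma_finite : sigma_finite setT leb_succ.
Proof.
have /sigma_finiteP[F [TF ndF Foo]] := sigma_finiteT leb1.
have /sigma_finiteP[G [TG ndG Goo]] := sigma_finiteT m.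
(* The exhaustions [F] and [G] are taken increasing, so that a point whose components enter at ranks
   [i] and [k] lies in the box of rank [maxn i k]. *)
exists (fun k => @uncons1 n @^-1` (F k `*` G k)).
 rewrite -preimage_bigcup (_ : \bigcup_k _ = setT) ?preimage_setT//.
 rewrite -setXTT TF TG predeqE => -[x y]; split.
  by move=> [k _ []/= ? ?]; split; exists k.
 move=> [/= [i _ Fx] [k _ Gy]]; exists (maxn i k) => //; split.
 - by move: x Fx; exact/subsetPset/ndF/leq_maxl.
 - by move: y Gy; exact/subsetPset/ndG/leq_maxr.
move=> k; have [? ?] := Foo k; have [? ?] := Goo k; split.
 by rewrite -[X in measurable X]setTI; apply: msble_uncons1 => //; exact: measurableX.
rewrite /leb_succ /pushforward -comp_preimage.
rewrite (_ : _ \o _ = id) ?preimage_id; last first.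
 by apply/funext => p /=; rewrite rcons1K.
by rewrite product_measure1E// lte_mul_pinfty// ge0_fin_numE.
Qed.

HB.instance Definition _ := Measure_isSigmaFinite.Build _ _ _ leb_succ
 leb_succ_sigma_finite.

End succ_measure.

(** In dimension 0 the measure is the Dirac mass at the only point, in accordance with the base case
    of [intRn]. *)
Fixpoint lebn n : {sigma_finite_measure set 'rV[R]_n -> \bar R} :=
 match n return {sigma_finite_measure set 'rV[R]_n -> \bar R} with
 | 0 => [the {sigma_finite_measure set 'rV[R]_0 -> \bar R} of \d_ (0 : 'rV[R]_0)]
 | n'.+1 => [the {sigma_finite_measure set 'rV[R]_n'.+1 -> \bar R} of leb_succ (lebn n')]
 end.

Local Open Scope ereal_scope.

Lemma integral_lebnS n (F : 'rV[R]_n.+1 -> \bar R) : msble F ->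
 (forall x, 0 <= F x) ->
 \int[lebn n.+1]_x F x = \int[leb1 \x lebn n]_p F (rcons1 p).
Proof.
move=> mF F0; rewrite /=.
have := @ge0_integral_pushforward _ _ (R * 'rV[R]_n)%type 'rV[R]_n.+1 R (@rcons1 n)
 (@msble_rcons1 n) (leb1 \x lebn n) setT F measurableT mF
 (fun x _ => F0 x).
by rewrite preimage_setT => <-.
Qed.

(** Splitting into positive and negative parts reduces the signed case to the measurability part of
    Tonelli's theorem. *)
Lemma msble_fun_integral2 d (T : measurableType d) (H : T * R -> \bar R) :
 msble H ->
 msble (fun t => \int[leb1]_s H (t, s)).
Proof.
move=> mH; rewrite [X in measurable_fun _ X](_ : _ =
 (fubini_F leb1 H^\+ \- fubini_F leb1 H^\-)); last first.
 by apply/funext => t; rewrite integralE; congr (_ - _); apply: eq_integral => s _; rewrite ?funeposE ?funenegE.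
apply: emeasurable_funB.
 by apply: measurable_fun_fubini_tonelli_F => //; exact: measurable_funepos.
by apply: measurable_fun_fubini_tonelli_F => //; exact: measurable_funeneg.
Qed.

(** The parameter ranges over an arbitrary measurable space: the induction on the dimension adds the
    first coordinate to the parameter, replacing [T] by [T * R]. *)
Lemma msble_intRn n d (T : measurableType d) (F : T * 'rV[R]_n -> \bar R) :
 msble F ->
 msble (fun t => intRn (fun w => F (t, w))).
Proof.
elim: n d T F => [|n IH] d T F mF.
 exact: (measurableT_comp mF (pair2_measurable _)).
pose G (p : T * R) := intRn (fun w => F (p.1, rcons1 (p.2, w))).
have mG : msble G; last first.
 rewrite [X in measurable_fun _ X](_ : _ = fun t => \int[leb1]_s G (t, s)).
  exact: msble_fun_integral2.
 apply/funext => t /=; rewrite integral_leb1//.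
 by apply: (measurableT_comp mG); exact: pair1_measurable.
apply: (IH _ _ (fun q : (T * R) * 'rV[R]_n => F (q.1.1, rcons1 (q.1.2, q.2)))).
apply: (measurableT_comp mF); apply/measurable_fun_pairP; split => /=.
 exact: measurableT_comp measurable_fst measurable_fst.
apply: (measurableT_comp (@msble_rcons1 n)) => /=.
apply/measurable_fun_pairP; split => /=.
 exact: measurableT_comp measurable_snd measurable_fst.
exact: measurable_snd.
Qed.

Lemma intRnS n (F : 'rV[R]_n.+1 -> \bar R) : msble F ->
 intRn F = \int[leb1]_t intRn (fun w => F (rcons1 (t, w))).
Proof.
move=> mF; rewrite integral_leb1//.
apply: (@msble_intRn _ _ _ (F \o @rcons1 n)).
by apply: measurableT_comp => //; exact: msble_rcons1.
Qed.

Lemma intRn_ge0E n (F : 'rV[R]_n -> \bar R) : msble F ->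
 (forall x, 0 <= F x) -> intRn F = \int[lebn n]_x F x.
Proof.
elim: n F => [|n IH] F mF F0.
 by rewrite /= integral_dirac// diracT mul1e.
have mFr : msble (F \o @rcons1 n).
 by apply: measurableT_comp => //; exact: msble_rcons1.
rewrite intRnS// integral_lebnS// -/(F \o @rcons1 n) fubini_tonelli1//=.
apply: eq_integral => t _; rewrite /fubini_F /=.
by rewrite -IH//; apply: (measurableT_comp mFr); exact: pair1_measurable.
Qed.

Lemma integrable_lebnS n (F : 'rV[R]_n.+1 -> \bar R) :
 (lebn n.+1).-integrable setT F ->
 (leb1 \x lebn n).-integrable setT (F \o @rcons1 n).
Proof.
move=> /integrableP[mF Foo]; apply/integrableP; split.
 by apply: measurableT_comp => //; exact: msble_rcons1.
rewrite integral_lebnS// in Foo; exact: measurableT_comp.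
Qed.

Lemma eq_intRn n (F G : 'rV[R]_n -> \bar R) : F =1 G -> intRn F = intRn G.
Proof. by move=> /funext ->. Qed.

(** For signed functions the two inner integrals agree only for almost every first coordinate, since
    Fubini makes only almost every slice integrable; this is enough for the outer integral. *)
Lemma intRn_integrableE n (F : 'rV[R]_n -> \bar R) :
 (lebn n).-integrable setT F -> intRn F = \int[lebn n]_x F x.
Proof.
elim: n F => [|n IH] F iF.
 have mF := measurable_int _ iF.
 by rewrite /= integral_dirac// diracT mul1e.
have mF := measurable_int _ iF.
have iFr := integrable_lebnS iF.
have mFr := measurable_int _ iFr.
rewrite intRnS//; transitivity (\int[leb1 \x lebn n]_p (F \o @rcons1 n) p).
 rewrite -integral12_prod_meas1//= /fubini_F.
 apply: ae_eq_integral => //.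
 - exact: (msble_intRn mFr).
 - exact: (measurable_fubini_F iFr).
 - by have := ae_integrable1 iFr; apply: filterS => t it _; exact: IH.
rewrite [RHS]integralE [LHS]integralE; congr (_ - _).
 rewrite integral_lebnS//; last exact: measurable_funepos.
 by apply: eq_integral => p _; rewrite !funeposE.
rewrite integral_lebnS//; last exact: measurable_funeneg.
by apply: eq_integral => p _; rewrite !funenegE.
Qed.

Lemma msble_rV_add d (T : measurableType d) n (f g : T -> 'rV[R]_n) :
 msble f -> msble g ->
 msble (fun t => f t + g t)%R.
Proof.
move=> mf mg; apply: msble_to_rV => i.
under eq_fun do rewrite mxE.
by apply: measurable_funD; [exact: (measurableT_comp (msble_coord i) mf)|
 exact: (measurableT_comp (msble_coord i) mg)].
Qed.

Lemma msble_rV_opp d (T : measurableType d) n (f : T -> 'rV[R]_n) :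
 msble f -> msble (fun t => - f t)%R.
Proof.
move=> mf; apply: msble_to_rV => i.
under eq_fun do rewrite mxE.
by apply: measurableT_comp => //; exact: (measurableT_comp (msble_coord i) mf).
Qed.

Lemma msble_rV_sub d (T : measurableType d) n (f g : T -> 'rV[R]_n) :
 msble f -> msble g ->
 msble (fun t => f t - g t)%R.
Proof. by move=> mf mg; apply: msble_rV_add => //; exact: msble_rV_opp. Qed.

Lemma msble_rV_scale d (T : measurableType d) n (a : T -> R) (f : T -> 'rV[R]_n) :
 msble a ->
 msble f -> msble (fun t => a t *: f t)%R.
Proof.
move=> ma mf; apply: msble_to_rV => i.
under eq_fun do rewrite mxE.
by apply: measurable_funM => //; exact: (measurableT_comp (msble_coord i) mf).
Qed.

Lemma msble_enorm n : msble (@enorm R n).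
Proof.
rewrite /enorm; apply: measurableT_comp.
 by apply: continuous_measurable_fun; exact: sqrt_continuous.
rewrite [X in measurable_fun _ X](_ : _ =
 (fun x => \sum_(i <- index_enum 'I_n) (fun i (x : 'rV[R]_n) => (x ord0 i) ^+ 2) i x)%R) //.
apply: measurable_sum => i; apply: measurable_funX; exact: msble_coord.
Qed.

Local Close Scope ereal_scope.

Lemma rV_norm_le n (x : 'rV[R]_n) e : 0 <= e ->
 (forall i, `|x ord0 i| <= e) -> `|x| <= e.
Proof.
move=> e0 xe; rewrite [leLHS]mx_normrE; apply/bigmax_leP; split => // -[i j] _ /=.
by rewrite (ord1 i).
Qed.

Lemma coord_le_norm n (x : 'rV[R]_n) i : `|x ord0 i| <= `|x|.
Proof.
rewrite [leRHS]mx_normrE.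
exact: (@le_bigmax _ _ _ 0 (fun p : 'I_1 * 'I_n => `|x p.1 p.2|) (ord0, i)).
Qed.

(* A continuous function is the pointwise limit of its values at the points of
  the lattices Z^n / (k + 1), hence measurable. *)
Lemma cont_rV_msble n (u : 'rV[R]_n -> R) :
 continuous u -> msble u.
Proof.
move=> cu.
pose a k : 'rV[R]_n -> 'rV[int]_n := fun x => \row_i Num.floor (x ord0 i * k.+1%:R).
pose b k (z : 'rV[int]_n) : 'rV[R]_n := \row_i ((z ord0 i)%:~R / k.+1%:R).
have ma k (z : 'rV[int]_n) : measurable (a k @^-1` [set z]).
 rewrite (_ : _ @^-1` _ = \bigcap_(i in [set: 'I_n])
   (fun x : 'rV[R]_n => x ord0 i * k.+1%:R) @^-1`
    `[(z ord0 i)%:~R, (z ord0 i + 1)%:~R[).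
  apply: fin_bigcap_measurable => // i _.
  rewrite -[X in measurable X]setTI.
  have mi : msble (fun x : 'rV[R]_n => x ord0 i * k.+1%:R).
   by apply: measurable_funM => //; exact: msble_coord.
  exact: mi.
 apply/seteqP; split => x /=.
  by move=> <- i _ /=; rewrite in_itv/= mxE floor_itv.
 move=> xz; apply/rowP => i; rewrite mxE; apply/eqP.
 by have := xz i I; rewrite /= in_itv/= -floor_eq.
(* The lattice is countable, so the preimage of [Y] is a countable union of the cells over those
   lattice points at which [u] takes a value in [Y]. *)
have muk k : msble (fun x => u (b k (a k x))).
 move=> _ Y mY; rewrite setTI.
 rewrite (_ : _ @^-1` _ = \bigcup_(z : 'rV[int]_n)
   (if `[< Y (u (b k z)) >] then a k @^-1` [set z] else set0)).
  apply: countable_bigcupT_measurable => [|z]; first exact: countableP.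
  by case: ifP.
 apply/seteqP; split => [x /= Yx|x [z _]].
  by exists (a k x) => //; rewrite asboolT.
 by case: asboolP => //= Yz ->.
apply: (@measurable_fun_cvg _ _ _ setT (fun k x => u (b k (a k x)))) => // x _.
apply: (cvg_comp (fun k => b k (a k x)) u _ (cu x)).
apply/cvgrPdist_le => e e0; near=> k.
apply: rV_norm_le; first exact: ltW.
move=> i; rewrite !mxE.
have k0 : 0 < k.+1%:R :> R by rewrite ltr0n.
have -> : x ord0 i - (Num.floor (x ord0 i * k.+1%:R))%:~R / k.+1%:R =
 (x ord0 i * k.+1%:R - (Num.floor (x ord0 i * k.+1%:R))%:~R) / k.+1%:R.
 by rewrite mulrBl mulfK// gt_eqF.
have /andP[f1 f2] := floor_itv (x ord0 i * k.+1%:R).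
rewrite ger0_norm; last by rewrite divr_ge0 ?subr_ge0// ltW.
apply: (@le_trans _ _ (k.+1%:R^-1)).
 rewrite -[leRHS]mul1r ler_wpM2r ?invr_ge0 ?(ltW k0)//.
 by rewrite lerBlDr ltW// (lt_le_trans f2)// rmorphD/= addrC.
apply: ltW; near: k; exact: (near_infty_natSinv_lt (PosNum e0)).
Unshelve. all: by end_near. Qed.

End rV_measurable.

(** * Image measures and affine invariance of Lebesgue measure *)

Section push_measure.
Context d1 d2 (T1 : measurableType d1) (T2 : measurableType d2) (R : realType).
Variables (f : T1 -> T2) (m : {measure set T1 -> \bar R}).

(* Unlike [pushforward], the measurability proof is an argument, which lets the
  measure structure be inferred. *)
Definition push (_ : msble f) : set T2 -> \bar R := pushforward m f.
Variable mf : msble f.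

Let push0 : push mf set0 = 0%E.
Proof. by rewrite /push /pushforward preimage_set0 measure0. Qed.

Let push_ge0 A : (0 <= push mf A)%E.
Proof. exact: measure_ge0. Qed.

Let push_sigma_additive : semi_sigma_additive (push mf).
Proof.
move=> F mF tF mUF; rewrite /push /pushforward preimage_bigcup.
apply: measure_semi_sigma_additive.
- by move=> k; rewrite -[X in measurable X]setTI; exact: mf.
- apply/trivIsetP => /= i j _ _ ij; rewrite -preimage_setI.
 by move/trivIsetP : tF => /(_ _ _ _ _ ij) ->//; rewrite preimage_set0.
- by rewrite -preimage_bigcup -[X in measurable X]setTI; exact: mf.
Qed.

HB.instance Definition _ := isMeasure.Build _ _ _ (push mf)
 push0 push_ge0 push_sigma_additive.
End push_measure.

Section invariance.
Context {R : realType}.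
Local Open Scope ereal_scope.

(** Uniqueness of Lebesgue measure: [|c|] times the image measure has the right value on half-open
    intervals. For negative [c] the preimage is half-open at the other end, which does not change
    its length. *)
Lemma leb1_affine (c a : R) (A : set R) : (c != 0)%R -> measurable A ->
 leb1 ((fun x => c * x + a)%R @^-1` A) = (`|c|^-1)%:E * leb1 A.
Proof.
move=> c0 mA.
have mphi : measurable_fun [set: measurableTypeR R]
  (fun x => c * x + a : measurableTypeR R)%R.
 have : measurable_fun [set: R] (fun x : R => c * x + a)%R.
  by apply: measurable_funD => //; apply: measurable_funM.
 exact.
have nc : (0 < `|c|)%R by rewrite normr_gt0.
pose nu := mscale (NngNum (ltW nc)) (push (@lebesgue_measure R) mphi).
have nuE : forall X, ocitv X -> lebesgue_measure X = nu X.
 move=> _ [[a0 b0] _ <-] /=; rewrite /nu /mscale/= /push /pushforward.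
 have [cp|cn] := ltP 0%R c.
  rewrite (_ : _ @^-1` _ = [set` `](a0 - a) / c, (b0 - a) / c]%R]); last first.
   apply/seteqP; split => x /=; rewrite !in_itv/= ltr_pdivrMr// ler_pdivlMr//;
   by rewrite ltrBlDr lerBrDr (mulrC x).
  rewrite !lebesgue_measure_itv/= !lte_fin ltr_pM2r ?invr_gt0// ltrD2r.
  case: ifP => _; last by rewrite mule0.
  by rewrite -!EFinB -EFinM ger0_norm ?(ltW cp)//; congr EFin; field.
 have {}cn : (c < 0)%R by rewrite lt_neqAle c0.
 rewrite (_ : _ @^-1` _ = [set` `[(b0 - a) / c, (a0 - a) / c[%R]); last first.
  apply/seteqP; split => x /=; rewrite !in_itv/= ltr_ndivlMr// ler_ndivrMr//;
  by rewrite ltrBlDr lerBrDr (mulrC x) andbC.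
 rewrite !lebesgue_measure_itv/= !lte_fin ltr_nM2r ?invr_lt0// ltrD2r.
 case: ifP => _; last by rewrite mule0.
 by rewrite -!EFinB -EFinM ltr0_norm//; congr EFin; field; rewrite lt_eqF.
have -> : leb1 A = nu A by apply: lebesgue_measure_unique.
rewrite /nu /mscale /= /push /pushforward muleA -EFinM mulVf ?mul1e//.
by rewrite gt_eqF.
Qed.

Lemma ge0_integral_affine (c a : R) (f : R -> \bar R) : (c != 0)%R ->
 msble f -> (forall x, 0 <= f x) ->
 \int[leb1]_x f (c * x + a)%R = (`|c|^-1)%:E * \int[leb1]_x f x.
Proof.
move=> c0 mf f0.
have mphi : measurable_fun [set: R] (fun x : R => c * x + a)%R.
 by apply: measurable_funD => //; apply: measurable_funM.
have nc : (0 <= `|c|^-1)%R by rewrite invr_ge0.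
have := @ge0_integral_pushforward _ _ R R R _ mphi leb1 setT f measurableT mf
 (fun x _ => f0 x).
rewrite preimage_setT => <-.
rewrite (@eq_measure_integral _ R R setT (mscale (NngNum nc) leb1)).
 by rewrite ge0_integral_mscale.
by move=> A mA _ /=; rewrite /mscale /= /push /pushforward leb1_affine.
Qed.

Lemma integral_shift (a : R) (f : R -> \bar R) : msble f ->
 \int[leb1]_x f (x + a)%R = \int[leb1]_x f x.
Proof.
have h (g : R -> \bar R) : msble g -> (forall x, 0 <= g x) ->
  \int[leb1]_x g (x + a)%R = \int[leb1]_x g x.
 move=> mg g0; have := @ge0_integral_affine 1%R a g (oner_neq0 _) mg g0.
 by rewrite normr1 invr1 mul1e => <-; apply: eq_integral => y _; rewrite mul1r.
move=> mf; rewrite integralE [RHS]integralE; congr (_ - _).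
 rewrite -[RHS]h//; last exact: measurable_funepos.
 by apply: eq_integral => x _; rewrite !funeposE.
rewrite -[RHS]h//; last exact: measurable_funeneg.
by apply: eq_integral => x _; rewrite !funenegE.
Qed.

Lemma integral_scale (c : R) (f : R -> \bar R) : (0 < c)%R ->
 msble f -> (forall x, 0 <= f x) ->
 \int[leb1]_x f (c * x)%R = (c^-1)%:E * \int[leb1]_x f x.
Proof.
move=> c0 mf f0; have cn0 : c != 0%R by rewrite gt_eqF.
have := @ge0_integral_affine c 0%R f cn0 mf f0.
by rewrite ger0_norm ?(ltW c0)// => <-; apply: eq_integral => y _; rewrite addr0.
Qed.

(** With slopes of modulus one this diagonal map covers translations, the central reflection, and
    the reflection of a single coordinate that later kills the mixed second moments of the
    Gaussian. *)
Definition affV n (s a : 'rV[R]_n) (x : 'rV[R]_n) : 'rV[R]_n :=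
 (\row_i (s ord0 i * x ord0 i + a ord0 i))%R.

Lemma msble_affV n (s a : 'rV[R]_n) : msble (affV s a).
Proof.
apply: msble_to_rV => i; under eq_fun do rewrite mxE.
by apply: measurable_funD => //; apply: measurable_funM => //; exact: msble_coord.
Qed.

Lemma ge0_integral_affV n (s a : 'rV[R]_n) (F : 'rV[R]_n -> \bar R) :
 (forall i, `|s ord0 i| = 1)%R ->
 msble F -> (forall x, 0 <= F x) ->
 \int[lebn n]_x F (affV s a x) = \int[lebn n]_x F x.
Proof.
elim: n s a F => [|n IH] s a F s1 mF F0.
 apply: eq_integral => x _; congr F; by apply/rowP => -[].
have mFa : msble (F \o affV s a).
 by apply: measurableT_comp => //; exact: msble_affV.
have mFr := measurableT_comp mF (@msble_rcons1 R n).
rewrite [LHS]integral_lebnS//= [RHS]integral_lebnS//.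
have sn i : (`|(uncons1 s).2 ord0 i| = 1)%R by rewrite mxE.
have E p : affV s a (rcons1 p) =
  rcons1 (s ord0 ord0 * p.1 + a ord0 ord0, affV (uncons1 s).2 (uncons1 a).2 p.2)%R.
 apply/rowP => i; rewrite mxE; case: (unliftP ord0 i) => [j ->|->].
  rewrite !rcons1_S /= !mxE; congr (s _ _ * _ + a _ _)%R; exact/val_inj.
 by rewrite !rcons1_0.
under eq_integral do rewrite E.
pose sig := uncons1 s; pose al := uncons1 a.
rewrite (@fubini_tonelli1 _ _ _ _ _ leb1 (lebn n) (fun p => F (rcons1 (s ord0 ord0 * p.1 + a ord0 ord0, affV sig.2 al.2 p.2)%R)))//; last first.
 apply: (measurableT_comp mFr); apply/measurable_fun_pairP; split => /=.
  by apply: measurable_funD => //; apply: measurable_funM.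
 by apply: (measurableT_comp (@msble_affV _ _ _)).
rewrite (@fubini_tonelli1 _ _ _ _ _ leb1 (lebn n) (fun p => F (rcons1 p)))//.
rewrite /fubini_F /=.
have G t : \int[lebn n]_y F (rcons1 (t, affV sig.2 al.2 y)) = \int[lebn n]_y F (rcons1 (t, y)).
 apply: (IH _ _ (fun y => F (rcons1 (t, y)))) => //.
 exact: (measurableT_comp mFr (pair1_measurable _)).
under eq_integral do rewrite G.
rewrite (@ge0_integral_affine _ _ (fun t => \int[lebn n]_y F (rcons1 (t, y))))//.
- by rewrite s1 invr1 mul1e.
- by rewrite -normr_gt0 s1.
- exact: (@measurable_fun_fubini_tonelli_F _ _ _ _ _ (lebn n) _ mFr (fun p => F0 _)).
- by move=> t; exact: integral_ge0.
Qed.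

Lemma integral_rV_affV n (s a : 'rV[R]_n) (F : 'rV[R]_n -> \bar R) :
 (forall i, `|s ord0 i| = 1)%R -> msble F ->
 \int[lebn n]_x F (affV s a x) = \int[lebn n]_x F x.
Proof.
move=> s1 mF; rewrite integralE [RHS]integralE; congr (_ - _).
 rewrite -[RHS](ge0_integral_affV a s1)//; last exact: measurable_funepos.
 by apply: eq_integral => x _; rewrite !funeposE.
rewrite -[RHS](ge0_integral_affV a s1)//; last exact: measurable_funeneg.
by apply: eq_integral => x _; rewrite !funenegE.
Qed.

Lemma integral_rV_add n (a : 'rV[R]_n) (F : 'rV[R]_n -> \bar R) :
 msble F -> \int[lebn n]_x F (x + a)%R = \int[lebn n]_x F x.
Proof.
move=> mF; rewrite -(@integral_rV_affV n (const_mx 1%R) a F)//.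
 apply: eq_integral => x _; congr F; apply/rowP => i.
 by rewrite !mxE mul1r.
by move=> i; rewrite mxE normr1.
Qed.

Lemma integral_rV_subr n (a : 'rV[R]_n) (F : 'rV[R]_n -> \bar R) :
 msble F -> \int[lebn n]_x F (a - x)%R = \int[lebn n]_x F x.
Proof.
move=> mF; rewrite -(@integral_rV_affV n (const_mx (-1)%R) a F)//.
 apply: eq_integral => x _; congr F; apply/rowP => i.
 by rewrite !mxE mulN1r addrC.
by move=> i; rewrite mxE normrN normr1.
Qed.

End invariance.

(** * Fundamental theorem of calculus and powers on the half-line *)

Section calculus.
Context {R : realType}.
Implicit Types (a b c t x : R).

Lemma FTC_closed (f F : R -> R) a b : a < b ->
 (forall x, a <= x <= b -> is_derive x 1 F (f x)) ->
 (forall x, a <= x <= b -> {for x, continuous f}) ->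
 (\int[leb1]_(x in `[a, b]) (f x)%:E = (F b - F a)%:E)%E.
Proof.
move=> ab dF cf.
have cfw : {within `[a, b], continuous f}.
 by apply: continuous_in_subspaceT => x /set_mem; rewrite /= in_itv/= => /cf.
have cF x : a <= x <= b -> {for x, continuous F}.
 move=> /dF [dFx _]; apply: differentiable_continuous.
 exact/derivable1_diffP.
rewrite integral_leb1//; last first.
 apply/measurable_EFinP; apply: subspace_continuous_measurable_fun => //.
rewrite (@continuous_FTC2 _ f F)//.
- split.
 + by move=> x; rewrite in_itv/= => /andP[/ltW ax /ltW xb]; have [] := dF x _; rewrite ?ax.
 + by apply: cvg_at_right_filter; apply: cF; rewrite lexx ltW.
 + by apply: cvg_at_left_filter; apply: cF; rewrite lexx ltW.
- move=> x; rewrite in_itv/= => /andP[/ltW ax /ltW xb].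
 by rewrite derive1E; have [] := dF x _; rewrite ?ax.
Qed.

Lemma FTC_infty (f F : R -> R) a l :
 (forall x, a <= x -> 0 <= f x) ->
 (forall x, a <= x -> is_derive x 1 F (f x)) ->
 (forall x, a <= x -> {for x, continuous f}) ->
 F x @[x --> +oo] --> l ->
 (\int[leb1]_(x in `[a, +oo[) (f x)%:E = (l - F a)%:E)%E.
Proof.
move=> f0 dF cf Fl.
have cF x : a <= x -> {for x, continuous F}.
 move=> /dF [dFx _]; apply: differentiable_continuous.
 exact/derivable1_diffP.
have cfw : {within `[a, +oo[, continuous f}.
 by apply: continuous_in_subspaceT => x /set_mem; rewrite /= in_itv/= andbT => /cf.
rewrite integral_leb1//; last first.
 by apply/measurable_EFinP; apply: subspace_continuous_measurable_fun.
rewrite (@ge0_continuous_FTC2y _ f F a l)//.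
- by move=> x /ltW /dF [].
- by apply: cvg_at_right_filter; apply: cF.
- move=> x; rewrite in_itv/= andbT => /ltW ax.
 by rewrite derive1E; have [] := dF x _.
Qed.

(** The power extended by 0 to [t <= 0]. Integrals over the half-line become integrals over [R], and
    a factor [pw b (r - s)] carries the constraint [s < r] by itself, which keeps Tonelli
    interchanges free of domains. *)
Definition pw (a t : R) : R := if 0 < t then t `^ a else 0.

Lemma pw_ge0 a t : 0 <= pw a t.
Proof. by rewrite /pw; case: ifP => // _; exact: powR_ge0. Qed.

Lemma pwE a t : 0 < t -> pw a t = t `^ a. Proof. by rewrite /pw => ->. Qed.

Lemma pw0 a t : t <= 0 -> pw a t = 0. Proof. by rewrite /pw leNgt => /negbTE ->. Qed.

Lemma msble_pw a : msble (pw a).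
Proof.
apply: measurable_fun_ifT => //.
 exact: (@measurable_fun_ltr _ _ _ setT (cst 0) id).
Qed.

Lemma pwD a b t : pw (a + b) t = pw a t * pw b t.
Proof.
have [t0|t0] := leP t 0; first by rewrite !pw0// mul0r.
by rewrite !pwE// powRD// (gt_eqF t0) implybT.
Qed.

Lemma pwM a t u : 0 < t -> pw a (t * u) = pw a t * pw a u.
Proof.
move=> t0; have [u0|u0] := leP u 0.
 by rewrite [in RHS](pw0 _ u0) mulr0 pw0// pmulr_rle0.
by rewrite !pwE ?mulr_gt0// powRM ?ltW.
Qed.

Lemma is_derive_powR a x c : 0 < x -> is_derive x 1 (fun t => c * t `^ a) (c * (a * x `^ (a - 1))).
Proof.
by move=> x0; have := is_derive1_powR a x0 => h; apply: is_deriveZ.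
Qed.

Lemma cont_powR_pos a x : 0 < x -> {for x, continuous (fun t : R => t `^ a)}.
Proof.
move=> x0; apply: differentiable_continuous; apply/derivable1_diffP.
by apply: derivable_powR; rewrite in_itv/= x0.
Qed.

Lemma cvgy_powRN a : 0 < a -> t `^ (- a) @[t --> +oo] --> (0 : R).
Proof.
move=> a0; apply/cvgrPdist_le => e e0; near=> t.
have t0 : 0 < t by near: t; exact: nbhs_pinfty_gt.
rewrite sub0r normrN ger0_norm ?powR_ge0// powRN.
rewrite -[leRHS]invrK lef_pV2 ?posrE ?invr_gt0 ?powR_gt0//.
rewrite (_ : e^-1 = (e^-1 `^ a^-1) `^ a); last first.
 by rewrite -powRrM mulVf ?gt_eqF// powRr1// invr_ge0 ltW.
apply: ge0_ler_powR; rewrite ?nnegrE ?powR_ge0 ?(ltW a0) ?(ltW t0)//.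
Unshelve. all: by end_near. Qed.

Lemma integral_pw_tail a c : 0 < a -> 0 < c ->
 (\int[leb1]_(t in `[c, +oo[) (pw (- a - 1) t)%:E = (c `^ (- a) / a)%:E)%E.
Proof.
move=> a0 c0.
rewrite (eq_integral (fun t => (t `^ (- a - 1))%:E)); last first.
 by move=> t /set_mem; rewrite /= in_itv/= andbT => ct; rewrite pwE// (lt_le_trans c0).
etransitivity; first apply: (@FTC_infty _ (fun t => - a^-1 * t `^ (- a))%R _ 0%R).
- by move=> x cx; exact: powR_ge0.
- move=> x cx; have x0 := lt_le_trans c0 cx.
 have := is_derive_powR (- a) (- a^-1)%R x0.
 by rewrite [X in is_derive _ _ _ X](_ : _ = x `^ (- a - 1))%R//; field; rewrite gt_eqF.
- by move=> x cx; apply: cont_powR_pos; rewrite (lt_le_trans c0).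
- rewrite -[X in _ --> X](mulr0 (- a^-1)%R); apply: cvgM; first exact: cvg_cst.
 exact: cvgy_powRN.
by congr EFin; field; rewrite gt_eqF.
Qed.

Lemma integral_pw_head a c : 0 < a -> 0 < c ->
 (\int[leb1]_(t in `]0%R, c]) (pw (a - 1) t)%:E = (c `^ a / a)%:E)%E.
Proof.
move=> a0 c0.
(* The integrand may blow up at 0, so the interval is exhausted from the right of 0. The denominator
   [k.+2] keeps [d k < c] strict, as the theorem on closed intervals requires. *)
pose d k : R := (c * k.+2%:R^-1)%R.
have d0 k : (0 < d k)%R by rewrite mulr_gt0// invr_gt0 ltr0n.
have dc k : (d k < c)%R by rewrite ltr_pdivrMr ?ltr0n// ltr_pMr// ltr1n.
have ndd k l : (k <= l)%N -> (d l <= d k)%R.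
 by move=> kl; rewrite ler_pM2l// lef_pV2 ?posrE ?ltr0n// ler_nat !ltnS.
have cvd : d k @[k --> \oo] --> (0:R)%R.
 rewrite -(mulr0 c); apply: cvgM; first exact: cvg_cst.
 by have := @cvg_harmonic R; rewrite -cvg_shiftS.
have U : `]0%R, c]%classic = \bigcup_k [set` `[d k, c]].
 apply/seteqP; split => x /=; rewrite in_itv/=.
  move=> /andP[x0 xc]; move/cvgrPdist_lt : cvd => /(_ _ x0)[N _ /(_ N (leqnn N))].
  by rewrite sub0r normrN gtr0_norm// => /ltW dx; exists N; rewrite //= in_itv/= dx.
 by move=> [k _]; rewrite /= in_itv/= => /andP[dx ->]; rewrite (lt_le_trans (d0 k)).
have H : ((\int[leb1]_(t in [set` `[d k, c]]) (pw (a - 1) t)%:E)%E @[k --> \oo] -->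
  (\int[leb1]_(t in \bigcup_k [set` `[d k, c]]) (pw (a - 1) t)%:E)%E).
 apply: ge0_nondecreasing_set_cvg_integral.
 - move=> k l kl; apply/subsetPset => x /=; rewrite !in_itv/= => /andP[dx ->].
  by rewrite (le_trans (ndd _ _ kl)).
 - by move=> k; exact: measurable_itv.
 - by move=> k; apply: measurable_funTS; apply/measurable_EFinP; exact: msble_pw.
 - by move=> k x _; rewrite lee_fin pw_ge0.
rewrite U -(cvg_lim _ H)//.
apply/cvg_lim => //.
rewrite (_ : (fun _ => _) = (fun k => (a^-1 * c `^ a - a^-1 * d k `^ a)%:E)); last first.
 apply/funext => k; rewrite (eq_integral (fun t => (t `^ (a - 1))%:E)); last first.
  by move=> t /set_mem; rewrite /= in_itv/= => /andP[dt _]; rewrite pwE// (lt_le_trans (d0 k)).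
 apply: (@FTC_closed _ (fun t => a^-1 * t `^ a)); first exact: dc.
  move=> x /andP[dx _]; have x0 := lt_le_trans (d0 k) dx.
  have := is_derive_powR a a^-1 x0.
  by rewrite mulrA mulVf ?mul1r// gt_eqF.
 by move=> x /andP[dx _]; apply: cont_powR_pos; rewrite (lt_le_trans (d0 k)).
apply: cvg_EFin; first exact: nearW.
rewrite -[X in _ --> X]subr0 mulrC; apply: cvgB; first exact: cvg_cst.
rewrite -[X in _ --> X](mulr0 a^-1); apply: cvgM; first exact: cvg_cst.
exact: (cvg_at_rightP _ _ _).1 (powR_cvg0 a0) d (conj d0 cvd).
Qed.

End calculus.

(** * Nonnegative integrals and measurability of real functions *)

Section helpers.
Context {R : realType}.

Lemma mEFin d (T : measurableType d) (f : T -> R) :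
 msble f -> msble (fun x : T => (f x)%:E).
Proof. by move=> mf; apply/measurable_EFinP. Qed.

Lemma msble_boolR d (T : measurableType d) (b : T -> bool) :
 msble b -> msble (fun x : T => (b x)%:R : R).
Proof.
move=> mb; rewrite (_ : (fun _ => _) = (fun x => if b x then 1 else 0 : R)).
 exact: measurable_fun_ifT.
by apply/funext => x; case: (b x).
Qed.

Lemma msble_leR d (T : measurableType d) (f g : T -> R) :
 msble f -> msble g ->
 msble (fun x : T => (f x <= g x)%R%:R : R).
Proof. by move=> mf mg; apply: msble_boolR; exact: measurable_fun_ler. Qed.

Lemma msble_ltR d (T : measurableType d) (f g : T -> R) :
 msble f -> msble g ->
 msble (fun x : T => (f x < g x)%R%:R : R).
Proof. by move=> mf mg; apply: msble_boolR; exact: measurable_fun_ltr. Qed.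

Lemma msble_expf d (T : measurableType d) (f : T -> R) :
 msble f -> msble (fun x : T => expR (f x)).
Proof. by move=> mf; apply: (measurableT_comp (@measurable_expR R)). Qed.

Lemma msble_oppf d (T : measurableType d) (f : T -> R) :
 msble f -> msble (fun x : T => - (f x)).
Proof. by move=> mf; apply: measurableT_comp. Qed.

Lemma ge0_intZl d (T : measurableType d) (mu : {measure set T -> \bar R}) (f : T -> R) c :
 0 <= c -> msble f -> (forall x, 0 <= f x) ->
 (\int[mu]_x (c * f x)%:E = c%:E * \int[mu]_x (f x)%:E)%E.
Proof.
move=> c0 mf f0; under eq_integral do rewrite EFinM.
by rewrite ge0_integralZl//; [exact: mEFin|move=> x _; rewrite lee_fin].
Qed.

Lemma le_intR d (T : measurableType d) (mu : {measure set T -> \bar R}) (f g : T -> R) :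
 (forall x, 0 <= f x) -> msble f -> msble g ->
 (forall x, f x <= g x) ->
 (\int[mu]_x (f x)%:E <= \int[mu]_x (g x)%:E)%E.
Proof.
move=> f0 mf mg fg; apply: ge0_le_integral => //.
- by move=> x _; rewrite lee_fin.
- exact: mEFin.
- exact: mEFin.
- by move=> x _; rewrite lee_fin.
Qed.

Lemma le_int_lty d (T : measurableType d) (mu : {measure set T -> \bar R}) (f g : T -> R) :
 (forall x, 0 <= f x) -> msble f -> msble g ->
 (forall x, f x <= g x) -> (\int[mu]_x (g x)%:E < +oo)%E ->
 (\int[mu]_x (f x)%:E < +oo)%E.
Proof. by move=> f0 mf mg fg; apply: le_lt_trans; exact: le_intR. Qed.

Lemma int_ge0R d (T : measurableType d) (mu : {measure set T -> \bar R}) (f : T -> R) :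
 (forall x, 0 <= f x) -> (0 <= \int[mu]_x (f x)%:E)%E.
Proof. by move=> f0; apply: integral_ge0 => x _; rewrite lee_fin. Qed.

Lemma ge0_intD d (T : measurableType d) (mu : {measure set T -> \bar R}) (f g : T -> R) :
 (forall x, 0 <= f x) -> (forall x, 0 <= g x) ->
 msble f -> msble g ->
 (\int[mu]_x (f x + g x)%:E = \int[mu]_x (f x)%:E + \int[mu]_x (g x)%:E)%E.
Proof.
move=> f0 g0 mf mg; under eq_integral do rewrite EFinD.
by rewrite ge0_integralD//; solve [exact: mEFin|by move=> x _; rewrite lee_fin].
Qed.

Lemma int_swapR d1 d2 (T1 : measurableType d1) (T2 : measurableType d2)
 (m1 : {sigma_finite_measure set T1 -> \bar R}) (m2 : {sigma_finite_measure set T2 -> \bar R})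
 (f : T1 -> T2 -> R) : msble (fun p : T1 * T2 => f p.1 p.2) ->
 (forall x y, 0 <= f x y) ->
 (\int[m1]_x \int[m2]_y (f x y)%:E = \int[m2]_y \int[m1]_x (f x y)%:E)%E.
Proof.
move=> mf f0.
apply: (@fubini_tonelli _ _ _ _ _ m1 m2 (fun p => (f p.1 p.2)%:E)).
 exact: mEFin.
by move=> p; rewrite lee_fin.
Qed.

Lemma msble_int2 d1 d2 (T1 : measurableType d1) (T2 : measurableType d2)
 (m2 : {sigma_finite_measure set T2 -> \bar R})
 (f : T1 -> T2 -> \bar R) : msble (fun p : T1 * T2 => f p.1 p.2) ->
 (forall x y, (0 <= f x y)%E) ->
 msble (fun x => \int[m2]_y (f x y))%E.
Proof.
move=> mf f0.
exact: (@measurable_fun_fubini_tonelli_F _ _ _ _ _ m2 (fun p => f p.1 p.2)).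
Qed.

Lemma msble_fst_comp d1 d2 d3 (T1 : measurableType d1) (T2 : measurableType d2)
 (T3 : measurableType d3) (f : T1 -> T3) : msble f ->
 msble (fun p : T1 * T2 => f p.1).
Proof. by move=> mf; apply: (measurableT_comp mf); exact: measurable_fst. Qed.

Lemma msble_snd_comp d1 d2 d3 (T1 : measurableType d1) (T2 : measurableType d2)
 (T3 : measurableType d3) (f : T2 -> T3) : msble f ->
 msble (fun p : T1 * T2 => f p.2).
Proof. by move=> mf; apply: (measurableT_comp mf); exact: measurable_snd. Qed.

End helpers.

(** * The Gamma function and integrals of Gamma type *)

Section gamma.
Context {R : realType}.
Implicit Types (a b c t x : R).

Lemma int_pw_tail a c : 0 < a -> 0 < c ->
 (\int[leb1]_t (pw (- a - 1) t * (c <= t)%R%:R)%:E = (c `^ (- a) / a)%:E)%E.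
Proof.
move=> a0 c0; rewrite -integral_pw_tail// [RHS]integral_mkcond.
apply: eq_integral => t _; rewrite /patch mem_setE in_itv/= andbT.
by case: ifP => _; rewrite ?mulr1// mulr0.
Qed.

Lemma int_pw_head a c : 0 < a -> 0 < c ->
 (\int[leb1]_t (pw (a - 1) t * (t <= c)%R%:R)%:E = (c `^ a / a)%:E)%E.
Proof.
move=> a0 c0; rewrite -integral_pw_head// [RHS]integral_mkcond.
apply: eq_integral => t _; rewrite /patch mem_setE in_itv/=.
have [t0|t0] := leP t 0; first by rewrite pw0// mul0r.
by rewrite /=; case: ifP => _; rewrite ?mulr1// mulr0.
Qed.

Lemma msble_pw_tail a c : msble (fun t => pw a t * (c <= t)%R%:R).
Proof. by apply: measurable_funM; [exact: msble_pw|exact: msble_leR]. Qed.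

Lemma msble_pw_head a c : msble (fun t => pw a t * (t <= c)%R%:R).
Proof. by apply: measurable_funM; [exact: msble_pw|exact: msble_leR]. Qed.

Definition gexp a t : R := pw (a - 1) t * expR (- t).

Lemma gexp_ge0 a t : 0 <= gexp a t.
Proof. by rewrite mulr_ge0 ?pw_ge0 ?expR_ge0. Qed.

Lemma msble_gexp a : msble (gexp a).
Proof.
apply: measurable_funM; first exact: msble_pw.
by apply: msble_expf; exact: msble_oppf.
Qed.

(** Raise [x / a <= expR (x / a)] to the power [a]. *)
Lemma powR_le_expR a x : 0 < a -> 0 <= x -> x `^ a <= a `^ a * expR x.
Proof.
move=> a0 x0.
have -> : expR x = expR (x / a) `^ a by rewrite -expRM divfK// gt_eqF.
rewrite -powRM ?(ltW a0) ?expR_ge0//.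
apply: ge0_ler_powR; rewrite ?nnegrE ?(ltW a0)// ?mulr_ge0 ?expR_ge0 ?(ltW a0)//.
rewrite mulrC -ler_pdivrMr//; apply: le_trans (expR_ge1Dx _).
by rewrite lerDr.
Qed.

Lemma integral_gexp_lty a : 0 < a -> (\int[leb1]_t (gexp a t)%:E < +oo)%E.
Proof.
move=> a0; pose C := (a + 1) `^ (a + 1).
have C0 : 0 <= C by exact: powR_ge0.
apply: (@le_int_lty _ _ _ _ _ (fun t => pw (a - 1) t * (t <= 1)%R%:R
  + C * (pw (- 1 - 1) t * (1 <= t)%R%:R))) => //.
- exact: gexp_ge0.
- exact: msble_gexp.
- apply: measurable_funD; first exact: msble_pw_head.
 by apply: measurable_funM => //; exact: msble_pw_tail.
- move=> t; rewrite /gexp; have [t0|t0] := leP t 0; first by rewrite !pw0// !mul0r mulr0 addr0.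
 have p0 b := pw_ge0 b t.
 have [t1|t1] := leP t 1.
  rewrite mulr1 -[leLHS]addr0 lerD ?mulr_ge0//.
  by rewrite -[leRHS]mulr1 ler_wpM2l// expR_le1 oppr_le0 ltW.
 rewrite mulr0 add0r (ltW t1) mulr1.
 have -> : a - 1 = (- 1 - 1) + (a + 1) by ring.
 rewrite pwD -mulrA mulrC ler_wpM2r//.
 rewrite expRN -ler_pdivlMr ?invr_gt0 ?expR_gt0// invrK pwE//.
 by apply: powR_le_expR; rewrite ?ltW// addr_gt0.
- rewrite ge0_intD//.
 + rewrite int_pw_head// ge0_intZl//; last 2 first.
  * exact: msble_pw_tail.
  * by move=> t; rewrite mulr_ge0// pw_ge0.
  by rewrite int_pw_tail// -EFinM -EFinD ltry.
 + by move=> t; rewrite mulr_ge0// pw_ge0.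
 + by move=> t; rewrite !mulr_ge0// pw_ge0.
 + exact: msble_pw_head.
 + by apply: measurable_funM => //; exact: msble_pw_tail.
Qed.

Lemma GammaE a : 0 < a -> ((Gamma a)%:E = \int[leb1]_t (gexp a t)%:E)%E.
Proof.
move=> a0; rewrite /Gamma.
rewrite (_ : (\int[_]_(t in _) _)%E = (\int[leb1]_t (gexp a t)%:E)%E).
 rewrite fineK// ge0_fin_numE ?integral_gexp_lty//.
 by apply: int_ge0R => t; exact: gexp_ge0.
transitivity (\int[@lebesgue_measure R]_(t in [set t : R | (0 < t)%R]) (gexp a t)%:E)%E.
 by apply: eq_integral => t /set_mem /= t0; rewrite /gexp pwE.
rewrite -ge0_integral_leb1//.
- rewrite integral_mkcond; apply: eq_integral => t _; rewrite /patch.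
 case: ifPn => // /negP; rewrite inE /= => /negP; rewrite -leNgt => t0.
 by rewrite /gexp pw0// mul0r.
- rewrite (_ : [set t | 0 < t] = `]0, +oo[%classic)//.
 by apply/seteqP; split => x /=; rewrite in_itv/= andbT.
- apply: measurable_funTS; apply: mEFin; exact: msble_gexp.
- by move=> x _; rewrite lee_fin gexp_ge0.
Qed.

Lemma Gamma_gt0 a : 0 < a -> 0 < Gamma a.
Proof.
move=> a0; rewrite -lte_fin GammaE//.
apply: (@lt_le_trans _ _ (expR (- 1) * (1 `^ a / a))%:E).
 by rewrite lte_fin mulr_gt0 ?expR_gt0// powR1 divr_gt0.
rewrite EFinM -int_pw_head// -ge0_intZl ?expR_ge0//; last 2 first.
- exact: msble_pw_head.
- by move=> t; rewrite mulr_ge0// pw_ge0.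
apply: le_intR.
- by move=> t; rewrite !mulr_ge0 ?expR_ge0 ?pw_ge0.
- by apply: measurable_funM => //; exact: msble_pw_head.
- exact: msble_gexp.
- move=> t; rewrite mulrC -mulrA ler_wpM2l ?pw_ge0//.
 have [t1|t1] := leP t 1; last by rewrite mul0r expR_ge0.
 by rewrite mul1r ler_expR lerN2.
Qed.

Lemma int_exp_tail c : (\int[leb1]_t (expR (- t) * (c <= t)%R%:R)%:E = (expR (- c))%:E)%E.
Proof.
transitivity (\int[leb1]_(t in `[c, +oo[) (expR (- t))%:E)%E.
 rewrite [RHS]integral_mkcond; apply: eq_integral => t _.
 rewrite /patch mem_setE in_itv/= andbT.
 by case: ifP => _; rewrite ?mulr1// mulr0.
etransitivity; first apply: (@FTC_infty _ _ (fun t => - expR (- t)) _ 0).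
- by move=> x _; exact: expR_ge0.
- by move=> x _; apply: is_derive_eq; rewrite mulrN1 opprK.
- move=> x _; apply: continuous_comp; [exact: opp_continuous|exact: continuous_expR].
- rewrite -[X in _ --> X]oppr0; apply: cvgN; exact: cvgr_expR.
by rewrite sub0r opprK.
Qed.

(** In place of an integration by parts, $t^a$ is written as $a\int_0^t u^{a-1}du$ and the order of
    integration is exchanged; the inner integral becomes an exponential tail. *)
Lemma GammaS a : 0 < a -> Gamma (a + 1) = a * Gamma a.
Proof.
move=> a0; apply: EFin_inj; rewrite EFinM !GammaE ?addr_gt0//.
transitivity (\int[leb1]_t \int[leb1]_u (a * (pw (a - 1) u * (u <= t)%R%:R) * expR (- t))%:E)%E.
 apply: eq_integral => t _; rewrite /gexp addrK.
 have [t0|t0] := leP t 0.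
  rewrite pw0// mul0r; under eq_integral => u _.
   rewrite (_ : pw (a - 1) u * (u <= t)%R%:R = 0).
    by rewrite mulr0 mul0r; over.
   have [ut|] := leP u t; last by rewrite mulr0.
   by rewrite pw0 ?mul0r// (le_trans ut).
  by rewrite integral0.
 under eq_integral do rewrite mulrAC.
 rewrite ge0_intZl ?mulr_ge0 ?expR_ge0 ?(ltW a0)//.
 + by rewrite int_pw_head// -EFinM pwE//; congr EFin; field; rewrite gt_eqF.
 + exact: msble_pw_head.
 + by move=> u; rewrite mulr_ge0 ?pw_ge0.
rewrite int_swapR; last 2 first.
- apply: measurable_funM.
  apply: measurable_funM => //; apply: measurable_funM.
   by apply: msble_snd_comp; exact: msble_pw.
  by apply: msble_leR; [exact: measurable_snd|exact: measurable_fst].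
 apply: (measurableT_comp (@measurable_expR R)); apply: measurableT_comp => //.
- by move=> x y; rewrite !mulr_ge0 ?pw_ge0 ?expR_ge0 ?(ltW a0).
rewrite -ge0_intZl ?(ltW a0)//; last 2 first.
- exact: msble_gexp.
- by move=> t; exact: gexp_ge0.
apply: eq_integral => u _.
under eq_integral => t _.
 rewrite (_ : a * _ * _ = (a * pw (a - 1) u) * (expR (- t) * (u <= t)%R%:R)); last by ring.
 over.
rewrite ge0_intZl//.
- by rewrite int_exp_tail -EFinM /gexp mulrA.
- by rewrite mulr_ge0 ?pw_ge0 ?(ltW a0).
- apply: measurable_funM; last exact: msble_leR.
 by apply: msble_expf; exact: msble_oppf.
Qed.

Lemma int_gamma_scale a l : 0 < a -> 0 < l ->
 (\int[leb1]_t (pw (a - 1) t * expR (- (l * t)))%:E = (Gamma a * l `^ (- a))%:E)%E.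
Proof.
move=> a0 l0.
under eq_integral => t _.
 rewrite (_ : pw (a - 1) t * _ = l `^ (1 - a) * gexp a (l * t)); last first.
  rewrite /gexp pwM// (pwE _ l0) !mulrA -powRD ?(gt_eqF l0) ?implybT//.
  by rewrite addrA subrK subrr powRr0 mul1r.
 over.
rewrite ge0_intZl ?powR_ge0//; last 2 first.
- by apply: measurableT_comp; [exact: msble_gexp|exact: mulrl_measurable].
- by move=> t; exact: gexp_ge0.
rewrite (integral_scale l0 (f := fun t => (gexp a t)%:E)).
- rewrite -GammaE// -!EFinM; congr EFin.
 have -> : l^-1 = l `^ (-1) by rewrite powR_inv1// ltW.
 rewrite mulrA -powRD ?(gt_eqF l0) ?implybT// mulrC; congr (_ * _ `^ _).
 by ring.
- exact: mEFin (msble_gexp a).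
- by move=> t; rewrite lee_fin gexp_ge0.
Qed.

(** The substitution $t \mapsto r/t$ is replaced by Tonelli: $e^{-r/t}$ is the exponential tail from
    $r/t$, and after the exchange the [t]-integral is a power tail, leaving $\Gamma(a+1)/a$. *)
Lemma int_gamma_inv a r : 0 < a -> 0 < r ->
 (\int[leb1]_t (pw (- a - 1) t * expR (- (r / t)))%:E = (Gamma a * r `^ (- a))%:E)%E.
Proof.
move=> a0 r0.
transitivity (\int[leb1]_t \int[leb1]_u
  (pw (- a - 1) t * (expR (- u) * (r <= u * t)%R%:R))%:E)%E.
 apply: eq_integral => t _; have [t0|t0] := leP t 0.
  by rewrite pw0// mul0r; under [RHS]eq_integral do rewrite mul0r; rewrite integral0.
 rewrite ge0_intZl ?pw_ge0//.
 - under eq_integral do rewrite -ler_pdivrMr//.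
  by rewrite int_exp_tail EFinM.
 - apply: measurable_funM; last by apply: msble_leR => //; exact: mulrr_measurable.
  by apply: msble_expf; exact: msble_oppf.
rewrite int_swapR; last 2 first.
- apply: measurable_funM.
  by apply: msble_fst_comp; exact: msble_pw.
 apply: measurable_funM.
  by apply: msble_expf; apply: msble_oppf; exact: measurable_snd.
 apply: msble_leR => //; apply: measurable_funM; [exact: measurable_snd|exact: measurable_fst].
- by move=> x y; rewrite !mulr_ge0 ?pw_ge0 ?expR_ge0.
transitivity (\int[leb1]_u (r `^ (- a) / a * gexp (a + 1) u)%:E)%E.
 apply: eq_integral => u _; have [u0|u0] := leP u 0.
  rewrite /gexp pw0// mul0r mulr0; under eq_integral => t _.
   rewrite (_ : pw (- a - 1) t * _ = 0); first by over.
   have [t0|t0] := leP t 0; first by rewrite pw0// mul0r.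
   have [ru|] := leP r (u * t); last by rewrite !mulr0.
   have : r <= 0 by rewrite (le_trans ru)// mulr_le0_ge0// ltW.
   by rewrite leNgt r0.
  by rewrite integral0.
 under eq_integral => t _.
  rewrite mulrCA [u * t]mulrC -ler_pdivrMr//; over.
 rewrite ge0_intZl ?expR_ge0//.
 - rewrite int_pw_tail ?divr_gt0// -EFinM; congr EFin; rewrite /gexp addrK pwE//.
  rewrite powRM ?(ltW r0) ?invr_ge0 ?(ltW u0)//.
  have -> : u^-1 `^ (- a) = u `^ a.
   by rewrite -(powR_inv1 (ltW u0)) -powRrM mulrN mulN1r opprK.
  by ring.
 - exact: msble_pw_tail.
 - by move=> t; rewrite mulr_ge0 ?pw_ge0.
rewrite ge0_intZl ?divr_ge0 ?powR_ge0 ?(ltW a0)//.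
- rewrite -GammaE ?addr_gt0// -EFinM GammaS//; congr EFin; field.
 by rewrite gt_eqF.
- exact: msble_gexp.
- by move=> t; exact: gexp_ge0.
Qed.

End gamma.

(** * The Gaussian heat kernel *)

Section gauss.
Context {R : realType}.
Implicit Types (a b c t x : R).

Lemma msble_invf d (T : measurableType d) (f : T -> R) :
 msble f -> msble (fun x : T => (f x)^-1).
Proof.
move=> mf; rewrite (_ : (fun _ => _) =
 (fun x : T => if 0 < f x then f x `^ (-1) else - ((- f x) `^ (-1)))); last first.
 apply/funext => x; case: ifPn => [f0|]; first by rewrite powR_inv1// ltW.
 by rewrite -leNgt => f0; rewrite powR_inv1 ?oppr_ge0// invrN opprK.
apply: measurable_fun_ifT.
- by apply: measurable_fun_ltr.
- exact: (measurableT_comp (@measurable_powR R (-1)) mf).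
- apply: msble_oppf; apply: (measurableT_comp (@measurable_powR R (-1))).
 exact: msble_oppf.
Qed.

(** The heat kernel of the line at time [t], that is, the centred normal density of variance
    [2 * t]. *)
Definition g1 t x : R := (4 * pi * t) `^ (- 2^-1) * expR (- (x ^+ 2 / (4 * t))).

Lemma g1_ge0 t x : 0 <= g1 t x.
Proof. by rewrite mulr_ge0 ?powR_ge0 ?expR_ge0. Qed.

Lemma msble_g1 : msble (fun p : R * R => g1 p.1 p.2).
Proof.
apply: measurable_funM.
 apply: (measurableT_comp (@measurable_powR R _)).
 by apply: measurable_funM => //; exact: measurable_fst.
apply: msble_expf; apply: msble_oppf; apply: measurable_funM.
 by apply: measurable_funX; exact: measurable_snd.
apply: msble_invf.
by apply: measurable_funM => //; exact: measurable_fst.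
Qed.

Lemma g1_normal t x m : 0 < t -> g1 t (x - m) = normal_pdf m (Num.sqrt (2 * t)) x.
Proof.
move=> t0; have s0 : Num.sqrt (2 * t) != 0 by rewrite gt_eqF// sqrtr_gt0 mulr_gt0.
rewrite normal_pdfE// /normal_peak /normal_fun /g1.
rewrite sqr_sqrtr; last by rewrite mulr_ge0 ?ltW.
congr (_ * expR _).
 rewrite powRN powR12_sqrt ?mulr_ge0 ?pi_ge0 ?(ltW t0)//; congr (Num.sqrt _)^-1.
 by rewrite -mulr_natl; ring.
rewrite mulNr; congr (- (_ / _)); rewrite -mulr_natl; ring.
Qed.

Lemma int_g1 t : 0 < t -> (\int[leb1]_x (g1 t x)%:E = 1)%E.
Proof.
move=> t0; rewrite -(integral_normal_pdf 0 (Num.sqrt (2 * t))).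
rewrite integral_leb1//; last first.
 by apply: mEFin; exact: (measurableT_comp msble_g1 (pair1_measurable t)).
by apply: eq_integral => x _; rewrite -g1_normal// subr0.
Qed.

(* Completing the square in y. *)
Lemma g1_mul t u x y : 0 < t -> 0 < u ->
 g1 t (x - y) * g1 u y = g1 (t + u) x * g1 (t * u / (t + u)) (y - x * u / (t + u)).
Proof.
move=> t0 u0; rewrite /g1 mulrACA [RHS]mulrACA -!expRD; congr (_ * expR _).
 have p4 : 0 <= 4 * pi :> R by rewrite mulr_ge0 ?pi_ge0.
 have tu : 0 < t + u by rewrite addr_gt0.
 rewrite -!powRM ?mulr_ge0 ?pi_ge0 ?invr_ge0 ?(ltW t0) ?(ltW u0) ?(ltW tu)//.
 by congr (_ `^ _); field; rewrite gt_eqF.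
by field; rewrite !gt_eqF// addr_gt0.
Qed.

Lemma int_g1_conv t u x : 0 < t -> 0 < u ->
 (\int[leb1]_y (g1 t (x - y) * g1 u y)%:E = (g1 (t + u) x)%:E)%E.
Proof.
move=> t0 u0; under eq_integral do rewrite g1_mul//.
have tu : 0 < t * u / (t + u) by rewrite !(mulr_gt0, invr_gt0, addr_gt0).
have mg s : msble (g1 s) by exact: (measurableT_comp msble_g1 (pair1_measurable s)).
rewrite ge0_intZl ?g1_ge0//.
- rewrite (@integral_shift _ (- (x * u / (t + u))) (fun y => (g1 (t * u / (t + u)) y)%:E)).
  by rewrite int_g1// mule1.
 exact: mEFin.
- apply: (measurableT_comp (mg _)); exact: measurable_funB.
- by move=> y; exact: g1_ge0.
Qed.

Lemma int_rV_prod n (f : 'I_n -> R -> R) (c : 'I_n -> R) :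
 (forall i, msble (f i)) -> (forall i x, 0 <= f i x) ->
 (forall i, (\int[leb1]_x (f i x)%:E = (c i)%:E)%E) ->
 (\int[lebn n]_z (\prod_i f i (z ord0 i))%:E = (\prod_i c i)%:E)%E.
Proof.
elim: n f c => [|n IH] f c mf f0 fc.
 under eq_integral do rewrite big_ord0.
 by rewrite /= integral_dirac// diracT mul1e big_ord0.
have mfi i : msble (fun z : 'rV[R]_n.+1 => f i (z ord0 i)).
 by apply: (measurableT_comp (mf i)); exact: msble_coord.
have mprod : msble (fun z : 'rV[R]_n.+1 => \prod_i f i (z ord0 i)).
 exact: measurable_prod.
have mprod' : msble (fun z : 'rV[R]_n => \prod_i f (lift ord0 i) (z ord0 i)).
 apply: measurable_prod => i _.
 by apply: (measurableT_comp (mf _)); exact: msble_coord.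
rewrite integral_lebnS//; last 2 first.
- exact: mEFin.
- by move=> z; rewrite lee_fin prodr_ge0.
rewrite (@fubini_tonelli1 _ _ _ _ _ leb1 (lebn n) (fun p => (\prod_i f i (rcons1 p ord0 i))%:E))//; last 2 first.
- by apply: mEFin; exact: (measurableT_comp mprod (@msble_rcons1 R n)).
- by move=> z; rewrite lee_fin prodr_ge0.
rewrite big_ord_recl /fubini_F.
transitivity (\int[leb1]_t ((\prod_(i < n) c (lift ord0 i)) * f ord0 t)%:E)%E.
 apply: eq_integral => t _.
 under eq_integral => w _.
  rewrite big_ord_recl rcons1_0 /=; under eq_bigr do rewrite rcons1_S /=; over.
 rewrite ge0_intZl//.
  by rewrite (IH (fun i => f (lift ord0 i)) (fun i => c (lift ord0 i)))// -EFinM mulrC.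
 by move=> w; exact: prodr_ge0.
have c0 i : 0 <= c i by rewrite -lee_fin -fc; apply: int_ge0R.
by rewrite ge0_intZl ?prodr_ge0// fc -EFinM mulrC.
Qed.

Definition sqn n (x : 'rV[R]_n) : R := \sum_i x ord0 i ^+ 2.

Lemma sqn_ge0 n (x : 'rV[R]_n) : 0 <= sqn x.
Proof. by apply: sumr_ge0 => i _; exact: sqr_ge0. Qed.

Lemma enorm_sqr n (x : 'rV[R]_n) : enorm x ^+ 2 = sqn x.
Proof. by rewrite sqr_sqrtr// sqn_ge0. Qed.

Lemma enorm_ge0 n (x : 'rV[R]_n) : 0 <= enorm x.
Proof. exact: sqrtr_ge0. Qed.

Lemma sqnN n (x : 'rV[R]_n) : sqn (- x) = sqn x.
Proof. by apply: eq_bigr => i _; rewrite mxE sqrrN. Qed.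

Lemma sqn_eq0 n (x : 'rV[R]_n) : (sqn x == 0) = (x == 0).
Proof.
apply/idP/eqP => [|->]; last by rewrite /sqn big1// => i _; rewrite mxE expr0n.
rewrite psumr_eq0; last by move=> i _; exact: sqr_ge0.
move/allP => h; apply/rowP => i; rewrite mxE; apply/eqP.
by have := h i; rewrite mem_index_enum sqrf_eq0 => /(_ isT).
Qed.

Lemma msble_sqn n : msble (@sqn n).
Proof.
rewrite /sqn; apply: (@measurable_sum _ _ _ _ _ _ (fun i (x : 'rV[R]_n) => x ord0 i ^+ 2)) => i.
by apply: measurable_funX; exact: msble_coord.
Qed.

Fact gauss_key : unit. Proof. exact: tt. Qed.

(* Locked so that unification does not see the product. *)
Definition gauss n t (z : 'rV[R]_n) : R := locked_with gauss_key
 ((4 * pi * t) `^ (- (n%:R / 2)) * expR (- (sqn z / (4 * t)))).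

Lemma gaussE n t (z : 'rV[R]_n) :
 gauss t z = (4 * pi * t) `^ (- (n%:R / 2)) * expR (- (sqn z / (4 * t))).
Proof. by rewrite /gauss unlock. Qed.

Lemma gauss_prod n t (z : 'rV[R]_n) : 0 < t -> gauss t z = \prod_i g1 t (z ord0 i).
Proof.
move=> t0; rewrite gaussE /g1 big_split /= prodr_const card_ord -expR_sum.
congr (_ * expR _).
 by rewrite -powR_mulrn ?powR_ge0// -powRrM; congr (_ `^ _); field.
by rewrite sumrN /sqn mulr_suml.
Qed.

Lemma gauss_ge0 n t (z : 'rV[R]_n) : 0 <= gauss t z.
Proof. by rewrite gaussE mulr_ge0 ?powR_ge0 ?expR_ge0. Qed.

Lemma gauss_gt0 n t (z : 'rV[R]_n) : 0 < t -> 0 < gauss t z.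
Proof. by move=> t0; rewrite gaussE mulr_gt0 ?expR_gt0// powR_gt0// !mulr_gt0 ?pi_gt0. Qed.

Lemma gaussN n t (z : 'rV[R]_n) : gauss t (- z) = gauss t z.
Proof. by rewrite !gaussE sqnN. Qed.

Lemma msble_gauss n : msble (fun p : R * 'rV[R]_n => gauss p.1 p.2).
Proof.
under eq_fun do rewrite gaussE.
apply: measurable_funM.
 apply: (measurableT_comp (@measurable_powR R _)).
 by apply: measurable_funM => //; exact: measurable_fst.
apply: msble_expf; apply: msble_oppf; apply: measurable_funM.
 by apply: (measurableT_comp (@msble_sqn n)); exact: measurable_snd.
apply: msble_invf.
by apply: measurable_funM => //; exact: measurable_fst.
Qed.

Lemma msble_gaussf d (T : measurableType d) n (t : T -> R) (z : T -> 'rV[R]_n) :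
 msble t -> msble z ->
 msble (fun x : T => gauss (t x) (z x)).
Proof.
move=> mt mz; apply: (measurableT_comp (@msble_gauss n) (_ : msble (fun x : T => (t x, z x)))).
exact/measurable_fun_pairP.
Qed.

Lemma int_gauss n t : 0 < t -> (\int[lebn n]_z (gauss t z)%:E = 1)%E.
Proof.
move=> t0; under eq_integral do rewrite gauss_prod//.
rewrite (@int_rV_prod n (fun _ => g1 t) (fun _ => 1))//.
- by rewrite big1.
- by move=> _; exact: (measurableT_comp msble_g1 (pair1_measurable t)).
- by move=> _ x; exact: g1_ge0.
- by move=> _; exact: int_g1.
Qed.

Lemma gauss_semigroup n t u (x : 'rV[R]_n) : 0 < t -> 0 < u ->
 (\int[lebn n]_y (gauss t (x - y) * gauss u y)%:E = (gauss (t + u) x)%:E)%E.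
Proof.
move=> t0 u0.
have mg s : msble (g1 s) by exact: (measurableT_comp msble_g1 (pair1_measurable s)).
under eq_integral => y _.
 rewrite !gauss_prod// -big_split /=.
 under eq_bigr do rewrite !mxE.
 over.
rewrite (@int_rV_prod n (fun i y => g1 t (x ord0 i - y) * g1 u y) (fun i => g1 (t + u) (x ord0 i))).
- by rewrite gauss_prod// addr_gt0.
- move=> i; apply: measurable_funM => //; apply: (measurableT_comp (mg _)).
 exact: measurable_funB.
- by move=> i y; rewrite mulr_ge0 ?g1_ge0.
- by move=> i; exact: int_g1_conv.
Qed.

Lemma powR_time a t u : 0 < t -> 0 < u ->
 (4 * pi * t) `^ (- a) = (u / t) `^ a * (4 * pi * u) `^ (- a).
Proof.
move=> t0 u0; have -> : 4 * pi * u = (u / t) * (4 * pi * t) :> R by field; rewrite gt_eqF.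
have A0 : 0 <= 4 * pi * t by rewrite !mulr_ge0 ?pi_ge0 ?(ltW t0).
move: (4 * pi * t) A0 => A A0; rewrite [(_ * A) `^ _]powRM ?divr_ge0 ?(ltW t0) ?(ltW u0)// mulrA.
by rewrite [X in _ = _ * X * _]powRN mulfV ?mul1r// gt_eqF// powR_gt0// divr_gt0.
Qed.

Lemma gauss_time n t u (z : 'rV[R]_n) : 0 < t -> t <= u ->
 gauss t z <= (u / t) `^ (n%:R / 2) * gauss u z.
Proof.
move=> t0 tu; have u0 := lt_le_trans t0 tu.
rewrite !gaussE mulrA; apply: ler_pM; rewrite ?powR_ge0 ?expR_ge0//.
 by rewrite -powR_time.
rewrite ler_expR lerN2 ler_wpM2l ?sqn_ge0// lef_pV2 ?posrE ?mulr_gt0//.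
by rewrite ler_pM2l.
Qed.

(** In each coordinate the two sides differ by a multiple of a square. The free parameter [d] gives
    the triangle inequality when optimised, and it is the relative time loss in the Harnack
    inequality. *)
Lemma sqnD_le n d (x y : 'rV[R]_n) : 0 < d ->
 sqn (x + y) <= (1 + d) * sqn x + (1 + d^-1) * sqn y.
Proof.
move=> d0; rewrite /sqn !mulr_sumr -big_split /=; apply: ler_sum => i _.
rewrite mxE; set a := x _ _; set b := y _ _; rewrite -subr_ge0.
have -> : (1 + d) * a ^+ 2 + (1 + d^-1) * b ^+ 2 - (a + b) ^+ 2 =
  d * (a - b / d) ^+ 2 by field; rewrite gt_eqF.
by rewrite mulr_ge0 ?sqr_ge0 ?(ltW d0).
Qed.

(** Changing the base point is paid for by the longer time [(1 + d) * t]: apply [sqnD_le] to $x'-y =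
    (x-y)+(x'-x)$. The exponential factor stays bounded once [t] is at least of the order of
    $|x-x'|^2$. *)
Lemma gauss_harnack n t d (x x' y : 'rV[R]_n) : 0 < t -> 0 < d ->
 gauss t (x - y) <= (1 + d) `^ (n%:R / 2) * expR (sqn (x - x') / (4 * t * d)) *
   gauss ((1 + d) * t) (x' - y).
Proof.
move=> t0 d0; have d1 : 0 < 1 + d by rewrite addr_gt0.
rewrite !gaussE [leRHS]mulrACA -expRD; apply: ler_pM; rewrite ?powR_ge0 ?expR_ge0//.
 by rewrite (powR_time _ t0 (mulr_gt0 d1 t0)) mulfK// gt_eqF.
rewrite ler_expR.
have := sqnD_le (x - y) (x' - x) d0; rewrite [x - y + _]addrC subrKA => h.
rewrite -(sqnN (x - x')) opprB.
rewrite -subr_ge0.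
have -> : sqn (x' - x) / (4 * t * d) - sqn (x' - y) / (4 * ((1 + d) * t)) - - (sqn (x - y) / (4 * t)) =
 ((1 + d) * sqn (x - y) + (1 + d^-1) * sqn (x' - x) - sqn (x' - y)) / (4 * ((1 + d) * t)).
 by field; rewrite !gt_eqF.
by rewrite divr_ge0 ?subr_ge0// !mulr_ge0 ?ltW.
Qed.

(* Both the kernel of the fractional Laplacian (b = - gamma) and the Riesz
  kernel (b = s). *)
Lemma int_gauss_time n b (z : 'rV[R]_n) : b < n%:R / 2 -> z != 0 ->
 (\int[leb1]_t (pw (b - 1) t * gauss t z)%:E =
  (Gamma (n%:R / 2 - b) * pi `^ (- (n%:R / 2)) * 4 `^ (- b) * enorm z `^ (2 * b - n%:R))%:E)%E.
Proof.
move=> bn z0; have sz : 0 < sqn z by rewrite lt_neqAle sqn_ge0 eq_sym sqn_eq0 z0.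
have a0 : 0 < n%:R / 2 - b by rewrite subr_gt0.
have p4 : 0 < 4 * pi :> R by rewrite mulr_gt0 ?pi_gt0.
transitivity (\int[leb1]_t ((4 * pi) `^ (- (n%:R / 2)) *
  (pw (- (n%:R / 2 - b) - 1) t * expR (- (sqn z / 4 / t))))%:E)%E.
 apply: eq_integral => t _; congr EFin.
 have [t0|t0] := leP t 0; first by rewrite !pw0// !mul0r mulr0.
 rewrite !gaussE powRM ?(ltW p4) ?(ltW t0)//.
 have -> : - (n%:R / 2 - b) - 1 = (b - 1) + (- (n%:R / 2)) by ring.
 rewrite (pwD (b - 1) (- (n%:R / 2))) (pwE (- (n%:R / 2)) t0).
 have -> : sqn z / (4 * t) = sqn z / 4 / t by rewrite invfM mulrA.
 by ring.
rewrite ge0_intZl ?powR_ge0//.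
- rewrite int_gamma_inv ?divr_gt0// -EFinM; congr EFin.
 rewrite -enorm_sqr !powRM ?pi_ge0 ?exprn_ge0 ?sqrtr_ge0 ?invr_ge0//.
 have ez : 0 < enorm z by rewrite sqrtr_gt0.
 have -> : enorm z `^ (2 * b - n%:R) =
   enorm z `^ (- (n%:R / 2 - b)) * enorm z `^ (- (n%:R / 2 - b)).
  by rewrite -powRD ?(gt_eqF ez) ?implybT//; congr (_ `^ _); field.
 have -> : 4^-1 `^ (- (n%:R / 2 - b)) = 4 `^ (n%:R / 2) * 4 `^ (- b) :> R.
  have -> : 4^-1 = 4 `^ (-1) :> R by rewrite powR_inv1.
  by rewrite -powRrM -powRD ?pnatr_eq0 ?implybT//; congr (_ `^ _); ring.
 have -> : 4 `^ (- (n%:R / 2)) = (4 `^ (n%:R / 2))^-1 :> R by rewrite powRN.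
 by field; rewrite gt_eqF// powR_gt0.
- apply: measurable_funM; first exact: msble_pw.
 apply: msble_expf; apply: msble_oppf; apply: measurable_funM => //.
 exact: msble_invf.
- by move=> t; rewrite mulr_ge0 ?pw_ge0 ?expR_ge0.
Qed.

End gauss.

(** * The Euclidean norm and polynomial weights *)

Section norms.
Context {R : realType}.
Implicit Types (a b c t : R).

Lemma enormN n (x : 'rV[R]_n) : enorm (- x) = enorm x.
Proof. by rewrite /enorm -!/(sqn _) sqnN. Qed.

Lemma enorm_sub n (x y : 'rV[R]_n) : enorm (x - y) = enorm (y - x).
Proof. by rewrite -enormN opprB. Qed.

Lemma enorm_eq0 n (x : 'rV[R]_n) : (enorm x == 0) = (x == 0).
Proof. by rewrite -sqn_eq0 -enorm_sqr sqrf_eq0. Qed.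

Lemma enorm0 n : enorm (0 : 'rV[R]_n) = 0.
Proof. by apply/eqP; rewrite enorm_eq0. Qed.

Lemma enorm_gt0 n (x : 'rV[R]_n) : (0 < enorm x) = (x != 0).
Proof. by rewrite lt_neqAle enorm_ge0 andbT eq_sym enorm_eq0. Qed.

Lemma enormZ n c (x : 'rV[R]_n) : enorm (c *: x) = `|c| * enorm x.
Proof.
rewrite /enorm (_ : \sum_i _ = c ^+ 2 * \sum_i x ord0 i ^+ 2).
 by rewrite sqrtrM ?sqr_ge0// sqrtr_sqr.
by rewrite mulr_sumr; apply: eq_bigr => i _; rewrite mxE exprMn.
Qed.

Lemma enorm_triangle n (x y : 'rV[R]_n) : enorm (x + y) <= enorm x + enorm y.
Proof.
have [->|x0] := eqVneq x 0; first by rewrite add0r enorm0 add0r.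
have [->|y0] := eqVneq y 0; first by rewrite addr0 enorm0 addr0.
have ex : 0 < enorm x by rewrite enorm_gt0.
have ey : 0 < enorm y by rewrite enorm_gt0.
rewrite -(@ler_pXn2r _ 2%N)// ?nnegrE ?addr_ge0 ?enorm_ge0// enorm_sqr.
(* The choice [d = enorm y / enorm x] is optimal: it turns the right-hand side into the square of
   the sum of the norms. *)
apply: le_trans (sqnD_le _ _ (divr_gt0 ey ex)) _.
rewrite -!enorm_sqr le_eqVlt; apply/orP; left; apply/eqP; field.
by rewrite !gt_eqF.
Qed.

Lemma coord_le_enorm n (x : 'rV[R]_n) i : `|x ord0 i| <= enorm x.
Proof.
rewrite -(@ler_pXn2r _ 2%N)// ?nnegrE ?enorm_ge0// enorm_sqr real_normK ?num_real//.
by rewrite /sqn (bigD1 i)//= lerDl sumr_ge0// => j _; rewrite sqr_ge0.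
Qed.

Lemma norm_le_enorm n (x : 'rV[R]_n) : `|x| <= enorm x.
Proof. by apply: rV_norm_le => [|i]; [exact: enorm_ge0|exact: coord_le_enorm]. Qed.

Lemma enorm_le_norm n (x : 'rV[R]_n) : enorm x <= Num.sqrt n%:R * `|x|.
Proof.
rewrite -(@ler_pXn2r _ 2%N)// ?nnegrE ?enorm_ge0 ?mulr_ge0 ?sqrtr_ge0//.
rewrite enorm_sqr exprMn sqr_sqrtr//.
apply: (@le_trans _ _ (\sum_(i < n) `|x| ^+ 2)).
 apply: ler_sum => i _; rewrite -[leLHS]real_normK ?num_real//.
 by rewrite ler_pXn2r ?nnegrE//; exact: coord_le_norm.
by rewrite sumr_const card_ord mulr_natl.
Qed.

Lemma enorm_delta n (i : 'I_n) : enorm (ebase R i) = 1.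
Proof.
rewrite /enorm (bigD1 i)//= big1 ?addr0.
 by rewrite mxE !eqxx expr1n sqrtr1.
by move=> j ji; rewrite mxE eqxx (negbTE ji) expr0n.
Qed.

Lemma cont_enorm n : continuous (@enorm R n).
Proof.
move=> x; apply/(cvgrPdist_le (FF := nbhs_filter x)) => e e0.
have s0 : 0 < Num.sqrt n%:R + 1 :> R by rewrite ltr_wpDl ?sqrtr_ge0.
near=> y.
have h (u w : 'rV[R]_n) : enorm u - enorm w <= enorm (u - w).
 by rewrite lerBlDr; apply: le_trans (enorm_triangle _ _); rewrite subrK.
apply: (@le_trans _ _ (enorm (x - y))).
 by rewrite ler_norml h andbT lerNl opprB enorm_sub h.
apply: le_trans (enorm_le_norm _) _.
apply: (@le_trans _ _ ((Num.sqrt n%:R + 1) * `|x - y|)).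
 by rewrite ler_wpM2r// lerDl.
rewrite mulrC -ler_pdivlMr//.
near: y; apply: cvgr_dist_le; [exact: cvg_id|exact: divr_gt0].
Unshelve. all: by end_near. Qed.

Lemma powR_add_le a s t : 0 <= a -> 0 <= s -> 0 <= t ->
 (s + t) `^ a <= 2 `^ a * (s `^ a + t `^ a).
Proof.
move=> a0 s0 t0; wlog st : s t s0 t0 / s <= t.
 move=> h; have [/h|/ltW/h] := leP s t; first exact.
 by rewrite addrC [_ `^ _ + _]addrC; exact.
apply: (@le_trans _ _ ((2 * t) `^ a)).
 by apply: ge0_ler_powR; rewrite ?nnegrE ?addr_ge0 ?mulr_ge0// mulr_natl mulr2n lerD2r.
by rewrite powRM// ler_wpM2l ?powR_ge0// lerDr powR_ge0.
Qed.

(** For [a = n + 2g] this is the weight in the definition of [Ls]. *)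
Definition wt n a (x : 'rV[R]_n) : R := (1 + enorm x `^ a)^-1.

Lemma wt_gt0 n a (x : 'rV[R]_n) : 0 < wt a x.
Proof. by rewrite invr_gt0 ltr_pwDl// powR_ge0. Qed.

Lemma wt_ge0 n a (x : 'rV[R]_n) : 0 <= wt a x. Proof. exact/ltW/wt_gt0. Qed.

Lemma msble_powf d (T : measurableType d) (f : T -> R) a :
 msble f -> msble (fun x : T => f x `^ a).
Proof. exact: (measurableT_comp (@measurable_powR R a)). Qed.

Lemma msble_wt n a : msble (@wt n a).
Proof.
apply: msble_invf; apply: measurable_funD => //.
by apply: msble_powf; exact: msble_enorm.
Qed.

Lemma wt_shift n a r (x y : 'rV[R]_n) : 0 <= a -> enorm x <= r ->
 wt a (y - x) <= 2 `^ a * (1 + r `^ a) * wt a y.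
Proof.
move=> a0 xr; rewrite /wt -ler_pdivrMr ?invr_gt0 ?ltr_pwDl ?powR_ge0// invrK mulrC.
rewrite ler_pdivrMr ?ltr_pwDl ?powR_ge0//.
have r0 : 0 <= r by exact: le_trans (enorm_ge0 x) xr.
have A1 : 1 <= 2 `^ a :> R.
 apply: (@le_trans _ _ (2 `^ 0)); first by rewrite powRr0.
 by apply: ler_powR; rewrite // ler1n.
apply: (@le_trans _ _ (1 + 2 `^ a * (enorm (y - x) `^ a + r `^ a))).
 rewrite lerD2l; apply: le_trans (powR_add_le a0 (enorm_ge0 _) r0).
 apply: ge0_ler_powR; rewrite ?nnegrE ?addr_ge0 ?enorm_ge0//.
 rewrite -{1}(subrK x y); apply: le_trans (enorm_triangle _ _) _.
 by rewrite lerD2l.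
rewrite -[X in _ <= X]mulrA; set A := 2 `^ a; set B := r `^ a; set C := _ `^ a.
have B0 : 0 <= B by exact: powR_ge0.
have C0 : 0 <= C by exact: powR_ge0.
have -> : A * ((1 + B) * (1 + C)) = A + A * (C + B) + A * B * C by ring.
by rewrite -addrA lerD// ler_wpDr// !mulr_ge0// (le_trans _ A1).
Qed.

(** A bound by the weight amounts to a constant bound together with a bound after multiplication by
    $|x|^a$; the factor 2 pays for adding the two. *)
Lemma wt_ge_min n a (x : 'rV[R]_n) c b : 0 <= c ->
 b <= c -> b * enorm x `^ a <= c -> b <= 2 * c * wt a x.
Proof.
move=> c0 bc bxc; rewrite /wt ler_pdivlMr ?ltr_pwDl ?powR_ge0//.
by rewrite mulrDr mulr1 mulrDl mul1r lerD.
Qed.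

(* gauss t z = O(t^gamma wt z) *)
Lemma gauss_wt n g t0 : 0 <= g -> 0 < t0 -> exists2 C, 0 < C &
 forall t (z : 'rV[R]_n), t0 <= t -> gauss t z <= C * t `^ g * wt (n%:R + 2 * g) z.
Proof.
move=> g0 t00; pose a : R := n%:R / 2 + g.
have ga0 : 0 <= a by rewrite addr_ge0// divr_ge0.
have p4 : 0 < 4 * pi :> R by rewrite mulr_gt0 ?pi_gt0.
pose A := (4 * pi * t0) `^ (- (n%:R / 2)) * t0 `^ (- g).
pose B := (4 * pi) `^ (- (n%:R / 2)) * 4 `^ a * (a + 1) `^ (a + 1) : R.
pose B' := (4 * pi) `^ (- (n%:R / 2)) * 4 `^ a * (1 + a `^ a) : R.
exists (2 * (A + B')).
 rewrite mulr_gt0// addr_gt0 ?mulr_gt0 ?powR_gt0 ?mulr_gt0 ?pi_gt0//.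
 by rewrite ltr_pwDl ?powR_ge0.
move=> t z tt; have t1 := lt_le_trans t00 tt.
have A0 : 0 <= A by rewrite mulr_ge0 ?powR_ge0.
have B0 : 0 <= B' by rewrite !mulr_ge0 ?addr_ge0 ?powR_ge0.
rewrite -mulrA -[_ * (_ * wt _ z)]mulrA [2 * _]mulrA mulrA.
rewrite -[2 * _ * _]mulrA.
apply: wt_ge_min.
- by rewrite mulr_ge0 ?powR_ge0// addr_ge0.
- rewrite mulrDl; apply: ler_wpDr; first by rewrite mulr_ge0 ?powR_ge0.
 rewrite !gaussE; apply: (@le_trans _ _ ((4 * pi * t) `^ (- (n%:R / 2)) * 1)).
  by rewrite ler_wpM2l ?powR_ge0// expR_le1 oppr_le0 divr_ge0 ?sqn_ge0 ?mulr_ge0 ?(ltW t1).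
 rewrite mulr1 /A -[X in _ <= X]mulrA.
 have h : 1 <= t0 `^ (- g) * t `^ g.
  rewrite powRN mulrC -powR_inv1 ?powR_ge0//.
  rewrite powR_inv1 ?powR_ge0// ler_pdivlMr ?powR_gt0// mul1r.
  by apply: ge0_ler_powR; rewrite ?nnegrE ?(ltW t1) ?(ltW t00).
 apply: (@le_trans _ _ ((4 * pi * t0) `^ (- (n%:R / 2)) * 1)); last by rewrite ler_wpM2l ?powR_ge0.
 rewrite mulr1 !powRN lef_pV2 ?posrE ?powR_gt0 ?mulr_gt0 ?pi_gt0//.
 apply: ge0_ler_powR; rewrite ?nnegrE ?divr_ge0 ?mulr_ge0 ?pi_ge0 ?(ltW t1) ?(ltW t00)//.
 by rewrite ler_pM2l.
- rewrite [X in _ <= X]mulrDl; apply: ler_wpDl; first by rewrite !mulr_ge0 ?powR_ge0.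
 have -> : enorm z `^ (n%:R + 2 * g) = (4 * t) `^ a * (sqn z / (4 * t)) `^ a.
  rewrite -powRM ?mulr_ge0 ?invr_ge0 ?sqn_ge0 ?mulr_ge0 ?(ltW t1)//.
  have -> : 4 * t * (sqn z / (4 * t)) = sqn z by field; rewrite gt_eqF.
  rewrite -enorm_sqr -powR_mulrn ?enorm_ge0// -powRrM.
  by congr (_ `^ _); rewrite /a; field.
 rewrite !gaussE; set r := sqn z / _.
 have r0 : 0 <= r by rewrite divr_ge0 ?sqn_ge0 ?mulr_ge0 ?(ltW t1).
 have h : expR (- r) * r `^ a <= 1 + a `^ a.
  move: ga0; rewrite le_eqVlt => /predU1P[<-|aa].
   by rewrite !powRr0 mulr1 ler_wpDr// expR_le1 oppr_le0.
  rewrite expRN mulrC ler_pdivrMr ?expR_gt0//.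
  by apply: le_trans (powR_le_expR aa r0) _; rewrite ler_wpM2r ?expR_ge0// lerDr.
 have -> : (4 * pi * t) `^ (- (n%:R / 2)) * expR (- r) * ((4 * t) `^ a * r `^ a) =
   (4 * pi * t) `^ (- (n%:R / 2)) * (4 * t) `^ a * (expR (- r) * r `^ a) by ring.
 rewrite /B' [X in _ <= X]mulrAC.
 apply: ler_pM => //; rewrite ?mulr_ge0 ?powR_ge0 ?expR_ge0//.
 rewrite powRM ?(ltW p4) ?(ltW t1)// [(4 * t) `^ _]powRM ?(ltW t1)//.
 rewrite mulrACA ler_wpM2l ?mulr_ge0 ?powR_ge0// -powRD ?(gt_eqF t1) ?implybT//.
 by rewrite /a addrA addNr add0r.
Qed.

Lemma integrableR d (T : measurableType d) (mu : {measure set T -> \bar R}) (f : T -> R) :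
 msble f -> (\int[mu]_x (`|f x|)%:E < +oo)%E ->
 intgr mu f.
Proof. by move=> mf foo; apply/integrableP; split; [exact: mEFin|]. Qed.

Lemma integrableR_le d (T : measurableType d) (mu : {measure set T -> \bar R}) (f h : T -> R) :
 msble f -> msble h -> (forall x, `|f x| <= h x) ->
 (\int[mu]_x (h x)%:E < +oo)%E -> intgr mu f.
Proof.
move=> mf mh fh hoo; apply: integrableR => //.
apply: le_int_lty fh hoo => //; exact: measurableT_comp.
Qed.

Lemma integrable_abs_lty d (T : measurableType d) (mu : {measure set T -> \bar R}) (f : T -> R) :
 intgr mu f -> (\int[mu]_x (`|f x|)%:E < +oo)%E.
Proof. by move=> /integrableP[]. Qed.

Lemma integrable_meas d (T : measurableType d) (mu : {measure set T -> \bar R}) (f : T -> R) :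
 intgr mu f -> msble f.
Proof. by move=> /integrableP[/measurable_EFinP]. Qed.

Lemma EFin_int d (T : measurableType d) (mu : {measure set T -> \bar R}) (f : T -> R) :
 intgr mu f ->
 (\int[mu]_x (f x)%:E = (\int[mu]_x f x)%:E)%E.
Proof. by move=> h; rewrite /Rintegral fineK//; exact: integrable_fin_num. Qed.

Lemma Ls_lty n g (v : 'rV[R]_n -> R) : msble v -> Ls g v ->
 (\int[lebn n]_x (`|v x| * wt (n%:R + 2 * g) x)%:E < +oo)%E.
Proof.
move=> mv; rewrite /Ls intRn_ge0E//.
- apply: mEFin; apply: measurable_funM; last exact: msble_wt.
 exact: measurableT_comp.
- by move=> x; rewrite lee_fin mulr_ge0// wt_ge0.
Qed.

Lemma msble_pwf d (T : measurableType d) (f : T -> R) a :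
 msble f -> msble (fun x : T => pw a (f x)).
Proof. exact: (measurableT_comp (msble_pw a)). Qed.

Lemma msble_wtf d (T : measurableType d) n a (f : T -> 'rV[R]_n) :
 msble f -> msble (fun x : T => wt a (f x)).
Proof. exact: (measurableT_comp (@msble_wt n a)). Qed.

Lemma msble_enormf d (T : measurableType d) n (f : T -> 'rV[R]_n) :
 msble f -> msble (fun x : T => enorm (f x)).
Proof. exact: (measurableT_comp (@msble_enorm R n)). Qed.

Lemma msble_sqnf d (T : measurableType d) n (f : T -> 'rV[R]_n) :
 msble f -> msble (fun x : T => sqn (f x)).
Proof. exact: (measurableT_comp (@msble_sqn R n)). Qed.

Lemma msble_normf d (T : measurableType d) (f : T -> R) :
 msble f -> msble (fun x : T => `|f x|).
Proof. exact: measurableT_comp. Qed.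

(* The Riesz-type kernel |z|^{-a}, with value 0 at z = 0. *)
Definition rker n (a : R) (z : 'rV[R]_n) : R := (enorm z `^ a)^-1.

Lemma rker_ge0 n a (z : 'rV[R]_n) : 0 <= rker a z.
Proof. by rewrite invr_ge0 powR_ge0. Qed.

Lemma msble_rkerf d (T : measurableType d) n a (f : T -> 'rV[R]_n) :
 msble f -> msble (fun x : T => rker a (f x)).
Proof. by move=> mf; apply: msble_invf; apply: msble_powf; exact: msble_enormf. Qed.

Lemma rkerN n a (z : 'rV[R]_n) : rker a (- z) = rker a z.
Proof. by rewrite /rker enormN. Qed.

End norms.

(** * Automation for nonnegativity and measurability goals *)

Ltac pos1 := lazymatch goal with
 | |- is_true (0 <= gauss _ _) => exact: gauss_ge0
 | |- is_true (0 <= pw _ _) => exact: pw_ge0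
 | |- is_true (0 <= rker _ _) => exact: rker_ge0
 | |- is_true (0 <= wt _ _) => exact: wt_ge0
 | |- is_true (0 <= powR _ _) => exact: powR_ge0
 | |- is_true (0 <= expR _) => exact: expR_ge0
 | |- is_true (0 <= `|_|) => exact: normr_ge0
 | |- is_true (0 <= enorm _) => exact: enorm_ge0
 | |- is_true (0 <= sqn _) => exact: sqn_ge0
 | |- is_true (0 <= _%:R) => exact: ler0n
 | |- is_true (0 <= pi) => exact: pi_ge0
 | |- is_true (0 <= _ ^+ 2) => exact: sqr_ge0
 | |- is_true (0 <= _^-1) => rewrite invr_ge0
 | |- is_true (0 <= _ * _) => first [assumption | apply: mulr_ge0]
 | |- is_true (0 <= _ + _) => first [assumption | apply: addr_ge0]
 | |- is_true (0 <= _) => first [assumption | (apply: ltW; assumption)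
   | match goal with H : forall _, _ |- _ => exact: H end | exact: ler01 | exact: lexx]
 end.
Ltac pos := repeat pos1.

Ltac meas1 := first [ assumption | exact: measurable_cst | lazymatch goal with |- measurable_fun _ ?h => lazymatch h with
 | (fun x => x) => exact: measurable_id
 | (fun x => x.1) => exact: measurable_fst
 | (fun x => x.2) => exact: measurable_snd
 | (fun x => EFin _) => apply: mEFin
 | (fun x => gauss _ _) => apply: msble_gaussf
 | (fun x => pw _ _) => apply: msble_pwf
 | (fun x => rker _ _) => apply: msble_rkerf
 | (fun x => wt _ _) => apply: msble_wtf
 | (fun x => enorm _) => apply: msble_enormf
 | (fun x => sqn _) => apply: msble_sqnf
 | (fun x => expR _) => apply: msble_expf
 | (fun x => powR _ _) => apply: msble_powf
 | (fun x => `|_|) => apply: msble_normf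
 | (fun x => @Algebra.natmul _ _ (nat_of_bool (@Order.le _ _ _ _))) => apply: msble_leR
 | (fun x => @Algebra.natmul _ _ (nat_of_bool (@Order.lt _ _ _ _))) => apply: msble_ltR
 | (fun x => Num.min _ _) => apply: measurable_minr
 | (fun x => _ * _) => apply: measurable_funM
 | (fun x => _ - _) => first [apply: measurable_funB | apply: msble_rV_sub]
 | (fun x => _ + _) => first [apply: measurable_funD | apply: msble_rV_add]
 | (fun x => - _) => first [apply: msble_oppf | apply: msble_rV_opp]
 | (fun x => _^-1) => apply: msble_invf
 | (fun x => _ ^+ _) => apply: measurable_funX
 | (fun x => _ *: _) => apply: msble_rV_scale
 | (fun x => fun_of_matrix x _ _) => exact: msble_coord
 | (fun x => ?v _) => match goal with
    H : measurable_fun _ ?w |- _ => constr_eq v w; apply: (measurableT_comp H) end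
 | (pw _) => exact: msble_pw
 | (@gauss _ _ _) => exact: msble_gaussf
 | (@enorm _ _) => exact: msble_enorm
 | (rker _) => exact: msble_rkerf
 | (wt _) => exact: msble_wt
 | (@sqn _ _) => exact: msble_sqn
 | (@expR _) => exact: msble_expf
 end end ].
Ltac meas := repeat meas1.

Ltac side := lazymatch goal with
 | |- measurable_fun _ _ => solve [meas]
 | |- is_true (0 <= _) => solve [pos]
 | |- forall _, is_true (0 <= _) => solve [move=> *; pos]
 | |- forall _ _, is_true (0 <= _) => solve [move=> *; pos]
 | |- forall _ _, is_true (0 <= _%:E)%E => solve [move=> *; rewrite lee_fin; pos]
 | |- forall _, is_true (0 <= _%:E)%E => solve [move=> *; rewrite lee_fin; pos]
 | |- is_true (0 <= _%:E)%E => solve [rewrite lee_fin; pos]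
 end.

(** * The fractional Laplacian by second differences and subordination *)

Section fractional_laplacian.
Context {R : realType}.
Variable n : nat.
Implicit Types (v u : 'rV[R]_n -> R) (x y z : 'rV[R]_n).

Lemma msble_rker a : msble (@rker R n a).
Proof. exact: msble_rkerf. Qed.

(** Second differences cancel the odd part of the increment: the singular integral then converges
    absolutely and no principal value is left. *)
Definition sdiff u x z : R := 2 * u x - u (x + z) - u (x - z).

Lemma msble_sdiff u x : msble u -> msble (sdiff u x).
Proof.
move=> mu; apply: measurable_funB.
 apply: measurable_funB => //; apply: (measurableT_comp mu).
 exact: msble_rV_add.
by apply: (measurableT_comp mu); exact: msble_rV_sub.
Qed.

Lemma sdiff0 u x : sdiff u x 0 = 0.
Proof. by rewrite /sdiff addr0 subr0; ring. Qed.

Definition sdiff_int (a : R) u x : \bar R :=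
 (\int[lebn n]_z (`|sdiff u x z| * rker a z)%:E)%E.

(** The candidate for $(-\Delta)^g u$; the factor 1/2 compensates for counting both [x + z] and
    [x - z]. *)
Definition Lam g u x : R :=
 Cfl n g / 2 * \int[lebn n]_z (sdiff u x z * rker (n%:R + 2 * g) z).

Lemma integrable_sdiff a u x : msble u -> (sdiff_int a u x < +oo)%E ->
 intgr (lebn n) (fun z => sdiff u x z * rker a z).
Proof.
move=> mu fin; apply: integrableR.
 by apply: measurable_funM; [exact: msble_sdiff|exact: msble_rker].
by under eq_integral do rewrite normrM (ger0_norm (rker_ge0 _ _)).
Qed.

(* integral of min(1,|z|^b) against the kernel |z|^{-n-2g}, b > 2g *)
Lemma gauss_sqn_le t z : 0 < t ->
 gauss t z * (sqn z / t) <= 8 * 2 `^ (n%:R / 2) * gauss (2 * t) z.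
Proof.
move=> t0; have t20 : 0 < 2 * t by rewrite mulr_gt0.
rewrite !gaussE (powR_time _ t0 t20) mulfK ?gt_eqF// -!mulrA.
rewrite [leRHS]mulrCA ler_wpM2l ?powR_ge0// [leRHS]mulrCA ler_wpM2l ?powR_ge0//.
have -> : sqn z / (4 * (2 * t)) = sqn z / t / 8 by field; rewrite gt_eqF.
have -> : sqn z / (4 * t) = sqn z / t / 8 + sqn z / t / 8 by field; rewrite gt_eqF.
set r := sqn z / t; have r0 : 0 <= r by rewrite divr_ge0 ?sqn_ge0 ?ltW.
rewrite opprD expRD -mulrA mulrC -mulrA.
rewrite [expR _ * (r * _)]mulrCA mulrA; apply: ler_wpM2r; first exact: expR_ge0.
rewrite expRN ler_pdivrMr ?expR_gt0//.
apply: (@le_trans _ _ (8 * (1 + r / 8))); last by rewrite ler_pM2l// expR_ge1Dx.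
by rewrite mulrDr mulr1 mulrC divfK// ler_wpDl.
Qed.

Lemma powR_le_1Dsqr (y b : R) : 0 <= y -> 0 <= b -> b <= 2 -> y `^ b <= 1 + y ^+ 2.
Proof.
move=> y0 b0 b2; have [y1|y1] := leP y 1.
 rewrite ler_wpDr ?sqr_ge0//; apply: (@le_trans _ _ (1 `^ b)); last by rewrite powR1.
 by apply: ge0_ler_powR; rewrite ?nnegrE.
apply: (@le_trans _ _ (y `^ 2)); first by apply: ler_powR => //; exact: ltW.
by rewrite (powR_mulrn 2)// lerDr.
Qed.

(** The constant in the representation of $|z|^{-n-2g}$ as the mixture of Gaussians with density
    $t^{-g-1}$. *)
Definition ck (g : R) : R := Gamma (n%:R / 2 + g) * pi `^ (- (n%:R / 2)) * 4 `^ g.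

(** This is $1/|\Gamma(-g)|$, the subordination constant in $\lambda^g = \kappa\int_0^\infty
    (1-e^{-\lambda t})\,t^{-g-1}dt$. *)
Definition kap (g : R) : R := g / Gamma (1 - g).

Lemma ck_gt0 g : 0 < g -> 0 < ck g.
Proof.
by move=> g0; rewrite !mulr_gt0 ?powR_gt0 ?pi_gt0// Gamma_gt0// ltr_wpDl// divr_ge0.
Qed.

Lemma Cfl_kap g : Cfl n g = kap g * ck g.
Proof. by rewrite /Cfl /kap /ck powRN invfM; ring. Qed.

Lemma rker_gauss g z : 0 < g -> z != 0 ->
 (\int[leb1]_t (pw (- g - 1) t * gauss t z)%:E = (ck g * rker (n%:R + 2 * g) z)%:E)%E.
Proof.
move=> g0 z0; rewrite int_gauss_time//; last first.
 by apply: (@lt_le_trans _ _ 0); rewrite ?oppr_lt0// divr_ge0.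
congr EFin; rewrite /ck opprK /rker -powRN; congr (_ * _ `^ _); ring.
Qed.

(** Scaling: $|z|^b \le t^{b/2}(1+|z|^2/t)$ for $b \le 2$, and [gauss_sqn_le] absorbs $|z|^2/t$ into
    a Gaussian of twice the time. *)
Lemma int_sqn_gauss_le (b t : R) : 0 < t -> 0 <= b -> b <= 2 ->
 (\int[lebn n]_z (enorm z `^ b * gauss t z)%:E <=
  (t `^ (b / 2) * (1 + 8 * 2 `^ (n%:R / 2)))%:E)%E.
Proof.
move=> t0 b0 b2; set c := 8 * _.
have c0 : 0 <= c by rewrite mulr_ge0// powR_ge0.
have mg s : msble (fun z : 'rV[R]_n => gauss s z) by exact: msble_gaussf.
apply: (@le_trans _ _ (\int[lebn n]_z (t `^ (b / 2) * (gauss t z + c * gauss (2 * t) z))%:E)%E).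
 apply: le_intR.
 - by move=> z; pos.
 - apply: measurable_funM => //; apply: msble_powf; exact: msble_enorm.
 - apply: measurable_funM => //; apply: measurable_funD => //; exact: measurable_funM.
 - move=> z; have -> : enorm z `^ b = t `^ (b / 2) * (enorm z / Num.sqrt t) `^ b.
   have -> : (Num.sqrt t)^-1 = t `^ (- 2^-1) by rewrite powRN powR12_sqrt// ltW.
   rewrite powRM ?enorm_ge0 ?powR_ge0// -powRrM mulrCA -powRD ?(gt_eqF t0) ?implybT//.
   by rewrite (_ : _ + _ = 0) ?powRr0 ?mulr1//; field.
  rewrite -mulrA ler_wpM2l ?powR_ge0//.
  apply: (@le_trans _ _ ((1 + (enorm z / Num.sqrt t) ^+ 2) * gauss t z)).
   by rewrite ler_wpM2r ?gauss_ge0// powR_le_1Dsqr// divr_ge0 ?enorm_ge0 ?sqrtr_ge0.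
  rewrite mulrDl mul1r lerD2l expr_div_n enorm_sqr sqr_sqrtr ?(ltW t0)// mulrC.
  exact: gauss_sqn_le.
rewrite ge0_intZl ?powR_ge0//; last 2 first.
- by apply: measurable_funD => //; exact: measurable_funM.
- by move=> z; pos.
rewrite ge0_intD; try side.
rewrite ge0_intZl; try side.
by rewrite !int_gauss ?mulr_gt0// mule1 -EFinD -EFinM.
Qed.

(** The Gaussian mixture replaces polar coordinates. For [t <= 1] the moment of order [b] leaves
    $t^{b/2-g-1}$, integrable at 0 because [2 * g < b]; for [t >= 1] the minimum is bounded by 1 and
    $t^{-g-1}$ is integrable at infinity. *)
Lemma int_min_rker (g b : R) : 0 < g -> 2 * g < b -> b <= 2 ->
 (\int[lebn n]_z (Num.min 1 (enorm z `^ b) * rker (n%:R + 2 * g) z)%:E < +oo)%E.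
Proof.
move=> g0 gb b2; have b0 : 0 < b by apply: lt_trans gb; rewrite mulr_gt0.
pose mn z : R := Num.min 1 (enorm z `^ b).
have mn0 z : 0 <= mn z by rewrite le_min ler01 powR_ge0.
have mmn : msble mn.
 by apply: measurable_minr => //; apply: msble_powf; exact: msble_enorm.
have mg s : msble (fun z : 'rV[R]_n => gauss s z) by exact: msble_gaussf.
have c0 := ck_gt0 g0.
set c : R := 1 + 8 * 2 `^ (n%:R / 2).
have cp : 0 <= c by rewrite addr_ge0 ?mulr_ge0 ?powR_ge0.
have mG : msble (fun p : 'rV[R]_n * R => mn p.1 * (pw (- g - 1) p.2 * gauss p.2 p.1)).
 apply: measurable_funM; first exact: (measurableT_comp mmn measurable_fst).
 apply: measurable_funM; first exact: (measurableT_comp (msble_pw _) measurable_snd).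
 apply: msble_gaussf; [exact: measurable_snd|exact: measurable_fst].
have E : (\int[lebn n]_z (mn z * (ck g * rker (n%:R + 2 * g) z))%:E =
  \int[leb1]_t \int[lebn n]_z (mn z * (pw (- g - 1) t * gauss t z))%:E)%E.
 rewrite -(@int_swapR _ _ _ _ _ (lebn n) leb1 (fun z t => mn z * (pw (- g - 1) t * gauss t z)))//; last first.
  by move=> z t; pos.
 apply: eq_integral => z _; rewrite ge0_intZl//.
 - have [->|z0] := eqVneq z 0.
   by rewrite /mn enorm0 powR0 ?gt_eqF// (min_idPr _)// mul0r mul0e.
  by rewrite rker_gauss// -EFinM.
 - apply: measurable_funM; first exact: msble_pw.
  exact: msble_gaussf.
 - by move=> t; pos.
have F : (\int[lebn n]_z (mn z * (ck g * rker (n%:R + 2 * g) z))%:E < +oo)%E.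
 rewrite E; apply: (@le_lt_trans _ _ (\int[leb1]_t
   (c * (pw ((b / 2 - g) - 1) t * (t <= 1)%R%:R) + pw (- g - 1) t * (1 <= t)%R%:R)%:E)%E).
  apply: ge0_le_integral => //.
  - by move=> t _; apply: int_ge0R => z; pos.
  - apply: (@msble_int2 _ _ _ _ _ (lebn n) (fun t z => (mn z * (pw (- g - 1) t * gauss t z))%:E)).
    apply: mEFin; apply: measurable_funM; first exact: (measurableT_comp mmn measurable_snd).
    apply: measurable_funM; first exact: (measurableT_comp (msble_pw _) measurable_fst).
    apply: msble_gaussf; [exact: measurable_fst|exact: measurable_snd].
   by move=> t z; rewrite lee_fin; pos.
  - apply: mEFin; apply: measurable_funD; last exact: msble_pw_tail.
   by apply: measurable_funM => //; exact: msble_pw_head.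
  - move=> t _; have [t0|t0] := leP t 0.
    rewrite integral0_eq; first by rewrite lee_fin !pw0// !mul0r mulr0 addr0.
    by move=> z _; rewrite pw0// mul0r mulr0.
   under eq_integral do rewrite mulrCA.
   rewrite ge0_intZl ?pw_ge0//; last 2 first.
   + exact: measurable_funM.
   + by move=> z; pos.
   have [t1|t1] := leP t 1.
    apply: (@le_trans _ _ ((pw (- g - 1) t)%:E * (t `^ (b / 2) * c)%:E)%E).
     rewrite lee_wpmul2l ?lee_fin ?pw_ge0//; apply: le_trans (int_sqn_gauss_le t0 (ltW b0) b2).
     apply: le_intR => [z|||z].
     * by pos.
     * exact: measurable_funM.
     * by apply: measurable_funM => //; apply: msble_powf; exact: msble_enorm.
     * by rewrite ler_wpM2r ?mn0 ?gauss_ge0// ge_min lexx orbT.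
    rewrite -EFinM lee_fin mulr1 -[leLHS]addr0 lerD ?mulr_ge0 ?pw_ge0//.
    have -> : b / 2 - g - 1 = (- g - 1) + b / 2 by ring.
    by rewrite (pwD (- g - 1)) (pwE (b / 2) t0) le_eqVlt; apply/orP; left; apply/eqP; ring.
   rewrite (ltW t1) mulr1 mulr0 mulr0 add0r -[leRHS]mule1 lee_wpmul2l ?lee_fin ?pw_ge0//.
   rewrite -(int_gauss n t0); apply: le_intR => [z|||z] //.
   * by pos.
   * exact: measurable_funM.
   * by rewrite ler_piMl ?mn0 ?gauss_ge0// ge_min lexx.
 have h0 : 0 < b / 2 - g by rewrite subr_gt0 ltr_pdivlMr// mulrC.
 rewrite ge0_intD; last 4 first.
 - by move=> t; pos.
 - by move=> t; pos.
 - by apply: measurable_funM => //; exact: msble_pw_head.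
 - exact: msble_pw_tail.
 rewrite int_pw_tail// ge0_intZl//; last 2 first.
 - exact: msble_pw_head.
 - by move=> t; pos.
 by rewrite int_pw_head// -EFinM -EFinD ltry.
move: F; under eq_integral do rewrite mulrCA.
rewrite ge0_intZl ?(ltW c0)//; last 2 first.
- by apply: measurable_funM => //; exact: msble_rker.
- by move=> z; pos.
case: (\int[_]_z _)%E (int_ge0R (lebn n) (fun z => mulr_ge0 (mn0 z) (rker_ge0 (n%:R + 2 * g) z))) => [r _ _|_|].
- by rewrite ltry.
- by rewrite gt0_muley ?lte_fin.
- by rewrite leeNy_eq.
Qed.

(** Outside the unit ball the weight is below the integrand of [int_min_rker] with exponent 2;
    inside, it is at most 1, hence below a multiple of a Gaussian. *)
Lemma int_wt (g : R) : 0 < g -> g < 1 -> (\int[lebn n]_z (wt (n%:R + 2 * g) z)%:E < +oo)%E.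
Proof.
move=> g0 g1; set a := n%:R + 2 * g.
have a0 : 0 < a by rewrite ltr_wpDl// mulr_gt0.
have g2 : 2 * g < 2 by rewrite gtr_pMr.
have H := int_min_rker g0 g2 (lexx 2).
have mm : msble (fun z : 'rV[R]_n => Num.min 1 (enorm z `^ 2) * rker a z).
 apply: measurable_funM; last exact: msble_rker.
 by apply: measurable_minr => //; apply: msble_powf; exact: msble_enorm.
pose C : R := (gauss 1 (0 : 'rV[R]_n))^-1 * expR 1.
have C0 : 0 <= C by rewrite mulr_ge0 ?invr_ge0 ?gauss_ge0 ?expR_ge0.
apply: (@le_int_lty _ _ _ _ _ (fun z => Num.min 1 (enorm z `^ 2) * rker a z + C * gauss 1 z)).
- by move=> z; exact: wt_ge0.
- exact: msble_wt.
- by apply: measurable_funD => //; apply: measurable_funM => //; exact: msble_gaussf.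
- move=> z; have m0 : 0 <= Num.min 1 (enorm z `^ 2) * rker a z.
  by rewrite mulr_ge0 ?rker_ge0// le_min ler01 powR_ge0.
 have [z1|z1] := leP 1 (enorm z).
  apply: ler_wpDr; first by pos; rewrite invr_ge0 gauss_ge0.
  rewrite (min_idPl _) ?mul1r; last first.
   by rewrite (powR_mulrn 2) ?enorm_ge0// exprn_ege1.
  rewrite /wt /rker lef_pV2 ?posrE ?powR_gt0 ?ltr_pwDl ?powR_ge0//; last exact: lt_le_trans z1.
  by rewrite lerDr.
 rewrite ler_wpDl//; apply: (@le_trans _ _ 1).
  by rewrite /wt invf_le1 ?ltr_pwDl ?powR_ge0// lerDl powR_ge0.
 have -> : gauss 1 z = gauss 1 (0 : 'rV[R]_n) * expR (- (sqn z / 4)).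
  rewrite !gaussE !mulr1; have -> : sqn (0 : 'rV[R]_n) = 0 by apply/eqP; rewrite sqn_eq0.
  by rewrite mul0r oppr0 expR0 mulr1.
 rewrite /C mulrACA mulVf ?gt_eqF ?gauss_gt0// mul1r -expRD -[leLHS]expR0 ler_expR subr_ge0.
 rewrite ler_pdivrMr// mul1r -enorm_sqr.
 apply: (@le_trans _ _ 1); last by rewrite ler1n.
 by rewrite expr_le1 ?enorm_ge0// ltW.
- rewrite ge0_intD//.
 + rewrite ge0_intZl; try side.
  by rewrite int_gauss// mule1; apply: lte_add_pinfty; rewrite ?ltry.
 + by move=> z; rewrite mulr_ge0 ?rker_ge0// le_min ler01 powR_ge0.
 + by move=> z; pos.
 + by apply: measurable_funM => //; exact: msble_gaussf.
Qed.

Lemma kap_gt0 (g : R) : 0 < g -> g < 1 -> 0 < kap g.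
Proof. by move=> g0 g1; rewrite divr_gt0// Gamma_gt0// subr_gt0. Qed.

Definition heat t u x : R := \int[lebn n]_y (gauss t (x - y) * u y).

Lemma integrable_rV_subr (a : 'rV[R]_n) (f : 'rV[R]_n -> R) :
 intgr (lebn n) f ->
 intgr (lebn n) (fun z => f (a - z)).
Proof.
move=> fi; have mf := integrable_meas fi; apply: integrableR; first by meas.
rewrite (@integral_rV_subr _ _ a (fun z => (`|f z|)%:E)); last by meas.
exact: integrable_abs_lty.
Qed.

Lemma integrable_rV_add (a : 'rV[R]_n) (f : 'rV[R]_n -> R) :
 intgr (lebn n) f ->
 intgr (lebn n) (fun z => f (z + a)).
Proof.
move=> fi; have mf := integrable_meas fi; apply: integrableR; first by meas.
rewrite (@integral_rV_add _ _ a (fun z => (`|f z|)%:E)); last by meas.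
exact: integrable_abs_lty.
Qed.

Lemma Rint_rV_subr (a : 'rV[R]_n) (f : 'rV[R]_n -> R) : msble f ->
 \int[lebn n]_z f (a - z) = \int[lebn n]_z f z.
Proof.
by move=> mf; rewrite /Rintegral (@integral_rV_subr _ _ a (EFin \o f))//; exact: mEFin.
Qed.

Lemma Rint_rV_add (a : 'rV[R]_n) (f : 'rV[R]_n -> R) : msble f ->
 \int[lebn n]_z f (z + a) = \int[lebn n]_z f z.
Proof.
by move=> mf; rewrite /Rintegral (@integral_rV_add _ _ a (EFin \o f))//; exact: mEFin.
Qed.

Lemma integrable_gauss t x : 0 < t ->
 intgr (lebn n) (fun z => gauss t (x - z)).
Proof.
move=> t0; apply: integrable_rV_subr; apply: integrableR; first by meas.
by under eq_integral do rewrite ger0_norm ?gauss_ge0//; rewrite int_gauss// ltry.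
Qed.

Lemma int_gauss_sdiff t u x : 0 < t -> msble u ->
 intgr (lebn n) (fun y => gauss t (x - y) * u y) ->
 intgr (lebn n) (fun z => gauss t z * sdiff u x z) /\
 \int[lebn n]_z (gauss t z * sdiff u x z) = 2 * (u x - heat t u x).
Proof.
move=> t0 mu iu.
pose F y := gauss t (x - y) * u y.
have mF : msble F by rewrite /F; meas.
have i1 := integrable_rV_subr x iu; have i2 := integrable_rV_add x iu.
have e1 z : F (x - z) = gauss t z * u (x - z) by rewrite /F subKr.
have e2 z : F (z + x) = gauss t z * u (x + z) by rewrite /F opprD addrCA subrr addr0 gaussN [z + x]addrC.
have i0 : intgr (lebn n) (fun z => gauss t z * (2 * u x)).
 have := integrable_gauss 0 t0 => h.
 have := integrableZr measurableT (2 * u x) h; apply: eq_integrable => // z _ /=.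
 by rewrite sub0r gaussN.
have i3 : intgr (lebn n) (fun z => gauss t z * (2 * u x) - F (z + x)).
 by have := integrableB measurableT i0 i2; apply: eq_integrable.
have E : (fun z => gauss t z * sdiff u x z) =
  (fun z => gauss t z * (2 * u x) - F (z + x) - F (x - z)).
 by apply/funext => z; rewrite e1 e2 /sdiff; ring.
split.
 by rewrite E; have := integrableB measurableT i3 i1; apply: eq_integrable.
rewrite E RintegralB// RintegralB// Rint_rV_subr// Rint_rV_add//.
rewrite RintegralZr//; last first.
 by have := integrable_gauss 0 t0; apply: eq_integrable => // z _ /=; rewrite sub0r gaussN.
have -> : \int[lebn n]_z gauss t z = 1 by rewrite /Rintegral int_gauss.
rewrite -/(heat t u x); ring.
Qed.

(** Insert the Gaussian mixture for the kernel and apply Fubini in time and space. Finiteness of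
    [sdiff_int] is the absolute convergence it needs; the 2 produced by [int_gauss_sdiff] cancels
    the 1/2 in [Lam]. *)
Lemma Lam_heat g u x : 0 < g -> g < 1 -> msble u ->
 (forall t, 0 < t -> intgr (lebn n) (fun y => gauss t (x - y) * u y)) ->
 (sdiff_int (n%:R + 2 * g) u x < +oo)%E ->
 intgr leb1 (fun t => pw (- g - 1) t * (u x - heat t u x)) /\
 Lam g u x = kap g * \int[leb1]_t (pw (- g - 1) t * (u x - heat t u x)).
Proof.
move=> g0 g1 mu iu fin; have c0 := ck_gt0 g0.
have msd : msble (sdiff u x) := msble_sdiff x mu.
pose f (p : R * 'rV[R]_n) := pw (- g - 1) p.1 * (gauss p.1 p.2 * sdiff u x p.2).
have mf : msble f by rewrite /f; meas.
have I z : (\int[leb1]_t (pw (- g - 1) t * gauss t z)%:E * (`|sdiff u x z|)%:E =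
  (ck g * (`|sdiff u x z| * rker (n%:R + 2 * g) z))%:E)%E.
 have [->|z0] := eqVneq z 0.
  by rewrite sdiff0 normr0 mul0r mulr0 mule0.
 by rewrite rker_gauss// -EFinM; congr EFin; ring.
have fi : (leb1 \x lebn n)%E.-integrable setT (EFin \o f).
 apply/integrable21ltyP; first exact: mEFin.
 rewrite (eq_integral (fun z => (ck g * (`|sdiff u x z| * rker (n%:R + 2 * g) z))%:E)).
  rewrite ge0_intZl; try side.
  by rewrite -ge0_fin_numE ?fin_numM//= ?ge0_fin_numE//; try apply: mule_ge0; rewrite ?lee_fin ?(ltW c0)//; apply: int_ge0R => z; pos.
 move=> z _; rewrite -I muleC -(@ge0_intZl _ _ _ leb1 (fun t => pw (- g - 1) t * gauss t z))//; last 2 first.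
 - by meas.
 - by move=> t; pos.
 apply: eq_integral => t _ /=; rewrite normrM normrM ger0_norm ?pw_ge0// ger0_norm ?gauss_ge0//.
 by congr EFin; ring.
have F0 t : t <= 0 -> pw (- g - 1) t = 0 by move=> t0; rewrite pw0.
have Et t : fubini_F (lebn n) (EFin \o f) t = (2 * (pw (- g - 1) t * (u x - heat t u x)))%:E.
 rewrite /fubini_F /f /=; have [t0|t0] := leP t 0.
  rewrite pw0// mul0r mulr0; under eq_integral do rewrite mul0r; by rewrite integral0.
 have [i e] := int_gauss_sdiff t0 mu (iu t t0).
 under eq_integral do rewrite EFinM.
 by rewrite integralZl// EFin_int// e -EFinM mulrCA.
have Ez z : fubini_G leb1 (EFin \o f) z = (ck g * (sdiff u x z * rker (n%:R + 2 * g) z))%:E.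
 rewrite /fubini_G /f /=; have [->|z0] := eqVneq z 0.
  rewrite sdiff0.
  by rewrite mul0r mulr0; under eq_integral do rewrite !mulr0; rewrite integral0.
 under eq_integral do rewrite mulrA EFinM.
 rewrite integralZr//; last first.
  apply: integrableR; first by meas.
  under eq_integral do rewrite ger0_norm ?mulr_ge0 ?pw_ge0 ?gauss_ge0//.
  by rewrite rker_gauss// ltry.
 by rewrite rker_gauss// -EFinM; congr EFin; ring.
have iF := integrable_fubini_F fi; have iG := Fubini fi.
have i1 : intgr leb1 (fun t => pw (- g - 1) t * (u x - heat t u x)).
 have := integrableZl measurableT 2^-1 iF; apply: eq_integrable => // t _ /=.
 by rewrite Et -EFinM; congr EFin; field.
split=> //.
have isd := integrable_sdiff mu fin.
have : (2 * \int[leb1]_t (pw (- g - 1) t * (u x - heat t u x)))%:E =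
  (ck g * \int[lebn n]_z (sdiff u x z * rker (n%:R + 2 * g) z))%:E.
 rewrite -RintegralZl// -RintegralZl// -!EFin_int.
 - rewrite (eq_integral _ _ (fun t _ => esym (Et t))) [RHS](eq_integral _ _ (fun z _ => esym (Ez z))).
  exact: iG.
 - by have := integrableZl measurableT (ck g) isd; apply: eq_integrable.
 - by have := integrableZl measurableT 2 i1; apply: eq_integrable.
move=> [E]; rewrite /Lam Cfl_kap.
have -> : kap g * ck g / 2 * \int[lebn n]_z (sdiff u x z * rker (n%:R + 2 * g) z) =
 kap g / 2 * (ck g * \int[lebn n]_z (sdiff u x z * rker (n%:R + 2 * g) z)) by ring.
by rewrite -E; field.
Qed.

End fractional_laplacian.

(** * Dominated convergence for sequences and one-sided limits *)

Section dominated.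
Context {R : realType} d (T : measurableType d) (mu : {measure set T -> \bar R}).

Lemma lim_le_cst (u : nat -> R) (l c : R) : u @ \oo --> l -> (forall k, u k <= c) -> l <= c.
Proof.
move=> ul uc; rewrite -(cvg_lim _ ul)//; apply: limr_le; first by apply/cvg_ex; exists l.
exact: nearW.
Qed.

Lemma dominatedR (f : nat -> T -> R) (l h : T -> R) :
 (forall k, msble (f k)) -> intgr mu h ->
 (forall k x, `|f k x| <= h x) -> (forall x, f ^~ x @ \oo --> l x) ->
 intgr mu l /\
 (\int[mu]_x f k x) @[k --> \oo] --> \int[mu]_x l x.
Proof.
move=> mf ih fh fl.
have ml : msble l by apply: (@measurable_fun_cvg _ _ _ setT f) => // x _; exact: fl.
have mh := integrable_meas ih.
have hoo : (\int[mu]_x (h x)%:E < +oo)%E.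
 have := integrable_abs_lty ih; apply: le_lt_trans; apply: le_intR => //.
 - by move=> x; exact: le_trans (fh 0%N x).
 - exact: msble_normf.
 - by move=> x; exact: ler_norm.
have fi k : intgr mu (f k) by exact: (integrableR_le (mf k) mh (fh k)).
have lh x : `|l x| <= h x.
 by apply: (@lim_le_cst (fun k => `|f k x|)) => //; apply: cvg_norm; exact: fl.
have li : intgr mu l by exact: integrableR_le mh lh hoo.
split => //; apply: fine_cvg; rewrite -/(Rintegral _ _ _) -EFin_int//.
apply: (@dominated_cvg _ _ _ mu setT measurableT (fun k => EFin \o f k) (EFin \o l) (EFin \o h)) => //.
- by move=> k; exact: mEFin.
- by move=> x _; apply: cvg_EFin; [exact: nearW|exact: fl].
- by move=> k x _; rewrite lee_fin.
Qed.

Lemma dominated_right (f : R -> T -> R) (l h : T -> R) :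
 (forall e, 0 < e -> msble (f e)) -> intgr mu h ->
 (forall e x, 0 < e -> `|f e x| <= h x) -> (forall x, f e x @[e --> 0^'+] --> l x) ->
 (\int[mu]_x f e x) @[e --> 0^'+] --> \int[mu]_x l x.
Proof.
move=> mf ih fh fl; apply/cvg_at_rightP => u [u0 cu].
have [] := @dominatedR (fun k => f (u k)) l h _ ih _ _ => //.
- by move=> k; exact: mf.
- by move=> k x; exact: fh.
- by move=> x; have /cvg_at_rightP := fl x; apply.
Qed.

End dominated.

(** * The principal value equals the absolutely convergent integral *)

Section frac_lap_limit.
Context {R : realType}.
Variable n : nat.
Implicit Types (v u : 'rV[R]_n -> R) (x y z : 'rV[R]_n).

Lemma rker_wt (a e : R) z : 0 < a -> 0 < e -> e <= enorm z ->
 rker a z <= (1 + e `^ (- a)) * wt a z.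
Proof.
move=> a0 e0 ez; have z0 : 0 < enorm z by exact: lt_le_trans ez.
rewrite /rker /wt ler_pdivlMr ?ltr_pwDl ?powR_ge0// mulrDr mulr1 mulVf ?gt_eqF ?powR_gt0//.
rewrite addrC lerD2l -powRN -[X in X <= _]invrK -[X in _ <= X]invrK lef_pV2 ?posrE ?invr_gt0 ?powR_gt0//.
rewrite !powRN !invrK; apply: ge0_ler_powR; rewrite ?nnegrE ?(ltW a0) ?(ltW e0) ?(ltW z0)//.
Qed.

Lemma int_shift_wt (a r : R) v x : 0 <= a -> enorm x <= r -> msble v ->
 (\int[lebn n]_z (`|v (z + x)| * wt a z)%:E <=
  (2 `^ a * (1 + r `^ a))%:E * \int[lebn n]_z (`|v z| * wt a z)%:E)%E.
Proof.
move=> a0 xr mv.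
have C0 : 0 <= 2 `^ a * (1 + r `^ a) by rewrite mulr_ge0 ?addr_ge0 ?powR_ge0.
rewrite -ge0_intZl; try side.
rewrite -(@integral_rV_add _ _ x (fun y => (2 `^ a * (1 + r `^ a) * (`|v y| * wt a y))%:E)); last by meas.
apply: le_intR; try side.
move=> z; rewrite mulrCA ler_wpM2l//.
have -> : z = (z + x) - x by rewrite addrK.
by rewrite addrK; have := wt_shift (z + x) a0 xr; rewrite addrK.
Qed.

Lemma int_shift_wt_sub (a r : R) v x : 0 <= a -> enorm x <= r -> msble v ->
 (\int[lebn n]_z (`|v (x - z)| * wt a z)%:E <=
  (2 `^ a * (1 + r `^ a))%:E * \int[lebn n]_z (`|v z| * wt a z)%:E)%E.
Proof.
move=> a0 xr mv; apply: le_trans (int_shift_wt a0 xr mv).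
rewrite -(@integral_rV_subr _ _ 0 (fun y => (`|v (y + x)| * wt a y)%:E)); last by meas.
apply: le_intR; try side.
by move=> z; rewrite sub0r addrC /wt enormN.
Qed.

(** The integrand of [fl_trunc], with the truncation as a 0-1 factor. It is integrable in [y] for
    each [e > 0], thanks to [Ls] at infinity. *)
Definition ftr (a : R) v x (e : R) y : R :=
 (e < enorm (x - y))%R%:R * ((v x - v y) * rker a (x - y)).

Lemma ftr_integrable (a e : R) v x : 0 < a -> 0 < e -> msble v ->
 (\int[lebn n]_z (`|v z| * wt a z)%:E < +oo)%E ->
 (\int[lebn n]_z (wt a z)%:E < +oo)%E ->
 intgr (lebn n) (ftr a v x e).
Proof.
move=> a0 e0 mv vL wL; have aw := ltW a0.
pose C := (1 + e `^ (- a)) * (2 `^ a * (1 + enorm x `^ a)).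
have C0 : 0 <= C by rewrite !mulr_ge0 ?addr_ge0 ?powR_ge0.
apply: (@integrableR_le _ _ _ _ _ (fun y => C * (`|v x| * wt a y + `|v y| * wt a y))).
- by rewrite /ftr; meas.
- by meas.
- move=> y; rewrite /ftr; have [ey|ey] := ltP e (enorm (x - y)); last by rewrite mul0r normr0; pos.
 rewrite mul1r normrM (ger0_norm (rker_ge0 _ _)) -mulrDl mulrCA.
 apply: ler_pM; try pos; first exact: ler_normB.
 apply: le_trans (rker_wt a0 e0 (ltW ey)) _; rewrite -mulrA ler_wpM2l ?addr_ge0 ?powR_ge0//.
 by have := wt_shift y aw (lexx (enorm x)); rewrite /wt enorm_sub.
- rewrite ge0_intZl; try side.
 rewrite ge0_intD; try side.
 rewrite ge0_intZl; try side.
 have h1 := int_ge0R (lebn n) (fun z => mulr_ge0 (normr_ge0 (v z)) (wt_ge0 a z)).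
 have h2 := int_ge0R (lebn n) (fun z => wt_ge0 a z).
 move: h1 h2 vL wL; case: (\int[_]_z (_ * _)%:E)%E => [r1||]//; case: (\int[_]_z _)%E => [r2||]// _ _ _ _.
 by rewrite -!EFinM -?EFinD -?EFinM ltry.
Qed.

Lemma Rint_symm x (F : 'rV[R]_n -> R) : intgr (lebn n) F ->
 \int[lebn n]_y F y = 2^-1 * \int[lebn n]_z (F (x - z) + F (z + x)).
Proof.
move=> iF; have mF := integrable_meas iF.
have i1 := integrable_rV_subr x iF; have i2 := integrable_rV_add x iF.
rewrite RintegralD// Rint_rV_subr// Rint_rV_add//; set A := Rintegral _ _ _.
by field.
Qed.

Lemma int_ftr (a e : R) v x : 0 < a -> 0 < e -> msble v ->
 (\int[lebn n]_z (`|v z| * wt a z)%:E < +oo)%E ->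
 (\int[lebn n]_z (wt a z)%:E < +oo)%E ->
 \int[lebn n]_y ftr a v x e y =
 2^-1 * \int[lebn n]_z ((e < enorm z)%R%:R * (sdiff v x z * rker a z)).
Proof.
move=> a0 e0 mv vL wL; have iF := ftr_integrable x a0 e0 mv vL wL.
rewrite (Rint_symm x iF); congr (_ * _); apply: eq_Rintegral => z _; rewrite /ftr subKr.
have -> : x - (z + x) = - z by rewrite opprD addrCA subrr addr0.
by rewrite rkerN enormN /sdiff [z + x]addrC; ring.
Qed.

(** Averaging each truncated integral over the two reflected variables turns it into an integral of
    [sdiff], whose absolute value is an integrable majorant independent of the truncation. *)
Lemma frac_lap_Lam g v : 0 < g -> g < 1 -> msble v -> Ls g v ->
 (forall x, (sdiff_int (n%:R + 2 * g) v x < +oo)%E) ->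
 frac_lap g v (Lam g v).
Proof.
move=> g0 g1 mv vL fin; split; first by move=> h; rewrite h ltxx in g0.
move=> _ x; have a0 : 0 < n%:R + 2 * g :> R by rewrite ltr_wpDl// mulr_gt0.
have vL' := Ls_lty mv vL; have wL := int_wt n g0 g1.
have E e : 0 < e -> fl_trunc g v x e = (\int[lebn n]_y ftr (n%:R + 2 * g) v x e y)%:E.
 move=> e0; have iF := ftr_integrable x a0 e0 mv vL' wL.
 rewrite -EFin_int// -intRn_integrableE//; apply: eq_intRn => y /=.
 by rewrite /ftr; case: ifP => _; rewrite ?mul1r// mul0r.
split.
 near=> e; have e0 : 0 < e by near: e; exact: nbhs_right_gt.
 by rewrite (E e e0).
have H : Cfl n g * (2^-1 * \int[lebn n]_z ((e < enorm z)%R%:R * (sdiff v x z * rker (n%:R + 2 * g) z)))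
  @[e --> 0^'+] --> Lam g v x.
 rewrite /Lam -mulrA; apply: cvgM; first exact: cvg_cst.
 apply: cvgM; first exact: cvg_cst.
 apply: (@dominated_right _ _ _ _ _ _ (fun z => `|sdiff v x z * rker (n%:R + 2 * g) z|)).
 - move=> e e0; apply: measurable_funM; first by meas.
  by apply: measurable_funM; [exact: msble_sdiff|exact: msble_rker].
 - have := integrable_norm (integrable_sdiff mv (fin x)); exact.
 - move=> e z e0; case: (_ < _); rewrite ?mul1r// mul0r normr0; exact: normr_ge0.
 - move=> z; have [->|z0] := eqVneq z 0.
   by under eq_fun do rewrite sdiff0 mul0r mulr0; rewrite sdiff0 mul0r; exact: cvg_cst.
  apply: cvg_near_cst; near=> e.
  have -> : e < enorm z by near: e; apply: nbhs_right_lt; rewrite enorm_gt0.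
  by rewrite mul1r.
apply: cvg_trans H; apply: near_eq_cvg; near=> e.
have e0 : 0 < e by near: e; exact: nbhs_right_gt.
by rewrite (E e e0) (int_ftr _ a0 e0 mv vL' wL).
Unshelve. all: by end_near. Qed.

Lemma frac_lap_unique g v w w' : frac_lap g v w -> frac_lap g v w' -> w = w'.
Proof.
move=> [h0 h1] [k0 k1]; have [g0|/eqP g0] := eqVneq g 0; first by rewrite h0// k0.
apply/funext => x; have [_ c1] := h1 g0 x; have [_ c2] := k1 g0 x.
exact: (cvg_unique _ c1 c2).
Qed.

End frac_lap_limit.

(** * Partial derivatives, difference estimates and smoothness classes *)

Section line_derivatives.
Context {R : realType}.
Variable n : nat.
Implicit Types (u v : 'rV[R]_n -> R) (x y z : 'rV[R]_n).

Lemma is_derive_shift u (a y w : 'rV[R]_n) (d : R) :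
 is_derive (a + y) w u d -> is_derive y w (fun t => u (a + t)) d.
Proof.
have E : (fun h : R => h^-1 *: (((fun t => u (a + t)) \o shift y) (h *: w) - u (a + y))) =
  (fun h => h^-1 *: ((u \o shift (a + y)) (h *: w) - u (a + y))).
 by apply/funext => h /=; rewrite addrCA.
by move=> [ex val]; split; rewrite /derivable /derive E.
Qed.

Lemma is_derive_reflect u (a y w : 'rV[R]_n) (d : R) :
 is_derive (a - y) w u d -> is_derive y w (fun t => u (a - t)) (- d).
Proof.
move=> [ex val].
have H : h^-1 *: (((fun t => u (a - t)) \o shift y) (h *: w) - u (a - y)) @[h --> 0^'] --> - d.
 have : h^-1 *: ((u \o shift (a - y)) (h *: w) - u (a - y)) @[h --> 0^'] --> d.
  by rewrite -val; exact: ex.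
 move=> H0.
 have G : (fun h : R => - h) @ 0^' --> 0^'.
  move=> A [e /= e0 eA]; exists e => // h /= he h0; apply: eA; last by rewrite oppr_eq0.
  by rewrite /= sub0r normrN; move: he; rewrite sub0r normrN.
 rewrite (_ : (fun h : R => _) =
   - ((fun h : R => h^-1 *: ((u \o shift (a - y)) (h *: w) - u (a - y))) \o (fun h => - h))).
  exact: cvgN (cvg_comp _ _ G H0).
 apply/funext => h; rewrite [RHS]/GRing.opp /=.
 by rewrite invrN !scaleNr opprK opprD addrCA.
split; first by apply/cvg_ex; exists (- d).
exact: cvg_lim H.
Qed.

Lemma is_derive_line u x (w : 'rV[R]_n) (s d : R) :
 is_derive (x + s *: w) w u d -> is_derive s 1 (fun t : R => u (x + t *: w)) d.
Proof.
have E : (fun h : R => h^-1 *: (((fun t : R => u (x + t *: w)) \o shift s) (h *: 1) - u (x + s *: w))) =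
  (fun h => h^-1 *: ((u \o shift (x + s *: w)) (h *: w) - u (x + s *: w))).
 by apply/funext => h /=; rewrite scalerDl addrCA [h *: 1]mulr1.
by move=> [ex val]; split; rewrite /derivable /derive E.
Qed.

Lemma line_is_derive u x (w : 'rV[R]_n) (d : R) :
 is_derive (0 : R) 1 (fun t : R => u (x + t *: w)) d -> is_derive x w u d.
Proof.
have E : (fun h : R => h^-1 *: (((fun t : R => u (x + t *: w)) \o shift 0) (h *: 1) - u (x + 0 *: w))) =
  (fun h => h^-1 *: ((u \o shift x) (h *: w) - u x)).
 by apply/funext => h /=; rewrite addr0 scale0r addr0 [h *: 1]mulr1 [x + _]addrC.
by move=> [ex val]; split; rewrite /derivable /derive -E.
Qed.

Lemma derivable_pd u x i : derivable u x (ebase R i) -> is_derive x (ebase R i) u (pd i u x).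
Proof. by move=> h; split. Qed.

Lemma pd_val u x i d : is_derive x (ebase R i) u d -> pd i u x = d.
Proof. by move=> h; exact: derive_val. Qed.

Lemma MVT_line u x i (t : R) : (forall y, derivable u y (ebase R i)) ->
 exists2 c : R, `|c| <= `|t| & u (x + t *: ebase R i) - u x = t * pd i u (x + c *: ebase R i).
Proof.
move=> du; pose f (s : R) := u (x + s *: ebase R i).
have df (s : R) : is_derive s (1 : R) f (pd i u (x + s *: ebase R i)).
 by apply: is_derive_line; exact: derivable_pd.
have cf (a b : R) : {within `[a, b], continuous f}.
 by apply: derivable_within_continuous => s _; have [] := df s.
have f0 : f 0 = u x by rewrite /f scale0r addr0.
have [t0|/ltW t0] := leP 0 t.
 have [c cI e] := MVT_segment t0 (fun s _ => df s) (@cf 0 t).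
 exists c; first by rewrite !ger0_norm ?(itvP cI).
 by rewrite -f0 -/(f t) e subr0 mulrC.
have [c cI e] := MVT_segment t0 (fun s _ => df s) (@cf t 0).
exists c; first by rewrite !ler0_norm ?lerN2 ?(itvP cI).
by rewrite -f0 -/(f t) -opprB e sub0r mulrN opprK mulrC.
Qed.

(** Consecutive truncations of [z] differ in one coordinate. They form the path from 0 to [z] along
    the axes on which the one-variable mean value theorem is used. *)
Definition zpre z (k : nat) : 'rV[R]_n := \row_j (if (j < k)%N then z ord0 j else 0).

Lemma enorm_le_coord x y : (forall j, `|x ord0 j| <= `|y ord0 j|) -> enorm x <= enorm y.
Proof.
move=> h; rewrite /enorm ler_sqrt ?sumr_ge0//; last by move=> i _; exact: sqr_ge0.
apply: ler_sum => i _; rewrite -[leLHS]real_normK ?num_real// -[leRHS]real_normK ?num_real//.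
by rewrite ler_pXn2r ?nnegrE.
Qed.

Lemma zpre_step z (i : 'I_n) : zpre z i.+1 = zpre z i + z ord0 i *: ebase R i.
Proof.
apply/rowP => j; rewrite !mxE ltnS leq_eqVlt eqxx /=.
have [->|ji] := eqVneq j i; first by rewrite eqxx ltnn /= mulr1 add0r.
have -> : (nat_of_ord j == nat_of_ord i) = false by apply/negbTE.
by rewrite mulr0 addr0.
Qed.

Lemma zpre_enorm z (i : 'I_n) (c : R) : `|c| <= `|z ord0 i| ->
 enorm (zpre z i + c *: ebase R i) <= enorm z.
Proof.
move=> cz; apply: enorm_le_coord => j; rewrite !mxE eqxx /=.
have [->|ji] := eqVneq j i; first by rewrite ltnn mulr1 add0r.
by rewrite mulr0 addr0; case: ifP => // _; rewrite normr0.
Qed.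

Lemma telescope u x z :
 u (x + z) - u x = \sum_(i < n) (u (x + (zpre z i + z ord0 i *: ebase R i)) - u (x + zpre z i)).
Proof.
have -> : z = zpre z n by apply/rowP => j; rewrite mxE ltn_ord.
have e0 : zpre (zpre z n) 0 = 0 by apply/rowP => j; rewrite !mxE.
have e1 : zpre (zpre z n) n = zpre z n by apply/rowP => j; rewrite !mxE ltn_ord.
have := @telescope_sumr _ 0 n (fun k => u (x + zpre (zpre z n) k)) (leq0n n).
rewrite e0 e1 addr0 => <-; rewrite big_mkord; apply: eq_bigr => i _.
by rewrite zpre_step.
Qed.

(** The smoothness classes provide partial derivatives only, so the mean value theorem is applied
    one coordinate at a time. The intermediate points need not lie on the segment, but their norms
    stay below that of [z]. *)
Lemma telescope_MVT u x z : (forall y i, derivable u y (ebase R i)) ->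
 exists2 xi : 'I_n -> 'rV[R]_n, (forall i, enorm (xi i) <= enorm z) &
  u (x + z) - u x = \sum_(i < n) z ord0 i * pd i u (x + xi i).
Proof.
move=> du.
have H (i : 'I_n) : exists w : 'rV[R]_n, enorm w <= enorm z /\
  u (x + (zpre z i + z ord0 i *: ebase R i)) - u (x + zpre z i) = z ord0 i * pd i u (x + w).
 have [c cz e] := MVT_line (x + zpre z i) (z ord0 i) (fun y => du y i).
 exists (zpre z i + c *: ebase R i); split; first exact: zpre_enorm.
 by rewrite !addrA e.
have [xi xiP] := choice H; exists xi => [i|]; first by have [] := xiP i.
by rewrite telescope; apply: eq_bigr => i _; have [_ ->] := xiP i.
Qed.

(** The mean value formula is applied to the increment $y\mapsto u(x+y)-u(x-z+y)$: each first
    derivative then appears at two points that differ by exactly [z], ready for a Hölder bound. *)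
Lemma sdiff_telescope u x z : (forall y i, derivable u y (ebase R i)) ->
 exists2 xi : 'I_n -> 'rV[R]_n, (forall i, enorm (xi i) <= enorm z) &
  sdiff u x z = - \sum_(i < n) z ord0 i * (pd i u (x + xi i) - pd i u (x - z + xi i)).
Proof.
move=> du; pose w y := u (x + y) - u (x - z + y).
have dw y i : is_derive y (ebase R i) w (pd i u (x + y) - pd i u (x - z + y)).
 by apply: is_deriveB; apply: is_derive_shift; exact: derivable_pd.
have [xi xiz e] := telescope_MVT 0 z (fun y i => let: DeriveDef h _ := dw y i in h).
exists xi => //; transitivity (- (w (0 + z) - w 0)).
 by rewrite /w /sdiff add0r !addr0 subrK; ring.
rewrite e; congr (- _); apply: eq_bigr => i _.
by rewrite add0r (pd_val (dw _ _)).
Qed.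

(** A second application along [z], to each first derivative. The displacement is a sum of [- z] and
    two intermediate points, whence the factor 3. *)
Lemma sdiff_telescope2 u x z : (forall y i, derivable u y (ebase R i)) ->
 (forall y i j, derivable (pd i u) y (ebase R j)) ->
 exists2 xi : 'I_n -> 'I_n -> 'rV[R]_n, (forall i j, enorm (xi i j) <= 3 * enorm z) &
  sdiff u x z = - \sum_(i < n) \sum_(j < n) z ord0 i * z ord0 j * pd j (pd i u) (x + xi i j).
Proof.
move=> du du2; have [xi xiz ->] := sdiff_telescope x z du.
have H i : exists w : 'I_n -> 'rV[R]_n, (forall j, enorm (w j) <= 3 * enorm z) /\
  pd i u (x + xi i) - pd i u (x - z + xi i) = \sum_(j < n) z ord0 j * pd j (pd i u) (x + w j).
 have [w wz e] := telescope_MVT (x - z + xi i) z (fun y j => du2 y i j).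
 exists (fun j => - z + xi i + w j); split => [j|].
  apply: le_trans (enorm_triangle _ _) _; have := wz j.
  have := enorm_triangle (- z) (xi i); rewrite enormN; have := xiz i; lra.
 have -> : x + xi i = x - z + xi i + z by rewrite addrAC subrK.
 by rewrite e; apply: eq_bigr => j _; rewrite !addrA.
have [w wP] := choice H; exists w => [i j|]; first by have [] := wP i.
congr (- _); apply: eq_bigr => i _; have [_ ->] := wP i.
by rewrite mulr_sumr; apply: eq_bigr => j _; rewrite mulrA.
Qed.

Lemma enorm_compact (r : R) : compact [set x : 'rV[R]_n | enorm x <= r].
Proof.
apply: bounded_closed_compact.
 exists r; split; first exact: num_real.
 by move=> M rM x /= xr; apply: le_trans (norm_le_enorm x) (le_trans xr (ltW rM)).
have -> : [set x : 'rV[R]_n | enorm x <= r] = (@enorm R n) @^-1` [set t : R | t <= r] by [].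
by apply: closed_comp => [x _|]; [exact: cont_enorm|exact: closed_le].
Qed.

Lemma cont_bounded u (r : R) : continuous u ->
 exists2 C : R, 0 <= C & forall x, enorm x <= r -> `|u x| <= C.
Proof.
move=> cu; have [M [_ MP]] : bounded_set (u @` [set x | enorm x <= r]).
 by apply: compact_bounded; apply: continuous_compact; [exact: continuous_subspaceT|exact: enorm_compact].
exists (`|M| + 1) => [|x xr]; first by rewrite addr_ge0.
by apply: (MP (`|M| + 1)); [rewrite (le_lt_trans (ler_norm M))// ltrDl|exists x].
Qed.

Lemma lip_of_pd u (r C : R) : (forall y i, derivable u y (ebase R i)) ->
 (forall y i, enorm y <= 3 * r -> `|pd i u y| <= C) ->
 forall x y, enorm x <= r -> enorm y <= r -> `|u x - u y| <= n%:R * C * enorm (x - y).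
Proof.
move=> du bu x y xr yr; have [xi xiz e] := telescope_MVT y (x - y) du.
have -> : u x - u y = u (y + (x - y)) - u y by rewrite [y + _]addrC subrK.
rewrite e; apply: le_trans (ler_norm_sum _ _ _) _.
apply: (@le_trans _ _ (\sum_(i < n) (C * enorm (x - y)))); last first.
 by rewrite sumr_const card_ord -[leLHS]mulr_natl mulrA.
apply: ler_sum => i _.
rewrite normrM mulrC; apply: ler_pM => //; last exact: coord_le_enorm.
apply: bu; apply: le_trans (enorm_triangle _ _) _.
have := xiz i; have := enorm_triangle x (- y); rewrite enormN; lra.
Qed.

Lemma near_enorm x (e : R) : 0 < e -> \forall y \near x, enorm (x - y) < e.
Proof.
move=> e0; have s0 : 0 < Num.sqrt n%:R + 1 :> R by rewrite ltr_wpDl ?sqrtr_ge0.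
near=> y; apply: le_lt_trans (enorm_le_norm _) _.
apply: (@le_lt_trans _ _ ((Num.sqrt n%:R + 1) * `|x - y|)).
 by rewrite ler_wpM2r// lerDl.
rewrite mulrC -ltr_pdivlMr//.
near: y; apply: cvgr_dist_lt; [exact: cvg_id|exact: divr_gt0].
Unshelve. all: by end_near. Qed.

Lemma enorm_continuousP u x : {for x, continuous u} <->
 forall e : R, 0 < e -> exists2 d : R, 0 < d & forall y, enorm (x - y) < d -> `|u x - u y| <= e.
Proof.
split=> [cu e e0|h].
 have /(cvgrPdist_le (FF := nbhs_filter x))/(_ e e0)/nbhs_ballP[d /= d0 dP] := cu.
 exists d => // y xy; apply: dP; rewrite -ball_normE/=.
 exact: le_lt_trans (norm_le_enorm _) xy.
apply/(cvgrPdist_le (FF := nbhs_filter x)) => e /h[d d0 dP].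
by near=> y; apply: dP; near: y; exact: near_enorm.
Unshelve. all: by end_near. Qed.

Lemma sdiff_local u (b r C : R) : (forall x y, enorm x <= r + 1 -> enorm y <= r + 1 ->
  `|u x - u y| <= C * enorm (x - y) `^ b) ->
 forall x z, enorm x <= r -> enorm z <= 1 -> `|sdiff u x z| <= 2 * C * enorm z `^ b.
Proof.
move=> h x z xr z1.
have x1 : enorm x <= r + 1 by rewrite (le_trans xr)// lerDl.
have -> : sdiff u x z = (u x - u (x + z)) + (u x - u (x - z)) by rewrite /sdiff; ring.
apply: le_trans (ler_normD _ _) _.
rewrite -mulrA mulr_natl mulr2n; apply: lerD.
 have -> : enorm z = enorm (x - (x + z)) by rewrite opprD addNKr enormN.
 by apply: h => //; apply: le_trans (enorm_triangle _ _) _; exact: lerD.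
have -> : enorm z = enorm (x - (x - z)) by rewrite subKr.
by apply: h => //; apply: le_trans (enorm_triangle _ _) _; rewrite enormN; exact: lerD.
Qed.

(** Unlike in [Ckloc], continuity is recorded at every order and not only for the top
    derivatives. *)
Fixpoint Ck (k : nat) u : Prop :=
 continuous u /\ match k with
 | 0 => True
 | k'.+1 => (forall x i, derivable u x (ebase R i)) /\ forall i, Ck k' (pd i u)
 end.

Lemma Ck_cont k u : Ck k u -> continuous u.
Proof. by case: k => [|k] []. Qed.

Lemma CkW k u : Ck k.+1 u -> Ck k u.
Proof.
elim: k u => [|k IH] u [cu [du pu]]; split => //.
by split => // i; exact: IH.
Qed.

Lemma Ck_le k l u : (k <= l)%N -> Ck l u -> Ck k u.
Proof. by move=> /subnK <-; elim: (l - k)%N u => // j IH u /CkW; exact: IH. Qed.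

Lemma pdD u v i : (forall x, derivable u x (ebase R i)) -> (forall x, derivable v x (ebase R i)) ->
 pd i (fun x => u x + v x) = (fun x => pd i u x + pd i v x).
Proof. by move=> du dv; apply/funext => x; apply: pd_val; apply: is_deriveD; exact: derivable_pd. Qed.

Lemma pdZ u (c : R) i : (forall x, derivable u x (ebase R i)) ->
 pd i (fun x => c * u x) = (fun x => c * pd i u x).
Proof. by move=> du; apply/funext => x; apply: pd_val; apply: is_deriveZ; exact: derivable_pd. Qed.

Lemma CkD k u v : Ck k u -> Ck k v -> Ck k (fun x => u x + v x).
Proof.
elim: k u v => [|k IH] u v [cu pu] [cv pv]; split.
- by move=> x; apply: continuousD; [exact: cu|exact: cv].
- by [].
- by move=> x; apply: continuousD; [exact: cu|exact: cv].
- case: pu => du pu; case: pv => dv pv; split=> [x i|i].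
  by apply: derivableD; [exact: du|exact: dv].
 by rewrite (pdD (du^~ i) (dv^~ i)); apply: IH; [exact: pu|exact: pv].
Qed.

Lemma CkZ k u (c : R) : Ck k u -> Ck k (fun x => c * u x).
Proof.
elim: k u => [|k IH] u [cu pu]; split.
- by move=> x; apply: continuousM; [exact: cst_continuous|exact: cu].
- by [].
- by move=> x; apply: continuousM; [exact: cst_continuous|exact: cu].
- case: pu => du pu; split=> [x i|i]; first exact/derivableZ/du.
 by rewrite (pdZ _ (du^~ i)); apply: IH; exact: pu.
Qed.

Lemma Ck_sum k (I : Type) (s : seq I) (U : I -> 'rV[R]_n -> R) : (forall i, Ck k (U i)) ->
 Ck k (fun x => \sum_(i <- s) U i x).
Proof.
move=> hU; elim: s => [|i s IH].
 under eq_fun do rewrite big_nil.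
 elim: k {hU} => [|k IH]; split; try by move=> x; exact: cst_continuous.
  by [].
 split=> [x i|i]; first exact: derivable_cst.
 have -> : pd i (fun=> 0) = (fun=> 0 : R) :> ('rV[R]_n -> R).
  by apply/funext => x; apply: pd_val; exact: is_derive_cst.
 exact: IH.
by under eq_fun do rewrite big_cons; exact: CkD.
Qed.

Definition nlap u x : R := - \sum_(i < n) pd i (pd i u) x.

Lemma Ck_nlap k u : Ck k.+2 u -> Ck k (nlap u).
Proof.
move=> [_ [_ pu]].
have -> : nlap u = (fun x => (-1) * \sum_(i < n) pd i (pd i u) x).
 by apply/funext => x; rewrite mulN1r.
by apply/CkZ/Ck_sum => i; have [_ [_ +]] := pu i; exact.
Qed.

Lemma Ck_neg_lap k u : Ck k.+2 u -> neg_lap u (nlap u).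
Proof.
move=> [_ [du pu]] x; split => // i; split; first exact: du.
by have [_ [d2 _]] := pu i; exact: d2.
Qed.

Lemma neg_lap_unique u w : neg_lap u w -> w = nlap u.
Proof. by move=> h; apply/funext => x; have [_ ->] := h x. Qed.

Lemma pd_bounded u (r : R) : (forall i, continuous (pd i u)) ->
 exists2 C : R, 0 <= C & forall y i, enorm y <= r -> `|pd i u y| <= C.
Proof.
move=> cu.
have H i : exists C : R, 0 <= C /\ forall y, enorm y <= r -> `|pd i u y| <= C.
 by have [C C0 CP] := cont_bounded r (cu i); exists C.
have [C CP] := choice H; exists (\sum_i C i); first by apply: sumr_ge0 => i _; have [] := CP i.
move=> y i yr; rewrite (bigD1 i)//=; apply: ler_wpDr; last by have [_ +] := CP i; exact.
by apply: sumr_ge0 => j _; have [] := CP j.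
Qed.

Lemma Ck1_hoelder u : Ck 1 u -> hoelder_loc 1 u.
Proof.
move=> [cu [du pu]] r r0.
have [C C0 CP] := pd_bounded (3 * r) (fun i => proj1 (pu i)).
exists (n%:R * C) => x y xr yr; rewrite powRr1 ?enorm_ge0//.
exact: (lip_of_pd du CP).
Qed.

(** The missing continuity comes from below: continuous first derivatives are locally bounded, so
    the function is locally Lipschitz. *)
Lemma Ckloc_Ck k a u : 0 < a -> Ckloc k a u -> Ck k u.
Proof.
move=> a0; elim: k u => [|k IH] u /= [h1 h2]; first by split.
have pu i := IH _ (h2 i); split; last by split.
move=> x; pose r := enorm x + 1; have r0 : 0 < r by rewrite ltr_wpDl ?enorm_ge0.
have [C C0 CP] := pd_bounded (3 * r) (fun i => Ck_cont (pu i)).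
apply/enorm_continuousP => e e0; have C1 : 0 < n%:R * C + 1 by rewrite ltr_wpDl// mulr_ge0.
exists (Num.min 1 (e / (n%:R * C + 1))); first by rewrite lt_min ltr01 divr_gt0.
move=> y; rewrite lt_min => /andP[xy1 xy2].
have xr : enorm x <= r by rewrite lerDl.
have yr : enorm y <= r.
 rewrite -[y](subrK x); apply: le_trans (enorm_triangle _ _) _.
 by rewrite addrC lerD2l enorm_sub ltW.
apply: le_trans (lip_of_pd h1 CP xr yr) _.
apply: (@le_trans _ _ ((n%:R * C + 1) * enorm (x - y))).
 by rewrite ler_wpM2r ?enorm_ge0// lerDl.
by rewrite mulrC -ler_pdivlMr// ltW.
Qed.

(** With [b > 2g] this is what makes the singular integral converge at the origin, locally uniformly
    in [x]. It is a common form for the Hölder, $C^{1,a}$ and $C^2$ cases, and it passes to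
    derivatives. *)
Definition SD (b : R) u := forall r : R, exists2 C : R, 0 <= C &
 forall x z, enorm x <= r -> enorm z <= 1 -> `|sdiff u x z| <= C * enorm z `^ b.

Lemma hoelder_SD a b u : 0 < b -> b <= a -> hoelder_loc a u -> SD b u.
Proof.
move=> b0 ba hu r; have [|C CP] := hu (`|r| + 1); first by rewrite ltr_wpDl.
exists (2 * `|C|) => [|x z xr z1]; first by rewrite mulr_ge0.
have xr' : enorm x <= `|r| by exact: le_trans (ler_norm r).
apply: le_trans (sdiff_local CP xr' z1) _.
apply: (@le_trans _ _ (2 * `|C| * enorm z `^ a)).
 by rewrite ler_wpM2r ?powR_ge0// ler_wpM2l// ler_norm.
rewrite ler_wpM2l ?mulr_ge0//.
have [->|z0] := eqVneq z 0; first by rewrite enorm0 !powR0// gt_eqF// (lt_le_trans b0).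
by apply: ger_powR => //; rewrite z1 enorm_gt0 z0.
Qed.

Lemma powR_abs_le (s a b : R) : 0 <= s -> s <= 1 -> 0 < b -> b <= a -> s `^ a <= s `^ b.
Proof.
move=> s0 s1 b0 ba; move: s0; rewrite le_eqVlt => /predU1P[<-|s0].
 by rewrite !powR0// gt_eqF// (lt_le_trans b0).
by apply: ger_powR => //; rewrite s1 s0.
Qed.

Lemma C1hoelder_SD a b u : 0 < b -> b <= 1 + a -> 0 < a ->
 (forall x i, derivable u x (ebase R i)) -> (forall i, hoelder_loc a (pd i u)) -> SD b u.
Proof.
move=> b0 ba a0 du hu r.
(* The points [x + xi i] and [x - z + xi i] have norm at most [|r| + 2], since [z] and [xi i] have
   norm at most 1. *)
have r0 : 0 < `|r| + 3 by rewrite ltr_wpDl.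
have [C CP] := choice (fun i => hu i _ r0).
exists (\sum_i `|C i|) => [|x z xr z1]; first exact: sumr_ge0.
have [xi xiz ->] := sdiff_telescope x z du.
rewrite normrN; apply: le_trans (ler_norm_sum _ _ _) _; rewrite mulr_suml; apply: ler_sum => i _.
have xr' : enorm x <= `|r| by exact: le_trans (ler_norm r).
have xz := xiz i; have t1 := enorm_triangle x (xi i).
have t2 := enorm_triangle (x - z) (xi i); have t3 := enorm_triangle x (- z).
rewrite enormN in t3.
rewrite normrM; apply: (@le_trans _ _ (enorm z * (`|C i| * enorm z `^ a))).
 apply: ler_pM => //; first exact: coord_le_enorm.
 apply: le_trans (CP i _ _ _ _) _; [lra|lra|].
 have -> : x + xi i - (x - z + xi i) = z by rewrite opprD addrACA subrr addr0 subKr.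
 by rewrite ler_wpM2r ?powR_ge0// ler_norm.
rewrite mulrCA ler_wpM2l//; apply: le_trans (powR_abs_le _ _ b0 ba); rewrite ?enorm_ge0//.
have [->|z0] := eqVneq z 0; first by rewrite enorm0 mul0r powR_ge0.
by rewrite powRD ?powRr1 ?enorm_ge0// enorm_eq0 z0 implybT.
Qed.

Lemma Ck2_SD b u : 0 < b -> b <= 2 -> Ck 2 u -> SD b u.
Proof.
move=> b0 b2 [cu [du pu]]; apply: (C1hoelder_SD (a := 1)) => // i.
by apply: Ck1_hoelder; exact: pu.
Qed.

(** One exponent must serve all orders [j], so it is capped by what additional smoothness yields: 1
    (Lipschitz) if [2 * g < 1], and 2 (two derivatives) otherwise. Both caps exceed [2 * g]. *)
Lemma Ckloc_SD g e : 0 < g -> g < 1 -> 0 < e -> exists b : R, [/\ 2 * g < b, b <= 2 &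
 forall j u, Ckloc (j + Num.truncn (2 * g)) (2 * g - (Num.truncn (2 * g))%:R + e) u -> SD b u].
Proof.
move=> g0 g1 e0; have g20 : 0 <= 2 * g by rewrite mulr_ge0// ltW.
have [gh|gh] := ltP (2 * g) 1.
 have -> : Num.truncn (2 * g) = 0%N by apply/eqP; rewrite truncn_eq// g20 gh.
 exists (Num.min (2 * g + e) 1); rewrite subr0; split.
 - by rewrite lt_min gh ltrDl e0.
 - by rewrite ge_min orbC ler1n.
 have b0 : 0 < Num.min (2 * g + e) 1 by rewrite lt_min ltr01 andbT ltr_wpDl.
 move=> j u; rewrite addn0; case: j => [|j] hu.
  by apply: (hoelder_SD (a := 2 * g + e)) => //; [rewrite ge_min lexx|have [] := hu].
 apply: (hoelder_SD (a := 1)) => //; first by rewrite ge_min lexx orbT.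
 by apply: Ck1_hoelder; apply: (@Ck_le _ j.+1) => //; apply: Ckloc_Ck hu; rewrite ltr_wpDl.
have -> : Num.truncn (2 * g) = 1%N by apply/eqP; rewrite truncn_eq// gh /=; lra.
exists (Num.min (2 * g + e) 2); split.
- by rewrite lt_min; apply/andP; split; lra.
- by rewrite ge_min lexx orbT.
have b0 : 0 < Num.min (2 * g + e) 2 by rewrite lt_min; apply/andP; split; lra.
have a0 : 0 < 2 * g - 1 + e by lra.
move=> j u; rewrite addn1; case: j => [|j] hu; last first.
 apply: Ck2_SD => //; first by rewrite ge_min lexx orbT.
 by apply: (@Ck_le _ j.+2) => //; apply: Ckloc_Ck hu.
case: hu => du hu; apply: (C1hoelder_SD (a := 2 * g - 1 + e)) => //.
 by rewrite addrA addrCA subrr addr0 ge_min lexx.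
by move=> i; have [] := hu i.
Qed.

End line_derivatives.

(** * Continuity of parameter integrals *)

Section dominated_continuity.
Context {R : realType} d (T : measurableType d) (mu : {measure set T -> \bar R}).
Variable n : nat.

(** Dominated convergence is sequential, so a failure of continuity is turned into points [y k] at
    distance less than [k.+1%:R^-1] from [x]. *)
Lemma dominated_continuous (f : 'rV[R]_n -> T -> R) (h : T -> R) (x : 'rV[R]_n) :
 (forall y, enorm (x - y) < 1 -> msble (f y)) -> intgr mu h ->
 (forall y t, enorm (x - y) < 1 -> `|f y t| <= h t) ->
 (forall t, {for x, continuous (f^~ t)}) ->
 {for x, continuous (fun y => \int[mu]_t f y t)}.
Proof.
move=> mf ih fh cf; apply/enorm_continuousP => e e0; apply: contrapT => H.
have K k : exists y, enorm (x - y) < k.+1%:R^-1 /\ ~~ (`|\int[mu]_t f x t - \int[mu]_t f y t| <= e).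
 apply: contrapT => /forallNP h'; apply: H; exists k.+1%:R^-1; first by rewrite invr_gt0.
 by move=> y xy; have /not_andP[//|/negP] := h' y; rewrite negbK.
have [y yP] := choice K.
have y1 k : enorm (x - y k) < 1.
 by have [h1 _] := yP k; apply: lt_le_trans h1 _; rewrite invf_le1// ler1n.
have L t : f (y k) t @[k --> \oo] --> f x t.
 apply/cvgrPdist_le => e' e'0; have /enorm_continuousP/(_ e' e'0)[d' d0 dP] := cf t.
 near=> k; apply: dP; have [h1 _] := yP k; apply: lt_le_trans h1 _.
 by rewrite ltW//; near: k; exact: (near_infty_natSinv_lt (PosNum d0)).
have [_] := dominatedR (fun k => mf _ (y1 k)) ih (fun k t => fh _ t (y1 k)) L.
move=> /cvgrPdist_le/(_ e e0)[N _ /(_ N (leqnn _))] /= h1.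
by have [_ /negP] := yP N; apply.
Unshelve. all: by end_near. Qed.

End dominated_continuity.

(** * Smooth weights and radial derivatives *)

Section weights.
Context {R : realType}.
Variable n : nat.
Implicit Types (x y z : 'rV[R]_n) (a b : R).

(** A smooth substitute for [wt] whose exponents add under products. The exponent is that of the
    squared norm: [bw (a / 2)] is comparable to [wt a]. *)
Definition bw b x : R := (1 + sqn x) `^ (- b).

Lemma bw1_gt0 x : 0 < 1 + sqn x. Proof. by rewrite ltr_wpDr ?sqn_ge0. Qed.

Lemma bw_ge0 b x : 0 <= bw b x. Proof. exact: powR_ge0. Qed.

Lemma bwD a b x : bw (a + b) x = bw a x * bw b x.
Proof. by rewrite /bw opprD powRD// (gt_eqF (bw1_gt0 x)) implybT. Qed.

Lemma bw0 x : bw 0 x = 1. Proof. by rewrite /bw oppr0 powRr0. Qed.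

Lemma bw_le a b x : a <= b -> bw b x <= bw a x.
Proof. by move=> ab; apply: ler_powR; rewrite ?lerN2// lerDl sqn_ge0. Qed.

Lemma coord_le_bw x i : `|x ord0 i| <= bw (- 2^-1) x.
Proof.
rewrite /bw opprK powR12_sqrt ?(ltW (bw1_gt0 x))// -sqrtr_sqr ler_wsqrtr//.
by apply: ler_wpDl => //; rewrite /sqn (bigD1 i)//= lerDl sumr_ge0// => j _; exact: sqr_ge0.
Qed.

Lemma bw_shift b (r : R) x y : 0 <= b -> enorm x <= r ->
 bw b (x - y) <= (2 * (1 + r ^+ 2)) `^ b * bw b y.
Proof.
move=> b0 xr; have r0 : 0 <= r by exact: le_trans (enorm_ge0 x) xr.
have A0 : 0 < 2 * (1 + r ^+ 2) by rewrite mulr_gt0// ltr_wpDr ?sqr_ge0.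
rewrite /bw !powRN ler_pdivlMr ?powR_gt0 ?bw1_gt0// mulrC ler_pdivrMr ?powR_gt0 ?bw1_gt0//.
rewrite -powRM ?(ltW A0) ?(ltW (bw1_gt0 _))//; apply: ge0_ler_powR; rewrite ?nnegrE ?(ltW (bw1_gt0 _))//.
 by rewrite mulr_ge0 ?(ltW A0) ?(ltW (bw1_gt0 _)).
have h : sqn y <= 2 * sqn x + 2 * sqn (x - y).
 have := sqnD_le x (y - x) (@ltr01 R); rewrite addrC subrK invr1 -(sqnN (y - x)) opprB.
 by rewrite -[1 + 1]/(2%:R).
have hx : sqn x <= r ^+ 2 by rewrite -enorm_sqr ler_pXn2r ?nnegrE ?enorm_ge0.
have p := sqn_ge0 (x - y); have q := sqr_ge0 r.
have : 0 <= r ^+ 2 * sqn (x - y) by rewrite mulr_ge0.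
nra.
Qed.

Lemma bw_wt a x : 0 <= a -> bw (a / 2) x <= 2 * wt a x.
Proof.
move=> a0; rewrite /bw /wt powRN ler_pdivlMr ?ltr_pwDl ?powR_ge0// mulrC ler_pdivrMr ?powR_gt0 ?bw1_gt0//.
have -> : enorm x `^ a = (sqn x) `^ (a / 2).
 by rewrite -enorm_sqr -(powR_mulrn 2) ?enorm_ge0// -powRrM mulrC divfK.
rewrite mulr_natl mulr2n; apply: lerD.
 have := @ler_powR _ (1 + sqn x) _ 0 (a / 2); rewrite powRr0; apply; first by rewrite lerDl sqn_ge0.
 by rewrite divr_ge0.
by apply: ge0_ler_powR; rewrite ?nnegrE ?divr_ge0 ?sqn_ge0 ?lerDr ?(ltW (bw1_gt0 _)).
Qed.

Lemma wt_bw a x : 0 <= a -> wt a x <= 2 `^ (a / 2) * bw (a / 2) x.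
Proof.
move=> a0; rewrite /bw /wt powRN ler_pdivlMr ?powR_gt0 ?bw1_gt0// mulrC ler_pdivrMr ?ltr_pwDl ?powR_ge0//.
have -> : enorm x `^ a = (sqn x) `^ (a / 2).
 by rewrite -enorm_sqr -(powR_mulrn 2) ?enorm_ge0// -powRrM mulrC divfK.
have := @powR_add_le _ (a / 2) 1 (sqn x); rewrite powR1; apply; rewrite ?sqn_ge0//.
by rewrite divr_ge0.
Qed.

Lemma msble_bw b : msble (@bw b).
Proof. by rewrite /bw; meas. Qed.

Lemma cont_sqn : continuous (@sqn R n).
Proof.
have -> : @sqn R n = (fun x => enorm x ^+ 2) by apply/funext => x; rewrite enorm_sqr.
by move=> x; apply: continuousM; exact: cont_enorm.
Qed.

Lemma is_derive_sqn x i : is_derive x (ebase R i) (@sqn R n) (2 * x ord0 i).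
Proof.
apply: line_is_derive.
have -> : (fun t : R => sqn (x + t *: ebase R i)) = (fun t : R => t ^+ 2 + (2 * x ord0 i) * t + sqn x).
 apply/funext => t; rewrite /sqn (bigD1 i)//= [in RHS](bigD1 i)//= !mxE !eqxx mulr1.
 rewrite [X in _ + X](eq_bigr (fun j => x ord0 j ^+ 2)); first by ring.
 by move=> j ji; rewrite !mxE eqxx (negbTE ji) mulr0 addr0.
apply: is_derive_eq; rewrite /GRing.scale /=; ring.
Qed.

Lemma is_derive_comp_line (u : 'rV[R]_n -> R) x i (g : R -> R) (d c : R) :
 is_derive x (ebase R i) u d -> is_derive (u x) 1 g c ->
 is_derive x (ebase R i) (fun y : 'rV[R]_n => g (u y)) (c * d).
Proof.
move=> du dg; apply: line_is_derive.
have dl : is_derive (0 : R) 1 (fun t : R => u (x + t *: ebase R i)) d.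
 by apply: is_derive_line; rewrite scale0r addr0.
apply: (@is_derive1_comp _ g (fun t : R => u (x + t *: ebase R i))).
by rewrite scale0r addr0.
Qed.

Lemma is_derive_radial x i (g : R -> R) (c : R) : is_derive (sqn x) 1 g c ->
 is_derive x (ebase R i) (fun y : 'rV[R]_n => g (sqn y)) (c * (2 * x ord0 i)).
Proof. by move=> h; apply: is_derive_comp_line => //; exact: is_derive_sqn. Qed.

Lemma is_derive_coord x i j : is_derive x (ebase R i) (fun y : 'rV[R]_n => y ord0 j) (j == i)%:R.
Proof.
apply: line_is_derive.
have -> : (fun t : R => (x + t *: ebase R i) ord0 j) = (fun t : R => x ord0 j + (j == i)%:R * t).
 by apply/funext => t; rewrite !mxE eqxx mulrC.
apply: is_derive_eq; rewrite /GRing.scale /=; ring.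
Qed.

Lemma cont_coord j : continuous (fun y : 'rV[R]_n => y ord0 j).
Proof.
move=> x; apply/enorm_continuousP => e e0; exists e => // y xy; apply: ltW.
by apply: le_lt_trans xy; have := coord_le_enorm (x - y) j; rewrite !mxE.
Qed.

End weights.

(** * Weighted convergence of functions with their derivatives *)

Section families.
Context {R : realType}.
Variable n : nat.
Implicit Types (x y z : 'rV[R]_n) (a b : R) (K L : nat -> 'rV[R]_n -> R) (Kl Ll u v : 'rV[R]_n -> R).

(* Bounded convergence K k --> Kl of all derivatives of order <= l, uniformly
  dominated by the weight (1 + |x|^2)^(-b). *)
Fixpoint Fam (l : nat) b K (Kl : 'rV[R]_n -> R) : Prop :=
 [/\ forall k, continuous (K k), continuous Kl,
   exists2 C : R, 0 <= C & forall k x, `|K k x| <= C * bw b x,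
   forall x, K ^~ x @ \oo --> Kl x &
   match l with
   | 0 => True
   | l'.+1 => [/\ forall k x i, derivable (K k) x (ebase R i),
     forall x i, derivable Kl x (ebase R i) &
     forall i, Fam l' b (fun k => pd i (K k)) (pd i Kl)]
   end].

Lemma Fam_bound l b K Kl : Fam l b K Kl ->
 exists2 C : R, 0 <= C & forall k x, `|K k x| <= C * bw b x.
Proof. by case: l => [|l] []. Qed.

Lemma Fam_cvg l b K Kl : Fam l b K Kl -> forall x, K ^~ x @ \oo --> Kl x.
Proof. by case: l => [|l] []. Qed.

Lemma Fam_cont l b K Kl : Fam l b K Kl -> forall k, continuous (K k).
Proof. by case: l => [|l] []. Qed.

Lemma Fam_pd l b K Kl i : Fam l.+1 b K Kl -> Fam l b (fun k => pd i (K k)) (pd i Kl).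
Proof. by move=> [_ _ _ _ [_ _ +]]; exact. Qed.

Lemma FamW l b K Kl : Fam l.+1 b K Kl -> Fam l b K Kl.
Proof.
elim: l K Kl => [|l IH] K Kl [c c0 B L [d d0 P]]; split => //.
by split => // i; apply: IH; exact: P.
Qed.

Lemma Fam_le k l b K Kl : (k <= l)%N -> Fam l b K Kl -> Fam k b K Kl.
Proof. by move=> /subnK <-; elim: (l - k)%N K Kl => // j IH K Kl /FamW; exact: IH. Qed.

Lemma Fam_weight l a b K Kl : a <= b -> Fam l b K Kl -> Fam l a K Kl.
Proof.
move=> ab; elim: l K Kl => [|l IH] K Kl [c c0 [C C0 B] L P]; split => //.
- by exists C => // k x; apply: le_trans (B k x) _; rewrite ler_wpM2l// bw_le.
- by exists C => // k x; apply: le_trans (B k x) _; rewrite ler_wpM2l// bw_le.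
- by case: P => d d0 P; split; [exact: d|exact: d0|move=> i; apply: IH; exact: P].
Qed.

Lemma FamD l b K Kl L Ll : Fam l b K Kl -> Fam l b L Ll ->
 Fam l b (fun k x => K k x + L k x) (fun x => Kl x + Ll x).
Proof.
elim: l K Kl L Ll => [|l IH] K Kl L Ll [c c0 [C C0 B] lim P] [c' c0' [C' C0' B'] lim' P'].
 split => //.
 - by move=> k x; apply: continuousD; [exact: c|exact: c'].
 - by move=> x; apply: continuousD; [exact: c0|exact: c0'].
 - exists (C + C') => [|k x]; first exact: addr_ge0.
  by rewrite mulrDl; apply: le_trans (ler_normD _ _) (lerD _ _).
 - by move=> x; apply: cvgD.
case: P => d d0 P; case: P' => d' d0' P'.
split.
- by move=> k x; apply: continuousD; [exact: c|exact: c'].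
- by move=> x; apply: continuousD; [exact: c0|exact: c0'].
- exists (C + C') => [|k x]; first exact: addr_ge0.
 by rewrite mulrDl; apply: le_trans (ler_normD _ _) (lerD _ _).
- by move=> x; apply: cvgD.
split.
- by move=> k x i; apply: derivableD; [exact: d|exact: d'].
- by move=> x i; apply: derivableD; [exact: d0|exact: d0'].
- move=> i; rewrite (pdD (d0^~ i) (d0'^~ i)).
 have -> : (fun k => pd i (fun x => K k x + L k x)) = (fun k x => pd i (K k) x + pd i (L k) x).
  by apply/funext => k; rewrite (pdD (fun x => d k x i) (fun x => d' k x i)).
 by apply: IH; [exact: P|exact: P'].
Qed.

Lemma pdM u v i : (forall x, derivable u x (ebase R i)) -> (forall x, derivable v x (ebase R i)) ->
 pd i (fun x : 'rV[R]_n => u x * v x) = (fun x => pd i u x * v x + u x * pd i v x).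
Proof.
move=> du dv; apply/funext => x; apply: pd_val.
have := is_deriveM (derivable_pd (du x)) (derivable_pd (dv x)) => h.
by apply: is_derive_eq; rewrite /GRing.scale /= addrC [v x * _]mulrC.
Qed.

Lemma FamM l a b K Kl L Ll : Fam l a K Kl -> Fam l b L Ll ->
 Fam l (a + b) (fun k x => K k x * L k x) (fun x => Kl x * Ll x).
Proof.
elim: l K Kl L Ll => [|l IH] K Kl L Ll FK FL.
 case: (FK) => [c c0 [C C0 B] lim P]; case: (FL) => [c' c0' [C' C0' B'] lim' P'].
 split => //.
 - by move=> k x; apply: continuousM; [exact: c|exact: c'].
 - by move=> x; apply: continuousM; [exact: c0|exact: c0'].
 - exists (C * C') => [|k x]; first exact: mulr_ge0.
  by rewrite normrM bwD mulrACA; apply: ler_pM.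
 - by move=> x; apply: cvgM.
case: (FK) => [c c0 [C C0 B] lim [d d0 P]]; case: (FL) => [c' c0' [C' C0' B'] lim' [d' d0' P']].
split.
- by move=> k x; apply: continuousM; [exact: c|exact: c'].
- by move=> x; apply: continuousM; [exact: c0|exact: c0'].
- exists (C * C') => [|k x]; first exact: mulr_ge0.
 by rewrite normrM bwD mulrACA; apply: ler_pM.
- by move=> x; apply: cvgM.
split.
- by move=> k x i; apply: derivableM; [exact: d|exact: d'].
- by move=> x i; apply: derivableM; [exact: d0|exact: d0'].
- move=> i; rewrite (pdM (d0^~ i) (d0'^~ i)).
 have -> : (fun k => pd i (fun x => K k x * L k x)) =
   (fun k x => pd i (K k) x * L k x + K k x * pd i (L k) x).
  by apply/funext => k; rewrite (pdM (fun x => d k x i) (fun x => d' k x i)).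
 apply: FamD; apply: IH; [exact: P|exact: FamW FL|exact: FamW FK|exact: P'].
Qed.

Lemma pd_cst i (c : R) : pd i (fun _ : 'rV[R]_n => c) = fun=> 0.
Proof. by apply/funext => x; apply: pd_val; exact: is_derive_cst. Qed.

Lemma Fam_cst l (c : nat -> R) (c0 : R) : c @ \oo --> c0 -> Fam l 0 (fun k _ => c k) (fun=> c0).
Proof.
elim: l c c0 => [|l IH] c c0 cc.
 split => //; try by move=> *; exact: cst_continuous.
 have /cvg_seq_bounded : cvgn c by apply/cvg_ex; exists c0.
 move=> [M [_ MP]]; exists (`|M| + 1) => [|k x]; first exact: addr_ge0.
 by rewrite bw0 mulr1; apply: MP => //; rewrite (le_lt_trans (ler_norm M))// ltrDl.
split => //; try by move=> *; exact: cst_continuous.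
 exact: Fam_bound (IH c c0 cc).
split => [*|*|i]; try exact: derivable_cst.
rewrite pd_cst; under [X in Fam _ _ X]eq_fun do rewrite pd_cst.
by apply: IH; exact: cvg_cst.
Qed.

Lemma Fam_coord l j : Fam l (- 2^-1) (fun _ x => x ord0 j) (fun x => x ord0 j).
Proof.
case: l => [|l]; split => //; try by move=> *; exact: cont_coord.
- by exists 1 => // k x; rewrite mul1r coord_le_bw.
- by move=> x; exact: cvg_cst.
- by exists 1 => // k x; rewrite mul1r coord_le_bw.
- by move=> x; exact: cvg_cst.
split => [_ x i|x i|i]; try by have [] := is_derive_coord x i j.
have -> : pd i (fun x : 'rV[R]_n => x ord0 j) = fun=> (j == i)%:R.
 by apply/funext => x; apply: pd_val; exact: is_derive_coord.
apply: (@Fam_weight _ _ 0); first by rewrite oppr_le0.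
by apply: (@Fam_cst l (fun=> (j == i)%:R)); exact: cvg_cst.
Qed.

(** By the chain rule a derivative is [g'] times $2x_i$. The coordinate grows like weight [- 2^-1],
    so [g'] must decay by one half more than [g]. *)
Lemma Fam_radial l b (g g' : nat -> R -> R) (g0 g0' : R -> R) :
 (forall k (t : R), is_derive t 1 (g k) (g' k t)) -> (forall t : R, is_derive t 1 g0 (g0' t)) ->
 (exists2 C : R, 0 <= C & forall k x, `|g k (sqn x)| <= C * bw b x) ->
 (forall t, g ^~ t @ \oo --> g0 t) ->
 Fam l (b + 2^-1) (fun k x => g' k (sqn x)) (fun x => g0' (sqn x)) ->
 Fam l.+1 b (fun k x => g k (sqn x)) (fun x => g0 (sqn x)).
Proof.
move=> dg dg0 B lim P.
have cg (h h' : R -> R) : (forall t : R, is_derive t 1 h (h' t)) -> continuous (fun x : 'rV[R]_n => h (sqn x)).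
 move=> dh x; apply: (@continuous_comp _ _ _ (@sqn R n) h); first exact: cont_sqn.
 by apply/differentiable_continuous/derivable1_diffP; have [] := dh (sqn x).
split => //; first by move=> k; exact: (cg _ _ (dg k)).
- exact: (cg _ _ dg0).
have pE (h h' : R -> R) i : (forall t : R, is_derive t 1 h (h' t)) ->
  pd i (fun x : 'rV[R]_n => h (sqn x)) = (fun x => h' (sqn x) * (2 * x ord0 i)).
 by move=> dh; apply/funext => x; apply: pd_val; exact: is_derive_radial.
split.
- by move=> k x i; have [] := is_derive_radial i (dg k (sqn x)).
- by move=> x i; have [] := is_derive_radial i (dg0 (sqn x)).
move=> i; rewrite (pE _ _ i dg0).
have -> : (fun k => pd i (fun x : 'rV[R]_n => g k (sqn x))) = (fun k x => g' k (sqn x) * (2 * x ord0 i)).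
 by apply/funext => k; rewrite (pE _ _ i (dg k)).
have -> : b = (b + 2^-1) + (0 - 2^-1) by ring.
apply: FamM => //; apply: FamM; last exact: Fam_coord.
by apply: (@Fam_cst l (fun=> 2)); exact: cvg_cst.
Qed.

Lemma Fam_0 l b : Fam l b (fun _ _ => 0) (fun=> 0).
Proof.
have E : (fun=> 0 : R) = (fun _ : 'rV[R]_n => 0) by [].
elim: l => [|l IH]; split => //; try by move=> *; exact: cst_continuous.
- by exists 0 => // k x; rewrite normr0 mul0r.
- by move=> x; exact: cvg_cst.
- by exists 0 => // k x; rewrite normr0 mul0r.
- by move=> x; exact: cvg_cst.
by split => [*|*|i]; [exact: derivable_cst|exact: derivable_cst|rewrite pd_cst].
Qed.

Lemma Fam_sum l b (I : Type) (s : seq I) (F : I -> nat -> 'rV[R]_n -> R) (G : I -> 'rV[R]_n -> R) :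
 (forall i, Fam l b (F i) (G i)) ->
 Fam l b (fun k x => \sum_(i <- s) F i k x) (fun x => \sum_(i <- s) G i x).
Proof.
move=> h; elim: s => [|i s IH].
 have -> : (fun x => \sum_(i <- [::]) G i x) = fun=> 0 by apply/funext => x; rewrite big_nil.
 have -> : (fun k x => \sum_(i <- [::]) F i k x) = fun _ _ => 0.
  by apply/funext => k; apply/funext => x; rewrite big_nil.
 exact: Fam_0.
have -> : (fun x => \sum_(i <- i :: s) G i x) = fun x => G i x + \sum_(i <- s) G i x.
 by apply/funext => x; rewrite big_cons.
have -> : (fun k x => \sum_(i <- i :: s) F i k x) = fun k x => F i k x + \sum_(i <- s) F i k x.
 by apply/funext => k; apply/funext => x; rewrite big_cons.
exact: FamD.
Qed.

Lemma FamZ l b (c : R) K Kl : Fam l b K Kl -> Fam l b (fun k x => c * K k x) (fun x => c * Kl x).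
Proof.
move=> h; rewrite -[b]add0r; apply: FamM => //.
by apply: (@Fam_cst l (fun=> c)); exact: cvg_cst.
Qed.

Lemma Fam_nlap l b K Kl : Fam l.+2 b K Kl -> Fam l b (fun k => nlap (K k)) (nlap Kl).
Proof.
move=> h; have nlapE u : nlap u = (fun x => (-1) * \sum_(i < n) pd i (pd i u) x).
 by apply/funext => x; rewrite mulN1r.
rewrite nlapE; have -> : (fun k => nlap (K k)) = (fun k x => (-1) * \sum_(i < n) pd i (pd i (K k)) x).
 by apply/funext => k; exact: nlapE.
by apply: FamZ; apply: Fam_sum => i; apply/Fam_pd/Fam_pd.
Qed.

Lemma Fam_Ck l b K Kl k : Fam l b K Kl -> Ck l (K k).
Proof.
elim: l K Kl => [|l IH] K Kl [c c0 B L P]; split => //.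
by case: P => d d0 P; split; [exact: d|move=> i; apply: (IH (fun k => pd i (K k))); exact: P].
Qed.

End families.

(** * Cut-offs, Gaussians and regularised powers *)

Section members.
Context {R : realType}.
Variable n : nat.
Implicit Types (x y z : 'rV[R]_n) (a b t : R).

(** A cut-off profile of finite smoothness: for [N > 0] the [N]-th power of the positive part is of
    class $C^{N-1}$, and [N] is chosen according to the number of derivatives needed. *)
Definition pp (N : nat) t : R := Num.max 0 t ^+ N.

Lemma pp_ge0 N t : 0 <= pp N t. Proof. by rewrite exprn_ge0// le_max lexx. Qed.

Lemma pp_le1 N t : t <= 1 -> pp N t <= 1.
Proof. by move=> t1; rewrite exprn_ile1// ?le_max ?lexx// ge_max ler01. Qed.

Lemma pp_neg N t : t <= 0 -> pp N.+1 t = 0.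
Proof. by move=> t0; rewrite /pp (max_idPl t0) expr0n. Qed.

Lemma pp_pos N t : 0 <= t -> pp N t = t ^+ N.
Proof. by move=> t0; rewrite /pp (max_idPr t0). Qed.

Lemma is_derive_pp N t : is_derive t 1 (pp N.+2) (N.+2%:R * pp N.+1 t).
Proof.
have [t0|t0|->] := ltgtP t 0.
- rewrite pp_neg ?(ltW t0)// mulr0.
 have h : is_derive t 1 (cst (0 : R)) 0 by exact: is_derive_cst.
 apply: (near_eq_is_derive _ h).
 by near=> s; rewrite pp_neg//; apply: ltW; near: s; exact: lt_nbhsl.
- rewrite pp_pos ?(ltW t0)//.
 have h : is_derive t 1 (fun s : R => s ^+ N.+2) (N.+2%:R * t ^+ N.+1).
  by split; [exact: exprn_derivable|rewrite exp_derive /GRing.scale /= mulr1].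
 apply: (near_eq_is_derive _ h).
 by near=> s; rewrite pp_pos//; apply: ltW; near: s; exact: lt_nbhsr.
- rewrite pp_neg// mulr0.
 have H : h^-1 *: ((pp N.+2 \o shift 0) (h *: 1) - pp N.+2 0) @[h --> 0^'] --> (0 : R).
  apply/cvgrPdist_le => e e0; near=> h.
  rewrite sub0r normrN /= addr0 [h *: 1]mulr1 (pp_neg _ (lexx 0)) subr0 [_ *: _]mulrC.
  have h1 : `|h| <= 1 by near: h; apply: dnbhs0_le; exact: ltr01.
  have he : `|h| <= e by near: h; exact: dnbhs0_le.
  have [hp|hn] := leP 0 h; last by rewrite pp_neg ?(ltW hn)// mul0r normr0 ltW.
  have [->|h0] := eqVneq h 0; first by rewrite pp_neg// mul0r normr0 ltW.
  rewrite pp_pos// exprS mulrAC divff// mul1r normrX.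
  apply: le_trans he; rewrite exprS ler_piMr// exprn_ile1//.
 split; first by apply/cvg_ex; exists 0.
 exact: cvg_lim H.
Unshelve. all: by end_near. Qed.

Lemma is_derive_pp_aff N (e t : R) :
 is_derive t 1 (fun s => pp N.+2 (1 - e * s)) (- e * (N.+2%:R * pp N.+1 (1 - e * t))).
Proof.
have d1 : is_derive t 1 (fun s : R => 1 - e * s) (- e).
 by apply: is_derive_eq; rewrite /GRing.scale /=; ring.
by rewrite mulrC; apply: (@is_derive1_comp _ (pp N.+2) (fun s => 1 - e * s)); exact: is_derive_pp.
Qed.

Lemma is_derive_continuous (g : R -> R) t d : is_derive t 1 g d -> {for t, continuous g}.
Proof. by move=> [h _]; apply/differentiable_continuous/derivable1_diffP. Qed.

Lemma cont_pp N : continuous (pp N).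
Proof.
move=> t; rewrite /pp; elim: N => [|N IH].
 by have -> : (fun s : R => Num.max 0 s ^+ 0) = fun=> 1 by []; exact: cst_continuous.
have -> : (fun s : R => Num.max 0 s ^+ N.+1) = fun s => Num.max 0 s * Num.max 0 s ^+ N.
 by apply/funext => s; rewrite exprS.
apply: continuousM => //; apply: continuous_max; [exact: cst_continuous|exact: cvg_id].
Qed.

Definition epsk (k : nat) : R := k.+1%:R^-1.

Lemma cvg_epsk : epsk @ \oo --> (0 : R). Proof. exact: cvg_harmonic. Qed.

(** Each differentiation brings out [epsk k], which tends to 0, and a coordinate, which costs weight
    [2^-1]. The result converges to the constant 1 with uniform polynomial bounds, which a Gaussian
    factor later absorbs. *)
Lemma Fam_cut l N : (l < N)%N ->
 Fam l (- (l%:R / 2)) (fun k x => pp N (1 - epsk k * sqn x)) (fun _ : 'rV[R]_n => 1).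
Proof.
have cv M (s : R) : (fun k => pp M (1 - epsk k * s)) @ \oo --> (1 : R).
 suff : (fun k => pp M (1 - epsk k * s)) @ \oo --> pp M (1 - 0 * s).
  by rewrite mul0r subr0 [X in _ --> X]pp_pos// expr1n.
 have h : (fun k => 1 - epsk k * s) @ \oo --> 1 - 0 * s; last exact: cvg_comp h (@cont_pp M _).
 by apply: cvgB; [exact: cvg_cst|apply: cvgM; [exact: cvg_epsk|exact: cvg_cst]].
have bd M k x : `|pp M (1 - epsk k * sqn x)| <= 1.
 rewrite ger0_norm ?pp_ge0// pp_le1// gerBl mulr_ge0 ?sqn_ge0// invr_ge0//.
elim: l N => [|l IH] [|N]// lN.
 split => //.
 - move=> k x; apply: (@continuous_comp _ _ _ (fun x => 1 - epsk k * sqn x) (pp N.+1)); last exact: cont_pp.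
  by apply: continuousB; [exact: cst_continuous|apply: continuousM; [exact: cst_continuous|exact: cont_sqn]].
 - by move=> x; exact: cst_continuous.
 - by exists 1 => // k x; rewrite mul0r oppr0 bw0 mulr1.
case: N lN => [|N]// lN.
apply: (@Fam_radial _ _ l _ (fun k t => pp N.+2 (1 - epsk k * t))
  (fun k t => - epsk k * (N.+2%:R * pp N.+1 (1 - epsk k * t))) (fun=> 1) (fun=> 0)).
- by move=> k t; exact: is_derive_pp_aff.
- exists 1 => // k x; rewrite mul1r; apply: le_trans (bd _ _ _) _.
 by rewrite -[leLHS](bw0 x) bw_le// oppr_le0 divr_ge0.
- by move=> t; exact: cv.
have -> : - (l.+1%:R / 2) + 2^-1 = 0 + - (l%:R / 2) :> R by rewrite -natr1; field.
have -> : (fun=> 0 : R) = (fun _ : 'rV[R]_n => - 0 * (N.+2%:R * 1)) by apply/funext => x; rewrite oppr0 mul0r.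
apply: FamM; first by apply: (@Fam_cst _ _ l (fun k => - epsk k)); apply: cvgN; exact: cvg_epsk.
by apply: FamZ; exact: IH.
Qed.

Lemma Fam_cut1 l N b : (l < N)%N ->
 Fam l b (fun _ x => pp N (1 - sqn x)) (fun x : 'rV[R]_n => pp N (1 - sqn x)).
Proof.
have bd M c : exists2 C : R, 0 <= C & forall (k : nat) x, `|pp M.+1 (1 - sqn x)| <= C * bw c x.
 exists (2 `^ `|c|) => [|_ x]; first exact: powR_ge0.
 rewrite ger0_norm ?pp_ge0//; have [x1|x1] := leP 1 (sqn x).
  by rewrite pp_neg ?subr_le0// mulr_ge0 ?powR_ge0 ?bw_ge0.
 apply: (@le_trans _ _ 1); first by rewrite pp_le1// gerBl sqn_ge0.
 rewrite /bw powRN ler_pdivlMr ?powR_gt0 ?bw1_gt0// mul1r.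
 apply: (@le_trans _ _ ((1 + sqn x) `^ `|c|)).
  by apply: ler_powR; rewrite ?ler_norm// lerDl sqn_ge0.
 by apply: ge0_ler_powR; rewrite ?nnegrE ?(ltW (bw1_gt0 _))// -[2]/(1 + 1) lerD2l ltW.
elim: l N b => [|l IH] [|N]// b lN.
 have cc : continuous (fun x : 'rV[R]_n => pp N.+1 (1 - sqn x)).
  move=> x; apply: (@continuous_comp _ _ _ (fun x => 1 - sqn x) (pp N.+1)); last exact: cont_pp.
  by apply: continuousB; [exact: cst_continuous|exact: cont_sqn].
 by split => // x; exact: cvg_cst.
case: N lN => [|N]// lN.
apply: (@Fam_radial _ _ l _ (fun _ t => pp N.+2 (1 - t)) (fun _ t => - 1 * (N.+2%:R * pp N.+1 (1 - t)))
 (fun t => pp N.+2 (1 - t)) (fun t => - 1 * (N.+2%:R * pp N.+1 (1 - t)))) => //.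
- by move=> _ t; have := is_derive_pp_aff N 1 t; rewrite mul1r; under eq_fun do rewrite mul1r.
- by move=> t; have := is_derive_pp_aff N 1 t; rewrite mul1r; under eq_fun do rewrite mul1r.
- by move=> t; exact: cvg_cst.
by apply: FamZ; apply: FamZ; exact: IH.
Qed.

Lemma Fam_gauss l t b : 0 < t -> Fam l b (fun _ => gauss t) (@gauss R n t).
Proof.
move=> t0; pose c : R := (4 * pi * t) `^ (- (n%:R / 2)).
pose g (s : R) := c * expR (- (s / (4 * t))).
have gE : @gauss R n t = fun x => g (sqn x) by apply/funext => x; rewrite gaussE.
have t4 : 0 < 4 * t by rewrite mulr_gt0.
rewrite gE; have dg (s : R) : is_derive s 1 g (- (4 * t)^-1 * g s).
 have d1 : is_derive s 1 (fun s : R => - (s / (4 * t))) (- (4 * t)^-1).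
  by apply: is_derive_eq; rewrite /GRing.scale /= ?mulr1 ?mulr0 ?add0r ?addr0.
 have d2 := @is_derive1_comp _ expR (fun s : R => - (s / (4 * t))) _ _ _ (is_derive_expR _) d1.
 have d3 := is_deriveZ c d2.
 by apply: is_derive_eq; rewrite /g /GRing.scale /=; ring.
have bd d : exists2 C : R, 0 <= C & forall (k : nat) x, `|g (sqn x)| <= C * bw d x.
 wlog d0 : d / 0 < d.
  move=> h; have [//|d0] := ltP 0 d; first exact: h.
  have [C C0 CP] := h 1 ltr01; exists C => // k x; apply: le_trans (CP k x) _.
  by rewrite ler_wpM2l// bw_le// (le_trans d0).
 have c0 : 0 <= c by exact: powR_ge0.
 pose A : R := (1 + 4 * t) `^ d * (d `^ d * expR 1).
 have A0 : 0 <= A by rewrite !mulr_ge0 ?powR_ge0 ?expR_ge0.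
 exists (c * A) => [|_ x]; first exact: mulr_ge0.
 rewrite ger0_norm ?mulr_ge0 ?expR_ge0// -mulrA ler_wpM2l//.
 rewrite /bw powRN ler_pdivlMr ?powR_gt0 ?bw1_gt0//.
 pose r := sqn x / (4 * t); have r0 : 0 <= r by rewrite divr_ge0 ?sqn_ge0 ?ltW.
 apply: (@le_trans _ _ (expR (- r) * ((1 + 4 * t) * (1 + r)) `^ d)).
  rewrite ler_wpM2l ?expR_ge0//; apply: ge0_ler_powR; rewrite ?nnegrE ?(ltW d0) ?(ltW (bw1_gt0 _))//.
   by rewrite mulr_ge0// addr_ge0// ltW.
  have -> : sqn x = 4 * t * r by rewrite /r; field; rewrite gt_eqF.
  nra.
 rewrite powRM ?addr_ge0 ?(ltW t4)// mulrCA /A ler_wpM2l ?powR_ge0//.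
 rewrite expRN mulrC ler_pdivrMr ?expR_gt0// -mulrA -expRD.
 by apply: powR_le_expR; rewrite // addr_ge0.
elim: l b => [|l IH] b.
 have cc : continuous (fun x : 'rV[R]_n => g (sqn x)).
  move=> x; apply: (@continuous_comp _ _ _ (@sqn R n) g); first exact: cont_sqn.
  exact: is_derive_continuous (dg _).
 by split => // x; exact: cvg_cst.
apply: (@Fam_radial _ _ l _ (fun _ => g) (fun _ s => - (4 * t)^-1 * g s) g (fun s => - (4 * t)^-1 * g s)) => //.
- by move=> s; exact: cvg_cst.
by apply: FamZ; exact: IH.
Qed.

(* A smooth positive function equal to t for t >= 1. *)
Definition phi (N : nat) t : R := t + pp N (1 - t).

Lemma phi_gt0 N t : 0 < phi N.+1 t.
Proof.
rewrite /phi; have [t1|t1] := leP t 0; last by rewrite ltr_pwDl// pp_ge0.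
have h : 1 <= 1 - t by rewrite lerBrDr gerDl.
rewrite pp_pos ?(le_trans ler01)//; apply: (@lt_le_trans _ _ (t + (1 - t))); first by rewrite subrKC.
by rewrite lerD2l exprS ler_peMr ?(le_trans ler01 h)// exprn_ege1.
Qed.

Lemma phi_ge N t : 0 <= t -> (2 ^- N.+1) / 3 * (1 + t) <= phi N.+1 t.
Proof.
move=> t0; have e0 : 0 <= 2 ^- N.+1 :> R by rewrite invr_ge0 exprn_ge0.
have e1 : 2 ^- N.+1 <= 1 :> R by rewrite invf_le1 ?exprn_gt0// exprn_ege1// ler1n.
(* For [t >= 1/2] the term [t] alone exceeds [(1 + t) / 3]; for smaller [t] the cut-off term exceeds
   [2 ^- N.+1]. The product of the two constants serves both cases. *)
rewrite /phi; have [t2|t2] := leP 2^-1 t.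
 have p := pp_ge0 N.+1 (1 - t).
 suff : 2 ^- N.+1 / 3 * (1 + t) <= t by lra.
 apply: (@le_trans _ _ (1 / 3 * (1 + t))); last lra.
 by rewrite ler_wpM2r ?addr_ge0// ler_wpM2r.
have : 2 ^- N.+1 <= pp N.+1 (1 - t).
 rewrite pp_pos ?subr_ge0; last lra.
 by rewrite -exprVn ler_pXn2r ?nnegrE//; lra.
set c := 2 ^- N.+1 in e0 e1 *; move=> h; nra.
Qed.

Lemma phi1 N t : 1 <= t -> phi N.+1 t = t.
Proof. by move=> t1; rewrite /phi pp_neg ?subr_le0// addr0. Qed.

Lemma Fam_phi l N b : (l < N)%N -> 0 <= b ->
 Fam l b (fun _ x => phi N (sqn x) `^ (- b)) (fun x : 'rV[R]_n => phi N (sqn x) `^ (- b)).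
Proof.
case: N => // N lN.
have dphi M (s : R) : is_derive s 1 (phi M.+2) (1 - M.+2%:R * pp M.+1 (1 - s)).
 have h := is_derive_pp_aff M 1 s; rewrite mul1r in h.
 have -> : phi M.+2 = (fun s => s + pp M.+2 (1 - 1 * s)) by apply/funext => r; rewrite mul1r.
 by apply: is_derive_eq; rewrite mulN1r.
have cphi : continuous (phi N.+1).
 move=> s; apply: (@continuousD _ _ _ (fun s : R => s) (fun s => pp N.+1 (1 - s))); first exact: cvg_id.
 apply: (@continuous_comp R R R (fun x : R => 1 - x) (pp N.+1) s); last exact: cont_pp.
 by apply: (@continuousB _ _ _ (cst (1 : R)) (fun x : R => x) s); [exact: cst_continuous|exact: cvg_id].
have bd c : 0 <= c -> exists2 C : R, 0 <= C & forall (k : nat) x, `|phi N.+1 (sqn x) `^ (- c)| <= C * bw c x.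
 move=> c0; have d0 : 0 < 2 ^- N.+1 / 3 :> R by rewrite divr_gt0// invr_gt0 exprn_gt0.
 exists ((2 ^- N.+1 / 3) `^ (- c)) => [|_ x]; first exact: powR_ge0.
 rewrite ger0_norm ?powR_ge0// -powRM ?(ltW d0) ?(ltW (bw1_gt0 _))// !powRN.
 rewrite lef_pV2 ?posrE ?powR_gt0 ?phi_gt0 ?mulr_gt0 ?bw1_gt0//.
 apply: ge0_ler_powR; rewrite ?nnegrE ?(ltW (phi_gt0 _ _)) ?phi_ge ?sqn_ge0//.
 by rewrite mulr_ge0 ?(ltW d0) ?(ltW (bw1_gt0 _)).
elim: l lN b => [|l IH] lN b b0.
 have cc : continuous (fun x : 'rV[R]_n => phi N.+1 (sqn x) `^ (- b)).
  move=> x; apply: (@continuous_comp _ _ _ (fun x => phi N.+1 (sqn x)) (fun s : R => s `^ (- b))).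
   by apply: (@continuous_comp _ _ _ (@sqn R n) (phi N.+1)); [exact: cont_sqn|exact: cphi].
  have [_ _] := is_derive_powR (- b) 1 (phi_gt0 N (sqn x)).
  by apply: cont_powR_pos; exact: phi_gt0.
 by split => //; [exact: bd|move=> x; exact: cvg_cst].
case: N lN dphi cphi bd IH => [|N]// lN dphi cphi bd IH.
pose g' (s : R) := - b * phi N.+2 s `^ (- (b + 1)) * (1 + - N.+2%:R * pp N.+1 (1 - s)).
have dg (s : R) : is_derive s 1 (fun s => phi N.+2 s `^ (- b)) (g' s).
 have h := is_derive1_comp (is_derive_powR (- b) 1 (phi_gt0 N.+1 s)) (dphi N s).
 have -> : (fun s => phi N.+2 s `^ (- b)) = (fun t => 1 * t `^ (- b)) \o phi N.+2.
  by apply/funext => r /=; rewrite mul1r.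
 by apply: is_derive_eq; rewrite /g' opprD mul1r mulNr.
apply: (@Fam_radial _ _ l _ (fun _ s => phi N.+2 s `^ (- b)) (fun _ => g') (fun s => phi N.+2 s `^ (- b)) g') => //.
- exact: bd.
- by move=> s; exact: cvg_cst.
(* The derivative of the power gains a full unit of weight, more than the half required; its other
   factor is 1 plus a compactly supported term. *)
apply: (@Fam_weight _ _ _ _ (b + 1 + 0)); first by rewrite addr0 lerD2l; lra.
rewrite /g'; apply: FamM.
 by apply: FamZ; apply: IH; [exact: ltnW|exact: addr_ge0].
apply: FamD; first by apply: (@Fam_cst _ _ l (fun=> 1)); exact: cvg_cst.
by apply: FamZ; exact: Fam_cut1.
Qed.

End members.

(** * Convolution with weighted kernels *)

Section convolution.
Context {R : realType}.
Variable n : nat.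
Implicit Types (x y z : 'rV[R]_n) (a b : R) (K h u v : 'rV[R]_n -> R).

Definition cvl K h x : R := \int[lebn n]_y (K (x - y) * h y).

Definition bwint b h := msble h /\
 (\int[lebn n]_y (`|h y| * bw b y)%:E < +oo)%E.

Lemma bwint_int b h : bwint b h -> intgr (lebn n) (fun y => `|h y| * bw b y).
Proof.
move=> [mh fin]; have mb := @msble_bw R n b; apply: integrableR; first by meas.
by under eq_integral do rewrite normrM normr_id (ger0_norm (bw_ge0 _ _)).
Qed.

Lemma cvl_dom b K (C r : R) h x y : 0 <= b -> 0 <= C -> (forall z, `|K z| <= C * bw b z) ->
 enorm x <= r -> `|K (x - y) * h y| <= C * (2 * (1 + r ^+ 2)) `^ b * (`|h y| * bw b y).
Proof.
move=> b0 C0 KC xr; rewrite normrM.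
apply: (@le_trans _ _ (C * ((2 * (1 + r ^+ 2)) `^ b * bw b y) * `|h y|)).
 by rewrite ler_wpM2r//; apply: le_trans (KC _) _; rewrite ler_wpM2l// bw_shift.
by apply: eq_leW; ring.
Qed.

Lemma cvl_integrable b K (C : R) h x : 0 <= b -> 0 <= C -> msble K ->
 (forall z, `|K z| <= C * bw b z) -> bwint b h ->
 intgr (lebn n) (fun y => K (x - y) * h y).
Proof.
move=> b0 C0 mK KC hb; have [mh fin] := hb; have mb := @msble_bw R n b.
apply: (@integrableR_le _ _ _ _ _ (fun y => C * (2 * (1 + enorm x ^+ 2)) `^ b * (`|h y| * bw b y))).
- by meas.
- by meas.
- by move=> y; exact: cvl_dom.
- rewrite ge0_intZl.
 + by apply: lte_mul_pinfty => //; rewrite lee_fin mulr_ge0 ?powR_ge0.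
 + by rewrite mulr_ge0 ?powR_ge0.
 + by meas.
 + by move=> y; rewrite mulr_ge0 ?bw_ge0.
Qed.

Lemma cvl_bound b K (C : R) h (r : R) : 0 <= b -> 0 <= C -> msble K ->
 (forall z, `|K z| <= C * bw b z) -> bwint b h ->
 forall x, enorm x <= r ->
 `|cvl K h x| <= C * (2 * (1 + r ^+ 2)) `^ b * \int[lebn n]_y (`|h y| * bw b y).
Proof.
move=> b0 C0 mK KC hb x xr; have i1 := cvl_integrable x b0 C0 mK KC hb.
have i2 := bwint_int hb.
rewrite -RintegralZl//; apply: le_trans (le_normr_Rintegral _ i1) _ => //.
apply: le_Rintegral => //.
- exact: integrable_norm i1.
- by have := integrableZl measurableT (C * (2 * (1 + r ^+ 2)) `^ b) i2; apply: eq_integrable.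
- by move=> y _; exact: cvl_dom.
Qed.

Lemma cvl_pd b K h : 0 <= b -> Fam 1 b (fun=> K) K -> bwint b h ->
 forall x i, is_derive x (ebase R i) (cvl K h) (cvl (pd i K) h x).
Proof.
move=> b0 FK hb x i; have [_ cK [C C0 KC] _ [_ dK P]] := FK.
have [_ cK' [C' C'0 KC'] _ _] := P i.
have mK := cont_rV_msble cK; have mK' := cont_rV_msble (cK' : continuous (pd i K)).
have i2 := bwint_int hb.
apply: line_is_derive.
pose f (s : R) y := K (x + s *: ebase R i - y) * h y.
have df s y : is_derive s (1 : R) (f ^~ y) (pd i K (x + s *: ebase R i - y) * h y).
 have h1 : is_derive s (1 : R) (fun t : R => K ((x - y) + t *: ebase R i)) (pd i K (x + s *: ebase R i - y)).
  by apply: is_derive_line; rewrite addrAC; exact: derivable_pd.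
 have := is_deriveM h1 (is_derive_cst (h y) s 1).
 have -> : (fun t : R => K (x - y + t *: ebase R i)) * cst (h y) = f ^~ y.
  by apply/funext => t; rewrite /f addrAC.
 by move=> H; apply: (is_derive_eq H); rewrite /GRing.scale /= mulr0 add0r mulrC.
have d1 s y : partial1of2 f s y = pd i K (x + s *: ebase R i - y) * h y.
 by rewrite partial1of2E; have [_ ->] := df s y.
pose r := enorm x + 1.
have xr s : `]-1, 1[%classic s -> enorm (x + s *: ebase R i) <= r.
 move=> /=; rewrite in_itv /= => /andP[s1 s2]; apply: le_trans (enorm_triangle _ _) _.
 by rewrite lerD2l enormZ enorm_delta mulr1 ler_norml !ltW.
have I0 : `]-1, 1[%classic (0 : R) by rewrite /= in_itv /= ltrN10 ltr01.
pose G y := C' * (2 * (1 + r ^+ 2)) `^ b * (`|h y| * bw b y).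
have G0 y : 0 <= G y by rewrite !mulr_ge0 ?powR_ge0 ?bw_ge0.
have iG : intgr (lebn n) G.
 by have := integrableZl measurableT (C' * (2 * (1 + r ^+ 2)) `^ b) i2; apply: eq_integrable.
have intf s : `]-1, 1[%classic s -> intgr (lebn n) (f s).
 by move=> _; exact: cvl_integrable (KC 0%N) hb.
have derf s y : `]-1, 1[%classic s -> setT y -> derivable (f ^~ y) s 1.
 by move=> _ _; have [] := df s y.
have Gub s y : `]-1, 1[%classic s -> setT y -> `|partial1of2 f s y| <= G y.
 by move=> sI _; rewrite d1; apply: cvl_dom => //; [exact: (KC' 0%N)|exact: xr].
have D := derivable_under_integral measurableT I0 intf derf G0 iG Gub.
have V := differentiation_under_integral measurableT I0 intf derf G0 iG Gub.
split; first exact: D.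
rewrite -derive1E; transitivity (\int[lebn n]_y partial1of2 f 0 y); first exact: V.
by apply: eq_Rintegral => y _; rewrite d1 scale0r addr0.
Qed.

(** The kernel has one derivative more than the conclusion because continuity at the last order is
    read off from a local Lipschitz bound. *)
Lemma cvl_Ck l b K h : 0 <= b -> Fam l.+1 b (fun=> K) K -> bwint b h -> Ck l (cvl K h).
Proof.
move=> b0; elim: l K => [|l IH] K FK hb.
 split => //; have [_ cK [C C0 KC] _ [_ dK P]] := FK.
 have D := cvl_pd b0 FK hb.
 move=> x; pose r := enorm x + 1; have r0 : 0 < r by rewrite ltr_wpDl ?enorm_ge0.
 have H i : exists A : R, forall y, enorm y <= 3 * r -> `|pd i (cvl K h) y| <= A.
  have [_ cK' [C' C'0 KC'] _ _] := P i.
  eexists => y yr; rewrite (pd_val (D y i)).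
  exact: (cvl_bound b0 C'0 (cont_rV_msble (cK' : continuous (pd i K))) (KC' 0%N) hb yr).
 have [A AP] := choice H.
 have AP' y i : enorm y <= 3 * r -> `|pd i (cvl K h) y| <= \sum_j `|A j|.
  move=> yr; apply: le_trans (AP i y yr) _; apply: le_trans (ler_norm _) _.
  by rewrite (bigD1 i)//= lerDl sumr_ge0.
 have dc y i : derivable (cvl K h) y (ebase R i) by have [] := D y i.
 apply/enorm_continuousP => e e0; have C1 : 0 < n%:R * (\sum_j `|A j|) + 1.
  by rewrite ltr_wpDl// mulr_ge0// sumr_ge0.
 exists (Num.min 1 (e / (n%:R * (\sum_j `|A j|) + 1))).
  by rewrite lt_min ltr01 /=; exact: divr_gt0.
 move=> y; rewrite lt_min => /andP[xy1 xy2].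
 have xr : enorm x <= r by rewrite lerDl.
 have yr : enorm y <= r.
  rewrite -[y](subrK x); apply: le_trans (enorm_triangle _ _) _.
  by rewrite addrC lerD2l enorm_sub ltW.
 apply: le_trans (lip_of_pd dc AP' xr yr) _.
 apply: (@le_trans _ _ ((n%:R * (\sum_j `|A j|) + 1) * enorm (x - y))).
  by rewrite ler_wpM2r ?enorm_ge0// lerDl.
 by rewrite mulrC -ler_pdivlMr// ltW.
have D := cvl_pd b0 (Fam_le (ltn0Sn l.+1) FK) hb.
split; first exact: (Ck_cont (IH K (FamW FK) hb)).
split => [x i|i]; first by have [] := D x i.
have -> : pd i (cvl K h) = cvl (pd i K) h by apply/funext => x; apply: pd_val.
by apply: IH => //; exact: Fam_pd FK.
Qed.

Lemma cvl_sum b (I : Type) (s : seq I) (F : I -> 'rV[R]_n -> R) h x : 0 <= b ->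
 (forall i, Fam 0 b (fun=> F i) (F i)) -> bwint b h ->
 cvl (fun z => \sum_(i <- s) F i z) h x = \sum_(i <- s) cvl (F i) h x.
Proof.
move=> b0 FF hb; elim: s => [|i s IH].
 rewrite big_nil /cvl; under eq_Rintegral do rewrite big_nil mul0r.
 by rewrite Rintegral_cst// mul0r.
rewrite big_cons -IH /cvl -RintegralD//.
- by apply: eq_Rintegral => y _; rewrite big_cons mulrDl.
- have [_ c [C C0 B] _ _] := FF i.
 exact: cvl_integrable b0 C0 (cont_rV_msble c) (B 0%N) hb.
- have [_ c [C C0 B] _ _] := Fam_sum s FF.
 exact: cvl_integrable b0 C0 (cont_rV_msble c) (B 0%N) hb.
Qed.

Lemma cvl_nlap b K h : 0 <= b -> Fam 2 b (fun=> K) K -> bwint b h ->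
 nlap (cvl K h) = cvl (nlap K) h.
Proof.
move=> b0 FK hb; apply/funext => x; rewrite /nlap.
have D1 i : pd i (cvl K h) = cvl (pd i K) h.
 by apply/funext => y; apply: pd_val; apply: (cvl_pd b0 _ hb); exact: (Fam_le (isT : (1 <= 2)%N) FK).
have D2 i : pd i (pd i (cvl K h)) = cvl (pd i (pd i K)) h.
 by rewrite D1; apply/funext => y; apply: pd_val; apply: (cvl_pd b0 _ hb); exact: (@Fam_pd _ _ 1%N _ _ _ i FK).
under eq_bigr do rewrite D2.
have F2 i : Fam 0 b (fun=> pd i (pd i K)) (pd i (pd i K)) by apply/Fam_pd/Fam_pd.
rewrite -(cvl_sum _ _ b0 F2 hb) /cvl.
have [_ c [C C0 B] _ _] := Fam_sum (index_enum 'I_n) F2.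
have i1 := cvl_integrable x b0 C0 (cont_rV_msble c) (B 0%N) hb.
rewrite -mulN1r -RintegralZl//; apply: eq_Rintegral => y _.
by rewrite mulN1r mulNr.
Qed.

End convolution.

Lemma powR_le1 (R : realType) (s a : R) : 0 <= s -> s <= 1 -> 0 <= a -> s `^ a <= 1.
Proof.
move=> s0 s1 a0; apply: (@le_trans _ _ (1 `^ a)); last by rewrite powR1.
by apply: ge0_ler_powR; rewrite ?nnegrE.
Qed.

(** * Regularity of the fractional Laplacian of [v] *)

Section regularity.
Context {R : realType}.
Variables (n N : nat) (g bt : R).
Hypotheses (g0 : 0 < g) (g1 : g < 1) (gb : 2 * g < bt) (b2 : bt <= 2).
Implicit Types (x y z : 'rV[R]_n) (u v : 'rV[R]_n -> R).
Let W : R := n%:R + 2 * g.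

Let bt0 : 0 < bt. Proof. by apply: lt_trans gb; rewrite mulr_gt0. Qed.
Let W0 : 0 < W. Proof. by rewrite ltr_wpDl// mulr_gt0. Qed.
Let a0 : 0 <= W / 2. Proof. by rewrite divr_ge0// ltW. Qed.

(* The kernel |z|^(-n-2g) is split into a smooth part kf and a part kn which is
  supported in the unit ball: kn only sees v near x, so that derivatives can be
  moved onto v, while for kf they are moved onto the kernel. *)
Definition kf z : R := phi N.+2 (sqn z) `^ (- (W / 2)).
Definition kn z : R := (enorm z <= 1)%R%:R * (rker W z - kf z).

Lemma Fam_kf : Fam N.+1 (W / 2) (fun=> kf) kf.
Proof. exact: Fam_phi. Qed.

Lemma kfN z : kf (- z) = kf z. Proof. by rewrite /kf sqnN. Qed.

Lemma cont_kf : continuous kf.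
Proof. by have [_ + _ _ _] := Fam_kf. Qed.

Lemma msble_kf : msble kf.
Proof. exact: cont_rV_msble cont_kf. Qed.

Lemma msble_kn : msble kn.
Proof. by have mk := msble_kf; rewrite /kn; meas. Qed.

Lemma kf_bound : exists2 C : R, 0 <= C & forall z, `|kf z| <= C * bw (W / 2) z.
Proof. by have [_ _ [C C0 B] _ _] := Fam_kf; exists C => // z; exact: (B 0%N). Qed.

Lemma kf_far z : 1 <= enorm z -> kf z = rker W z.
Proof.
move=> z1; rewrite /kf phi1; last by rewrite -enorm_sqr exprn_ege1.
by rewrite -enorm_sqr -(powR_mulrn 2) ?enorm_ge0// -powRrM mulrN mulrC divfK// powRN.
Qed.

Lemma sdiff_split u x z : sdiff u x z * rker W z = sdiff u x z * kn z + sdiff u x z * kf z.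
Proof.
rewrite -mulrDr /kn; have [z1|z1] := leP (enorm z) 1; first by rewrite mul1r subrK.
by rewrite mul0r add0r kf_far// ltW.
Qed.

(** The constant [D] is independent of the function and of the point. In the unit ball [kf] is
    bounded and the singular kernel is at least 1, so [kn] is at most [D] times that kernel. *)
Lemma sdiff_kn_bound : exists2 D : R, 0 <= D & forall u x z (C : R), 0 <= C ->
 (forall z, enorm z <= 1 -> `|sdiff u x z| <= C * enorm z `^ bt) ->
 `|sdiff u x z * kn z| <= C * D * (Num.min 1 (enorm z `^ bt) * rker W z).
Proof.
have [C1 C10 B] := kf_bound; exists (1 + C1) => [|u x z C C0 h]; first exact: addr_ge0.
have m0 : 0 <= Num.min 1 (enorm z `^ bt) :> R by rewrite le_min ler01 powR_ge0.
rewrite /kn; have [z1|z1] := leP (enorm z) 1; last first.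
 by rewrite mul0r mulr0 normr0 !mulr_ge0 ?addr_ge0 ?rker_ge0.
have [->|z0] := eqVneq z 0.
 by rewrite sdiff0 mul0r normr0 !mulr_ge0 ?addr_ge0 ?rker_ge0// le_min ler01 powR_ge0.
have zp : 0 < enorm z by rewrite enorm_gt0.
have -> : Num.min 1 (enorm z `^ bt) = enorm z `^ bt.
 by apply/min_idPr; apply: powR_le1; rewrite ?enorm_ge0// ltW.
rewrite mul1r normrM -mulrA; apply: (@le_trans _ _ (C * enorm z `^ bt * ((1 + C1) * rker W z))); last first.
 by apply: eq_leW; ring.
apply: ler_pM => //; first exact: h.
rewrite mulrDl mul1r; apply: le_trans (ler_normB _ _) _.
rewrite ger0_norm ?rker_ge0// lerD2l; apply: le_trans (B z) _; rewrite ler_wpM2l//.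
apply: (@le_trans _ _ 1); first by rewrite -[leRHS](bw0 z) bw_le.
by rewrite /rker -[leLHS]invr1 lef_pV2 ?posrE ?powR_gt0// powR_le1 ?enorm_ge0// ltW.
Qed.

Let mrk := int_min_rker n g0 gb b2.

Lemma min_rker_integrable :
 intgr (lebn n) (fun z => Num.min 1 (enorm z `^ bt) * rker W z).
Proof.
apply: integrableR; first by meas.
under eq_integral do rewrite ger0_norm ?mulr_ge0 ?rker_ge0 ?le_min ?ler01 ?powR_ge0//.
exact: mrk.
Qed.

Definition near u x : R := \int[lebn n]_z (sdiff u x z * kn z).

Lemma near_integrable u x : msble u -> SD bt u ->
 intgr (lebn n) (fun z => sdiff u x z * kn z).
Proof.
move=> mu hu; have [D D0 DB] := sdiff_kn_bound; have [C C0 CP] := hu (enorm x).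
have ms := msble_sdiff x mu; have mk := msble_kn.
apply: (@integrableR_le _ _ _ _ _ (fun z => C * D * (Num.min 1 (enorm z `^ bt) * rker W z))).
- by meas.
- by meas.
- by move=> z; apply: DB => // w w1; exact: CP.
- rewrite ge0_intZl; last 3 first.
 + exact: mulr_ge0.
 + by meas.
 + by move=> z; rewrite mulr_ge0 ?rker_ge0 ?le_min ?ler01 ?powR_ge0.
 by apply: lte_mul_pinfty => //; rewrite lee_fin mulr_ge0.
Qed.

Lemma is_derive_sdiff u x z i (s : R) : (forall y, derivable u y (ebase R i)) ->
 is_derive s (1 : R) (fun t : R => sdiff u (x + t *: ebase R i) z) (sdiff (pd i u) (x + s *: ebase R i) z).
Proof.
move=> du; have L (w : 'rV[R]_n) : is_derive s (1 : R) (fun t : R => u (x + t *: ebase R i + w))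
  (pd i u (x + s *: ebase R i + w)).
 have -> : (fun t : R => u (x + t *: ebase R i + w)) = (fun t : R => u ((x + w) + t *: ebase R i)).
  by apply/funext => t; rewrite addrAC.
 by rewrite addrAC; apply: is_derive_line; exact: derivable_pd.
have L0 := L 0; rewrite addr0 in L0.
have E0 : (fun t : R => u (x + t *: ebase R i + 0)) = (fun t : R => u (x + t *: ebase R i)).
 by apply/funext => t; rewrite addr0.
rewrite E0 in L0.
exact: is_deriveB (is_deriveB (is_deriveZ 2 L0) (L z)) (L (- z)).
Qed.

(** Because [kn] is compactly supported, the integrated second differences of the derivative are
    controlled by [SD] alone, uniformly on a neighbourhood of [x]; this is the majorant for
    differentiating under the integral. *)
Lemma near_pd u i : msble u -> msble (pd i u) ->
 (forall y, derivable u y (ebase R i)) -> SD bt u -> SD bt (pd i u) ->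
 forall x, is_derive x (ebase R i) (near u) (near (pd i u) x).
Proof.
move=> mu mpu du hu hpu x; have [D D0 DB] := sdiff_kn_bound.
pose r := enorm x + 1; have [C C0 CP] := hpu r.
apply: line_is_derive.
pose f (s : R) z := sdiff u (x + s *: ebase R i) z * kn z.
have df s z : is_derive s (1 : R) (f ^~ z) (sdiff (pd i u) (x + s *: ebase R i) z * kn z).
 have := is_deriveM (is_derive_sdiff x z s du) (is_derive_cst (kn z) s 1).
 by move=> H; apply: (is_derive_eq H); rewrite /GRing.scale /= mulr0 add0r mulrC.
have d1 s y : partial1of2 f s y = sdiff (pd i u) (x + s *: ebase R i) y * kn y.
 by rewrite partial1of2E; have [_ ->] := df s y.
have xr s : `]-1, 1[%classic s -> enorm (x + s *: ebase R i) <= r.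
 move=> /=; rewrite in_itv /= => /andP[s1 s2]; apply: le_trans (enorm_triangle _ _) _.
 by rewrite lerD2l enormZ enorm_delta mulr1 ler_norml !ltW.
have I0 : `]-1, 1[%classic (0 : R) by rewrite /= in_itv /= ltrN10 ltr01.
pose G z := C * D * (Num.min 1 (enorm z `^ bt) * rker W z).
have G0 y : 0 <= G y by rewrite !mulr_ge0 ?rker_ge0// le_min ler01 powR_ge0.
have iG : intgr (lebn n) G.
 by have := integrableZl measurableT (C * D) min_rker_integrable; apply: eq_integrable.
have intf s : `]-1, 1[%classic s -> intgr (lebn n) (f s).
 by move=> _; exact: near_integrable.
have derf s y : `]-1, 1[%classic s -> setT y -> derivable (f ^~ y) s 1.
 by move=> _ _; have [] := df s y.
have Gub s y : `]-1, 1[%classic s -> setT y -> `|partial1of2 f s y| <= G y.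
 by move=> sI _; rewrite d1; apply: DB => // w w1; apply: CP => //; exact: xr.
have D1 := derivable_under_integral measurableT I0 intf derf G0 iG Gub.
have V := differentiation_under_integral measurableT I0 intf derf G0 iG Gub.
split; first exact: D1.
rewrite -derive1E; transitivity (\int[lebn n]_y partial1of2 f 0 y); first exact: V.
by apply: eq_Rintegral => y _; rewrite d1 scale0r addr0.
Qed.

Lemma near_continuous u : continuous u -> SD bt u -> continuous (near u).
Proof.
move=> cu hu x; have [D D0 DB] := sdiff_kn_bound.
have mu := cont_rV_msble cu; have mk := msble_kn.
have [C C0 CP] := hu (enorm x + 1).
apply: (@dominated_continuous _ _ _ _ _ _ (fun z => C * D * (Num.min 1 (enorm z `^ bt) * rker W z))).
- by move=> y _; have ms := msble_sdiff y mu; meas.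
- by have := integrableZl measurableT (C * D) min_rker_integrable; apply: eq_integrable.
- move=> y z xy; apply: DB => // w w1; apply: CP => //.
 rewrite -[y](subrK x); apply: le_trans (enorm_triangle _ _) _.
 by rewrite addrC lerD2l enorm_sub ltW.
- move=> z; apply: continuousM; last exact: cst_continuous.
 apply: continuousB; first apply: continuousB.
 + by apply: continuousM; [exact: cst_continuous|exact: cu].
 + apply: (@continuous_comp _ _ _ (fun y => y + z) u); last exact: cu.
  by apply: continuousD; [exact: cvg_id|exact: cst_continuous].
 + apply: (@continuous_comp _ _ _ (fun y => y - z) u); last exact: cu.
  by apply: continuousB; [exact: cvg_id|exact: cst_continuous].
Qed.

Fixpoint SDk (l : nat) u : Prop :=
 [/\ continuous u, SD bt u &
  match l with
  | 0 => True
  | l'.+1 => (forall x i, derivable u x (ebase R i)) /\ forall i, SDk l' (pd i u)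
  end].

Lemma near_Ck l u : SDk l u -> Ck l (near u).
Proof.
elim: l u => [|l IH] u [cu hu P]; first by split => //; exact: near_continuous.
case: P => du P.
have cp i : continuous (pd i u) /\ SD bt (pd i u) by move: (P i); case: (l) => [|?] [].
have D x i : is_derive x (ebase R i) (near u) (near (pd i u) x).
 have [c h] := cp i; apply: near_pd => //; exact: cont_rV_msble.
split; first exact: near_continuous.
split => [x i|i]; first by have [] := D x i.
have -> : pd i (near u) = near (pd i u) by apply/funext => x; exact: pd_val.
by apply: IH; exact: P.
Qed.

Variable v : 'rV[R]_n -> R.
Hypotheses (cv : continuous v) (vL : Ls g v) (vSD : SD bt v).

Let mv : msble v. Proof. exact: cont_rV_msble. Qed.

Lemma Ls_bwint : bwint (W / 2) v.
Proof.
split => //; have mb := @msble_bw R n (W / 2).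
apply: (@le_int_lty _ _ _ _ _ (fun z => 2 * (`|v z| * wt W z))).
- by move=> z; rewrite mulr_ge0 ?bw_ge0.
- by meas.
- by meas.
- by move=> z; rewrite mulrCA ler_wpM2l// bw_wt// ltW.
- rewrite ge0_intZl; last 3 first.
 + by [].
 + by meas.
 + by move=> z; pos.
 by apply: lte_mul_pinfty => //; exact: Ls_lty.
Qed.

(** In the unit ball [SD] gives integrability; outside it the kernel is at most twice the weight and
    [Ls] takes over, after translation by [x]. Uniformity on balls is what Fubini needs when [Lam]
    is convolved with a compactly supported kernel. *)
Lemma sdiff_int_local (r : R) : exists2 C : R, 0 <= C &
 forall x, enorm x <= r -> (sdiff_int W v x <= C%:E)%E.
Proof.
have [C C0 CP] := vSD r; have [A A0 AP] := cont_bounded r cv.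
have vw := Ls_lty mv vL; have ww := int_wt n g0 g1.
pose B := 2 `^ W * (1 + `|r| `^ W).
pose I1 := fine (\int[lebn n]_z (Num.min 1 (enorm z `^ bt) * rker W z)%:E)%E.
pose I2 := fine (\int[lebn n]_z (wt W z)%:E)%E.
pose I3 := fine (\int[lebn n]_z (`|v z| * wt W z)%:E)%E.
have p1 z : 0 <= Num.min 1 (enorm z `^ bt) * rker W z.
 by rewrite mulr_ge0 ?rker_ge0// le_min ler01 powR_ge0.
have E1 : (\int[lebn n]_z (Num.min 1 (enorm z `^ bt) * rker W z)%:E = I1%:E)%E.
 by rewrite fineK// ge0_fin_numE// int_ge0R.
have E2 : (\int[lebn n]_z (wt W z)%:E = I2%:E)%E.
 by rewrite fineK// ge0_fin_numE// int_ge0R// => z; exact: wt_ge0.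
have E3 : (\int[lebn n]_z (`|v z| * wt W z)%:E = I3%:E)%E.
 by rewrite fineK// ge0_fin_numE// int_ge0R// => z; pos.
have I10 : 0 <= I1 by rewrite -lee_fin -E1 int_ge0R.
have I20 : 0 <= I2 by rewrite -lee_fin -E2 int_ge0R// => z; exact: wt_ge0.
have I30 : 0 <= I3 by rewrite -lee_fin -E3 int_ge0R// => z; pos.
have B0 : 0 <= B by rewrite mulr_ge0 ?addr_ge0 ?powR_ge0.
exists (C * I1 + (4 * A * I2 + (2 * (B * I3) + 2 * (B * I3)))) => [|x xr].
 by rewrite !addr_ge0// !mulr_ge0.
have ms := msble_sdiff x mv.
have xr' : enorm x <= `|r| by exact: le_trans (ler_norm r).
apply: (@le_trans _ _ (\int[lebn n]_z (C * (Num.min 1 (enorm z `^ bt) * rker W z) +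
  (4 * A * wt W z + (2 * (`|v (z + x)| * wt W z) + 2 * (`|v (x - z)| * wt W z))))%:E)%E).
 apply: le_intR.
 - by move=> z; pos.
 - by meas.
 - by meas.
 - move=> z; have q : 0 <= 4 * A * wt W z + (2 * (`|v (z + x)| * wt W z) + 2 * (`|v (x - z)| * wt W z)).
   by rewrite !addr_ge0// !mulr_ge0 ?wt_ge0.
  have [z1|z1] := leP (enorm z) 1.
   apply: ler_wpDr => //; rewrite mulrA ler_wpM2r ?rker_ge0//.
   apply: le_trans (CP x z xr z1) _; rewrite ler_wpM2l//.
   by rewrite le_min lexx andbT powR_le1 ?enorm_ge0// ltW.
  apply: ler_wpDl; first by rewrite mulr_ge0.
  have k2 : rker W z <= 2 * wt W z.
   by have := @rker_wt _ _ W 1 z W0 ltr01 (ltW z1); rewrite powR1.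
  apply: (@le_trans _ _ ((2 * A + `|v (z + x)| + `|v (x - z)|) * (2 * wt W z))).
   apply: ler_pM; rewrite ?rker_ge0// /sdiff.
   apply: le_trans (ler_normB _ _) _; apply: lerD => //.
   apply: le_trans (ler_normB _ _) _; rewrite [x + z]addrC; apply: lerD => //.
   by rewrite normrM ger0_norm// ler_wpM2l// AP.
  by apply: eq_leW; ring.
have w0 := wt_ge0 W : forall z : 'rV[R]_n, 0 <= wt W z.
rewrite ge0_intD; last 4 first.
- by move=> z; rewrite mulr_ge0.
- by move=> z; rewrite !addr_ge0// !mulr_ge0.
- by meas.
- by meas.
rewrite ge0_intD; last 4 first.
- by move=> z; rewrite !mulr_ge0.
- by move=> z; rewrite !addr_ge0// !mulr_ge0.
- by meas.
- by meas.
rewrite ge0_intD; last 4 first.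
- by move=> z; rewrite !mulr_ge0.
- by move=> z; rewrite !mulr_ge0.
- by meas.
- by meas.
rewrite ge0_intZl//; last by meas.
rewrite ge0_intZl ?mulr_ge0//; last by meas.
rewrite ge0_intZl//; last 2 first.
- by meas.
- by move=> z; rewrite mulr_ge0.
rewrite ge0_intZl//; last 2 first.
- by meas.
- by move=> z; rewrite mulr_ge0.
have h1 := int_shift_wt (ltW W0) xr' mv; have h2 := int_shift_wt_sub (ltW W0) xr' mv.
rewrite E1 E2 E3 in h1 h2 *; rewrite -/B -EFinM in h1 h2.
rewrite !EFinD !EFinM; apply: leeD => //; apply: leeD => //.
by apply: leeD; rewrite lee_wpmul2l ?lee_fin// -EFinM.
Qed.

Lemma sdiff_int_fin x : (sdiff_int W v x < +oo)%E.
Proof.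
have [C _ h] := sdiff_int_local (enorm x).
by apply: le_lt_trans (h x (lexx _)) _; rewrite ltry.
Qed.

(** In the smooth part the second difference can be expanded and its three terms integrated
    separately: a multiple of [v] and, by symmetry of [kf], twice the same convolution. *)
Lemma Lam_split x :
 Lam g v x = Cfl n g / 2 * (near v x + (2 * (v x * \int[lebn n]_z kf z) - 2 * cvl kf v x)).
Proof.
have [C C0 KC] := kf_bound; have mk := msble_kf; have mkn := msble_kn.
have ms := msble_sdiff x mv.
have ic := cvl_integrable x a0 C0 mk KC Ls_bwint.
have [fi1 fi2] := (integrable_rV_subr x ic, integrable_rV_add x ic).
have e1 z : kf (x - (x - z)) * v (x - z) = kf z * v (x - z) by rewrite subKr.
have e2 z : kf (x - (z + x)) * v (z + x) = kf z * v (x + z).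
 by rewrite opprD addrCA subrr addr0 kfN [z + x]addrC.
have ik : intgr (lebn n) kf.
 apply: (@integrableR_le _ _ _ _ _ (fun z => 2 * C * wt W z)) => //; first by meas.
  move=> z; apply: le_trans (KC z) _; rewrite [2 * C]mulrC -mulrA ler_wpM2l//.
  by apply: bw_wt; exact: ltW.
 rewrite ge0_intZl ?mulr_ge0//; last 2 first.
 - by meas.
 - by move=> z; exact: wt_ge0.
 by apply: lte_mul_pinfty; rewrite ?lee_fin ?mulr_ge0//; exact: int_wt.
have ik2 : intgr (lebn n) (fun z => 2 * v x * kf z).
 by have := integrableZl measurableT (2 * v x) ik; apply: eq_integrable.
have ik3 : intgr (lebn n) (fun z => 2 * v x * kf z - kf (x - (z + x)) * v (z + x)).
 by have := integrableB measurableT ik2 fi2; apply: eq_integrable.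
have E : (fun z => sdiff v x z * kf z) =
  (fun z => 2 * v x * kf z - kf (x - (z + x)) * v (z + x) - kf (x - (x - z)) * v (x - z)).
 by apply/funext => z; rewrite e1 e2 /sdiff; ring.
have isk : intgr (lebn n) (fun z => sdiff v x z * kf z).
 by rewrite E; have := integrableB measurableT ik3 fi1; apply: eq_integrable.
rewrite /Lam; congr (_ * _).
under eq_Rintegral do rewrite -/W sdiff_split.
rewrite RintegralD//; last exact: near_integrable.
congr (_ + _); rewrite E RintegralB// RintegralB// RintegralZl//.
rewrite (@Rint_rV_add _ _ x (fun y => kf (x - y) * v y)); last exact: integrable_meas ic.
rewrite (@Rint_rV_subr _ _ x (fun y => kf (x - y) * v y)); last exact: integrable_meas ic.
by rewrite -/(cvl kf v x); ring.
Qed.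

Lemma Lam_Ck : Ck N v -> SDk N v -> Ck N (Lam g v).
Proof.
move=> vN sN.
have -> : Lam g v = (fun x => Cfl n g / 2 * (near v x + ((2 * \int[lebn n]_z kf z) * v x + (- 2) * cvl kf v x))).
 by apply/funext => x; rewrite Lam_split; ring.
apply/CkZ/CkD; first exact: near_Ck.
apply: CkD; first exact: CkZ.
by apply/CkZ/(cvl_Ck a0 Fam_kf Ls_bwint).
Qed.

End regularity.

Lemma Ckloc_SDk (R : realType) (n l : nat) (g e b : R) (u : 'rV[R]_n -> R) : 0 < g -> 0 < e ->
 0 < 2 * g - (Num.truncn (2 * g))%:R + e ->
 (forall j (u : 'rV[R]_n -> R), Ckloc (j + Num.truncn (2 * g)) (2 * g - (Num.truncn (2 * g))%:R + e) u -> SD b u) ->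
 Ckloc (l + Num.truncn (2 * g)) (2 * g - (Num.truncn (2 * g))%:R + e) u -> SDk b l u.
Proof.
move=> g0 e0 a0 H; elim: l u => [|l IH] u hu.
 by split => //; [exact: (Ck_cont (Ckloc_Ck a0 hu))|exact: H hu].
split; [exact: (Ck_cont (Ckloc_Ck a0 hu))|exact: H hu|].
by move: hu; rewrite addSn /= => -[du pu]; split => // i; exact: IH.
Qed.

(** * The Beta function and fractional integrals *)

Section fractional_integrals.
Context {R : realType}.
Implicit Types (a b c r s t : R) (f : R -> \bar R).

Lemma mono_int_cvg d (T : measurableType d) (mu : {measure set T -> \bar R}) (h : nat -> T -> R) (l : T -> R) :
 (forall k, msble (h k)) -> (forall k x, 0 <= h k x) ->
 (forall x, nondecreasing_seq (h ^~ x)) -> (forall x, h ^~ x @ \oo --> l x) ->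
 (\int[mu]_x (h k x)%:E)%E @[k --> \oo] --> (\int[mu]_x (l x)%:E)%E.
Proof.
move=> mh h0 nd hl.
have := @cvg_monotone_convergence _ _ _ mu setT measurableT (fun k x => (h k x)%:E) _ _ _.
move=> /(_ (fun k => mEFin (mh k)) (fun k x _ => h0 k x)) H.
have {}H := H (fun x _ i j ij => nd x i j ij).
rewrite (_ : (\int[mu]_x (l x)%:E)%E = (\int[mu]_x (limn (fun k => (h k x)%:E)))%E)//.
apply: eq_integral => x _; apply/esym/cvg_lim => //.
by apply: cvg_EFin; [exact: nearW|exact: hl].
Qed.

Lemma mono_int_le d (T : measurableType d) (mu : {measure set T -> \bar R}) (h : nat -> T -> R) (l : T -> R) (B : \bar R) :
 (forall k, msble (h k)) -> (forall k x, 0 <= h k x) ->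
 (forall x, nondecreasing_seq (h ^~ x)) -> (forall x, h ^~ x @ \oo --> l x) ->
 (forall k, (\int[mu]_x (h k x)%:E <= B)%E) -> (\int[mu]_x (l x)%:E <= B)%E.
Proof.
move=> mh h0 nd hl hB; have H := @mono_int_cvg _ _ mu _ _ mh h0 nd hl.
rewrite -(cvg_lim _ H)//; apply: lime_le; first by apply/cvg_ex; eexists; exact: H.
exact: nearW.
Qed.

Lemma Gamma1 : Gamma 1 = 1 :> R.
Proof.
apply/eqP; rewrite eq_le -!lee_fin GammaE//; apply/andP; split.
 rewrite -[leRHS](congr1 EFin (@expR0 R)) -[0]oppr0 -int_exp_tail.
 apply: le_intR; first exact: gexp_ge0.
 - exact: msble_gexp.
 - by meas.
 - move=> t; rewrite /gexp subrr; have [t0|t0] := leP t 0; first by rewrite pw0// mul0r mulr_ge0 ?expR_ge0.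
  by rewrite pwE// powRr0 mul1r (ltW t0) mulr1.
(* Since [pw] vanishes at 0, the lower bound uses tails from [e > 0], where
   [expR (- e) >= 1 - e]. *)
apply/lee_subgt0Pr => e e0.
apply: (@le_trans _ _ (expR (- e))%:E).
 by rewrite lee_fin; apply: le_trans (expR_ge1Dx _).
rewrite -int_exp_tail; apply: le_intR.
- by move=> t; rewrite mulr_ge0 ?expR_ge0.
- by meas.
- exact: msble_gexp.
- move=> t; rewrite /gexp subrr; have [et|te] := leP e t; last by rewrite mulr0 mulr_ge0 ?pw_ge0 ?expR_ge0.
 by rewrite pwE ?(lt_le_trans e0)// powRr0 mulr1 mul1r.
Qed.

Definition Bt a b : R := Gamma a * Gamma b / Gamma (a + b).

Lemma Bt_gt0 a b : 0 < a -> 0 < b -> 0 < Bt a b.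
Proof. by move=> a0 b0; rewrite divr_gt0 ?mulr_gt0 ?Gamma_gt0 ?addr_gt0. Qed.

(** By scaling, the convolution is a constant times [pw (a + b - 1) r]. The constant is identified
    by integrating against [expR (- r)], which factors the left side into a product of two Gamma
    values. *)
Lemma beta_conv a b r : 0 < a -> 0 < b ->
 (\int[leb1]_s (pw (a - 1) s * pw (b - 1) (r - s))%:E = (Bt a b * pw (a + b - 1) r)%:E)%E.
Proof.
move=> a0 b0; pose K r := (\int[leb1]_s (pw (a - 1) s * pw (b - 1) (r - s))%:E)%E.
rewrite -/(K r); have K0 t : (0 <= K t)%E by apply: int_ge0R => s; pos.
have mk t : msble (fun s : R => pw (a - 1) s * pw (b - 1) (t - s)) by meas.
have KS t : (K t = (pw (a + b - 1) t)%:E * K 1%R)%E.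
 have [t0|t0] := leP t 0.
  rewrite pw0// mul0e /K integral0_eq// => s _.
  have [s0|s0] := leP s 0; first by rewrite pw0// mul0r.
  by rewrite [X in _ * X]pw0 ?mulr0// subr_le0 (le_trans t0) ?ltW.
 have H := integral_scale t0 (mEFin (mk t)) (fun s => (_ : 0 <= (pw (a - 1) s * pw (b - 1) (t - s))%:E)%E).
 have {}H := H (fun s => mulr_ge0 (pw_ge0 _ _) (pw_ge0 _ _)); rewrite -/(K t) in H.
 have E : (\int[leb1]_s (pw (a - 1) (t * s) * pw (b - 1) (t - t * s))%:E =
   (pw (a - 1) t * pw (b - 1) t)%:E * K 1%R)%E.
  rewrite -ge0_intZl; [|by pos|exact: mk|by move=> s; pos].
  apply: eq_integral => s _; congr EFin.
  by rewrite -{2}[t]mulr1 -mulrBr !pwM//; ring.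
 rewrite E in H; have pwt : pw (a + b - 1) t = t * (pw (a - 1) t * pw (b - 1) t).
  by rewrite -pwD -{2}[t](powRr1 (ltW t0)) -(pwE 1 t0) -pwD; congr (pw _ t); ring.
 rewrite pwt; move: H; move: (K t) (K 1%R) => Kt K1 H.
 by rewrite EFinM -muleA H muleA -EFinM mulfV ?gt_eqF// mul1e.
have GE : ((Gamma a * Gamma b)%:E = (Gamma (a + b))%:E * K 1%R)%E.
 transitivity (\int[leb1]_s \int[leb1]_r (pw (a - 1) s * pw (b - 1) (r - s) * expR (- r))%:E)%E.
  rewrite EFinM muleC (GammaE a0) -ge0_integralZl//; last 3 first.
  - by apply: mEFin; exact: msble_gexp.
  - by move=> s _; rewrite lee_fin gexp_ge0.
  - by rewrite lee_fin ltW// Gamma_gt0.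
  apply: eq_integral => s _.
  have ms : msble (fun r => pw (a - 1) s * pw (b - 1) (r - s) * expR (- r)) by meas.
  rewrite -(integral_shift s (mEFin ms)) (GammaE b0) muleC -ge0_intZl.
  - apply: eq_integral => u _; congr EFin; rewrite /gexp addrK opprD expRD; ring.
  - exact: gexp_ge0.
  - exact: msble_gexp.
  - exact: gexp_ge0.
 rewrite (@int_swapR _ _ _ _ _ leb1 leb1 (fun s r => pw (a - 1) s * pw (b - 1) (r - s) * expR (- r))).
 - rewrite (GammaE (addr_gt0 a0 b0)) -ge0_integralZr//; last 2 first.
  + by apply: mEFin; exact: msble_gexp.
  + by move=> s _; rewrite lee_fin gexp_ge0.
  apply: eq_integral => t _; rewrite (_ : gexp (a + b) t = expR (- t) * pw (a + b - 1) t); last by rewrite /gexp mulrC.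
  rewrite EFinM -muleA -KS -ge0_intZl; [|exact: expR_ge0|exact: mk|by move=> s; pos].
  by apply: eq_integral => s _; congr EFin; ring.
 - by meas.
 - by move=> s u; pos.
have Gp := Gamma_gt0 (addr_gt0 a0 b0); have [k Ek] : exists k, K 1%R = k%:E.
 have := K0 1; move: GE; case: (K 1%R) => [k|H|//]; first by exists k.
 by move: H; rewrite gt0_muley ?lte_fin.
rewrite KS; move: GE; rewrite Ek -EFinM => -[GE]; rewrite -EFinM; congr EFin; by rewrite /Bt GE; field; rewrite gt_eqF.
Qed.

(** Extended values allow the semigroup law to be stated and used before any finiteness is known; it
    then serves to prove finiteness. *)
Definition J a f t : \bar R := (((Gamma a)^-1)%:E * \int[leb1]_s ((pw (a - 1) s)%:E * f (t + s)%R))%E.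

Lemma J_ge0 a f t : 0 < a -> (forall s, (0 <= f s)%E) -> (0 <= J a f t)%E.
Proof.
move=> a0 f0; apply: mule_ge0; first by rewrite lee_fin invr_ge0 ltW// Gamma_gt0.
by apply: integral_ge0 => s _; apply: mule_ge0 => //; rewrite lee_fin pw_ge0.
Qed.

Lemma msble_J a f : 0 < a -> msble f -> (forall s, (0 <= f s)%E) -> msble (J a f).
Proof.
move=> a0 mf f0; apply: measurable_funeM.
apply: (@msble_int2 _ _ _ _ _ leb1 (fun t s => (pw (a - 1) s)%:E * f (t + s)%R)%E).
 apply: emeasurable_funM; first by meas.
 have mu : msble (fun p : R * R => p.1 + p.2) by meas.
 exact: (measurableT_comp mf mu).
by move=> t s; apply: mule_ge0 => //; rewrite lee_fin pw_ge0.
Qed.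

Lemma J_semigroup a b f t : 0 < a -> 0 < b -> msble f -> (forall s, (0 <= f s)%E) ->
 J a (J b f) t = J (a + b) f t.
Proof.
move=> a0 b0 mf f0; have Ga := Gamma_gt0 a0; have Gb := Gamma_gt0 b0; have Gab := Gamma_gt0 (addr_gt0 a0 b0).
have mpf c s u : msble (fun r => ((pw c (r - s))%:E * f (u + r)%R)%E).
 apply: emeasurable_funM; first by meas.
 have mu : msble (fun r : R => u + r) by apply: measurable_funD.
 exact: (measurableT_comp mf mu).
have G0 s r : (0 <= (pw (a - 1) s)%:E * ((pw (b - 1) (r - s))%:E * f (t + r)%R))%E.
 by rewrite !mule_ge0// lee_fin pw_ge0.
have mG : msble (fun p : R * R => ((pw (a - 1) p.1)%:E * ((pw (b - 1) (p.2 - p.1))%:E * f (t + p.2)%R))%E).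
 apply: emeasurable_funM; first by meas.
 apply: emeasurable_funM; first by meas.
 have mu : msble (fun p : R * R => t + p.2) by meas.
 exact: (measurableT_comp mf mu).
have gb0 : (0 <= ((Gamma b)^-1)%:E)%E by rewrite lee_fin invr_ge0 ltW.
have I0 s : (0 <= \int[leb1]_r ((pw (b - 1) (r - s))%:E * f (t + r)%R))%E.
 by apply: integral_ge0 => r _; rewrite mule_ge0// lee_fin pw_ge0.
have E1 s : J b f (t + s) = (((Gamma b)^-1)%:E * \int[leb1]_r ((pw (b - 1) (r - s))%:E * f (t + r)%R))%E.
 rewrite /J; congr (_ * _)%E; rewrite -(integral_shift s (mpf (b - 1) s t)).
 by apply: eq_integral => u _; rewrite addrK [u + s]addrC addrA.
have mF : msble (fun s => \int[leb1]_r ((pw (a - 1) s)%:E * ((pw (b - 1) (r - s))%:E * f (t + r)%R)))%E.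
 exact: (@msble_int2 _ _ _ _ _ leb1 (fun s r => ((pw (a - 1) s)%:E * ((pw (b - 1) (r - s))%:E * f (t + r)%R))%E)).
have E2 : (\int[leb1]_s ((pw (a - 1) s)%:E * J b f (t + s)%R) = ((Gamma b)^-1)%:E *
  \int[leb1]_s \int[leb1]_r ((pw (a - 1) s)%:E * ((pw (b - 1) (r - s))%:E * f (t + r)%R)))%E.
 rewrite -ge0_integralZl//; last by move=> s _; apply: integral_ge0 => r _.
 apply: eq_integral => s _; rewrite E1 muleCA; congr (_ * _)%E.
 by rewrite ge0_integralZl//; solve [exact: mpf | by move=> r _; rewrite mule_ge0// lee_fin pw_ge0 | by rewrite lee_fin pw_ge0].
rewrite [in LHS]/J E2.
rewrite (@fubini_tonelli _ _ _ _ _ leb1 leb1 (fun p => ((pw (a - 1) p.1)%:E * ((pw (b - 1) (p.2 - p.1))%:E * f (t + p.2)%R))%E))//; last first.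
have mp c : msble (fun r => ((pw c r)%:E * f (t + r)%R)%E).
 by have := mpf c 0 t; under eq_fun do rewrite subr0.
have E3 : (\int[leb1]_r \int[leb1]_s ((pw (a - 1) s)%:E * ((pw (b - 1) (r - s))%:E * f (t + r)%R)) =
  (Bt a b)%:E * \int[leb1]_r ((pw (a + b - 1) r)%:E * f (t + r)%R))%E.
 rewrite -ge0_integralZl//; last 2 first.
 - by move=> r _; rewrite mule_ge0// lee_fin pw_ge0.
 - by rewrite lee_fin ltW// Bt_gt0.
 apply: eq_integral => r _; rewrite muleA -EFinM -beta_conv// -ge0_integralZr//; last 2 first.
 - by meas.
 - by move=> s _; rewrite lee_fin mulr_ge0 ?pw_ge0.
 by apply: eq_integral => s _; rewrite EFinM muleA.
rewrite E3 !muleA -!EFinM; congr (_%:E * _)%E.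
by rewrite /Bt; field; rewrite !gt_eqF.
Qed.

Lemma pw_ratio c x y : 0 < x -> x <= y -> y <= 2 * x ->
 pw c x <= 2 `^ `|c| * pw c y /\ pw c y <= 2 `^ `|c| * pw c x.
Proof.
move=> x0 xy yx; have y0 := lt_le_trans x0 xy; rewrite !pwE//.
have one : 1 <= 2 `^ `|c| :> R.
 by rewrite -[leLHS](powRr0 2); apply: ler_powR; rewrite ?ler1n.
have mon d u v : 0 <= d -> 0 < u -> u <= v -> u `^ d <= v `^ d :> R.
 by move=> d0 u0 uv; apply: ge0_ler_powR; rewrite ?nnegrE ?(ltW u0) ?(ltW (lt_le_trans u0 uv)).
have [c0|c0] := leP 0 c.
 split; first by apply: le_trans (mon _ _ _ c0 x0 xy) _; rewrite ler_peMl ?powR_ge0.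
 by rewrite ger0_norm// -powRM ?(ltW x0)//; exact: mon.
have d0 : 0 <= - c by rewrite oppr_ge0 ltW.
have inv u : 0 < u -> u `^ c = (u `^ (- c))^-1 :> R by move=> u0; rewrite powRN invrK.
rewrite ltr0_norm//; rewrite (inv x)// (inv y)//; split.
 rewrite ler_pdivlMr ?powR_gt0// mulrC ler_pdivrMr ?powR_gt0//.
 by rewrite -powRM ?(ltW x0)//; exact: mon.
apply: (@le_trans _ _ (x `^ (- c))^-1); last first.
 by rewrite ler_peMl ?invr_ge0 ?powR_ge0//; rewrite ltr0_norm in one.
by rewrite lef_pV2 ?posrE ?powR_gt0//; exact: mon.
Qed.

End fractional_integrals.

(** * Continuity of fractional integrals at time zero *)

Section behaviour_at_zero.
Context {R : realType}.
Implicit Types (a c r s t u : R).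

Lemma pw_cvg c r : 0 < r -> pw c (r - t) @[t --> 0^'+] --> pw c r.
Proof.
move=> r0; rewrite [in X in _ --> X]pwE//.
have H : (r - t) `^ c @[t --> 0^'+] --> (r - 0) `^ c.
 apply: (@cvg_comp _ _ _ (fun t => r - t) (fun t => t `^ c) _ (nbhs (r - 0))).
  by apply: cvg_at_right_filter; apply: cvgB; [exact: cvg_cst|exact: cvg_id].
 by apply: cont_powR_pos; rewrite subr0.
rewrite subr0 in H; apply: cvg_trans H; apply: near_eq_cvg; near=> t.
by rewrite pwE// subr_gt0; near: t; exact: nbhs_right_lt.
Unshelve. all: by end_near. Qed.

Lemma pw_cvgD c r : 0 < r -> pw c (r + t) @[t --> 0^'+] --> pw c r.
Proof.
move=> r0; rewrite [in X in _ --> X]pwE//.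
have H : (r + t) `^ c @[t --> 0^'+] --> (r + 0) `^ c.
 apply: (@cvg_comp _ _ _ (fun t => r + t) (fun t => t `^ c) _ (nbhs (r + 0))).
  by apply: cvg_at_right_filter; apply: cvgD; [exact: cvg_cst|exact: cvg_id].
 by apply: cont_powR_pos; rewrite addr0.
rewrite addr0 in H; apply: cvg_trans H; apply: near_eq_cvg; near=> t.
have t0 : 0 < t by near: t; exact: nbhs_right_gt.
by rewrite pwE// addr_gt0.
Unshelve. all: by end_near. Qed.

Lemma integrable_pw_tail a c : 0 < a -> 0 < c ->
 intgr leb1 (fun t : R => pw (- a - 1) t * (c <= t)%R%:R).
Proof.
move=> a0 c0; apply: integrableR; first by meas.
under eq_integral do rewrite ger0_norm ?mulr_ge0 ?pw_ge0//.
by rewrite int_pw_tail// ltry.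
Qed.

Variables (a C : R) (f : R -> R).
Hypotheses (a0 : 0 < a) (C0 : 0 <= C) (mf : msble f) (f0 : forall r, 0 <= f r).

(** On [r >= 2 * t] the weights at [r] and [r - t] are comparable, so the bound on the shifted
    integrals controls the integral over that range uniformly; then [t] decreases to 0 by monotone
    convergence. *)
Lemma finite_of_shift B : (forall t, 0 < t -> t <= 1 -> (\int[leb1]_s (pw (a - 1) s * f (t + s))%:E <= B%:E)%E) ->
 (\int[leb1]_s (pw (a - 1) s * f s)%:E < +oo)%E.
Proof.
move=> hB; pose D := 2 `^ `|a - 1| : R; have D0 : 0 <= D by exact: powR_ge0.
apply: (@le_lt_trans _ _ (D * B)%:E); last by rewrite ltry.
pose h (k : nat) r := pw (a - 1) r * f r * (2 * k.+1%:R^-1 <= r)%R%:R.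
apply: (@mono_int_le _ _ _ leb1 h).
- by move=> k; rewrite /h; meas.
- by move=> k r; rewrite !mulr_ge0 ?pw_ge0.
- move=> r i j ij; rewrite /h ler_wpM2l ?mulr_ge0 ?pw_ge0// ler_nat.
 case: (leP (2 * i.+1%:R^-1) r) => //= ir; rewrite lt0b (le_trans _ ir)//.
 by rewrite ler_pM2l// lef_pV2 ?posrE// ler_nat.
- move=> r; have [r0|r0] := leP r 0.
  rewrite /h pw0// mul0r; under eq_fun do rewrite mul0r; exact: cvg_cst.
 apply: cvg_near_cst; near=> k; rewrite /h (_ : (_ <= r) = true) ?mulr1//.
 rewrite mulrC -ler_pdivlMr//; apply: ltW; near: k.
 have r2 : 0 < r / 2 by rewrite divr_gt0.
 exact: (near_infty_natSinv_lt (PosNum r2)).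
- move=> k; pose t : R := k.+1%:R^-1; have t0 : 0 < t by rewrite invr_gt0.
 have t1 : t <= 1 by rewrite invf_le1// ler1n.
 have ms : msble (fun r => pw (a - 1) (r - t) * f r) by meas.
 have E : (\int[leb1]_s (pw (a - 1) s * f (t + s))%:E = \int[leb1]_r (pw (a - 1) (r - t) * f r)%:E)%E.
  rewrite -(integral_shift t (mEFin ms)); apply: eq_integral => s _.
  by rewrite addrK [s + t]addrC.
 apply: (@le_trans _ _ (D%:E * \int[leb1]_r (pw (a - 1) (r - t) * f r)%:E)%E); last first.
  by rewrite EFinM lee_wpmul2l ?lee_fin// -E hB.
 rewrite -ge0_intZl//; last by move=> r; rewrite mulr_ge0 ?pw_ge0.
 apply: le_intR.
 + by move=> r; rewrite !mulr_ge0 ?pw_ge0.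
 + by rewrite /h; meas.
 + by meas.
 + move=> r; rewrite /h -/t; have [tr|tr] := leP (2 * t) r; last first.
   by rewrite mulr0 !mulr_ge0 ?pw_ge0.
  rewrite mulr1 mulrA ler_wpM2r//.
  have [p1 p2 p3] : [/\ 0 < r - t, r - t <= r & r <= 2 * (r - t)] by split; lra.
  exact: (pw_ratio (a - 1) p1 p2 p3).2.
Unshelve. all: by end_near. Qed.

Hypothesis comp : forall s u, 0 < s -> s <= u -> u <= 4 * s -> f s <= C * f u.
Hypothesis fin : (\int[leb1]_s (pw (a - 1) s * f s)%:E < +oo)%E.

Lemma ifpw : intgr leb1 (fun s => pw (a - 1) s * f s).
Proof.
apply: integrableR; first by meas.
by under eq_integral do rewrite ger0_norm ?mulr_ge0 ?pw_ge0//.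
Qed.

Let D : R := 2 `^ `|a - 1|.
(** After the substitution $r = t+s$ the integral is cut at $r = 2t$. [far] has an integrable
    majorant; [near], where the shifted weight is singular, is bounded by a multiple of [tail], the
    integral over $(0,4t]$, which vanishes in the limit. *)
Let far t r := pw (a - 1) (r - t) * f r * (2 * t < r)%R%:R.
Let tail t r := pw (a - 1) r * f r * (r <= 4 * t)%R%:R.
Let near t r := pw (a - 1) (r - t) * f r * (r <= 2 * t)%R%:R.

Let far_cvg : (\int[leb1]_r far t r) @[t --> 0^'+] --> \int[leb1]_r (pw (a - 1) r * f r).
Proof.
have D0 : 0 <= D by exact: powR_ge0.
apply: (@dominated_right _ _ _ leb1 far _ (fun r => D * (pw (a - 1) r * f r))).
- by move=> t _; rewrite /far; meas.
- by have := integrableZl measurableT D ifpw; apply: eq_integrable.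
- move=> t r t0; rewrite /far ger0_norm ?mulr_ge0 ?pw_ge0//.
 have [tr|tr] := ltP (2 * t) r; last by rewrite mulr0 !mulr_ge0 ?pw_ge0.
 rewrite mulr1 mulrA ler_wpM2r//.
 have [p1 p2 p3] : [/\ 0 < r - t, r - t <= r & r <= 2 * (r - t)] by split; lra.
  exact: (pw_ratio (a - 1) p1 p2 p3).1.
- move=> r; have [r0|r0] := leP r 0.
  rewrite pw0// mul0r; apply: cvg_near_cst; near=> t.
  have t0 : 0 < t by near: t; exact: nbhs_right_gt.
  by rewrite /far pw0 ?mul0r//; lra.
 have H : pw (a - 1) (r - t) * f r @[t --> 0^'+] --> pw (a - 1) r * f r.
  by apply: cvgM; [exact: pw_cvg|exact: cvg_cst].
 apply: cvg_trans H; apply: near_eq_cvg; near=> t.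
 rewrite /far (_ : (2 * t < r) = true) ?mulr1// mulrC -ltr_pdivlMr//.
 by near: t; apply: nbhs_right_lt; rewrite divr_gt0.
Unshelve. all: by end_near. Qed.

Let tail_cvg : (\int[leb1]_r tail t r) @[t --> 0^'+] --> (0 : R).
Proof.
suff : (\int[leb1]_r tail t r) @[t --> 0^'+] --> \int[leb1]_r (cst (0 : R)) r.
 by rewrite Rintegral_cst// mul0r.
apply: (@dominated_right _ _ _ leb1 tail _ (fun r => pw (a - 1) r * f r)).
- by move=> t _; rewrite /tail; meas.
- exact: ifpw.
- move=> t r t0; rewrite /tail ger0_norm ?mulr_ge0 ?pw_ge0//.
 by rewrite ler_piMr ?mulr_ge0 ?pw_ge0// lern1 leq_b1.
- move=> r; have [r0|r0] := leP r 0.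
  by apply: cvg_near_cst; near=> t; rewrite /tail pw0// !mul0r.
 apply: cvg_near_cst; near=> t; rewrite /tail.
 rewrite (_ : (r <= 4 * t) = false) ?mulr0//; apply/negbTE; rewrite -ltNge mulrC -ltr_pdivlMr//.
 by near: t; apply: nbhs_right_lt; rewrite divr_gt0.
Unshelve. all: by end_near. Qed.

(** From $\int_{2t}^{4t}u^{a-1}du = (4^a-2^a)\,t^a/a$. *)
Let cc := 4 `^ a - 2 `^ a : R.

Let cc0 : 0 < cc.
Proof. by rewrite subr_gt0; apply: gt0_ltr_powR; rewrite ?nnegrE//; lra. Qed.

(** On $(t,2t]$ the function is at most $C f(2t)$, and on $[2t,4t]$ it is at least $f(2t)/C$. Both
    intervals carry weight of order $t^a$, whence the constant [C ^+ 2 / cc]. *)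
Let near_le t : 0 < t -> (\int[leb1]_r (near t r)%:E <= (C ^+ 2 / cc)%:E * \int[leb1]_r (tail t r)%:E)%E.
Proof.
move=> t0; have t2 : 0 < 2 * t by rewrite mulr_gt0.
have t4 : 0 < 4 * t by rewrite mulr_gt0.
have c1 : 0 <= C ^+ 2 / cc by rewrite divr_ge0 ?sqr_ge0// ltW.
have mnear : msble (near t) by rewrite /near; meas.
have mtail : msble (tail t) by rewrite /tail; meas.
apply: (@le_trans _ _ ((C * f (2 * t)) * (t `^ a / a))%:E).
 apply: (@le_trans _ _ (\int[leb1]_r ((C * f (2 * t)) * (pw (a - 1) (r - t) * (r - t <= t)%R%:R))%:E)%E).
  apply: le_intR => //.
  - by move=> r; rewrite !mulr_ge0 ?pw_ge0.
  - by meas.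
  - move=> r; rewrite /near; have -> : (r <= 2 * t) = (r - t <= t) by rewrite lerBlDr mulr_natl mulr2n.
   have [rt|rt] := leP (r - t) 0; first by rewrite pw0// !mul0r mulr0.
   have [rt2|rt2] := leP (r - t) t; last by rewrite !mulr0.
   rewrite !mulr1 mulrC ler_wpM2r ?pw_ge0//; apply: comp; lra.
 have ms : msble (fun s => (C * f (2 * t)) * (pw (a - 1) s * (s <= t)%R%:R)) by meas.
 have := integral_shift (- t) (mEFin ms) => /= ->.
 rewrite ge0_intZl ?mulr_ge0//; last 2 first.
 - by meas.
 - by move=> s; rewrite mulr_ge0 ?pw_ge0.
 by rewrite int_pw_head// -EFinM.
have S : ((t `^ a * cc / a)%:E <= \int[leb1]_u (pw (a - 1) u * ((2 * t <= u)%R%:R * (u <= 4 * t)%R%:R))%:E)%E.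
 have H1 := int_pw_head a0 t4; have H2 := int_pw_head a0 t2.
 have : (\int[leb1]_u (pw (a - 1) u * (u <= 4 * t)%R%:R)%:E <=
   \int[leb1]_u (pw (a - 1) u * (u <= 2 * t)%R%:R + pw (a - 1) u * ((2 * t <= u)%R%:R * (u <= 4 * t)%R%:R))%:E)%E.
  apply: le_intR.
  - by move=> u; pos.
  - by meas.
  - by meas.
  - move=> u; rewrite -mulrDr ler_wpM2l ?pw_ge0//.
   by case: (leP u (2 * t)) => u2; [rewrite ler_wpDr ?mulr_ge0// lern1 leq_b1|rewrite (ltW u2) mul1r add0r].
 rewrite H1 ge0_intD; last 4 first.
 - by move=> u; pos.
 - by move=> u; rewrite !mulr_ge0 ?pw_ge0.
 - by meas.
 - by meas.
 rewrite H2; set X := (\int[_]_u _)%E; have : (0 <= X)%E by apply: int_ge0R => u; rewrite !mulr_ge0 ?pw_ge0.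
 clearbody X; case: X => [x| |]; [|by move=> *; rewrite leey|by []].
 rewrite -EFinD !lee_fin => x0 h; have -> : t `^ a * cc / a = (4 * t) `^ a / a - (2 * t) `^ a / a.
  by rewrite !powRM ?(ltW t0)// /cc; field; rewrite gt_eqF.
 by rewrite lerBlDl.
apply: (@le_trans _ _ ((C ^+ 2 / cc)%:E * \int[leb1]_u ((f (2 * t) / C) * (pw (a - 1) u * ((2 * t <= u)%R%:R * (u <= 4 * t)%R%:R)))%:E)%E); last first.
 rewrite lee_wpmul2l ?lee_fin//; apply: le_intR => //.
 - by move=> u; rewrite !mulr_ge0 ?invr_ge0 ?pw_ge0.
 - by meas.
 - move=> u; rewrite /tail; have [u2|u2] := leP (2 * t) u; last first.
   by rewrite mul0r !mulr0 !mulr_ge0 ?pw_ge0.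
  have [u4|u4] := leP u (4 * t); last by rewrite !mulr0.
  rewrite !mulr1 mulrC ler_wpM2l ?pw_ge0//.
  have h : f (2 * t) <= C * f u by apply: comp; lra.
  move: C0; rewrite le_eqVlt => /predU1P[<-|Cp]; first by rewrite invr0 mulr0.
  by rewrite ler_pdivrMr// [f u * C]mulrC.
rewrite ge0_intZl ?mulr_ge0 ?invr_ge0//; last 2 first.
- by meas.
- by move=> u; rewrite !mulr_ge0 ?pw_ge0.
apply: (@le_trans _ _ ((C ^+ 2 / cc)%:E * ((f (2 * t) / C)%:E * (t `^ a * cc / a)%:E))%E); last first.
 by rewrite !lee_wpmul2l ?lee_fin// divr_ge0.
rewrite -!EFinM lee_fin; have [->|Cn0] := eqVneq C 0; first by rewrite !mul0r expr0n !mul0r.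
by apply: eq_leW; field; rewrite Cn0 !gt_eqF.
Qed.

Lemma shift_cvg : (\int[leb1]_s (pw (a - 1) s * f (t + s))) @[t --> 0^'+] --> \int[leb1]_s (pw (a - 1) s * f s).
Proof.
have itail t : intgr leb1 (tail t).
 apply: (@integrableR_le _ _ _ _ _ (fun r => pw (a - 1) r * f r)) => //; try by rewrite ?/tail; meas.
 move=> r; rewrite /tail ger0_norm ?mulr_ge0 ?pw_ge0//.
 by rewrite ler_piMr ?mulr_ge0 ?pw_ge0// lern1 leq_b1.
have inear t : 0 < t -> intgr leb1 (near t).
 move=> t0; apply: integrableR; first by rewrite /near; meas.
 under eq_integral do rewrite ger0_norm ?mulr_ge0 ?pw_ge0//.
 apply: le_lt_trans (near_le t0) _; rewrite EFin_int// -EFinM ltry//.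
have ifar t : 0 < t -> intgr leb1 (far t).
 move=> t0; apply: (@integrableR_le _ _ _ _ _ (fun r => D * (pw (a - 1) r * f r))).
 - by rewrite /far; meas.
 - by meas.
 - move=> r; rewrite /far ger0_norm ?mulr_ge0 ?pw_ge0//.
  have [tr|tr] := ltP (2 * t) r; last by rewrite mulr0 !mulr_ge0 ?pw_ge0 ?powR_ge0.
  rewrite mulr1 mulrA ler_wpM2r//.
  have [p1 p2 p3] : [/\ 0 < r - t, r - t <= r & r <= 2 * (r - t)] by split; lra.
  exact: (pw_ratio (a - 1) p1 p2 p3).1.
 - rewrite ge0_intZl ?powR_ge0//; last 2 first.
  + by meas.
  + by move=> r; rewrite mulr_ge0 ?pw_ge0.
  by apply: lte_mul_pinfty; rewrite ?lee_fin ?powR_ge0.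
have E t : 0 < t -> \int[leb1]_s (pw (a - 1) s * f (t + s)) = \int[leb1]_r near t r + \int[leb1]_r far t r.
 move=> t0; rewrite -RintegralD; [|by []|exact: inear|exact: ifar].
 have ms : msble (fun r => pw (a - 1) (r - t) * f r) by meas.
 rewrite /Rintegral; congr fine.
 have := integral_shift t (mEFin ms) => H.
 transitivity (\int[leb1]_r (pw (a - 1) (r - t) * f r)%:E)%E.
  by rewrite -H; apply: eq_integral => s _; rewrite addrK [s + t]addrC.
 apply: eq_integral => r _; congr EFin; rewrite /near /far -mulrDr.
 by case: (leP r (2 * t)) => _; rewrite ?addr0 ?add0r mulr1.
have N0 : (\int[leb1]_r near t r) @[t --> 0^'+] --> (0 : R).
 have U : (C ^+ 2 / cc) * (\int[leb1]_r tail t r) @[t --> 0^'+] --> (0 : R).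
  by rewrite -[X in _ --> X](mulr0 (C ^+ 2 / cc)); apply: cvgM; [exact: cvg_cst|exact: tail_cvg].
 apply: (squeeze_cvgr _ (cvg_cst 0) U); near=> t.
 have t0 : 0 < t by near: t; exact: nbhs_right_gt.
 apply/andP; split; first by apply: Rintegral_ge0 => r _; rewrite !mulr_ge0 ?pw_ge0.
 by have := near_le t0; rewrite EFin_int ?inear// EFin_int// -EFinM lee_fin.
have H : \int[leb1]_r near t r + \int[leb1]_r far t r @[t --> 0^'+] -->
  0 + \int[leb1]_r (pw (a - 1) r * f r) by apply: cvgD => //; exact: far_cvg.
rewrite add0r in H; apply: cvg_trans H; apply: near_eq_cvg; near=> t.
have t0 : 0 < t by near: t; exact: nbhs_right_gt.
by rewrite [RHS]E.
Unshelve. all: by end_near. Qed.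

End behaviour_at_zero.

(** * Explicit integrals behind the Marchaud inversion *)

Section marchaud.
Context {R : realType}.
Variable g : R.
Hypotheses (g0 : 0 < g) (g1 : g < 1).
Implicit Types (a b c d r s t u : R).

Let h1 : 0 < 1 - g. Proof. by rewrite subr_gt0. Qed.

Lemma int_point r (f1 f2 : R -> R) : msble f1 -> msble f2 ->
 (forall x, x != r -> f1 x = f2 x) -> (\int[leb1]_x (f1 x)%:E = \int[leb1]_x (f2 x)%:E)%E.
Proof.
move=> m1 m2 h; have e (f : R -> R) : msble f ->
  (\int[leb1]_x (f x)%:E = \int[@lebesgue_measure R]_x (f x)%:E)%E.
 by move=> mf; rewrite integral_leb1//; exact/measurable_EFinP.
rewrite !e//; apply: ae_eq_integral; [exact: measurableT|exact/measurable_EFinP|exact/measurable_EFinP|].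
exists [set r]; split => //; first exact: lebesgue_measure_set1.
by move=> x /= hx; apply: contrapT => xr; apply: hx => _; rewrite h//; exact/eqP.
Qed.

(** The integrand may be unbounded at [b]; closed intervals exhaust [[a, b[] and only the limit of
    the primitive is used. *)
Lemma FTC_open (f F : R -> R) a b l : a < b -> msble f ->
 (forall x, a <= x -> x < b -> 0 <= f x) ->
 (forall x, a <= x -> x < b -> is_derive x 1 F (f x)) ->
 (forall x, a <= x -> x < b -> {for x, continuous f}) ->
 F x @[x --> b^'-] --> l ->
 (\int[leb1]_x (f x * ((a <= x)%R%:R * (x < b)%R%:R))%:E = (l - F a)%:E)%E.
Proof.
move=> ab mf f0 dF cf Fl; have ba : 0 < b - a by rewrite subr_gt0.
pose bk (k : nat) : R := b - (b - a) / k.+2%:R.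
have bkb k : bk k < b by rewrite ltrBlDr ltrDl divr_gt0.
have abk k : a < bk k by rewrite ltrBrDl -ltrBrDr ltr_pdivrMr// ltr_pMr// ltr1n.
have ndb i j : (i <= j)%N -> bk i <= bk j.
 by move=> ij; rewrite lerD2l lerN2 ler_pM2l// lef_pV2 ?posrE// ler_nat !ltnS.
have cvb : bk @ \oo --> b.
 rewrite -[X in _ --> X]subr0 -[X in _ - X](mulr0 (b - a)); apply: cvgB; first exact: cvg_cst.
 apply: cvgM; first exact: cvg_cst.
 by have := @cvg_harmonic R; rewrite -cvg_shiftS.
pose h (k : nat) x := f x * ((a <= x)%R%:R * (x <= bk k)%R%:R).
have := @mono_int_cvg _ _ _ leb1 h (fun x => f x * ((a <= x)%R%:R * (x < b)%R%:R)).
have mh k : msble (h k) by rewrite /h; meas.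
have h0 k x : 0 <= h k x.
 rewrite /h; have [ax|ax] := leP a x; last by rewrite mul0r mulr0.
 have [xb|xb] := leP x (bk k); last by rewrite !mulr0.
 by rewrite !mulr1 f0// (le_lt_trans xb).
have ndh x : nondecreasing_seq (h ^~ x).
 move=> i j ij; rewrite /h; have [ax|ax] := leP a x; last by rewrite !mul0r !mulr0.
 have [xb|xb] := leP x (bk i); last by rewrite !mulr0; have := h0 j x; rewrite /h ax.
 by rewrite (le_trans xb (ndb _ _ ij)).
move=> /(_ mh h0 ndh) H.
have {}H := H (fun x => _); have {}H := H _.
have L x : h ^~ x @ \oo --> f x * ((a <= x)%R%:R * (x < b)%R%:R).
 have [xb|xb] := ltP x b; last first.
  rewrite !mulr0; apply: cvg_near_cst; near=> k; rewrite /h.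
  by rewrite (_ : (x <= bk k) = false) ?mulr0//; apply/negbTE; rewrite -ltNge (lt_le_trans (bkb k)).
 apply: cvg_near_cst; near=> k; rewrite /h (_ : (x <= bk k) = true)//.
 by apply: ltW; near: k; apply: (cvgr_gt b).
have {}H := H L.
have E k : (\int[leb1]_x (h k x)%:E = (F (bk k) - F a)%:E)%E.
 transitivity (\int[leb1]_(x in `[a, bk k]) (f x)%:E)%E; last first.
  apply: FTC_closed; first exact: abk.
  - by move=> x /andP[ax xb]; apply: dF => //; exact: le_lt_trans xb _.
  - by move=> x /andP[ax xb]; apply: cf => //; exact: le_lt_trans xb _.
 rewrite [RHS]integral_mkcond; apply: eq_integral => x _.
 rewrite /patch mem_setE in_itv/= /h; case: (a <= x) => /=; last by rewrite mul0r mulr0.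
 by rewrite mul1r; case: ifP => _; rewrite ?mulr1 ?mulr0.
have C : (F (bk k) - F a)%:E @[k --> \oo] --> (l - F a)%:E.
 apply: cvg_EFin; first exact: nearW.
 apply: cvgB; last exact: cvg_cst.
 by apply: (proj1 (cvg_at_leftP _ _ _) Fl); split.
rewrite (_ : (fun k => (\int[leb1]_x (h k x)%:E)%E) = (fun k => (F (bk k) - F a)%:E)) in H; last by apply/funext.
exact: (cvg_unique _ H C).
Unshelve. all: by end_near. Qed.

(** The kernel is an approximate identity at 0 as [d] tends to 0, with the same mass for every [d].
    The mass is computed by writing $1/(r+d)$ as $\int_0^\infty e^{-(r+d)u}du$, which separates into
    two Gamma integrals. *)
Lemma gker_mass d : 0 < d ->
 (\int[leb1]_r (d `^ (1 - g) * (pw (g - 1) r * (r + d)^-1))%:E = (Gamma g * Gamma (1 - g))%:E)%E.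
Proof.
move=> d0.
have mp : msble (fun p : R * R => pw (g - 1) p.1 * (pw 0 p.2 * expR (- ((p.1 + d) * p.2)))) by meas.
have E : (\int[leb1]_r `|pw (g - 1) r * (r + d)^-1|%:E = (Gamma g * Gamma (1 - g) * d `^ (- (1 - g)))%:E)%E.
 transitivity (\int[leb1]_r \int[leb1]_u (pw (g - 1) r * (pw 0 u * expR (- ((r + d) * u))))%:E)%E.
  apply: eq_integral => r _; have [r0|r0] := leP r 0.
   by rewrite pw0// mul0r normr0 integral0_eq// => u _; rewrite mul0r.
  have rd : 0 < r + d by rewrite addr_gt0.
  rewrite ger0_norm ?mulr_ge0 ?pw_ge0 ?invr_ge0 ?(ltW rd)//.
  rewrite ge0_intZl ?pw_ge0//; last 2 first.
  - by meas.
  - by move=> u; pos.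
  have := int_gamma_scale (@ltr01 R) rd; rewrite subrr Gamma1 mul1r powR_inv1 ?(ltW rd)// => ->.
  by rewrite EFinM.
 rewrite (@int_swapR _ _ _ _ _ leb1 leb1 (fun r u => pw (g - 1) r * (pw 0 u * expR (- ((r + d) * u)))))//; last first.
  by move=> r u; pos.
 transitivity (\int[leb1]_u (Gamma g * (pw ((1 - g) - 1) u * expR (- (d * u))))%:E)%E.
  apply: eq_integral => u _; have [u0|u0] := leP u 0.
   by rewrite [in RHS]pw0// mul0r mulr0 integral0_eq// => r _; rewrite (pw0 _ u0) mul0r mulr0.
  transitivity (\int[leb1]_r ((pw 0 u * expR (- (d * u))) * (pw (g - 1) r * expR (- (u * r))))%:E)%E.
   apply: eq_integral => r _; congr EFin.
   by rewrite mulrDl opprD expRD [u * r]mulrC; ring.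
  rewrite ge0_intZl; [|by pos|by meas|by move=> r; pos].
  rewrite (int_gamma_scale g0 u0) -EFinM; congr EFin.
  rewrite !pwE// powRr0 (_ : 1 - g - 1 = - g); last by ring.
  by ring.
 rewrite ge0_intZl; [|by rewrite ltW// Gamma_gt0|by meas|by move=> r; pos].
 by rewrite (int_gamma_scale h1 d0) -EFinM; congr EFin; ring.
have dg : 0 < d `^ (1 - g) by exact: powR_gt0.
transitivity (\int[leb1]_r (d `^ (1 - g) * `|pw (g - 1) r * (r + d)^-1|)%:E)%E.
 apply: eq_integral => r _; have [r0|r0] := leP r 0; first by rewrite pw0// !mul0r normr0.
 by rewrite [X in _ = (_ * X)%:E]ger0_norm// mulr_ge0 ?pw_ge0// invr_ge0 addr_ge0 ?ltW.
rewrite ge0_intZl; [|exact: ltW|by meas|by move=> r; pos].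
rewrite E -EFinM; congr EFin; rewrite powRN; field; by rewrite gt_eqF.
Qed.

Lemma abel_shift r d : 0 < r -> 0 < d ->
 (\int[leb1]_t (pw (- g - 1) (t + d) * (0 <= t)%R%:R * pw (g - 1) (r - t))%:E =
  (d `^ (- g) / g * (r `^ g / (r + d)))%:E)%E.
Proof.
move=> r0 d0; have rd : 0 < r + d by rewrite addr_gt0.
pose f t : R := (t + d) `^ (- g - 1) * (r - t) `^ (g - 1).
(* [F] is a multiple of the [g]-th power of the fractional linear map $(r-t)/(t+d)$, whose
   derivative is $-(r+d)/(t+d)^2$. *)
pose F t : R := - (g * (r + d))^-1 * ((r - t) `^ g * (t + d) `^ (- g)).
transitivity (\int[leb1]_t (f t * ((0 <= t)%R%:R * (t < r)%R%:R))%:E)%E.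
 apply: eq_integral => t _; congr EFin; have [t0|t0] := leP 0 t; last by rewrite mulr0 !mul0r mulr0.
 have [tr|tr] := ltP t r; last by rewrite [X in _ * X]pw0 ?subr_le0// !mulr0.
 by rewrite /f !mulr1 !pwE ?subr_gt0// ltr_wpDl.
have dd t : 0 <= t -> t < r -> is_derive t 1 F (f t).
 move=> t0 tr; have p1 : 0 < r - t by rewrite subr_gt0.
 have p2 : 0 < t + d by rewrite ltr_wpDl.
 have d1 : is_derive t 1 (fun t : R => r - t) (-1) by apply: is_derive_eq; ring.
 have d2 : is_derive t 1 (fun t : R => t + d) 1 by apply: is_derive_eq; ring.
 have e1 := @is_derive1_comp _ (fun y => 1 * y `^ g) (fun t : R => r - t) _ _ _ (is_derive_powR g 1 p1) d1.
 have e2 := @is_derive1_comp _ (fun y => 1 * y `^ (- g)) (fun t : R => t + d) _ _ _ (is_derive_powR (- g) 1 p2) d2.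
 have e3 := is_deriveZ (- (g * (r + d))^-1) (is_deriveM e1 e2).
 have -> : F = (fun t => - (g * (r + d))^-1 * ((1 * (r - t) `^ g) * (1 * (t + d) `^ (- g)))).
  by apply/funext => y; rewrite /F !mul1r.
 apply: (is_derive_eq e3); rewrite /GRing.scale /= /f !mul1r.
 have q1 : (r - t) `^ g = (r - t) * (r - t) `^ (g - 1).
  by rewrite -{2}[r - t](powRr1 (ltW p1)) -powRD ?(gt_eqF p1) ?implybT//; congr (_ `^ _); ring.
 have q2 : (t + d) `^ (- g) = (t + d) * (t + d) `^ (- g - 1).
  by rewrite -{2}[t + d](powRr1 (ltW p2)) -powRD ?(gt_eqF p2) ?implybT//; congr (_ `^ _); ring.
 by rewrite q1 q2; field; rewrite !gt_eqF.
rewrite (@FTC_open f F 0 r 0 r0).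
- congr EFin; rewrite /F subr0 !add0r; field; by rewrite !gt_eqF.
- by rewrite /f; meas.
- by move=> t _ _; rewrite /f mulr_ge0 ?powR_ge0.
- move=> t t0 tr; have p1 : 0 < r - t by rewrite subr_gt0.
 have p2 : 0 < t + d by rewrite ltr_wpDl.
 apply: continuousM.
  apply: (@continuous_comp _ _ _ (fun t : R => t + d) (fun y => y `^ (- g - 1))); last exact: cont_powR_pos.
  by apply: continuousD; [exact: cvg_id|exact: cst_continuous].
 apply: (@continuous_comp _ _ _ (fun t : R => r - t) (fun y => y `^ (g - 1))); last exact: cont_powR_pos.
 by apply: continuousB; [exact: cst_continuous|exact: cvg_id].
- rewrite -[X in _ --> X](mulr0 (- (g * (r + d))^-1)); apply: cvgM; first exact: cvg_cst.
 rewrite -[X in _ --> X](mul0r ((r + d) `^ (- g))); apply: cvgM.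
  apply/cvg_at_leftP => u [ur uc].
  apply: ((cvg_at_rightP _ _ _).1 (powR_cvg0 g0) (fun k => r - u k)); split.
   by move=> k; rewrite subr_gt0.
  by rewrite -[X in _ --> X](subrr r); apply: cvgB => //; exact: cvg_cst.
 apply: cvg_at_left_filter.
 apply: (@continuous_comp _ _ _ (fun t : R => t + d) (fun y => y `^ (- g))); last exact: cont_powR_pos.
 by apply: continuousD; [exact: cvg_id|exact: cst_continuous].
Qed.

End marchaud.

(** * The Marchaud derivative of a fractional integral at time zero *)

Section marchaud_zero.
Context {R : realType}.
Variable g : R.
Hypotheses (g0 : 0 < g) (g1 : g < 1).
Implicit Types (a b c d r s t u : R).

Let h1 : 0 < 1 - g. Proof. by rewrite subr_gt0. Qed.

Variables (f V : R -> R) (l : R).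
Hypotheses (mf : msble f) (f0 : forall r, 0 <= f r)
 (fl : f r @[r --> 0^'+] --> l)
 (fin : (\int[leb1]_s (pw (g - 1) s * f s)%:E < +oo)%E)
 (mV : msble V)
 (VE : forall t, 0 <= t -> (\int[leb1]_s (pw (g - 1) s * f (t + s))%:E = (Gamma g * V t)%:E)%E)
 (iV : intgr leb1 (fun t => pw (- g - 1) t * (V 0 - V t))).

(** Shifting the singular weight by [d > 0] makes the two terms of [V 0 - V t] separately
    integrable, so that each can be computed by Tonelli. *)
Let Wd d t : R := pw (- g - 1) (t + d) * (0 <= t)%R%:R.
Let gd d r : R := d `^ (1 - g) * (pw (g - 1) r * (r + d)^-1).

Let Gg : 0 < Gamma g. Proof. exact: Gamma_gt0. Qed.

Let V_ge0 t : 0 <= t -> 0 <= V t.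
Proof.
move=> t0; have : (0 <= (Gamma g * V t)%:E)%E.
 by rewrite -VE//; apply: int_ge0R => s; rewrite mulr_ge0 ?pw_ge0.
by rewrite lee_fin pmulr_rge0.
Qed.

Let gd_ge0 d r : 0 < d -> 0 <= gd d r.
Proof.
move=> d0; rewrite /gd; have [r0|r0] := leP r 0; first by rewrite pw0// mul0r mulr0.
by rewrite !mulr_ge0 ?powR_ge0 ?pw_ge0 ?invr_ge0 ?addr_ge0 ?ltW.
Qed.

Let W_int d : 0 < d -> (\int[leb1]_t (Wd d t)%:E = (d `^ (- g) / g)%:E)%E.
Proof.
move=> d0; rewrite -int_pw_tail//.
have m : msble (fun t => pw (- g - 1) t * (d <= t)%R%:R) by meas.
rewrite -(integral_shift d (mEFin m)); apply: eq_integral => t _; congr (_ * _)%:E.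
by rewrite -[X in (X <= t + d)]add0r lerD2r.
Qed.

Let WV_int d : 0 < d -> ((Gamma g)%:E * \int[leb1]_t (Wd d t * V t)%:E =
 \int[leb1]_r ((d `^ (- g) / g) * (pw g r * (r + d)^-1) * f r)%:E)%E.
Proof.
move=> d0; rewrite -ge0_intZl; last 3 first.
- exact: ltW.
- by rewrite /Wd; meas.
- move=> t; rewrite /Wd; have [t0|t0] := leP 0 t; last by rewrite mulr0 mul0r.
 by rewrite mulr1 mulr_ge0 ?pw_ge0 ?V_ge0.
transitivity (\int[leb1]_t \int[leb1]_r (Wd d t * pw (g - 1) (r - t) * f r)%:E)%E.
 apply: eq_integral => t _; have [t0|t0] := leP 0 t; last first.
  have W0 : Wd d t = 0 by rewrite /Wd leNgt t0 /= mulr0.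
  by rewrite W0 mul0r mulr0 integral0_eq// => r _; rewrite !mul0r.
 have m : msble (fun r => pw (g - 1) (r - t) * f r) by meas.
 have W0 : 0 <= Wd d t by rewrite /Wd mulr_ge0 ?pw_ge0.
 transitivity (\int[leb1]_r (Wd d t * (pw (g - 1) (r - t) * f r))%:E)%E; last first.
  by apply: eq_integral => r _; rewrite mulrA.
 rewrite ge0_intZl//; last by move=> r; rewrite mulr_ge0 ?pw_ge0.
 rewrite -(integral_shift t (mEFin m)) mulrCA EFinM; congr (_ * _)%E.
 by rewrite -VE//; apply: eq_integral => s _; rewrite addrK [s + t]addrC.
rewrite (@int_swapR _ _ _ _ _ leb1 leb1 (fun t r => Wd d t * pw (g - 1) (r - t) * f r)); last 2 first.
- by rewrite /Wd; meas.
- by move=> t r; rewrite /Wd !mulr_ge0 ?pw_ge0.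
apply: eq_integral => r _; have [r0|r0] := leP r 0.
 rewrite (pw0 _ r0) mul0r mulr0 mul0r integral0_eq// => t _.
 rewrite /Wd; have [t0|t0] := leP 0 t; last by rewrite mulr0 !mul0r.
 by rewrite (@pw0 _ (g - 1)) ?mulr0 ?mul0r// subr_le0 (le_trans r0).
transitivity (\int[leb1]_t (f r * (Wd d t * pw (g - 1) (r - t)))%:E)%E.
 by apply: eq_integral => t _; rewrite mulrC.
rewrite ge0_intZl//; last 2 first.
- by rewrite /Wd; meas.
- by move=> t; rewrite /Wd !mulr_ge0 ?pw_ge0.
by rewrite (abel_shift g0 r0 d0) -EFinM pwE//; congr EFin; exact: mulrC.
Qed.

Let WV_fin d : 0 < d -> intgr leb1 (fun t => Wd d t * V t) /\
 intgr leb1 (fun r => gd d r * f r) /\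
 Gamma g * (\int[leb1]_t (Wd d t * (V 0 - V t))) = g^-1 * \int[leb1]_r (gd d r * f r).
Proof.
move=> d0; have A0 : 0 <= d `^ (- g) / g by rewrite divr_ge0 ?powR_ge0 ?ltW.
have WV0 t : 0 <= Wd d t * V t.
 rewrite /Wd; have [t0|t0] := leP 0 t; last by rewrite mulr0 mul0r.
 by rewrite mulr1 mulr_ge0 ?pw_ge0 ?V_ge0.
pose X := (\int[leb1]_r (gd d r * f r)%:E)%E; pose Y := (\int[leb1]_t (Wd d t * V t)%:E)%E.
have mg : msble (gd d) by rewrite /gd; meas.
have mW : msble (Wd d) by rewrite /Wd; meas.
have X0 : (0 <= X)%E by apply: int_ge0R => r; rewrite mulr_ge0 ?gd_ge0.
have Y0 : (0 <= Y)%E by apply: int_ge0R.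
have VE0 : (\int[leb1]_s (pw (g - 1) s * f s)%:E = (Gamma g * V 0)%:E)%E.
 by rewrite -VE//; apply: eq_integral => s _; rewrite add0r.
(* The splitting $r^{g-1} = d\,r^{g-1}/(r+d) + r^g/(r+d)$ against [f]. All terms are nonnegative and
   the left side is finite, so the finiteness of [X] and [Y] is read off. *)
have E : ((d `^ (- g) / g * (Gamma g * V 0))%:E = (g^-1)%:E * X + (Gamma g)%:E * Y)%E.
 rewrite EFinM -VE0 /X /Y WV_int// -(@ge0_intZl _ _ _ leb1 (fun r => gd d r * f r) g^-1); last 3 first.
 - by rewrite invr_ge0 ltW.
 - by meas.
 - by move=> r; rewrite mulr_ge0 ?gd_ge0.
 rewrite -(@ge0_intZl _ _ _ leb1 (fun s => pw (g - 1) s * f s))//; last 2 first.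
 - by meas.
 - by move=> s; rewrite mulr_ge0 ?pw_ge0.
 have P r : 0 <= d `^ (- g) / g * (pw g r * (r + d)^-1) * f r.
  have [r0|r0] := leP r 0; first by rewrite (pw0 _ r0) mul0r mulr0 mul0r.
  have rd : 0 < r + d by rewrite addr_gt0.
  by apply: mulr_ge0 => //; apply: mulr_ge0 => //; apply: divr_ge0; rewrite ?pw_ge0// ltW.
 rewrite -ge0_intD//; last 3 first.
 - move=> r; have /mulr_ge0 := gd_ge0 r d0; have gi : 0 <= g^-1 by rewrite invr_ge0 ltW.
  by move=> /(_ _ (f0 r)) /(mulr_ge0 gi).
 - by meas.
 - by meas.
 apply: eq_integral => r _; congr EFin; rewrite /gd.
 have [r0|r0] := leP r 0; first by rewrite !(pw0 _ r0) !(mul0r, mulr0) addr0.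
 have rd : 0 < r + d by rewrite addr_gt0.
 have -> : pw g r = r * pw (g - 1) r.
  by rewrite -{2}[r](powRr1 (ltW r0)) -(pwE 1 r0) -pwD; congr (pw _ r); ring.
 have -> : d `^ (1 - g) = d * d `^ (- g) by rewrite -{2}[d](powRr1 (ltW d0)) -powRD ?(gt_eqF d0) ?implybT.
 by field; rewrite !gt_eqF.
have [x Ex] : exists x, X = x%:E.
 move: E X0; case: X => [x|E _|//]; first by exists x.
 move: E; rewrite gt0_muley ?lte_fin ?invr_gt0//.
 case: Y Y0 => [y|_|//]; first by [].
 by rewrite gt0_muley ?lte_fin.
have [y Ey] : exists y, Y = y%:E.
 move: E Y0; rewrite Ex; case: Y => [y|E _|//]; first by exists y.
 by move: E; rewrite gt0_muley ?lte_fin.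
have iY : intgr leb1 (fun t => Wd d t * V t).
 by apply: integrableR; [meas|under eq_integral do rewrite ger0_norm//; rewrite -/Y Ey ltry].
have iX : intgr leb1 (fun r => gd d r * f r).
 apply: integrableR; first by meas.
 rewrite (@eq_integral _ _ _ leb1 setT (fun r => (gd d r * f r)%:E)) -?/X ?Ex ?ltry// => r _.
 by rewrite ger0_norm// mulr_ge0// gd_ge0.
split => //; split => //.
have iW : intgr leb1 (fun t => V 0 * Wd d t).
 have iW0 : intgr leb1 (Wd d).
  apply: integrableR => //; under eq_integral do rewrite ger0_norm ?mulr_ge0 ?pw_ge0//.
  by rewrite W_int// ltry.
 by have := integrableZl measurableT (V 0) iW0; apply: eq_integrable.
have -> : \int[leb1]_t (Wd d t * (V 0 - V t)) = V 0 * (d `^ (- g) / g) - y.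
 transitivity (\int[leb1]_t (V 0 * Wd d t - Wd d t * V t)).
  by apply: eq_Rintegral => t _; ring.
 rewrite RintegralB//; congr (_ - _).
  by rewrite /Rintegral ge0_intZl ?V_ge0// ?W_int// => t; rewrite /Wd mulr_ge0 ?pw_ge0.
 by rewrite /Rintegral -/Y Ey.
have -> : \int[leb1]_r (gd d r * f r) = x by rewrite /Rintegral -/X Ex.
move: E; rewrite Ex Ey -!EFinM -EFinD => -[E].
have -> : Gamma g * (V 0 * (d `^ (- g) / g) - y) = d `^ (- g) / g * (Gamma g * V 0) - Gamma g * y by ring.
by rewrite E; ring.
Qed.

Let gdf_cvg : (\int[leb1]_r (gd d r * f r)) @[d --> 0^'+] --> Gamma g * Gamma (1 - g) * l.
Proof.
have mass d : 0 < d -> intgr leb1 (gd d) /\ \int[leb1]_r gd d r = Gamma g * Gamma (1 - g).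
 move=> d0; have h := gker_mass g0 g1 d0; split; last by rewrite /Rintegral h.
 apply: integrableR; first by rewrite /gd; meas.
 by under eq_integral do rewrite ger0_norm ?gd_ge0//; rewrite h ltry.
have GG0 : 0 < Gamma g * Gamma (1 - g) by rewrite mulr_gt0// Gamma_gt0.
apply/cvgrPdist_le => e e0; pose e1 := e / 2 / (Gamma g * Gamma (1 - g)).
have e10 : 0 < e1 by rewrite !divr_gt0.
have [eta /= eta0 etaP] : \forall r \near 0^'+, `|l - f r| <= e1.
 by move/cvgrPdist_le : fl; exact.
have eta2 : 0 < eta / 2 by rewrite divr_gt0.
pose B r := pw (g - 1) r * f r / (eta / 2) + `|l| * (pw (- (1 - g) - 1) r * (eta / 2 <= r)%R%:R).
have if1 : intgr leb1 (fun r => pw (g - 1) r * f r).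
 apply: integrableR; first by meas.
 by under eq_integral do rewrite ger0_norm ?mulr_ge0 ?pw_ge0//.
have iB : intgr leb1 B.
 have i1 := integrableZr measurableT (eta / 2)^-1 if1.
 have i2 := integrableZl measurableT `|l| (integrable_pw_tail h1 eta2).
 by have := integrableD measurableT i1 i2; apply: eq_integrable.
have B0 r : 0 <= B r by rewrite !(addr_ge0, mulr_ge0) ?pw_ge0 ?invr_ge0 ?(ltW eta2).
have dle d r : 0 < d -> `|gd d r * (f r - l)| <= e1 * gd d r + d `^ (1 - g) * B r.
 move=> d0; have [r0|r0] := leP r 0.
  by rewrite {1 2}/gd (pw0 _ r0) !(mul0r, mulr0) normr0 add0r mulr_ge0 ?powR_ge0.
 rewrite normrM ger0_norm ?gd_ge0//; have [re|re] := ltP r (eta / 2).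
  apply: ler_wpDr; first by rewrite mulr_ge0 ?powR_ge0.
  rewrite mulrC ler_wpM2r ?gd_ge0// distrC; apply: etaP => //=.
  by rewrite sub0r normrN gtr0_norm//; lra.
 apply: ler_wpDl; first by rewrite mulr_ge0 ?gd_ge0// ltW.
 rewrite /gd -mulrA ler_wpM2l ?powR_ge0//.
 have rd : (r + d)^-1 <= r^-1 by rewrite lef_pV2 ?posrE ?addr_gt0// lerDl ltW.
 apply: (@le_trans _ _ (pw (g - 1) r * r^-1 * (f r + `|l|))).
  apply: ler_pM; rewrite ?mulr_ge0 ?pw_ge0 ?invr_ge0 ?addr_ge0 ?(ltW r0) ?(ltW d0)//.
   by rewrite ler_wpM2l ?pw_ge0.
  by apply: le_trans (ler_normB _ _) _; rewrite ger0_norm.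
 rewrite /B re mulr1 mulrDr; apply: lerD.
  rewrite mulrAC ler_wpM2l ?mulr_ge0 ?pw_ge0// lef_pV2 ?posrE//.
 rewrite mulrC ler_wpM2l// (_ : - (1 - g) - 1 = (g - 1) - 1); last by ring.
 by rewrite (pwD (g - 1) (-1)) (pwE (-1) r0) powR_inv1 ?(ltW r0).
have cv : d `^ (1 - g) * \int[leb1]_r B r @[d --> 0^'+] --> (0 : R).
 by rewrite -[X in _ --> X](mul0r (\int[leb1]_r B r)); apply: cvgM; [exact: powR_cvg0|exact: cvg_cst].
near=> d; have d0 : 0 < d by near: d; exact: nbhs_right_gt.
have [ig mg] := mass d d0; have [_ [igf _]] := WV_fin d0.
have igl : intgr leb1 (fun r => gd d r * l).
 by have := integrableZr measurableT l ig; apply: eq_integrable.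
have igd : intgr leb1 (fun r => gd d r * (f r - l)).
 have := integrableB measurableT igf igl; apply: eq_integrable => // r _ /=.
 by rewrite -EFinB mulrBr.
have -> : Gamma g * Gamma (1 - g) * l - \int[leb1]_r (gd d r * f r) = - \int[leb1]_r (gd d r * (f r - l)).
 rewrite -mg -RintegralZr// -RintegralB//.
 rewrite -mulN1r -RintegralZl//; apply: eq_Rintegral => r _; ring.
rewrite normrN; apply: le_trans (le_normr_Rintegral _ igd) _ => //.
have iR1 : intgr leb1 (fun r => e1 * gd d r).
 by have := integrableZl measurableT e1 ig; apply: eq_integrable.
have iR2 : intgr leb1 (fun r => d `^ (1 - g) * B r).
 by have := integrableZl measurableT (d `^ (1 - g)) iB; apply: eq_integrable.
apply: (@le_trans _ _ (\int[leb1]_r (e1 * gd d r + d `^ (1 - g) * B r))).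
 apply: le_Rintegral => //; first exact: integrable_norm igd.
  by have := integrableD measurableT iR1 iR2; apply: eq_integrable.
 by move=> r _; exact: dle.
rewrite RintegralD// RintegralZl// RintegralZl// mg /e1 divfK ?gt_eqF//.
rewrite [leRHS](splitr e) lerD2l; apply: le_trans (ler_norm _) _.
near: d; move/cvgrPdist_le : cv => /(_ (e / 2)); rewrite divr_gt0// => /(_ isT).
by apply: filterS => d; rewrite sub0r normrN.
Unshelve. all: by end_near. Qed.

(** Both sides of the regularised identity pass to the limit in [d]: the left by domination with the
    unshifted weight, the right by the approximate identity. The constants cancel since [kap g] is
    $g/\Gamma(1-g)$. *)
Lemma marchaud_at0 : kap g * \int[leb1]_t (pw (- g - 1) t * (V 0 - V t)) = l.
Proof.
have C : (\int[leb1]_t (Wd d t * (V 0 - V t))) @[d --> 0^'+] --> \int[leb1]_t (pw (- g - 1) t * (V 0 - V t)).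
 apply: (@dominated_right _ _ _ leb1 (fun d t => Wd d t * (V 0 - V t)) _ (fun t => `|pw (- g - 1) t * (V 0 - V t)|)).
 - by move=> d _; rewrite /Wd; meas.
 - exact: integrable_norm iV.
 - move=> d t d0; rewrite /Wd; have [t0|t0] := leP 0 t; last by rewrite mulr0 mul0r normr0.
  move: t0; rewrite le_eqVlt => /predU1P[<-|t0]; first by rewrite subrr !mulr0 normr0.
  rewrite mulr1 !normrM ler_wpM2r// !ger0_norm ?pw_ge0//.
  rewrite !pwE ?addr_gt0// (_ : - g - 1 = - (g + 1)); last by ring.
  rewrite !powRN lef_pV2 ?posrE ?powR_gt0 ?addr_gt0//.
  by apply: ge0_ler_powR; rewrite ?nnegrE ?addr_ge0 ?ltW// ltrDl.
 - move=> t; have [t0|t0] := ltP 0 t; last first.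
   rewrite pw0// mul0r; move: t0; rewrite le_eqVlt => /predU1P[->|t0].
    by under eq_fun do rewrite subrr mulr0; exact: cvg_cst.
   by under eq_fun do rewrite /Wd leNgt t0 /= mulr0 mul0r; exact: cvg_cst.
  apply: cvgM; last exact: cvg_cst.
  by rewrite /Wd (ltW t0); under eq_fun do rewrite mulr1; exact: pw_cvgD.
have C2 : Gamma g * (\int[leb1]_t (Wd d t * (V 0 - V t))) @[d --> 0^'+] -->
  Gamma g * \int[leb1]_t (pw (- g - 1) t * (V 0 - V t)).
 by apply: cvgM; [exact: cvg_cst|exact: C].
have C3 : g^-1 * (\int[leb1]_r (gd d r * f r)) @[d --> 0^'+] --> g^-1 * (Gamma g * Gamma (1 - g) * l).
 by apply: cvgM; [exact: cvg_cst|exact: gdf_cvg].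
have E : Gamma g * \int[leb1]_t (pw (- g - 1) t * (V 0 - V t)) = g^-1 * (Gamma g * Gamma (1 - g) * l).
 apply: (cvg_unique _ _ C3) => //; apply: cvg_trans C2; apply: near_eq_cvg; near=> d.
 have d0 : 0 < d by near: d; exact: nbhs_right_gt.
 by have [_ [_ ->]] := WV_fin d0.
apply: (mulfI (lt0r_neq0 Gg)); rewrite mulrCA E /kap; field.
by rewrite !gt_eqF// Gamma_gt0.
Unshelve. all: by end_near. Qed.

End marchaud_zero.

(** * Inversion of the Marchaud derivative on a bounded interval *)

Section truncated_inversion.
Context {R : realType}.
Variables (g M : R).
Hypotheses (g0 : 0 < g) (g1 : g < 1) (M0 : 0 < M).
Implicit Types (a b c d r s t u : R).

Let h1 : 0 < 1 - g. Proof. by rewrite subr_gt0. Qed.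

Let wM s : R := pw (g - 1) s * (s < M)%R%:R.

Let wM_ge0 s : 0 <= wM s. Proof. by rewrite mulr_ge0 ?pw_ge0. Qed.

Let mwM : msble wM. Proof. by rewrite /wM; meas. Qed.

(* The truncated inverse of the Marchaud derivative of a primitive: K is the
  (shifted) derivative and c the boundary value at M. *)
Let X (K : R -> R) c s := (\int[leb1]_t ((pw (- g - 1) t)%:E *
 (\int[leb1]_r (K r * ((s < r)%R%:R * (r <= s + t)%R%:R))%:E + (c * (M - s <= t)%R%:R)%:E)))%E.

Let beta0 r : (\int[leb1]_s (pw (g - 1) s * pw (- g) (r - s))%:E = (Bt g (1 - g) * pw 0 r)%:E)%E.
Proof.
have := beta_conv r g0 h1; rewrite (_ : 1 - g - 1 = - g); last by ring.
by rewrite (_ : g + (1 - g) - 1 = 0)//; ring.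
Qed.

(** Abel's method: the [t]-integral turns the primitive into $(r-s)^{-g}/g$, and the remaining
    [s]-integral is a Beta integral with the same value for each [r] in $(0,M]$. The boundary term
    gives the same Beta integral at [M]. *)
Let X_int (K : R -> R) c : msble K -> (forall r, 0 <= K r) -> (forall r, M < r -> K r = 0) -> 0 <= c ->
 (\int[leb1]_s ((wM s)%:E * X K c s) =
  (Bt g (1 - g) / g)%:E * (\int[leb1]_r (K r * pw 0 r)%:E + c%:E))%E.
Proof.
move=> mK K0 KM c0.
have gi : 0 <= g^-1 by rewrite invr_ge0 ltW.
have Xs s : 0 < s -> s < M -> (X K c s = (g^-1)%:E * (\int[leb1]_r (K r * pw (- g) (r - s))%:E + (c * (M - s) `^ (- g))%:E))%E.
 move=> s0 sM; have Ms : 0 < M - s by rewrite subr_gt0.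
 have mk : msble (fun p : R * R => K p.2 * ((s < p.2)%R%:R * (p.2 <= s + p.1)%R%:R)) by meas.
 have Kp t r : 0 <= K r * ((s < r)%R%:R * (r <= s + t)%R%:R) by rewrite !mulr_ge0.
 have mI : msble (fun t => \int[leb1]_r (K r * ((s < r)%R%:R * (r <= s + t)%R%:R))%:E)%E.
  apply: (@msble_int2 _ _ _ _ _ leb1 (fun t r => (K r * ((s < r)%R%:R * (r <= s + t)%R%:R))%:E)).
   exact: mEFin.
  by move=> t r; rewrite lee_fin.
 rewrite /X; transitivity (\int[leb1]_t ((pw (- g - 1) t)%:E *
   \int[leb1]_r (K r * ((s < r)%R%:R * (r <= s + t)%R%:R))%:E) +
   \int[leb1]_t (c * (pw (- g - 1) t * (M - s <= t)%R%:R))%:E)%E.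
  rewrite -ge0_integralD//.
  - apply: eq_integral => t _; rewrite ge0_muleDr ?int_ge0R// ?lee_fin ?mulr_ge0//.
   by rewrite -EFinM mulrCA.
  - by move=> t _; rewrite mule_ge0 ?int_ge0R// lee_fin pw_ge0.
  - by apply: emeasurable_funM => //; meas.
  - by move=> t _; rewrite lee_fin !mulr_ge0 ?pw_ge0.
  - by meas.
 rewrite ge0_intZl//; last 2 first.
 - by meas.
 - by move=> t; rewrite mulr_ge0 ?pw_ge0.
 rewrite int_pw_tail// ge0_muleDr; last 2 first.
 - by apply: int_ge0R => r; rewrite mulr_ge0 ?pw_ge0.
 - by rewrite lee_fin mulr_ge0 ?powR_ge0.
 congr (_ + _)%E; last by rewrite -!EFinM; congr EFin; ring.
 transitivity (\int[leb1]_t \int[leb1]_r (pw (- g - 1) t * (K r * ((s < r)%R%:R * (r <= s + t)%R%:R)))%:E)%E.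
  by apply: eq_integral => t _; rewrite ge0_intZl ?pw_ge0//; meas.
 rewrite (@int_swapR _ _ _ _ _ leb1 leb1 (fun t r => pw (- g - 1) t * (K r * ((s < r)%R%:R * (r <= s + t)%R%:R)))); last 2 first.
 - by meas.
 - by move=> t r; rewrite mulr_ge0 ?pw_ge0.
 rewrite -ge0_intZl//; last 2 first.
 - by meas.
 - by move=> r; rewrite mulr_ge0 ?pw_ge0.
 apply: eq_integral => r _; have [sr|rs] := ltP s r; last first.
  rewrite (@pw0 _ (- g)) ?subr_le0// !mulr0 integral0_eq// => t _.
  by rewrite mul0r !mulr0.
 transitivity (\int[leb1]_t (K r * (pw (- g - 1) t * (r - s <= t)%R%:R))%:E)%E.
  by apply: eq_integral => t _; rewrite mul1r lerBlDl mulrCA.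
 rewrite ge0_intZl//; last 2 first.
 - by meas.
 - by move=> t; rewrite mulr_ge0 ?pw_ge0.
 rewrite int_pw_tail// ?subr_gt0// -EFinM pwE ?subr_gt0//; congr EFin; ring.
have mKp : msble (fun p : R * R => wM p.1 * (K p.2 * pw (- g) (p.2 - p.1))).
 have m1 : msble (fun p : R * R => wM p.1) by exact: msble_fst_comp.
 have m2 : msble (fun p : R * R => K p.2) by exact: msble_snd_comp.
 by meas.
have Kp s r : 0 <= K r * pw (- g) (r - s) by rewrite mulr_ge0 ?pw_ge0.
have mI : msble (fun s => \int[leb1]_r (wM s * (K r * pw (- g) (r - s)))%:E)%E.
 apply: (@msble_int2 _ _ _ _ _ leb1 (fun s r => (wM s * (K r * pw (- g) (r - s)))%:E)).
  exact: mEFin.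
 by move=> s r; rewrite lee_fin mulr_ge0.
transitivity ((g^-1)%:E * (\int[leb1]_s \int[leb1]_r (wM s * (K r * pw (- g) (r - s)))%:E +
  \int[leb1]_s (c * (pw (g - 1) s * pw (- g) (M - s)))%:E))%E.
 rewrite -ge0_integralD//; last 3 first.
 - by move=> s _; apply: int_ge0R => r; rewrite mulr_ge0.
 - by move=> s _; rewrite lee_fin !mulr_ge0 ?pw_ge0.
 - by meas.
 rewrite -ge0_integralZl//; last 2 first.
 - apply: emeasurable_funD; first exact: mI.
  have mc : msble (fun s => c * (pw (g - 1) s * pw (- g) (M - s))) by meas.
  exact: mEFin.
 - move=> s _; rewrite adde_ge0//; first by apply: int_ge0R => r; rewrite mulr_ge0.
  by rewrite lee_fin !mulr_ge0 ?pw_ge0.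
 apply: eq_integral => s _; have [s0|s0] := leP s 0.
  rewrite /wM (pw0 _ s0) !(mul0r, mulr0, mul0e) adde0 integral0_eq ?mule0// => r _.
  by rewrite mul0r.
 have [sM|sM] := ltP s M; last first.
  rewrite /wM ltNge sM /= !mulr0 mul0e (@pw0 _ (- g)) ?subr_le0// !mulr0 adde0.
  by rewrite integral0_eq ?mule0// => r _; rewrite mul0r.
 have Ms : 0 < M - s by rewrite subr_gt0.
 rewrite Xs// muleCA; congr (_ * _)%E; rewrite ge0_muleDr; last 2 first.
 - exact: int_ge0R.
 - by rewrite lee_fin mulr_ge0 ?powR_ge0.
 rewrite -ge0_intZl//; last by meas.
 by congr (_ + _)%E; rewrite -EFinM /wM sM mulr1 (pwE (- g) Ms) mulrCA.
rewrite (@int_swapR _ _ _ _ _ leb1 leb1 (fun s r => wM s * (K r * pw (- g) (r - s)))) //; last first.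
 by move=> s r; rewrite mulr_ge0.
rewrite ge0_intZl//; last 2 first.
- by meas.
- by move=> s; rewrite mulr_ge0 ?pw_ge0.
rewrite beta0 (pwE 0 M0) powRr0 mulr1.
have -> : (\int[leb1]_r \int[leb1]_s (wM s * (K r * pw (- g) (r - s)))%:E =
  (Bt g (1 - g))%:E * \int[leb1]_r (K r * pw 0 r)%:E)%E.
 rewrite -ge0_intZl//; last 3 first.
 - by rewrite ltW// Bt_gt0.
 - by meas.
 - by move=> r; rewrite mulr_ge0 ?pw_ge0.
 apply: eq_integral => r _; have [rM|rM] := ltP M r.
  by rewrite KM// mul0r mulr0 integral0_eq// => s _; rewrite mul0r mulr0.
 transitivity (\int[leb1]_s (K r * (pw (g - 1) s * pw (- g) (r - s)))%:E)%E.
  apply: eq_integral => s _; congr EFin; rewrite /wM; have [sM|sM] := ltP s M; first by rewrite mulr1 mulrCA.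
  have rs : r - s <= 0 by rewrite subr_le0 (le_trans rM).
  by rewrite (pw0 _ rs) !mulr0.
 rewrite ge0_intZl//; last 2 first.
 - by meas.
 - by move=> s; rewrite mulr_ge0 ?pw_ge0.
 by rewrite beta0 -EFinM; congr EFin; ring.
rewrite [(c%:E * _)%E]muleC -ge0_muleDr; last 2 first.
- by apply: int_ge0R => r; rewrite mulr_ge0 ?pw_ge0.
- by rewrite lee_fin.
by rewrite muleA -EFinM mulrC.
Qed.

Variables (h G q : R -> R).
Hypotheses (dh : forall r, 0 <= r -> is_derive r 1 h (- G r))
 (cG : forall r, 0 <= r -> {for r, continuous G})
 (mh : msble h) (mG : msble G) (mq : msble q)
 (h0 : forall r, 0 <= r -> 0 <= h r) (q0 : forall s, 0 <= s -> 0 <= q s)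
 (iq : forall s, 0 < s -> intgr leb1 (fun t => pw (- g - 1) t * (h s - h (s + t))))
 (qE : forall s, 0 < s -> q s = kap g * \int[leb1]_t (pw (- g - 1) t * (h s - h (s + t)))).

Definition tailM s := (\int[leb1]_t (pw (- g - 1) t * ((M - s <= t)%R%:R * h (s + t)))%:E)%E.

Let EFin_muleDD (k w b : R) (T Y : \bar R) : 0 <= k -> 0 <= w -> (0 <= T)%E -> (0 <= Y)%E ->
 (k%:E * (w%:E * (b%:E + (T + Y))) = (w * (k * b))%:E + k%:E * (w%:E * T + w%:E * Y))%E.
Proof.
move=> k0 w0 T0 Y0; rewrite [(w%:E * (b%:E + _))%E]muleDr//.
rewrite -[(w%:E * b%:E)%E]EFinM [LHS]muleDr//.
by rewrite -EFinM mulrCA ge0_muleDr.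
Qed.

(** The increments of [h] are written as integrals of [G] up to [M] and Abel's method is applied.
    Values of [h] beyond [M] are not differentiated but kept in [tailM]; since [h >= 0], both terms
    on the left are nonnegative and no decay of [h] enters. *)
Lemma truncated_inversion :
 (\int[leb1]_s (pw (g - 1) s * (s < M)%R%:R * q s)%:E +
  (kap g)%:E * \int[leb1]_s ((pw (g - 1) s * (s < M)%R%:R)%:E * tailM s) = (Gamma g * h 0)%:E)%E.
Proof.
have kg := kap_gt0 g0 g1.
(* [G] has no sign. Adding a constant [L] that dominates its negative part on $[0,M]$ makes Tonelli
   applicable; the contribution of [L], carried by [KL], is finite and is subtracted at the end. *)
have [L L0 LG] : exists2 L, 0 <= L & forall r, 0 <= r -> r <= M -> 0 <= G r + L.
 have cw : {within `[0, M], continuous G}.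
  by apply: continuous_in_subspaceT => x /set_mem; rewrite /= in_itv/= => /andP[x0 _]; exact: cG.
 have [c cI cP] := EVT_min (ltW M0) cw.
 exists `|G c| => // r r0 rM; have : G c <= G r by apply: cP; rewrite in_itv/= r0.
 by have := ler_norm (- G c); rewrite normrN; lra.
pose K r := (G r + L) * ((0 <= r)%R%:R * (r <= M)%R%:R).
pose KL r := L * ((0 <= r)%R%:R * (r <= M)%R%:R).
have K0 r : 0 <= K r.
 rewrite /K; have [r0|r0] := leP 0 r; last by rewrite mul0r mulr0.
 by have [rM|rM] := leP r M; rewrite ?mulr0// !mulr1 LG.
have KL0 r : 0 <= KL r by rewrite /KL !mulr_ge0.
have mK : msble K by rewrite /K; meas.
have mKL : msble KL by rewrite /KL; meas.
have KM r : M < r -> K r = 0 by move=> rM; rewrite /K (leNgt r M) rM !mulr0.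
have KLM r : M < r -> KL r = 0 by move=> rM; rewrite /KL (leNgt r M) rM !mulr0.
have ftcK (f F : R -> R) s d : 0 <= s -> s <= d -> d <= M -> msble f ->
  (forall x, s <= x <= d -> is_derive x 1 F (f x)) -> (forall x, s <= x <= d -> {for x, continuous f}) ->
  (\int[leb1]_r (f r * ((0 <= r)%R%:R * (r <= M)%R%:R) * ((s < r)%R%:R * (r <= d)%R%:R))%:E = (F d - F s)%:E)%E.
 move=> s0 sd dM mf dF cf; move: sd; rewrite le_eqVlt => /predU1P[<-|sd].
  rewrite subrr integral0_eq// => r _; congr EFin.
  by have [sr|sr] := ltP s r; rewrite ?mul0r ?mulr0// mul1r mulr0.
 rewrite -(FTC_closed sd dF cf) [RHS]integral_mkcond.
 transitivity (\int[leb1]_r (f r * ((s <= r)%R%:R * (r <= d)%R%:R))%:E)%E.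
  apply: (@int_point _ s); [by meas|by meas|].
  move=> r rs; have -> : (s < r) = (s <= r) by rewrite lt_neqAle eq_sym rs.
  have [sr|sr] := leP s r; last by rewrite !(mul0r, mulr0).
  have [rd|rd] := leP r d; last by rewrite !(mul0r, mulr0).
  by rewrite (le_trans s0 sr) (le_trans rd dM) !mulr1.
 apply: eq_integral => r _; rewrite /patch mem_setE in_itv/=.
 by case: (s <= r); rewrite /= ?mul1r ?mul0r ?mulr0//; case: ifP => _; rewrite ?mulr1 ?mulr0.
have ftcG s d : 0 <= s -> s <= d -> d <= M ->
  (\int[leb1]_r (K r * ((s < r)%R%:R * (r <= d)%R%:R))%:E = (h s - h d + L * (d - s))%:E)%E.
 move=> s0 sd dM; transitivity (((- h d + L * d) - (- h s + L * s))%:E : \bar R); last by congr EFin; ring.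
 apply: (ftcK (fun r => G r + L) (fun r => - h r + L * r)) => //.
 - by meas.
 - move=> x /andP[sx _]; have x0 := le_trans s0 sx.
  have := is_deriveD (is_deriveN (dh x0)) (is_deriveZ L (is_derive_id x 1)).
  by move=> H; apply: (is_derive_eq H); rewrite opprK /GRing.scale /= mulr1.
 - move=> x /andP[sx _]; apply: continuousD; [exact/cG/(le_trans s0)|exact: cst_continuous].
have ftcL s d : 0 <= s -> s <= d -> d <= M ->
  (\int[leb1]_r (KL r * ((s < r)%R%:R * (r <= d)%R%:R))%:E = (L * (d - s))%:E)%E.
 move=> s0 sd dM; transitivity ((L * d - L * s)%:E : \bar R); last by congr EFin; ring.
 apply: (ftcK (fun r => L) (fun r => L * r)) => //.
 - move=> x _; have := is_deriveZ L (is_derive_id x 1).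
  by move=> H; apply: (is_derive_eq H); rewrite /GRing.scale /= mulr1.
 - by move=> x _; exact: cst_continuous.
have cut (k : R -> R) s t : s <= M -> (forall r, M < r -> k r = 0) -> M - s <= t ->
  (\int[leb1]_r (k r * ((s < r)%R%:R * (r <= s + t)%R%:R))%:E =
   \int[leb1]_r (k r * ((s < r)%R%:R * (r <= M)%R%:R))%:E)%E.
 move=> sM k0 Mt; apply: eq_integral => r _; have [rM|rM] := leP r M; last by rewrite k0// !mul0r.
 by rewrite (_ : r <= s + t)//; lra.
(* If $t < M-s$ the inner integral is $h(s)-h(s+t)+Lt$. Otherwise it stops at [M], and with the
   boundary term $h(M)$ it equals $h(s)+L(M-s)$, which is the increment plus the tail value $h(s+t)$
   plus the part due to [L]. *)
have Pw s : 0 < s -> s < M -> (X K (h M) s = (\int[leb1]_t (pw (- g - 1) t * (h s - h (s + t))))%:E + (tailM s + X KL 0 s))%E.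
 move=> s0 sM; set D := M - s; have D0 : 0 < D by rewrite subr_gt0.
 have msh : msble (fun t => h (s + t)).
  have mu : msble (fun t : R => s + t) by apply: measurable_funD.
  exact: (measurableT_comp mh mu).
 pose A1 t := pw (- g - 1) t * (h s - h (s + t)).
 pose A2 t := pw (- g - 1) t * ((D <= t)%R%:R * h (s + t)).
 pose A3 t := pw (- g - 1) t * (L * Num.min t D).
 have hst t : 0 <= t -> 0 <= h (s + t) by move=> t0; rewrite h0// addr_ge0// ltW.
 have i1 : intgr leb1 A1 by exact: iq.
 have i2 : intgr leb1 A2.
  have j1 := integrableZl measurableT (h s) (integrable_pw_tail g0 D0).
  have j := integrableD measurableT j1 (integrable_norm i1).
  apply: (le_integrable measurableT _ _ j); first by rewrite /A2; apply: mEFin; meas.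
  move=> t _ /=; rewrite lee_fin; have [t0|t0] := leP t 0; first by rewrite /A2 pw0// mul0r normr0.
  have p := pw_ge0 (- g - 1) t; have hs := h0 (ltW s0); have ht := hst t (ltW t0).
  rewrite [leRHS]ger0_norm; last by rewrite addr_ge0// !mulr_ge0.
  rewrite /A2; have [Dt|Dt] := leP D t; last by rewrite !(mul0r, mulr0) normr0 addr_ge0.
  rewrite !mul1r mulr1 ger0_norm ?mulr_ge0// /A1.
  have -> : pw (- g - 1) t * h (s + t) = h s * pw (- g - 1) t - pw (- g - 1) t * (h s - h (s + t)) by ring.
  by rewrite lerD2l -normrN ler_norm.
 have i3 : intgr leb1 A3.
  have j1 := integrableZl measurableT D (integrable_pw_tail g0 D0).
  have j2 : intgr leb1 (fun t => pw ((1 - g) - 1) t * (t <= D)%R%:R).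
   apply: integrableR; first by meas.
   by under eq_integral do rewrite ger0_norm ?mulr_ge0 ?pw_ge0//; rewrite int_pw_head// ltry.
  have j := integrableZl measurableT L (integrableD measurableT j1 j2).
  apply: (le_integrable measurableT _ _ j); first by rewrite /A3; apply: mEFin; meas.
  move=> t _ /=; rewrite lee_fin; have [t0|t0] := leP t 0; first by rewrite /A3 pw0// mul0r normr0.
  have p := pw_ge0 (- g - 1) t; have m0 : 0 <= Num.min t D by rewrite le_min (ltW t0) ltW.
  rewrite !ger0_norm; last 2 first.
  - apply: mulr_ge0 => //; apply: addr_ge0; last by rewrite mulr_ge0 ?pw_ge0.
   by apply: mulr_ge0; [exact: ltW|rewrite mulr_ge0].
  - by rewrite /A3 !mulr_ge0.
  rewrite /A3 mulrCA ler_wpM2l//; have [tD|tD] := leP t D.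
   rewrite mulr1; apply: ler_wpDl; first by rewrite !mulr_ge0// ltW.
   have -> : 1 - g - 1 = (- g - 1) + 1 by ring.
   by rewrite (pwD (- g - 1) 1) (pwE 1 t0) powRr1// ltW.
  by rewrite (ltW tD) mulr0 addr0 mulr1 mulrC.
 have E3 : X KL 0 s = (\int[leb1]_t A3 t)%:E.
  rewrite -EFin_int//; apply: eq_integral => t _; rewrite mul0r adde0 /A3.
  have [t0|t0] := leP t 0; first by rewrite pw0// mul0e mul0r.
  rewrite EFinM; congr (_ * _)%E; have [Dt|Dt] := leP D t.
   by rewrite (cut _ _ _ (ltW sM) KLM Dt) ftcL// ltW.
  rewrite ftcL ?(ltW s0)//; first by rewrite addrC addKr.
   by rewrite lerDl ltW.
  by rewrite addrC -lerBrDr ltW.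
 have E2 : tailM s = (\int[leb1]_t A2 t)%:E by rewrite -EFin_int.
 have i23 : intgr leb1 (fun t => A2 t + A3 t).
  by have := integrableD measurableT i2 i3; apply: eq_integrable.
 have i123 : intgr leb1 (fun t => A1 t + (A2 t + A3 t)).
  by have := integrableD measurableT i1 i23; apply: eq_integrable.
 have S1 : \int[leb1]_t A1 t + (\int[leb1]_t A2 t + \int[leb1]_t A3 t) = \int[leb1]_t (A1 t + (A2 t + A3 t)).
  by rewrite -RintegralD// -RintegralD.
 transitivity (\int[leb1]_t (A1 t + (A2 t + A3 t)))%:E; last by rewrite E3 E2 -S1 !EFinD.
 rewrite -EFin_int//.
 apply: eq_integral => t _; have [t0|t0] := leP t 0.
  by rewrite /A1 /A2 /A3 pw0// !mul0r mul0e !addr0.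
 have -> : A1 t + (A2 t + A3 t) = pw (- g - 1) t * (h s - h (s + t) + ((D <= t)%R%:R * h (s + t) + L * Num.min t D)).
  by rewrite /A1 /A2 /A3; ring.
 rewrite [in RHS]EFinM; congr (_ * _)%E; have [Dt|Dt] := leP D t.
  rewrite (cut _ _ _ (ltW sM) KM Dt) ftcG//; try exact: ltW.
  by rewrite -EFinD mulr1 mul1r; congr EFin; rewrite /D; ring.
 rewrite ftcG ?(ltW s0)//; last 2 first.
 - by rewrite lerDl ltW.
 - by rewrite addrC -lerBrDr ltW.
 by rewrite mulr0 adde0; congr EFin; rewrite mul0r; ring.
have hM0 : 0 <= h M by rewrite h0// ltW.
have XL_ge0 s : (0 <= X KL 0 s)%E.
 apply: integral_ge0 => t _; rewrite mule_ge0 ?lee_fin ?pw_ge0//.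
 by rewrite mul0r adde0; apply: int_ge0R => r; rewrite !mulr_ge0.
have tail_ge0 s : 0 <= s -> (0 <= tailM s)%E.
 move=> s0; apply: int_ge0R => t; have [t0|t0] := leP t 0; first by rewrite pw0// mul0r.
 by rewrite !mulr_ge0 ?pw_ge0// h0// addr_ge0// ltW.
have XKL0 s : (0 <= (wM s)%:E * X KL 0 s)%E by rewrite mule_ge0 ?lee_fin.
have T0 s : (0 <= (wM s)%:E * tailM s)%E.
 have [s0|s0] := leP s 0; first by rewrite /wM pw0// mul0r mul0e.
 by rewrite mule_ge0 ?lee_fin ?tail_ge0// ltW.
have mT : msble (fun s => (wM s)%:E * tailM s)%E.
 have mhp : msble (fun p : R * R => h (p.1 + p.2)).
  have mu : msble (fun p : R * R => p.1 + p.2) by meas.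
  exact: (measurableT_comp mh mu).
 have mw1 : msble (fun p : R * R => wM p.1) by exact: msble_fst_comp.
 have -> : (fun s => (wM s)%:E * tailM s)%E = (fun s => \int[leb1]_t (wM s * (pw (- g - 1) t * ((M - s <= t)%R%:R * h (s + t))))%:E)%E.
  apply/funext => s; have [s0|s0] := leP s 0.
   by rewrite /wM pw0// mul0r mul0e integral0_eq// => t _; rewrite mul0r.
  have msh : msble (fun t => h (s + t)).
   have mu : msble (fun t : R => s + t) by apply: measurable_funD.
   exact: (measurableT_comp mh mu).
  rewrite ge0_intZl//; first by meas.
  move=> t; have [t0|t0] := leP t 0; first by rewrite pw0// mul0r.
  by rewrite !mulr_ge0 ?pw_ge0// h0// addr_ge0// ltW.
 apply: (@msble_int2 _ _ _ _ _ leb1 (fun s t => (wM s * (pw (- g - 1) t * ((M - s <= t)%R%:R * h (s + t))))%:E)).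
  by apply: mEFin; meas.
 move=> s t; rewrite lee_fin; have [s0|s0] := leP s 0; first by rewrite /wM pw0// !mul0r.
 have [t0|t0] := leP t 0; first by rewrite (pw0 _ t0) mul0r mulr0.
 by rewrite !mulr_ge0 ?pw_ge0// h0// addr_ge0// ltW.
have mX (k : R -> R) c : msble k -> (forall r, 0 <= k r) -> 0 <= c ->
  msble (fun s => (wM s)%:E * X k c s)%E.
 move=> mk k0 c0; apply: emeasurable_funM; first exact: mEFin.
 have mI : msble (fun p : R * R => \int[leb1]_r (k r * ((p.1 < r)%R%:R * (r <= p.1 + p.2)%R%:R))%:E)%E.
  apply: (@msble_int2 _ _ _ _ _ leb1 (fun (p : R * R) r => (k r * ((p.1 < r)%R%:R * (r <= p.1 + p.2)%R%:R))%:E)).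
   have m1 : msble (fun p : (R * R) * R => p.1.1) by exact: (measurableT_comp measurable_fst measurable_fst).
   have m2 : msble (fun p : (R * R) * R => p.1.2) by exact: (measurableT_comp measurable_snd measurable_fst).
   have m3 : msble (fun p : (R * R) * R => k p.2) by exact: msble_snd_comp.
   have m4 : msble (fun p : (R * R) * R => p.1.1 + p.1.2) by exact: measurable_funD.
   apply: mEFin; apply: measurable_funM => //; apply: measurable_funM.
    by apply: msble_ltR => //; exact: measurable_snd.
   by apply: msble_leR => //; exact: measurable_snd.
  by move=> p r; rewrite lee_fin !mulr_ge0.
 apply: (@msble_int2 _ _ _ _ _ leb1 (fun s t => ((pw (- g - 1) t)%:E *
  (\int[leb1]_r (k r * ((s < r)%R%:R * (r <= s + t)%R%:R))%:E + (c * (M - s <= t)%R%:R)%:E))%E)).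
  apply: emeasurable_funM; first by meas.
  by apply: emeasurable_funD; [exact: mI|meas].
 move=> s t; rewrite mule_ge0 ?lee_fin ?pw_ge0// adde_ge0 ?lee_fin ?mulr_ge0//; apply: int_ge0R => r.
 by rewrite !mulr_ge0.
have I1 := X_int mK K0 KM hM0; have I2 := X_int mKL KL0 KLM (lexx 0).
have pwK (k : R -> R) : (forall r, M < r -> k r = 0) -> (\int[leb1]_r (k r * pw 0 r)%:E =
  \int[leb1]_r (k r * ((0 < r)%R%:R * (r <= M)%R%:R))%:E)%E.
 move=> k0; apply: eq_integral => r _; have [r0|r0] := leP r 0; first by rewrite pw0// mul0r.
 rewrite pwE// powRr0; have [rM|rM] := leP r M; first by rewrite !mulr1.
 by rewrite k0// !mul0r.
rewrite pwK// ftcG// ?(ltW M0)// in I1; rewrite pwK// ftcL// ?(ltW M0)// in I2.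
rewrite subr0 adde0 in I2; rewrite subr0 -EFinD in I1.
have kB : kap g * (Bt g (1 - g) / g) = Gamma g.
 rewrite /kap /Bt (_ : g + (1 - g) = 1); last by ring.
 by rewrite Gamma1; field; rewrite !gt_eqF// Gamma_gt0.
have S : ((kap g)%:E * \int[leb1]_s ((wM s)%:E * X K (h M) s) =
  (\int[leb1]_s (wM s * q s)%:E + (kap g)%:E * \int[leb1]_s ((wM s)%:E * tailM s)) +
  (kap g)%:E * \int[leb1]_s ((wM s)%:E * X KL 0 s))%E.
 have wq s : 0 <= wM s * q s.
  by have [s0|s0] := leP s 0; [rewrite /wM pw0// !mul0r|rewrite mulr_ge0// q0// ltW].
 have mwq : msble (fun s => (wM s * q s)%:E) by meas.
 have k0 : (0 <= (kap g)%:E)%E by rewrite lee_fin ltW.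
 have mXL := mX KL 0 mKL KL0 (lexx 0).
 transitivity (\int[leb1]_s ((wM s * q s)%:E + (kap g)%:E * ((wM s)%:E * tailM s + (wM s)%:E * X KL 0 s)))%E.
  rewrite -ge0_integralZl//; last 2 first.
  - exact: (mX _ _ mK K0 hM0).
  - move=> s _; rewrite mule_ge0 ?lee_fin//; apply: integral_ge0 => t _.
   rewrite mule_ge0 ?lee_fin ?pw_ge0// adde_ge0 ?lee_fin ?mulr_ge0//.
   by apply: int_ge0R => r; apply: mulr_ge0; [exact: K0|rewrite mulr_ge0].
  apply: eq_integral => s _; have [s0|s0] := leP s 0.
   by rewrite /wM pw0// !mul0r !mul0e adde0 mule0 adde0.
  have [sM|sM] := ltP s M; last first.
   by rewrite /wM ltNge sM /= mulr0 mul0r !mul0e adde0 mule0 adde0.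
  rewrite Pw// qE//.
  by rewrite EFin_muleDD//; apply: tail_ge0; exact: ltW.
 rewrite ge0_integralD//; last 3 first.
 - by move=> s _; rewrite lee_fin.
 - by move=> s _; rewrite mule_ge0// adde_ge0.
 - by apply: measurable_funeM; exact: emeasurable_funD.
 rewrite ge0_integralZl//; last 2 first.
 - exact: emeasurable_funD.
 - by move=> s _; rewrite adde_ge0.
 rewrite ge0_integralD// ge0_muleDr; last 2 first.
 - exact: integral_ge0.
 - exact: integral_ge0.
 by rewrite addeA.
have E1 z : ((kap g)%:E * ((Bt g (1 - g) / g)%:E * z%:E) = (Gamma g * z)%:E)%E by rewrite -!EFinM mulrA kB.
move: S; rewrite I1 I2 !E1.
move: (\int[leb1]_s _ + _)%E => [y [S]||//]; last by [].
by congr EFin; lra.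
Qed.

End truncated_inversion.

Lemma is_derive_eq_near {R : realType} (f h : R -> R) (t d : R) :
 is_derive t 1 f d -> (\forall s \near t, f s = h s) -> is_derive t 1 h d.
Proof. by move=> D e; exact: near_eq_is_derive e D. Qed.

Lemma msble_shiftl {R : realType} (q : R -> R) (t : R) :
 msble q -> msble (fun s => q (t + s)).
Proof.
move=> mq; apply: (measurableT_comp mq).
by apply: measurable_funD; [exact: measurable_cst|exact: measurable_id].
Qed.

(** * Comparison of two Marchaud pairs at infinity *)

Section marchaud_pairs.
Context {R : realType}.
Variable g : R.
Hypotheses (g0 : 0 < g) (g1 : g < 1).
Implicit Types (H G q h : R -> R) (t c M r s e : R).

(** The sign matches the heat flow, where the time derivative is minus the negative Laplacian.
    Monotonicity of [H] holds only once [G] is known to be nonnegative. *)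
Definition decreasing_to H G := (forall t, 0 < t -> is_derive t 1 H (- G t)) /\
 (forall t : R, 0 < t -> {for t, continuous G}).

Definition marchaud_pair H q := [/\ exists G, decreasing_to H G, msble q,
 forall t, 0 < t -> 0 <= q t,
 forall s, 0 < s -> intgr leb1 (fun r => pw (- g - 1) r * (H s - H (s + r))) &
 forall s, 0 < s -> q s = kap g * \int[leb1]_r (pw (- g - 1) r * (H s - H (s + r)))].

(** The maximum keeps the argument positive for every real [r], so the function is defined and
    continuous on the line and two-sided derivatives exist at [r = 0]; for [r >= 0] it is just
    [H (t + r) + c]. The constant [c] is there to enforce nonnegativity. *)
Definition shiftp H (t c r : R) := H (Num.max (t / 2) (t + r)) + c.
Definition truncI q (t M : R) := (\int[leb1]_s (pw (g - 1) s * (s < M)%R%:R * q (t + s))%:E)%E.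
Definition tailA h (M : R) := ((kap g)%:E * \int[leb1]_s ((pw (g - 1) s * (s < M)%R%:R)%:E * tailM g M h s))%E.

Lemma shiftpE H t c r : 0 < t -> 0 <= r -> shiftp H t c r = H (t + r) + c.
Proof. by move=> t0 r0; rewrite /shiftp max_r//; lra. Qed.

Lemma cont_shiftp H t c : 0 < t -> (forall t : R, 0 < t -> {for t, continuous H}) -> continuous (shiftp H t c).
Proof.
move=> t0 cH r; apply: continuousD; last exact: cst_continuous.
apply: (@continuous_comp _ _ _ (fun r => Num.max (t / 2) (t + r)) H).
 by apply: continuous_max; [exact: cst_continuous|apply: continuousD; [exact: cst_continuous|exact: cvg_id]].
by apply: cH; rewrite lt_max divr_gt0.
Qed.

Lemma msble_continuous_shiftp H t c : 0 < t -> (forall t : R, 0 < t -> {for t, continuous H}) ->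
 msble (shiftp H t c).
Proof. by move=> t0 cH; apply: continuous_measurable_fun; exact: cont_shiftp. Qed.

Lemma decreasing_continuous H G : decreasing_to H G -> forall t : R, 0 < t -> {for t, continuous H}.
Proof. by move=> [D _] t t0; have [d _] := D t t0; apply/differentiable_continuous/derivable1_diffP. Qed.

Lemma is_derive_shiftp H G t c r : decreasing_to H G -> 0 < t -> 0 <= r ->
 is_derive r 1 (shiftp H t c) (- shiftp G t 0 r).
Proof.
move=> [dH _] t0 r0; have tr : 0 < t + r by rewrite ltr_wpDr.
pose e (s : R) := t + s.
have De : is_derive r 1 e 1.
 by have D := is_deriveD (is_derive_cst t r 1) (is_derive_id r 1); apply: (is_derive_eq D); rewrite add0r.
have D1 := is_derive1_comp (dH (e r) tr) De.
have D2 : is_derive r 1 (fun s => H (e s) + c) (- G (e r)).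
 have D3 := is_deriveD D1 (is_derive_cst c r 1).
 by apply: (is_derive_eq D3); rewrite mulr1 addr0.
rewrite shiftpE// addr0; apply: (is_derive_eq_near D2); near=> s.
rewrite /shiftp /e max_r//.
have : r - t / 2 < s by near: s; apply: lt_nbhsr; lra.
lra.
Unshelve. all: by end_near.
Qed.

Lemma star H q t c M : marchaud_pair H q -> 0 < t -> 0 < M -> (forall r, 0 <= r -> 0 <= H (t + r) + c) ->
 (truncI q t M + tailA (shiftp H t c) M = (Gamma g * (H t + c))%:E)%E /\ msble (shiftp H t c).
Proof.
move=> [[G HG] mq q0 iq qE] t0 M0 h0; have cH := decreasing_continuous HG; have [dH cG] := HG.
have mh := msble_continuous_shiftp c t0 cH; split=> //.
have mG := msble_continuous_shiftp 0 t0 cG.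
have E s r : 0 < s -> pw (- g - 1) r * (shiftp H t c s - shiftp H t c (s + r)) =
  pw (- g - 1) r * (H (t + s) - H (t + s + r)).
 move=> s0; have [r0|r0] := leP r 0; first by rewrite pw0// !mul0r.
 by rewrite !shiftpE// ?addr_ge0 ?(ltW s0) ?(ltW r0)// addrA; congr (_ * _); ring.
have -> : Gamma g * (H t + c) = Gamma g * shiftp H t c 0 by rewrite shiftpE// addr0.
apply: (@truncated_inversion _ _ _ g0 g1 M0 (shiftp H t c) (shiftp G t 0) (fun s => q (t + s))).
- by move=> r r0; exact: is_derive_shiftp.
- by move=> r _; apply: (cont_shiftp (c := 0)).
- exact: mh.
- exact: mG.
- exact: msble_shiftl.
- by move=> r r0; rewrite shiftpE// h0.
- by move=> s s0; apply: q0; rewrite ltr_wpDr.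
- move=> s s0; have ts : 0 < t + s by exact: addr_gt0.
 have := iq _ ts; apply: eq_integrable => //.
 by move=> r _ /=; rewrite E.
- move=> s s0; have ts : 0 < t + s by exact: addr_gt0.
 by rewrite (qE _ ts); congr (_ * _); apply: eq_Rintegral => r _; rewrite E.
Qed.

Lemma truncI_ge0 q t M : 0 < t -> (forall t, 0 < t -> 0 <= q t) -> (0 <= truncI q t M)%E.
Proof.
move=> t0 q0; apply: int_ge0R => s; have [s0|s0] := leP s 0; first by rewrite pw0// !mul0r.
by apply: mulr_ge0; [apply: mulr_ge0; [exact: pw_ge0|exact: ler0n]|apply: q0; rewrite addr_gt0].
Qed.

(** The tail evaluates its function only at arguments [s + r >= M]; a comparison on that half-line
    is therefore enough. *)
Lemma tailA_le h1 h2 M : 0 < M -> msble h1 -> msble h2 ->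
 (forall r, 0 <= r -> 0 <= h1 r) -> (forall r, 0 <= r -> 0 <= h2 r) ->
 (forall r, M <= r -> h1 r <= h2 r) -> (0 <= tailA h1 M <= tailA h2 M)%E.
Proof.
move=> M0 m1 m2 p1 p2 le12; have kg : 0 <= kap g by exact/ltW/kap_gt0.
pose k (h : R -> R) s r := pw (- g - 1) r * ((0 < s)%R%:R * ((M - s <= r)%R%:R * h (s + r))).
have kE h s : (0 < s) -> tailM g M h s = (\int[leb1]_r (k h s r)%:E)%E.
 by move=> s0; apply: eq_integral => r _; rewrite /k s0 mul1r.
have k0 h s r : (forall r, 0 <= r -> 0 <= h r) -> 0 <= k h s r.
 move=> h0; rewrite /k; have [s0|s0] := ltP 0 s; last by rewrite mul0r mulr0.
 have [r0|r0] := leP r 0; first by rewrite pw0// !mul0r.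
 apply: mulr_ge0; first exact: pw_ge0.
 by rewrite mul1r; apply: mulr_ge0; [exact: ler0n|apply: h0; rewrite addr_ge0 ?(ltW s0) ?(ltW r0)].
have mk h : msble h -> msble (fun p : R * R => k h p.1 p.2).
 by move=> mh; rewrite /k; meas.
have mI h : msble h -> (forall r, 0 <= r -> 0 <= h r) ->
  msble (fun s => ((pw (g - 1) s * (s < M)%R%:R)%:E * \int[leb1]_r (k h s r)%:E)%E).
 move=> mh h0; apply: emeasurable_funM; first by apply: mEFin; meas.
 apply: (msble_int2 leb1 (f := fun s r => (k h s r)%:E) (mEFin (mk h mh))).
 by move=> s r; rewrite lee_fin k0.
have w0 s : 0 <= pw (g - 1) s * (s < M)%R%:R by apply: mulr_ge0; [exact: pw_ge0|exact: ler0n].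
have tE h : tailA h M = ((kap g)%:E * \int[leb1]_s ((pw (g - 1) s * (s < M)%R%:R)%:E * \int[leb1]_r (k h s r)%:E))%E.
 congr (_ * _)%E; apply: eq_integral => s _.
 have [s0|s0] := leP s 0; first by rewrite pw0// mul0r !mul0e.
 by rewrite kE.
have p h s : (forall r, 0 <= r -> 0 <= h r) -> (0 <= (pw (g - 1) s * (s < M)%R%:R)%:E * \int[leb1]_r (k h s r)%:E)%E.
 by move=> h0; apply: mule_ge0; [rewrite lee_fin|apply: int_ge0R => r; exact: k0].
rewrite !tE; apply/andP; split.
 by apply: mule_ge0; [rewrite lee_fin|apply: integral_ge0 => s _; exact: p].
apply: lee_wpmul2l; first by rewrite lee_fin.
apply: ge0_le_integral; [exact: measurableT|by move=> s _; exact: p|exact: mI|exact: mI|].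
move=> s _; apply: lee_wpmul2l; first by rewrite lee_fin.
have mks h : msble h -> msble (k h s) by move=> mh; have mhs := msble_shiftl s mh; rewrite /k; meas.
apply: le_intR; [by move=> r; exact: k0|exact: mks|exact: mks|].
move=> r; rewrite /k ler_wpM2l ?pw_ge0// ler_wpM2l ?ler0n//.
have [sr|sr] := leP (M - s) r; last by rewrite !mul0r.
by rewrite !mul1r le12//; lra.
Qed.

Lemma truncI_bound H q t c M : marchaud_pair H q -> 0 < t -> 0 < M -> (forall r, 0 <= r -> 0 <= H (t + r) + c) ->
 (truncI q t M <= (Gamma g * (H t + c))%:E)%E.
Proof.
move=> HP t0 M0 h0; have [<- mh] := star HP t0 M0 h0.
have hp r : 0 <= r -> 0 <= shiftp H t c r by move=> r0; rewrite shiftpE// h0.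
have /andP[a _] := tailA_le M0 mh mh hp hp (fun r _ => lexx _).
by rewrite leeDl.
Qed.

Let Iinf q t := (\int[leb1]_s (pw (g - 1) s * q (t + s))%:E)%E.

Lemma truncI_cvg q t (B : \bar R) N : 0 < t -> msble q -> (forall t, 0 < t -> 0 <= q t) ->
 (forall M, N < M -> 0 < M -> (truncI q t M <= B)%E) -> (Iinf q t <= B)%E.
Proof.
move=> t0 mq q0 IB; have mqt := msble_shiftl t mq.
have mw c : msble (fun s => pw (g - 1) s * (s < c)%R%:R) by meas.
apply: (@mono_int_le _ _ _ leb1 (fun (k : nat) s => pw (g - 1) s * (s < `|N| + k.+1%:R)%R%:R * q (t + s))).
- by move=> k; exact: measurable_funM (mw _) mqt.
- move=> k s; have [s0|s0] := leP s 0; first by rewrite pw0// !mul0r.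
 by apply: mulr_ge0; [apply: mulr_ge0; [exact: pw_ge0|exact: ler0n]|apply: q0; rewrite addr_gt0].
- move=> s i j ij; have [s0|s0] := leP s 0; first by rewrite pw0// !mul0r.
 apply: ler_wpM2r; first by apply: q0; rewrite addr_gt0.
 apply: ler_wpM2l; first exact: pw_ge0.
 have [si|si] := ltP s (`|N| + i.+1%:R); last exact: ler0n.
 by rewrite (lt_le_trans si)// lerD2l ler_nat.
- move=> s; apply: cvg_near_cst; exists (Num.truncn `|s|).+1 => // k /= ks.
 rewrite (_ : s < `|N| + k.+1%:R) ?mulr1//.
 have a := ler_norm s; have b := truncnS_gt `|s|; have c := normr_ge0 N.
 have d : (Num.truncn `|s|).+1%:R <= k.+1%:R :> R by rewrite ler_nat ltnW.
 lra.
- move=> k; apply: IB; first by have := ler_norm N; have : 0 < k.+1%:R :> R by []; lra.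
 by rewrite ltr_wpDl.
Qed.

Lemma Iinf_bound H q t c : marchaud_pair H q -> 0 < t -> (forall r, 0 <= r -> 0 <= H (t + r) + c) ->
 (0 <= Iinf q t <= (Gamma g * (H t + c))%:E)%E.
Proof.
move=> HP t0 h0; have [_ mq q0 _ _] := HP; apply/andP; split.
 apply: int_ge0R => s; have [s0|s0] := leP s 0; first by rewrite pw0// mul0r.
 by apply: mulr_ge0; [exact: pw_ge0|apply: q0; rewrite addr_gt0].
by apply: (truncI_cvg (N := 0)) => // M _ M0; exact: truncI_bound.
Qed.

Let Ir q t := fine (Iinf q t).

(** With [H'] raised by [e], the tail of [H] is below that of [H'] once [M] is large. Subtracting
    the two truncated identities leaves an inequality between the remaining terms, in which [M]
    tends to infinity. *)
Let compare1 H q t H' q' t' c e : marchaud_pair H q -> marchaud_pair H' q' -> 0 < t -> 0 < t' ->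
 (forall r, 0 <= r -> 0 <= H (t + r) + c) -> (forall r, 0 <= r -> 0 <= H' (t' + r) + c) -> 0 < e ->
 (exists N, forall r, N < r -> H (t + r) <= H' (t' + r) + e) ->
 Ir q' t' + Gamma g * H t <= Ir q t + Gamma g * (H' t' + e).
Proof.
move=> HP HP' t0 t'0 h0 h'0 e0 [N NP].
have /andP[a1 a2] := Iinf_bound HP t0 h0; have /andP[b1 b2] := Iinf_bound HP' t'0 h'0.
have aE : Iinf q t = (Ir q t)%:E by rewrite /Ir fineK// ge0_fin_numE//; exact: le_lt_trans a2 (ltry _).
have bE : Iinf q' t' = (Ir q' t')%:E by rewrite /Ir fineK// ge0_fin_numE//; exact: le_lt_trans b2 (ltry _).
have [_ mq q0 _ _] := HP; have [_ mq' q'0 _ _] := HP'.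
have h'e0 r : 0 <= r -> 0 <= H' (t' + r) + (c + e) by move=> r0; have := h'0 r r0; lra.
suff : (Iinf q' t' <= (Ir q t + Gamma g * (H' t' + (c + e)) - Gamma g * (H t + c))%:E)%E.
 by rewrite bE lee_fin; lra.
apply: (truncI_cvg (N := N)) => // M NM M0.
have [S1 m1] := star HP t0 M0 h0; have [S2 m2] := star HP' t'0 M0 h'e0.
have hp r : 0 <= r -> 0 <= shiftp H t c r by move=> r0; rewrite shiftpE// h0.
have hp' r : 0 <= r -> 0 <= shiftp H' t' (c + e) r by move=> r0; rewrite shiftpE// h'e0.
have le12 r : M <= r -> shiftp H t c r <= shiftp H' t' (c + e) r.
 move=> Mr; have r0 : 0 <= r by exact: le_trans (ltW M0) Mr.
 by rewrite !shiftpE//; have := NP r (lt_le_trans NM Mr); lra.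
have /andP[A0 A12] := tailA_le M0 m1 m2 hp hp' le12.
have T1 := truncI_ge0 M t0 q0; have T2 := truncI_ge0 M t'0 q'0.
have T1I : (truncI q t M <= (Ir q t)%:E)%E.
 rewrite -aE; apply: le_intR.
 - move=> s; have [s0|s0] := leP s 0; first by rewrite pw0// !mul0r.
  by apply: mulr_ge0; [apply: mulr_ge0; [exact: pw_ge0|exact: ler0n]|apply: q0; rewrite addr_gt0].
 - have mqt := msble_shiftl t mq.
  have mw : msble (fun s => pw (g - 1) s * (s < M)%R%:R) by meas.
  exact: measurable_funM mw mqt.
 - have mqt := msble_shiftl t mq.
  by meas.
 move=> s; have [s0|s0] := leP s 0; first by rewrite pw0// !mul0r.
 apply: ler_wpM2r; first by apply: q0; rewrite addr_gt0.
 by rewrite ler_piMr ?pw_ge0//; case: (s < M).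
move: S1 S2 A0 A12 T1 T2 T1I.
move: (truncI q t M) (truncI q' t' M) (tailA _ M) (tailA _ M) => [a| |] [b| |] [x| |] [y| |]//=.
rewrite -!EFinD !lee_fin => -[S1] -[S2]; lra.
Qed.

(** The defect [H t - J g q t] depends only on the behaviour at infinity. It is used twice: against
    the zero pair, where the defect vanishes, and for a single pair at two times, where the defect
    is thereby a constant. *)
Lemma marchaud_compare H q t H' q' t' c : marchaud_pair H q -> marchaud_pair H' q' -> 0 < t -> 0 < t' ->
 (forall r, 0 <= r -> 0 <= H (t + r) + c) -> (forall r, 0 <= r -> 0 <= H' (t' + r) + c) ->
 (forall e, 0 < e -> exists N, forall r, N < r -> `|H (t + r) - H' (t' + r)| <= e) ->
 exists k k' : R, [/\ J g (EFin \o q) t = k%:E, J g (EFin \o q') t' = k'%:E & H t - k = H' t' - k'].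
Proof.
move=> HP HP' t0 t'0 h0 h'0 lim; have Gg := Gamma_gt0 g0.
have /andP[a1 a2] := Iinf_bound HP t0 h0; have /andP[b1 b2] := Iinf_bound HP' t'0 h'0.
have aE : Iinf q t = (Ir q t)%:E by rewrite /Ir fineK// ge0_fin_numE//; exact: le_lt_trans a2 (ltry _).
have bE : Iinf q' t' = (Ir q' t')%:E by rewrite /Ir fineK// ge0_fin_numE//; exact: le_lt_trans b2 (ltry _).
have JI p s : J g (EFin \o p) s = (((Gamma g)^-1)%:E * Iinf p s)%E by [].
exists ((Gamma g)^-1 * Ir q t), ((Gamma g)^-1 * Ir q' t').
split; [by rewrite JI aE EFinM|by rewrite JI bE EFinM|].
suff : Gamma g * H t - Ir q t = Gamma g * H' t' - Ir q' t'.
 by move=> h; apply: (mulfI (lt0r_neq0 Gg)); rewrite !mulrBr !mulrA !divff ?gt_eqF// !mul1r.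
have P1 e : 0 < e -> Gamma g * H t - Ir q t <= Gamma g * H' t' - Ir q' t' + Gamma g * e.
 move=> e0; have [N NP] := lim e e0.
 have X : exists N, forall r, N < r -> H (t + r) <= H' (t' + r) + e.
  by exists N => r Nr; have := NP r Nr; rewrite ler_norml => /andP[]; lra.
 by have := compare1 HP HP' t0 t'0 h0 h'0 e0 X; lra.
have P2 e : 0 < e -> Gamma g * H' t' - Ir q' t' <= Gamma g * H t - Ir q t + Gamma g * e.
 move=> e0; have [N NP] := lim e e0.
 have X : exists N, forall r, N < r -> H' (t' + r) <= H (t + r) + e.
  by exists N => r Nr; have := NP r Nr; rewrite ler_norml => /andP[]; lra.
 by have := compare1 HP' HP t'0 t0 h'0 h0 e0 X; lra.
apply/le_anti/andP; split; apply/ler_addgt0Pr => e e0.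
 by have := P1 (e / Gamma g) (divr_gt0 e0 Gg); rewrite mulrCA divff ?gt_eqF// mulr1.
by have := P2 (e / Gamma g) (divr_gt0 e0 Gg); rewrite mulrCA divff ?gt_eqF// mulr1.
Qed.

Lemma marchaud_bound H q t c : marchaud_pair H q -> 0 < t -> (forall r, 0 <= r -> 0 <= H (t + r) + c) ->
 (0 <= J g (EFin \o q) t <= (H t + c)%:E)%E.
Proof.
move=> HP t0 h0; have Gg := Gamma_gt0 g0.
have /andP[a1 a2] := Iinf_bound HP t0 h0.
have JI : J g (EFin \o q) t = (((Gamma g)^-1)%:E * Iinf q t)%E by [].
rewrite JI; apply/andP; split; first by apply: mule_ge0 => //; rewrite lee_fin invr_ge0 ltW.
have Gi : (0 <= ((Gamma g)^-1)%:E)%E by rewrite lee_fin invr_ge0 ltW.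
by apply: le_trans (lee_wpmul2l Gi a2) _; rewrite -EFinM mulrA mulVf ?gt_eqF// mul1r.
Qed.

Lemma marchaud_pair0 : marchaud_pair (fun=> 0) (fun=> 0).
Proof.
have E s : (fun r => pw (- g - 1) r * ((fun=> 0) s - (fun=> 0) (s + r))) = (fun=> 0) :> (R -> R).
 by apply/funext => r; rewrite subrr mulr0.
split.
- exists (fun=> 0); split=> t _; first by rewrite oppr0; exact: is_derive_cst.
 exact: cst_continuous.
- exact: measurable_cst.
- by [].
- move=> s _; have := integrableZl measurableT 0 (integrable_pw_tail g0 (@ltr01 R)).
 by apply: eq_integrable => // r _ /=; rewrite mul0e subrr mulr0.
- move=> s _; have -> : \int[leb1]_r (pw (- g - 1) r * (0 - 0)) = 0 :> R.
  by rewrite /Rintegral integral0_eq// => r _; rewrite subrr mulr0.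
 by rewrite mulr0.
Qed.

End marchaud_pairs.

(** * Fubini's theorem for real integrals *)

Section real_fubini.
Context {R : realType} d1 d2 (T1 : measurableType d1) (T2 : measurableType d2).
Variables (m1 : {sigma_finite_measure set T1 -> \bar R}) (m2 : {sigma_finite_measure set T2 -> \bar R}).

Lemma msble_Rint2 (f : T1 -> T2 -> R) : msble (fun p : T1 * T2 => f p.1 p.2) ->
 msble (fun x => \int[m2]_y f x y).
Proof.
move=> mf; have mE := mEFin mf; pose F p := (f p.1 p.2)%:E : \bar R.
have m : msble (fubini_F m2 F^\+ \- fubini_F m2 F^\-)%E.
 apply: emeasurable_funB.
  by apply: measurable_fun_fubini_tonelli_F => //; exact: measurable_funepos.
 by apply: measurable_fun_fubini_tonelli_F => //; exact: measurable_funeneg.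
apply: (measurableT_comp (fine_measurable measurableT)).
rewrite [X in measurable_fun _ X](_ : _ = (fubini_F m2 F^\+ \- fubini_F m2 F^\-)%E)//.
apply/funext => x; rewrite integralE; congr (_ - _)%E; apply: eq_integral => y _.
 by rewrite !funeposE.
by rewrite !funenegE.
Qed.

Lemma Rint_swap (f : T1 -> T2 -> R) : msble (fun p : T1 * T2 => f p.1 p.2) ->
 (forall x, intgr m2 (f x)) -> (forall y, intgr m1 (f ^~ y)) ->
 (\int[m1]_x \int[m2]_y (`|f x y|)%:E < +oo)%E ->
 intgr m1 (fun x => \int[m2]_y f x y) /\
 \int[m1]_x \int[m2]_y f x y = \int[m2]_y \int[m1]_x f x y.
Proof.
move=> mf i2 i1 fin; pose F (p : T1 * T2) := f p.1 p.2.
have fi : (m1 \x m2)%E.-integrable setT (EFin \o F).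
 by apply/integrable12ltyP => //; exact: mEFin.
have EF x : fubini_F m2 (EFin \o F) x = (\int[m2]_y f x y)%:E by rewrite -EFin_int//; exact: i2.
have EG y : fubini_G m1 (EFin \o F) y = (\int[m1]_x f x y)%:E by rewrite -EFin_int//; exact: i1.
have j1 : intgr m1 (fun x => \int[m2]_y f x y).
 by have := integrable_fubini_F fi; apply: eq_integrable => // x _; rewrite EF.
split=> //; have := Fubini fi.
rewrite (eq_integral _ _ (fun x _ => EF x)) (eq_integral _ _ (fun y _ => EG y)).
by rewrite EFin_int// => /(congr1 fine).
Qed.

End real_fubini.

Lemma subrDr (V : zmodType) (x y z : V) : x - (z + y) = (x - y) - z.
Proof. by rewrite opprD addrA addrAC. Qed.

(** * Convolution with kernels dominated by Gaussians *)

Section gaussian_convolutions.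
Context {R : realType}.
Variable n : nat.
Implicit Types (x y z : 'rV[R]_n) (a b c s t : R) (A B K h u v : 'rV[R]_n -> R).

(** The class on which the heat flow is defined at all times; it is stable under the flow and
    contains [Ls]. *)
Definition GI h := msble h /\
 forall t x, 0 < t -> intgr (lebn n) (fun y => gauss t (x - y) * h y).

Definition gdom c t A := msble A /\ forall z, `|A z| <= c * gauss t z.

Lemma gdom_ge0 c t A : 0 < t -> gdom c t A -> 0 <= c.
Proof.
move=> t0 [_ /(_ 0) H]; have := le_trans (normr_ge0 _) H.
by rewrite pmulr_lge0// gauss_gt0.
Qed.

Lemma GI_abs h : GI h -> GI (fun y => `|h y|).
Proof.
move=> [mh ih]; split=> [|t x t0]; first by meas.
have := integrable_norm (ih t x t0); apply: eq_integrable => // y _ /=.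
by rewrite normrM ger0_norm ?gauss_ge0.
Qed.

Lemma GI_integrable c t A h x : 0 < t -> gdom c t A -> GI h ->
 intgr (lebn n) (fun y => A (x - y) * h y).
Proof.
move=> t0 gA hG; have c0 := gdom_ge0 t0 gA; case: gA => mA Ad; case: (hG) => mh ih.
have [_ ia] := GI_abs hG.
have := integrableZl measurableT c (ia t x t0); apply: le_integrable => //.
 by apply: mEFin; meas.
move=> y _ /=; rewrite lee_fin [leRHS]ger0_norm; last by pos.
by rewrite normrM mulrA ler_wpM2r.
Qed.

Lemma cvl_le c t A h x : 0 < t -> gdom c t A -> GI h ->
 `|cvl A h x| <= c * heat t (fun y => `|h y|) x.
Proof.
move=> t0 gA hG; have i := GI_integrable x t0 gA hG.
have [_ ia] := GI_abs hG; have [mA Ad] := gA.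
apply: le_trans (le_normr_Rintegral _ i) _ => //.
rewrite /heat -RintegralZl//; last exact: ia.
apply: le_Rintegral => //; first exact: integrable_norm i.
 by have := integrableZl measurableT c (ia t x t0); apply: eq_integrable.
by move=> y _; rewrite normrM mulrA ler_wpM2r.
Qed.

Lemma msble_cvl A h : msble A -> msble h -> msble (cvl A h).
Proof.
move=> mA mh; have mf : msble (fun p : 'rV[R]_n * 'rV[R]_n => A (p.1 - p.2) * h p.2) by meas.
exact: (msble_Rint2 (lebn n) (f := fun x y => A (x - y) * h y) mf).
Qed.

Lemma cvlC A h x : msble A -> msble h -> cvl A h x = cvl h A x.
Proof.
move=> mA mh; rewrite /cvl -(@Rint_rV_subr _ _ x (fun y => A (x - y) * h y)); last by meas.
by apply: eq_Rintegral => y _; rewrite subKr mulrC.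
Qed.

Lemma heat_ge0 t h x : (forall y, 0 <= h y) -> 0 <= heat t h x.
Proof. by move=> h0; apply: Rintegral_ge0 => y _; rewrite mulr_ge0 ?gauss_ge0. Qed.

Lemma EFin_heat t h x : 0 < t -> GI h ->
 (heat t h x)%:E = (\int[lebn n]_y (gauss t (x - y) * h y)%:E)%E.
Proof. by move=> t0 [_ ih]; rewrite EFin_int//; exact: ih. Qed.

(* Tonelli and the semigroup law *)
Lemma int2_gauss s t h x : 0 < s -> 0 < t -> GI h ->
 (\int[lebn n]_x' \int[lebn n]_y (gauss s (x - x') * (gauss t (x' - y) * `|h y|))%:E =
  (heat (s + t) (fun y => `|h y|) x)%:E)%E.
Proof.
move=> s0 t0 hG; have [mh _] := hG.
rewrite EFin_heat ?addr_gt0//; last exact: GI_abs.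
have mf : msble (fun p : 'rV[R]_n * 'rV[R]_n => gauss s (x - p.1) * (gauss t (p.1 - p.2) * `|h p.2|)) by meas.
rewrite (@int_swapR _ _ _ _ _ (lebn n) (lebn n) (fun x' y => gauss s (x - x') * (gauss t (x' - y) * `|h y|)) mf); last by side.
apply: eq_integral => y _.
transitivity (\int[lebn n]_x' (`|h y| * (gauss s (x - x') * gauss t (x' - y)))%:E)%E.
 by apply: eq_integral => x' _; congr EFin; ring.
rewrite ge0_intZl; try side.
rewrite -[X in (_ * X)%E](@integral_rV_add _ _ y); last by meas.
under eq_integral => z _ do rewrite addrK subrDr.
by rewrite gauss_semigroup// -EFinM mulrC.
Qed.

(** Fubini; absolute convergence follows from the two Gaussian majorants, whose double integral is a
    single heat flow of [|h|] at time [s + t]. *)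
Lemma cvl_assoc c c' s t A B h x : 0 < s -> 0 < t -> gdom c s A -> gdom c' t B -> GI h ->
 cvl A (cvl B h) x = cvl (cvl A B) h x.
Proof.
move=> s0 t0 gA gB hG; have [mA Ad] := gA; have [mB Bd] := gB; have [mh _] := hG.
have c0 := gdom_ge0 s0 gA; have c'0 := gdom_ge0 t0 gB.
have GIB y : GI (fun x' => B (x' - y)).
 split=> [|r z r0]; first by meas.
 have i : intgr (lebn n) (fun x' => gauss r (z - x') * (c' * gauss t (x' - y))).
  apply: integrableR; first by meas.
  apply: (@le_lt_trans _ _ (\int[lebn n]_x' (c' * (gauss r (z - x') * gauss t (x' - y)))%:E)%E).
   apply: le_intR; try side; move=> x'; rewrite mulrCA ger0_norm//; by pos.
  rewrite -(@integral_rV_add _ _ y); last by meas.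
  under eq_integral => x' _ do rewrite addrK subrDr.
  rewrite /=.
  by rewrite ge0_intZl; try side; rewrite gauss_semigroup// -EFinM ltry.
 apply: (le_integrable measurableT _ _ i); first by apply: mEFin; meas.
 move=> x' _ /=; rewrite lee_fin normrM ger0_norm ?gauss_ge0// [leRHS]ger0_norm; last by pos.
 by rewrite ler_wpM2l ?gauss_ge0.
have mI : msble (fun x' => \int[lebn n]_y (gauss s (x - x') * (gauss t (x' - y) * `|h y|))%:E)%E.
 have mf : msble (fun p : 'rV[R]_n * 'rV[R]_n => gauss s (x - p.1) * (gauss t (p.1 - p.2) * `|h p.2|)) by meas.
 by apply: (@msble_int2 _ _ _ _ _ (lebn n) (fun x' y => (gauss s (x - x') * (gauss t (x' - y) * `|h y|))%:E)); [exact: mEFin|move=> x' y; rewrite lee_fin; pos].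
have mf : msble (fun p : 'rV[R]_n * 'rV[R]_n => A (x - p.1) * (B (p.1 - p.2) * h p.2)) by meas.
have [] := @Rint_swap _ _ _ _ _ (lebn n) (lebn n) (fun x' y => A (x - x') * (B (x' - y) * h y)) mf.
- move=> x'; have i := integrableZl measurableT (A (x - x')) (GI_integrable x' t0 gB hG).
 by move: i; apply: eq_integrable.
- move=> y; have i := integrableZr measurableT (h y) (GI_integrable x s0 gA (GIB y)).
 by move: i; apply: eq_integrable => // x' _ /=; rewrite -EFinM mulrA.
- apply: (@le_lt_trans _ _ ((c * c')%:E * \int[lebn n]_x' \int[lebn n]_y (gauss s (x - x') * (gauss t (x' - y) * `|h y|))%:E)%E); last first.
  by rewrite int2_gauss// -EFinM ltry.
 pose I x' := (\int[lebn n]_y (gauss s (x - x') * (gauss t (x' - y) * `|h y|))%:E)%E.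
 have I0 x' : (0 <= I x')%E by apply: int_ge0R => y; pos.
 have -> : ((c * c')%:E * \int[lebn n]_x' I x' = \int[lebn n]_x' ((c * c')%:E * I x'))%E.
  by rewrite ge0_integralZl// lee_fin mulr_ge0.
 apply: ge0_le_integral => //.
 - by move=> x' _; apply: int_ge0R => y; pos.
 - apply: (@msble_int2 _ _ _ _ _ (lebn n) (fun x' y => (`|A (x - x') * (B (x' - y) * h y)|)%:E)).
   by apply: mEFin; exact: (msble_normf mf).
  by move=> x' y; rewrite lee_fin.
 - by apply: measurable_funeM; exact: mI.
 move=> x' _; rewrite -ge0_intZl; try side.
 apply: le_intR; try side; move=> y; rewrite !normrM.
 have -> : c * c' * (gauss s (x - x') * (gauss t (x' - y) * `|h y|)) =
  (c * gauss s (x - x')) * ((c' * gauss t (x' - y)) * `|h y|) by ring.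
 by apply: ler_pM => //; apply: ler_wpM2r.
move=> _ E; transitivity (\int[lebn n]_x' \int[lebn n]_y (A (x - x') * (B (x' - y) * h y))).
 apply: eq_Rintegral => x' _; rewrite /cvl -RintegralZl//.
 exact: GI_integrable gB hG.
rewrite E; apply: eq_Rintegral => y _; rewrite /cvl.
transitivity (\int[lebn n]_x' (A (x - x') * B (x' - y) * h y)); first by apply: eq_Rintegral => x' _; rewrite mulrA.
rewrite RintegralZr//; last exact: (GI_integrable x s0 gA (GIB y)).
congr (_ * _); rewrite -[LHS](@Rint_rV_add _ _ y); last by meas.
by apply: eq_Rintegral => z _; rewrite addrK subrDr.
Qed.

Lemma GI_cvl c t B h : 0 < t -> gdom c t B -> GI h -> GI (cvl B h).
Proof.
move=> t0 gB hG; have [mB Bd] := gB; have [mh _] := hG; have c0 := gdom_ge0 t0 gB.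
have mc := msble_cvl mB mh; split=> [//|s x s0].
have [_ ia] := GI_abs hG.
have mH : msble (heat t (fun y => `|h y|)) by apply: msble_cvl; meas.
apply: (@integrableR_le _ _ _ _ _ (fun x' => c * (gauss s (x - x') * heat t (fun y => `|h y|) x'))); [by meas|by meas| |].
 move=> x'; rewrite normrM ger0_norm ?gauss_ge0// mulrCA ler_wpM2l ?gauss_ge0//.
 exact: cvl_le gB hG.
rewrite ge0_intZl//; last 2 first.
- by meas.
- by move=> x'; rewrite mulr_ge0 ?gauss_ge0// heat_ge0.
rewrite (eq_integral (fun x' => \int[lebn n]_y (gauss s (x - x') * (gauss t (x' - y) * `|h y|))%:E)%E).
 by rewrite int2_gauss// -EFinM ltry.
move=> x' _; rewrite EFinM EFin_heat//; last exact: GI_abs.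
by rewrite ge0_intZl; try side.
Qed.

End gaussian_convolutions.

(** * Iterated Laplacians of the heat kernel *)

Section heat_kernel_derivatives.
Context {R : realType}.
Variable n : nat.
Implicit Types (x y z : 'rV[R]_n) (a b c s t : R) (A B K h u v : 'rV[R]_n -> R) (j k : nat).

Fact psi_key : unit. Proof. exact: tt. Qed.

(* Locked so that unification does not unfold the iteration. *)
Definition psi j t : 'rV[R]_n -> R := locked_with psi_key (iter j (@nlap R n) (gauss t)).

Lemma psiE j t : psi j t = iter j (@nlap R n) (gauss t).
Proof. exact: (locked_withE psi_key). Qed.

Lemma psi0 t : psi 0 t = gauss t. Proof. exact: psiE. Qed.

Lemma psiS j t : psi j.+1 t = nlap (psi j t). Proof. by rewrite !psiE. Qed.

Lemma Fam_psi l b j t : 0 < t -> Fam l b (fun=> psi j t) (psi j t).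
Proof.
move=> t0; elim: j l => [|j IH] l; first by rewrite psi0; exact: Fam_gauss.
by rewrite psiS; exact: (Fam_nlap (IH l.+2)).
Qed.

Lemma cont_psi j t : 0 < t -> continuous (psi j t).
Proof. by move=> t0; have /Fam_cont/(_ 0%N) := Fam_psi 0 0 j t0. Qed.

Lemma msble_psi j t : 0 < t -> msble (psi j t).
Proof. by move=> t0; apply: cont_rV_msble; exact: cont_psi. Qed.

Lemma psi1E t z : 0 < t -> psi 1 t z = (n%:R / (2 * t) - sqn z / (4 * t ^+ 2)) * gauss t z.
Proof.
move=> t0; pose c0 := (4 * pi * t) `^ (- (n%:R / 2)).
pose G (r : R) := c0 * expR (- (r / (4 * t))).
have gE : gauss t = fun y : 'rV[R]_n => G (sqn y) by apply/funext => y; rewrite gaussE.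
have dG (c r : R) : is_derive r 1 (fun r => c * G r) (- c / (4 * t) * G r).
 have h1 : is_derive r (1 : R) (fun r : R => - (4 * t)^-1 * r) (- (4 * t)^-1).
  have := is_deriveZ (- (4 * t)^-1) (is_derive_id r (1 : R)).
  by move=> H; apply: (is_derive_eq H); rewrite /GRing.scale /= mulr1.
 have h2 := is_derive1_comp (is_derive_expR (- (4 * t)^-1 * r)) h1.
 have := is_deriveZ (c * c0) h2.
 have -> : (c * c0) \*: (expR \o (fun r : R => - (4 * t)^-1 * r)) = (fun r => c * G r).
  by apply/funext => w; rewrite /G /= /GRing.scale /= -mulrA mulNr [(4 * t)^-1 * w]mulrC.
 by move=> H; apply: (is_derive_eq H); rewrite /G /GRing.scale /= mulNr [(4 * t)^-1 * r]mulrC; ring.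
have d1 y i : is_derive y (ebase R i) (fun y : 'rV[R]_n => 1 * G (sqn y)) (- 1 / (4 * t) * G (sqn y) * (2 * y ord0 i)).
 by apply: is_derive_radial; exact: dG.
have p1 i : pd i (fun y => G (sqn y)) = fun y => (- (2 * t)^-1 * G (sqn y)) * y ord0 i.
 apply/funext => y; have -> : (fun y => G (sqn y)) = (fun y : 'rV[R]_n => 1 * G (sqn y)) by apply/funext => w; rewrite mul1r.
 by rewrite (pd_val (d1 y i)); field; rewrite gt_eqF.
rewrite psiE /= /nlap gE; transitivity (- \sum_(i < n) ((z ord0 i ^+ 2 / (4 * t ^+ 2) - (2 * t)^-1) * G (sqn z))).
 congr (- _); apply: eq_bigr => i _; rewrite p1.
 have d2 : is_derive z (ebase R i) (fun y : 'rV[R]_n => - (2 * t)^-1 * G (sqn y)) (- (- (2 * t)^-1) / (4 * t) * G (sqn z) * (2 * z ord0 i)).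
  by apply: is_derive_radial; exact: dG.
 have := is_deriveM d2 (is_derive_coord z i i).
 move=> H; apply: (pd_val (is_derive_eq H _)); rewrite /GRing.scale /= eqxx /=; field.
 by rewrite gt_eqF.
rewrite -mulr_suml -mulNr sumrB sumr_const card_ord -mulr_suml -/(sqn z) opprB -mulr_natl.
by congr (_ * _); field; rewrite gt_eqF.
Qed.

Lemma is_derive_gauss t z : 0 < t -> is_derive t 1 (fun t => gauss t z) (- psi 1 t z).
Proof.
move=> t0; have t4 : 0 < 4 * pi * t by rewrite mulr_gt0// mulr_gt0// pi_gt0.
pose a : R := - (n%:R / 2).
have h1 : is_derive t 1 (fun s : R => (4 * pi) `^ a * s `^ a) ((4 * pi) `^ a * (a * t `^ (a - 1))).
 exact: is_derive_powR.
pose e2 (s : R) := - (sqn z / 4) * s `^ (- 1).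
have h2 : is_derive t 1 e2 (- (sqn z / 4) * (- 1 * t `^ (- 1 - 1))).
 exact: is_derive_powR.
have h3 := is_derive1_comp (is_derive_expR (e2 t)) h2.
have H := is_deriveM h1 h3.
have p1 : t `^ (- 1) = t^-1 by rewrite powR_inv1// ltW.
have p2 : t `^ (- 1 - 1) = (t ^+ 2)^-1.
 by rewrite powRD ?(gt_eqF t0) ?implybT// p1 -invfM expr2.
have p3 : t `^ (a - 1) = t `^ a / t by rewrite powRD ?(gt_eqF t0) ?implybT// p1.
have gE s : 0 < s -> gauss s z = (4 * pi) `^ a * s `^ a * expR (- (sqn z / 4) * s `^ (- 1)).
 move=> s0; rewrite gaussE powRM ?(ltW s0) ?mulr_ge0 ?pi_ge0// -/a; congr (_ * expR _).
 by rewrite powR_inv1 ?(ltW s0)// invfM mulrA mulNr.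
apply: (@near_eq_is_derive _ _ _ ((fun s : R => (4 * pi) `^ a * s `^ a) * (expR \o e2))).
 by near=> s; rewrite gE//; near: s; exact: lt_nbhsr.
apply: (is_derive_eq H); rewrite psi1E// gE// /GRing.scale /= /e2 p1 p2 p3 /a; field.
by rewrite gt_eqF.
Unshelve. all: by end_near. Qed.

Lemma psi1_bound : exists2 C : R, 0 <= C & forall t z, 0 < t -> `|psi 1 t z| <= C / t * gauss (2 * t) z.
Proof.
pose D : R := 2 `^ (n%:R / 2).
have D0 : 0 <= D := powR_ge0 _ _.
exists (n%:R / 2 * D + 2 * D); first by rewrite addr_ge0 ?mulr_ge0 ?divr_ge0.
move=> t z t0; have g0 := gauss_ge0 t z; have gg0 := gauss_ge0 (2 * t) z.
rewrite psi1E// mulrBl; apply: le_trans (ler_normB _ _) _.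
rewrite !ger0_norm; try pos; rewrite ?mulr_ge0 ?invr_ge0 ?(ltW t0) ?exprn_ge0 ?sqn_ge0//; try exact: ltW.
have h1 : gauss t z <= D * gauss (2 * t) z.
 have t2 : t <= 2 * t by lra.
 have := gauss_time z t0 t2.
 by rewrite (_ : 2 * t / t = 2)// mulfK ?gt_eqF.
have h2 := gauss_sqn_le z t0; rewrite -/D in h2.
have -> : n%:R / (2 * t) * gauss t z = n%:R / 2 / t * gauss t z by field; rewrite gt_eqF.
have -> : sqn z / (4 * t ^+ 2) * gauss t z = (4 * t)^-1 * (gauss t z * (sqn z / t)) by field; rewrite gt_eqF.
have -> : (n%:R / 2 * D + 2 * D) / t * gauss (2 * t) z = n%:R / 2 / t * (D * gauss (2 * t) z) +
  (4 * t)^-1 * (8 * D * gauss (2 * t) z) by field; rewrite gt_eqF.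
apply: lerD; apply: ler_wpM2l => //.
 by rewrite divr_ge0 ?divr_ge0// ltW.
by rewrite invr_ge0 mulr_ge0// ltW.
Qed.

Lemma bwint_psi j t : 0 < t -> bwint 0 (psi j t).
Proof.
move=> t0; split; first exact: msble_psi.
have [C C0 B] := Fam_bound (Fam_psi 0 (n%:R + 1) j t0).
apply: (@le_int_lty _ _ _ _ _ (fun y => C * bw (n%:R + 1) y)).
- by move=> y; rewrite mulr_ge0 ?bw_ge0.
- by have mp := msble_psi j t0; have mb := @msble_bw R n 0; meas.
- by apply: measurable_funM => //; exact: msble_bw.
- by move=> y; rewrite bw0 mulr1; exact: (B 0%N).
have h0 : 0 <= n%:R + 1 :> R by pos.
have hh : 0 < 2^-1 :> R by rewrite invr_gt0.
have i := @int_wt R n 2^-1 hh.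
apply: (@le_lt_trans _ _ ((2 * C)%:E * \int[lebn n]_y (wt (n%:R + 2 * 2^-1) y)%:E)%E).
 rewrite -ge0_intZl ?mulr_ge0//; [|exact: msble_wt|by move=> y; exact: wt_ge0].
 apply: le_intR.
 - by move=> y; rewrite mulr_ge0 ?bw_ge0.
 - by apply: measurable_funM => //; exact: msble_bw.
 - by apply: measurable_funM => //; exact: msble_wt.
 move=> y; rewrite -mulrA mulrCA ler_wpM2l//; apply: le_trans (bw_wt _ _); last first.
  by rewrite mulfV// h0.
 rewrite mulfV//; apply: bw_le; rewrite ler_pdivrMr//; lra.
by rewrite lte_mul_pinfty ?lee_fin ?mulr_ge0//; apply: i; lra.
Qed.

(** The Laplacian commutes with convolution, so derivatives falling on either factor can be
    collected outside the semigroup identity for the Gaussians. *)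
Lemma psi_conv (i j : nat) s t x : 0 < s -> 0 < t -> cvl (psi i s) (psi j t) x = psi (i + j) (s + t) x.
Proof.
move=> s0 t0; have st0 := addr_gt0 s0 t0.
have step k l r w : 0 < r -> 0 < w -> iter k (@nlap R n) (cvl (gauss r) (psi l w)) = cvl (psi k r) (psi l w).
 move=> r0 w0; elim: k => [|k IH] /=; first by rewrite psi0.
 rewrite IH psiS.
 by rewrite (cvl_nlap (lexx 0) (Fam_psi 2 0 k r0) (bwint_psi l w0)).
have gg r w : 0 < r -> 0 < w -> cvl (gauss r) (psi 0 w) = @gauss R n (r + w).
 by move=> r0 w0; apply/funext => y; rewrite psi0 /cvl /Rintegral gauss_semigroup.
rewrite -step//.
have -> : cvl (gauss s) (psi j t) = psi j (t + s).
 apply/funext => y; rewrite cvlC; [|by meas|exact: msble_psi].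
 by rewrite -(psi0 s) -(step j 0%N) ?gg// psiE.
by rewrite !psiE iterD addrC.
Qed.

(** Halving the time, [psi j.+1 t] is the convolution of [psi 1 (t / 2)] with [psi j (t / 2)]. The
    Gaussian majorants of time [t] convolve to one of time [2 * t], whatever [j] is; the halved
    times produce the factor [2 ^+ j.+1]. *)
Lemma psi_bound j : exists2 C : R, 0 <= C & forall t z, 0 < t -> `|psi j t z| <= C * t ^- j * gauss (2 * t) z.
Proof.
elim: j => [|j [C C0 CP]].
 exists (2 `^ (n%:R / 2)) => [|t z t0]; first exact: powR_ge0.
 rewrite psi0 expr0 invr1 mulr1 ger0_norm ?gauss_ge0//.
 have t2 : t <= 2 * t by lra.
 by have := gauss_time z t0 t2; rewrite (_ : 2 * t / t = 2)// mulfK ?gt_eqF.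
have [D D0 DP] := psi1_bound.
exists (2 ^+ j.+1 * (D * C)) => [|t z t0]; first by rewrite !mulr_ge0 ?exprn_ge0.
have h0 : 0 < t / 2 by rewrite divr_gt0.
have ht : 2 * (t / 2) = t by field.
have gA : gdom (D / (t / 2)) t (psi 1 (t / 2)).
 by split=> [|y]; [exact: msble_psi|have := DP (t / 2) y h0; rewrite ht].
have hB : forall y, `|psi j (t / 2) y| <= C * (t / 2) ^- j * gauss t y by move=> y; have := CP (t / 2) y h0; rewrite ht.
rewrite [t in psi _ t](splitr t) -(psi_conv 1 j z h0 h0).
have DD : 0 <= D / (t / 2) by rewrite divr_ge0// ltW.
have CC : 0 <= C * (t / 2) ^- j by rewrite mulr_ge0// invr_ge0 exprn_ge0// ltW.
have H : intgr (lebn n) (fun y => gauss t (z - y) * gauss t y).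
 apply: integrableR; first by meas.
 under eq_integral do rewrite ger0_norm ?mulr_ge0 ?gauss_ge0//.
 by rewrite gauss_semigroup// ltry.
have H' := integrableZl measurableT (D / (t / 2) * (C * (t / 2) ^- j)) H.
have mA := msble_psi 1 h0; have mB := msble_psi j h0.
have le y : `|psi 1 (t / 2) (z - y) * psi j (t / 2) y| <= D / (t / 2) * (C * (t / 2) ^- j) * (gauss t (z - y) * gauss t y).
 by rewrite normrM mulrACA; apply: ler_pM => //; case: gA.
have i : intgr (lebn n) (fun y => psi 1 (t / 2) (z - y) * psi j (t / 2) y).
 apply: (le_integrable measurableT _ _ H'); first by apply: mEFin; meas.
 by move=> y _ /=; rewrite lee_fin; apply: le_trans (le y) (ler_norm _).
apply: le_trans (le_normr_Rintegral _ i) _ => //.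
apply: (@le_trans _ _ (\int[lebn n]_y (D / (t / 2) * (C * (t / 2) ^- j) * (gauss t (z - y) * gauss t y)))).
 apply: le_Rintegral => //; first exact: integrable_norm i.
rewrite RintegralZl// [X in _ * X](_ : _ = gauss (2 * t) z); last first.
 by rewrite /Rintegral gauss_semigroup//= mulr_natl mulr2n.
rewrite ler_wpM2r ?gauss_ge0// exprS invfM exprMn exprVn invfM !invrK le_eqVlt; apply/orP; left; apply/eqP.
by rewrite exprS invfM; ring.
Qed.

End heat_kernel_derivatives.

(** * Time derivatives and decay of the heat flow *)

Section heat_flow.
Context {R : realType}.
Variable n : nat.
Implicit Types (x y z : 'rV[R]_n) (a b c s t : R) (A B K h u v : 'rV[R]_n -> R) (j k : nat).

Lemma gdom_psi j : exists2 C : R, 0 <= C & forall t, 0 < t -> gdom (C * t ^- j) (2 * t) (@psi R n j t).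
Proof.
by have [C C0 P] := @psi_bound R n j; exists C => // t t0; split=> [|z]; [exact: msble_psi|exact: P].
Qed.

Lemma GI_psi j t v : 0 < t -> GI v -> GI (cvl (psi j t) v).
Proof. by move=> t0; have [C C0 P] := gdom_psi j; apply: GI_cvl (P t t0); rewrite mulr_gt0. Qed.

Lemma cvl_psi_conv (i j : nat) s t v x : 0 < s -> 0 < t -> GI v ->
 cvl (psi i s) (cvl (psi j t) v) x = cvl (psi (i + j) (s + t)) v x.
Proof.
move=> s0 t0 vG; have [C C0 P] := gdom_psi i; have [D D0 Q] := gdom_psi j.
rewrite (cvl_assoc x _ _ (P s s0) (Q t t0) vG) ?mulr_gt0//.
by congr (cvl _ v x); apply/funext => y; exact: psi_conv.
Qed.

Lemma is_derive_heat t v x : 0 < t -> GI v -> is_derive t 1 (fun s => heat s v x) (- cvl (psi 1 t) v x).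
Proof.
move=> t0 vG; have [mv iv] := vG; have [C C0 CP] := @psi1_bound R n.
pose f s y := gauss s (x - y) * v y.
have df s y : 0 < s -> is_derive s 1 (f ^~ y) (- psi 1 s (x - y) * v y).
 move=> s0; have := is_deriveM (is_derive_gauss (x - y) s0) (is_derive_cst (v y) s 1).
 by move=> H; apply: (is_derive_eq H); rewrite /GRing.scale /= mulr0 add0r mulrC.
have d1 s y : 0 < s -> partial1of2 f s y = - psi 1 s (x - y) * v y.
 by move=> s0; rewrite partial1of2E; have [_ ->] := df s y s0.
(* For times in $(t/2,2t)$ the bound on [psi 1] has Gaussian time at most [4 * t], so by
   [gauss_time] one Gaussian of that time dominates. *)
pose I : set R := `](t / 2), (2 * t)[%classic.
have It : I t by rewrite /I /= in_itv /=; apply/andP; split; lra.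
have I0 s : I s -> 0 < s by rewrite /I /= in_itv /= => /andP[s1 _]; lra.
pose D : R := C / (t / 2) * 4 `^ (n%:R / 2).
have D0 : 0 <= D by rewrite mulr_ge0 ?powR_ge0// divr_ge0// ltW// divr_gt0.
pose G y := D * `|gauss (4 * t) (x - y) * v y|.
have t4 : 0 < 4 * t by rewrite mulr_gt0.
have iG : intgr (lebn n) G.
 by have := integrableZl measurableT D (integrable_norm (iv (4 * t) x t4)); apply: eq_integrable.
have intf s : I s -> intgr (lebn n) (f s) by move=> /I0 s0; exact: iv.
have derf s y : I s -> setT y -> derivable (f ^~ y) s 1 by move=> /I0 s0 _; have [] := df s y s0.
have G0 y : 0 <= G y by rewrite mulr_ge0.
have Gub s y : I s -> setT y -> `|partial1of2 f s y| <= G y.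
 move=> Is _; have s0 := I0 s Is; rewrite d1// normrM normrN /G normrM (ger0_norm (gauss_ge0 _ _)) mulrA.
 apply: ler_wpM2r => //; apply: le_trans (CP s _ s0) _.
 move: Is; rewrite /I /= in_itv /= => /andP[s1 s2].
 have s20 : 0 < 2 * s by rewrite mulr_gt0.
 have ss : 2 * s <= 4 * t by lra.
 have := gauss_time (x - y) s20 ss => H.
 rewrite /D -[leRHS]mulrA; apply: ler_pM.
 - by rewrite divr_ge0// ltW.
 - exact: gauss_ge0.
 - by rewrite ler_wpM2l// lef_pV2 ?posrE ?divr_gt0// ltW.
 apply: le_trans H _; apply: ler_wpM2r; first exact: gauss_ge0.
 apply: ge0_ler_powR; rewrite ?nnegrE ?divr_ge0 ?(ltW t4) ?(ltW s20)//.
 rewrite ler_pdivrMr//; lra.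
have DD := derivable_under_integral measurableT It intf derf G0 iG Gub.
have VV := differentiation_under_integral measurableT It intf derf G0 iG Gub.
split; first exact: DD.
rewrite -derive1E; transitivity (\int[lebn n]_y partial1of2 f t y); first exact: VV.
rewrite /cvl -mulN1r -RintegralZl//; last first.
 have [C' C'0 P] := gdom_psi 1; apply: GI_integrable (P t t0) vG; by rewrite mulr_gt0.
by apply: eq_Rintegral => y _; rewrite d1// mulN1r mulNr.
Qed.

(** Freezing [psi j] at time [t / 2] and letting the remaining time [s - t / 2] vary reduces the
    claim to the heat equation for a single function. *)
Lemma is_derive_cvl_psi j t v x : 0 < t -> GI v ->
 is_derive t 1 (fun s => cvl (psi j s) v x) (- cvl (psi j.+1 t) v x).
Proof.
move=> t0 vG; have h0 : 0 < t / 2 by rewrite divr_gt0.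
have UG := GI_psi j h0 vG; have D := is_derive_heat x h0 UG.
pose e (s : R) := s - t / 2.
have D1 : is_derive t 1 e (1 : R).
 have := is_deriveB (is_derive_id t (1 : R)) (is_derive_cst (t / 2) t 1).
 by move=> H; apply: (is_derive_eq H); rewrite subr0.
have D' : is_derive (e t) 1 (fun s => heat s (cvl (psi j (t / 2)) v) x) (- cvl (psi 1 (t / 2)) (cvl (psi j (t / 2)) v) x).
 by rewrite (_ : e t = t / 2)// /e; field.
have H := is_derive1_comp D' D1.
apply: (@near_eq_is_derive _ _ _ _ _ _ _ _ _); last first.
 by apply: (is_derive_eq H); rewrite cvl_psi_conv// mulr1 add1n -splitr.
near=> s; have s0 : 0 < s - t / 2.
 by rewrite subr_gt0; near: s; apply: lt_nbhsr; lra.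
by rewrite /= -[heat _ _ _]/(cvl (gauss _) _ _) -psi0 cvl_psi_conv// add0n subrK.
Unshelve. all: by end_near. Qed.

Lemma Ls_wt_integrable g v x : 0 <= g -> msble v -> Ls g v ->
 intgr (lebn n) (fun y => `|v y| * wt (n%:R + 2 * g) (x - y)).
Proof.
move=> g0 mv vL; have a0 : 0 <= n%:R + 2 * g :> R by rewrite addr_ge0// mulr_ge0.
have i : intgr (lebn n) (fun z => `|v (x - z)| * wt (n%:R + 2 * g) z).
 apply: integrableR; first by meas.
 under eq_integral do rewrite ger0_norm ?mulr_ge0 ?wt_ge0//.
 apply: le_lt_trans (int_shift_wt_sub a0 (lexx _) mv) _.
 by rewrite lte_mul_pinfty ?lee_fin ?(Ls_lty mv vL)// mulr_ge0 ?addr_ge0 ?powR_ge0.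
have := integrable_rV_subr x i; apply: eq_integrable => // y _ /=.
by rewrite subKr.
Qed.

Lemma Ls_GI g v : 0 <= g -> msble v -> Ls g v -> GI v.
Proof.
move=> g0 mv vL; split=> // t x t0; have [C C0 CP] := @gauss_wt R n g t g0 t0.
have := integrableZl measurableT (C * t `^ g) (Ls_wt_integrable x g0 mv vL).
apply: le_integrable => //; first by apply: mEFin; meas.
move=> y _ /=; rewrite lee_fin normrM ger0_norm ?gauss_ge0// [leRHS]ger0_norm; last first.
 by rewrite !mulr_ge0 ?powR_ge0 ?wt_ge0// ltW.
by rewrite [`|v y| * _]mulrC mulrA ler_wpM2r// CP.
Qed.

(** The rate combines $t^{-j}$ from the kernel bound with the growth $t^g$ that [gauss_wt] allows
    for a function in [Ls]. For [j >= 1] it is decay, for [j = 0] it is not. *)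
Lemma cvl_psi_decay g v x j t0 : 0 <= g -> 0 < t0 -> msble v -> Ls g v ->
 exists2 C : R, 0 <= C & forall t, t0 <= t -> `|cvl (psi j t) v x| <= C * t `^ (g - j%:R).
Proof.
move=> g0 t00 mv vL; have vG := Ls_GI g0 mv vL.
have [C C0 CP] := gdom_psi j; have [D D0 DP] := @gauss_wt R n g t0 g0 t00.
have iw := Ls_wt_integrable x g0 mv vL.
pose W := \int[lebn n]_y (`|v y| * wt (n%:R + 2 * g) (x - y)).
have W0 : 0 <= W by apply: Rintegral_ge0 => y _; rewrite mulr_ge0 ?wt_ge0.
exists (C * (D * 2 `^ g * W)) => [|t tt]; first by rewrite !mulr_ge0 ?powR_ge0// ltW.
have tp : 0 < t := lt_le_trans t00 tt; have t2 : 0 < 2 * t by rewrite mulr_gt0.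
apply: le_trans (cvl_le x t2 (CP t tp) vG) _.
have tj : t `^ (g - j%:R) = t ^- j * t `^ g.
 by rewrite powRD ?(gt_eqF tp) ?implybT// powRN powR_mulrn ?(ltW tp)// mulrC.
rewrite tj -!mulrA; apply: ler_wpM2l => //.
have -> : D * (2 `^ g * (W * (t ^- j * t `^ g))) = t ^- j * (D * (2 * t) `^ g * W).
 by rewrite powRM// ?ltW//; ring.
apply: ler_wpM2l; first by rewrite invr_ge0 exprn_ge0// ltW.
have c0 : 0 <= D * (2 * t) `^ g by rewrite mulr_ge0 ?powR_ge0// ltW.
have [_ ia] := GI_abs vG.
rewrite -RintegralZl//; apply: le_Rintegral => //; first exact: ia.
 by have := integrableZl measurableT (D * (2 * t) `^ g) iw; apply: eq_integrable.
move=> y _; rewrite [`|v y| * _]mulrC mulrA ler_wpM2r// DP//; lra.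
Qed.

End heat_flow.

(** * Short-time behaviour and moments of the Gaussian *)

Section small_time.
Context {R : realType}.
Variable n : nat.
Implicit Types (x y z : 'rV[R]_n) (a b c s t : R) (A B K h u v : 'rV[R]_n -> R) (j k : nat).

(** For $t \le 1/2$ and $|z| \ge r$ the exponent $|z|^2/(4t)$ is at least $r^2/(8t)+|z|^2/4$. The
    second part is the unit-time Gaussian, and the first beats any power of [t]; [t ^+ 2] is chosen
    to survive division by [t] in the generator. *)
Lemma gauss_far (r : R) : 0 < r -> exists2 C : R, 0 <= C &
 forall t z, 0 < t -> t <= 2^-1 -> r <= enorm z -> gauss t z <= C * t ^+ 2 * gauss 1 z.
Proof.
move=> r0; pose a : R := n%:R / 2; pose b : R := a + 2.
have a0 : 0 <= a by rewrite divr_ge0.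
have b0 : 0 < b by rewrite ltr_wpDl.
pose C : R := b `^ b * (r ^+ 2 / 8) `^ (- b).
exists C => [|t z t0 t1 rz]; first by rewrite mulr_ge0 ?powR_ge0.
have rz2 : r ^+ 2 <= sqn z by rewrite -enorm_sqr ler_sqr ?nnegrE ?enorm_ge0// ltW.
rewrite !gaussE -/a !mulr1 powRM ?(ltW t0) ?mulr_ge0 ?pi_ge0// -mulrA [C * _ * _]mulrCA.
rewrite ler_wpM2l ?powR_ge0//.
pose y : R := r ^+ 2 / 8 / t.
have y0 : 0 < y by rewrite !divr_gt0 ?exprn_gt0.
have e1 : expR (- (sqn z / (4 * t))) <= expR (- y) * expR (- (sqn z / 4)).
 rewrite -expRD ler_expR /y.
 have -> : sqn z / (4 * t) = sqn z / 4 / t by field; rewrite gt_eqF.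
 have rS : r ^+ 2 / 8 <= sqn z / 4 / 2 by lra.
 have S0 : 0 <= sqn z / 4 by rewrite divr_ge0 ?sqn_ge0.
 have : sqn z / 4 <= (sqn z / 4 - r ^+ 2 / 8) / t by rewrite ler_pdivlMr//; nra.
 by rewrite mulrBl; lra.
have e2 : t `^ (- a) * expR (- y) <= C * t ^+ 2.
 have := powR_le_expR b0 (ltW y0) => H.
 have h1 : expR (- y) <= b `^ b * y `^ (- b).
  by rewrite expRN powRN ler_pdivlMr ?powR_gt0// mulrC ler_pdivrMr ?expR_gt0.
 apply: (@le_trans _ _ (t `^ (- a) * (b `^ b * y `^ (- b)))); first by rewrite ler_wpM2l ?powR_ge0.
 have -> : y `^ (- b) = (r ^+ 2 / 8) `^ (- b) * t `^ b.
  rewrite /y powRM ?invr_ge0 ?divr_ge0 ?exprn_ge0 ?(ltW t0) ?(ltW r0)//; congr (_ * _).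
  by rewrite -(powR_inv1 (ltW t0)) -powRrM mulrNN mul1r.
 have -> : t ^+ 2 = t `^ (- a) * t `^ b.
  by rewrite -powRD ?(gt_eqF t0) ?implybT// /b addKr powR_mulrn// ltW.
 by rewrite /C le_eqVlt; apply/orP; left; apply/eqP; ring.
apply: (@le_trans _ _ (t `^ (- a) * expR (- y) * expR (- (sqn z / 4)))).
 by rewrite -mulrA ler_wpM2l ?powR_ge0.
by rewrite ler_wpM2r ?expR_ge0.
Qed.

(* Only the values of D near the origin matter as t tends to 0. *)
Lemma heat_local (D E : 'rV[R]_n -> R) (e r : R) : 0 < r -> 0 <= e ->
 msble D -> intgr (lebn n) (fun z => gauss 1 z * D z) ->
 (forall t, 0 < t -> intgr (lebn n) (fun z => gauss t z * E z)) ->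
 (forall z, 0 <= E z) -> (forall z, enorm z <= r -> `|D z| <= e * E z) ->
 exists2 C : R, 0 <= C & forall t, 0 < t -> t <= 2^-1 ->
  intgr (lebn n) (fun z => gauss t z * D z) /\
  `|\int[lebn n]_z (gauss t z * D z)| <= e * \int[lebn n]_z (gauss t z * E z) + C * t ^+ 2.
Proof.
move=> r0 e0 mD iD iE E0 DE; have [C C0 CP] := gauss_far r0.
have iaD := integrable_norm iD.
pose M := \int[lebn n]_z `|gauss 1 z * D z|.
have M0 : 0 <= M by apply: Rintegral_ge0.
exists (C * M) => [|t t0 t1]; first exact: mulr_ge0.
have i1 := integrableZl measurableT e (iE t t0).
have i2 := integrableZl measurableT (C * t ^+ 2) iaD.
have i12 : intgr (lebn n) (fun z => e * (gauss t z * E z) + C * t ^+ 2 * `|gauss 1 z * D z|).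
 by have := integrableD measurableT i1 i2; apply: eq_integrable.
have le z : `|gauss t z * D z| <= e * (gauss t z * E z) + C * t ^+ 2 * `|gauss 1 z * D z|.
 rewrite normrM ger0_norm ?gauss_ge0//; have [zr|rz] := leP (enorm z) r.
  apply: ler_wpDr; first by rewrite !mulr_ge0 ?exprn_ge0// ltW.
  by rewrite mulrCA ler_wpM2l ?gauss_ge0// DE.
 apply: ler_wpDl; first by rewrite !mulr_ge0 ?gauss_ge0.
 by rewrite normrM (ger0_norm (gauss_ge0 _ _)) mulrA ler_wpM2r// CP// ltW.
have it : intgr (lebn n) (fun z => gauss t z * D z).
 apply: (le_integrable measurableT _ _ i12); first by apply: mEFin; meas.
 by move=> z _ /=; rewrite lee_fin; apply: le_trans (le z) (ler_norm _).
split=> //; apply: le_trans (le_normr_Rintegral _ it) _ => //.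
have -> : e * \int[lebn n]_z (gauss t z * E z) + C * M * t ^+ 2 =
  \int[lebn n]_z (e * (gauss t z * E z) + C * t ^+ 2 * `|gauss 1 z * D z|).
 rewrite RintegralD//.
 by rewrite RintegralZl ?iE// RintegralZl// mulrAC.
by apply: le_Rintegral => //; exact: integrable_norm it.
Qed.

Lemma heat_one t x : 0 < t -> heat t (fun=> 1) x = 1 :> R.
Proof.
move=> t0; rewrite /heat; under eq_Rintegral do rewrite mulr1.
by rewrite (Rint_rV_subr x (f := gauss t)); [rewrite /Rintegral int_gauss|meas].
Qed.

Lemma GI_one : GI (fun _ : 'rV[R]_n => 1).
Proof.
split=> // t x t0; have := integrable_gauss x t0; apply: eq_integrable => // y _ /=.
by rewrite mulr1.
Qed.

Lemma gauss_sdiff_int t u x : 0 < t -> GI u ->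
 intgr (lebn n) (fun z => gauss t z * sdiff u x z) /\
 \int[lebn n]_z (gauss t z * sdiff u x z) = 2 * (u x - heat t u x).
Proof. by move=> t0 [mu iu]; apply: int_gauss_sdiff => //; exact: iu. Qed.

Lemma integrable_gauss0 t : 0 < t -> intgr (lebn n) (fun z => gauss t z * 1).
Proof.
move=> t0; have := integrable_gauss (0 : 'rV[R]_n) t0; apply: eq_integrable => // z _ /=.
by rewrite sub0r gaussN mulr1.
Qed.

(** The error [u x - heat t u x] is half the Gaussian average of [sdiff u x], which is small near
    the origin by continuity and negligible elsewhere by [heat_local]. *)
Lemma cvg_heat u x : GI u -> {for x, continuous u} -> heat t u x @[t --> 0^'+] --> u x.
Proof.
move=> uG cu; have [mu iu] := uG; apply/cvgrPdist_le => e e0.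
have [d d0 dP] := (enorm_continuousP u x).1 cu (e / 2) (divr_gt0 e0 (ltr0n _ 2)).
have d20 : 0 < d / 2 by rewrite divr_gt0.
have sm z : enorm z <= d / 2 -> `|sdiff u x z| <= e * 1.
 move=> zd; have zd' : enorm z < d by lra.
 have h1 := dP (x + z); have h2 := dP (x - z).
 rewrite opprD addrA subrr add0r enormN in h1; rewrite subKr in h2.
 have -> : sdiff u x z = (u x - u (x + z)) + (u x - u (x - z)) by rewrite /sdiff; ring.
 by apply: le_trans (ler_normD _ _) _; rewrite mulr1 (splitr e) lerD ?h1 ?h2.
have [i1 _] := gauss_sdiff_int x (ltr01 : 0 < 1 :> R) uG.
have [C C0 CP] := heat_local d20 (ltW e0) (msble_sdiff x mu) i1 integrable_gauss0 (fun=> ler01) sm.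
near=> t; have t0 : 0 < t by near: t; exact: nbhs_right_gt.
have t1 : t <= 2^-1 by near: t; apply: nbhs_right_le; rewrite invr_gt0.
have tC : t <= e / (C + 1) by near: t; apply: nbhs_right_le; rewrite divr_gt0// ltr_wpDl.
have te : C * t <= e by move: tC; rewrite ler_pdivlMr ?ltr_wpDl//; nra.
have [it] := CP t t0 t1; have [_ ->] := gauss_sdiff_int x t0 uG.
have -> : \int[lebn n]_z (gauss t z * 1) = 1.
 by under eq_Rintegral do rewrite mulr1; rewrite /Rintegral int_gauss.
rewrite normrM ger0_norm// => H; suff : C * t ^+ 2 <= e by lra.
apply: le_trans te; rewrite ler_wpM2l// expr2 ler_piMl ?(ltW t0)//; lra.
Unshelve. all: by end_near. Qed.

(** The total mass 1 does not depend on time, so [psi 1 t] has integral 0; by [psi1E] this is a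
    linear equation for the second moment. *)
Lemma gauss_sqn_integrable t : 0 < t -> intgr (lebn n) (fun z => gauss t z * sqn z) /\
 \int[lebn n]_z (gauss t z * sqn z) = 2 * n%:R * t.
Proof.
move=> t0; have t2 : 0 < 2 * t by rewrite mulr_gt0.
have i : intgr (lebn n) (fun z => gauss t z * sqn z).
 have := integrableZl measurableT (8 * 2 `^ (n%:R / 2) * t) (integrable_gauss0 t2).
 apply: le_integrable => //; first by apply: mEFin; meas.
 move=> z _ /=; rewrite lee_fin mulr1 !ger0_norm ?mulr_ge0 ?gauss_ge0 ?sqn_ge0 ?powR_ge0 ?(ltW t0)//.
 have := gauss_sqn_le z t0; rewrite mulrA ler_pdivrMr// => H; apply: le_trans H _.
 by apply: eq_leW; ring.
split=> //.
have D := is_derive_heat 0 t0 GI_one.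
have D0 : is_derive t 1 (fun s => heat s (fun=> 1) (0 : 'rV[R]_n)) 0.
 have D1 : is_derive t (1 : R) (fun _ : R => 1 : R) 0 by exact: is_derive_cst.
 apply: near_eq_is_derive D1.
 by near=> s; rewrite heat_one//; near: s; exact: lt_nbhsr.
have E : cvl (psi 1 t) (fun=> 1) (0 : 'rV[R]_n) = 0.
 by apply: oppr_inj; rewrite oppr0; have [_ <-] := D; have [_ <-] := D0.
have E2 : cvl (psi 1 t) (fun=> 1) (0 : 'rV[R]_n) =
  \int[lebn n]_z (n%:R / (2 * t) * (gauss t z * 1) - (4 * t ^+ 2)^-1 * (gauss t z * sqn z)).
 by apply: eq_Rintegral => z _; rewrite sub0r psi1E// sqnN gaussN; field; rewrite gt_eqF.
have i1 := integrable_gauss0 t0.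
have j1 := integrableZl measurableT (n%:R / (2 * t)) i1.
have j2 := integrableZl measurableT (4 * t ^+ 2)^-1 i.
move: E; rewrite E2 RintegralB//.
rewrite RintegralZl// RintegralZl//.
have -> : \int[lebn n]_z (gauss t z * 1) = 1.
 by under eq_Rintegral do rewrite mulr1; rewrite /Rintegral int_gauss.
move/eqP; rewrite subr_eq0 => /eqP H.
rewrite -[LHS]mul1r -(@mulfV _ (4 * t ^+ 2)); last by rewrite mulf_neq0 ?expf_neq0 ?gt_eqF.
by rewrite -[LHS]mulrA -H; field; rewrite gt_eqF.
Unshelve. all: by end_near. Qed.

Lemma gauss_coord_integrable t (i j : 'I_n) : 0 < t ->
 intgr (lebn n) (fun z => gauss t z * (z ord0 i * z ord0 j)).
Proof.
move=> t0; have [iq _] := gauss_sqn_integrable t0.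
have mi := @msble_coord R n i; have mj := @msble_coord R n j.
apply: (le_integrable measurableT _ _ iq); first by apply: mEFin; meas.
move=> z _ /=; rewrite lee_fin normrM [leRHS]ger0_norm ?mulr_ge0 ?gauss_ge0 ?sqn_ge0// (ger0_norm (gauss_ge0 _ _)) normrM.
rewrite ler_wpM2l ?gauss_ge0// -enorm_sqr expr2.
by apply: ler_pM => //; exact: coord_le_enorm.
Qed.

(** The integrand is odd under the reflection of the [i]-th coordinate, which preserves the measure
    and the Gaussian. *)
Lemma gauss_cross t (i j : 'I_n) : 0 < t -> i != j ->
 \int[lebn n]_z (gauss t z * (z ord0 i * z ord0 j)) = 0.
Proof.
move=> t0 ij; have mi := @msble_coord R n i; have mj := @msble_coord R n j.
pose s : 'rV[R]_n := \row_k (if k == i then - 1 else 1).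
have s1 (k : 'I_n) : `|s ord0 k| = 1 by rewrite mxE; case: eqP => _; rewrite ?normrN normr1.
pose F z := gauss t z * (z ord0 i * z ord0 j).
have mF : msble F by rewrite /F; meas.
have FE z : F (affV s 0 z) = - F z.
 rewrite /F !mxE eqxx (negbTE (_ : j != i)); last by rewrite eq_sym.
 have -> : gauss t (affV s 0 z) = gauss t z.
  rewrite !gaussE (_ : sqn (affV s 0 z) = sqn z)//; apply: eq_bigr => k _.
  by rewrite !mxE addr0 exprMn; case: eqP => _; rewrite ?sqrrN expr1n mul1r.
 by ring.
have : \int[lebn n]_z F (affV s 0 z) = \int[lebn n]_z F z.
 by rewrite /Rintegral (integral_rV_affV 0 s1 (mEFin mF)).
have -> : \int[lebn n]_z F (affV s 0 z) = - \int[lebn n]_z F z.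
 rewrite -[RHS]mulN1r -RintegralZl//; last exact: gauss_coord_integrable.
 by apply: eq_Rintegral => z _; rewrite FE mulN1r.
by rewrite -/F; lra.
Qed.

End small_time.

Lemma Rint_sum {R : realType} d (T : measurableType d) (mu : {measure set T -> \bar R})
 (I : Type) (r : seq I) (f : I -> T -> R) : (forall i, intgr mu (f i)) ->
 intgr mu (fun x => \sum_(i <- r) f i x) /\
 \int[mu]_x (\sum_(i <- r) f i x) = \sum_(i <- r) \int[mu]_x f i x.
Proof.
move=> fi; elim: r => [|i r [ir er]].
 split; first by under eq_fun do rewrite /= big_nil; exact: integrable0.
 by under eq_Rintegral do rewrite big_nil; rewrite big_nil Rintegral_cst// mul0r.
split; first by have := integrableD measurableT (fi i) ir; apply: eq_integrable => // x _ /=; rewrite big_cons.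
by under eq_Rintegral do rewrite big_cons; rewrite RintegralD// er big_cons.
Qed.

(** * Second moments coordinate by coordinate *)

Section second_moments.
Context {R : realType}.

(** The one-dimensional case of the total second moment, transported through row vectors of length
    1. *)
Lemma int_sqr_g1 (t : R) : 0 < t -> (\int[leb1]_x (x ^+ 2 * g1 t x)%:E = (2 * t)%:E)%E.
Proof.
move=> t0; have t2 : 0 < 2 * t by rewrite mulr_gt0.
pose K : R := 8 * 2 `^ (1%:R / 2) * t.
have K0 : 0 <= K by rewrite !mulr_ge0 ?powR_ge0// ltW.
have mg s : msble (g1 s : R -> R) by rewrite /g1; meas.
have gg s (x : R) : 0 < s -> gauss s (const_mx x : 'rV[R]_1) = g1 s x.
 by move=> s0; rewrite gauss_prod// big_ord1 mxE.
have m1 : msble (fun x : R => x ^+ 2 * g1 t x).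
 by apply: measurable_funM; [exact: measurable_funX|exact: mg].
have p x : 0 <= x ^+ 2 * g1 t x by apply: mulr_ge0; [exact: sqr_ge0|exact: g1_ge0].
have fin : (\int[leb1]_x (x ^+ 2 * g1 t x)%:E < +oo)%E.
 apply: (@le_int_lty _ _ _ _ _ (fun x => K * g1 (2 * t) x)) => //.
 - by apply: measurable_funM => //; exact: mg.
 - move=> x; have := gauss_sqn_le (const_mx x : 'rV[R]_1) t0.
  rewrite !gg// /sqn big_ord1 mxE mulrA ler_pdivrMr// => H; rewrite mulrC; apply: (le_trans H).
  by rewrite /K le_eqVlt; apply/orP; left; apply/eqP; ring.
 rewrite (ge0_intZl leb1 K0 (mg (2 * t)) (fun x => g1_ge0 _ x)).
 by rewrite int_g1// mule1 ltry.
pose c : R := fine (\int[leb1]_x (x ^+ 2 * g1 t x)%:E).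
have cE : (\int[leb1]_x (x ^+ 2 * g1 t x)%:E = c%:E)%E.
 by rewrite fineK// ge0_fin_numE//; exact: int_ge0R.
have := @int_rV_prod R 1 (fun _ x => x ^+ 2 * g1 t x) (fun=> c) (fun=> m1) (fun=> p) (fun=> cE).
have [_] := @gauss_sqn_integrable R 1 t t0.
rewrite /Rintegral (eq_integral (fun z : 'rV[R]_1 => (\prod_(i < 1) (z ord0 i ^+ 2 * g1 t (z ord0 i)))%:E)); last first.
 by move=> z _; rewrite gauss_prod// !big_ord1 /sqn big_ord1 mulrC.
by move=> H E; rewrite cE; move: H; rewrite E/= big_ord1 => ->; rewrite mulr1.
Qed.

Lemma gauss_square n (t : R) (i : 'I_n) : 0 < t ->
 \int[lebn n]_z (gauss t z * (z ord0 i * z ord0 i)) = 2 * t.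
Proof.
move=> t0; pose f (k : 'I_n) (x : R) := if k == i then x ^+ 2 * g1 t x else g1 t x.
have mg : msble (g1 t : R -> R) by rewrite /g1; meas.
have mf k : msble (f k) by rewrite /f; case: eqP => _; meas.
have f0 k x : 0 <= f k x by rewrite /f; case: eqP => _; [apply: mulr_ge0; [exact: sqr_ge0|exact: g1_ge0]|exact: g1_ge0].
have fE k : (\int[leb1]_x (f k x)%:E = (if k == i then 2 * t else 1)%:E)%E.
 by rewrite /f; case: eqP => _; [exact: int_sqr_g1|exact: int_g1].
rewrite /Rintegral (eq_integral (fun z : 'rV[R]_n => (\prod_k f k (z ord0 k))%:E)); last first.
 move=> z _; congr EFin; rewrite gauss_prod// (bigD1 i)//= [RHS](bigD1 i)//= /f eqxx.
 rewrite -expr2 mulrAC; congr (_ * _); first exact: mulrC.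
 by apply: eq_bigr => k /negbTE ->.
rewrite (int_rV_prod mf f0 fE) /= (bigD1 i)//= eqxx big1 ?mulr1// => k /negbTE -> //.
Qed.

End second_moments.

(** * The generator of the heat semigroup *)

Section heat_generator.
Context {R : realType}.
Variable n : nat.

(** The second difference is replaced by its quadratic part [Q], whose Gaussian average is exactly
    [2 * t * nlap u x] since mixed moments vanish. The rest [D] is small compared with $|z|^2$ near
    0 and contributes $O(t^2)$ elsewhere. *)
Lemma heat_generator (u : 'rV[R]_n -> R) (x : 'rV[R]_n) : GI u -> Ck 2 u ->
 (u x - heat t u x) / t @[t --> 0^'+] --> nlap u x.
Proof.
move=> uG [cu [du P]]; have [mu iu] := uG.
have dd y i j : derivable (pd i u) y (ebase R j) by have [_ [+ _]] := P i; exact.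
have cd i j : continuous (pd j (pd i u)) by have [_ [_ /(_ j) []]] := P i.
pose d i j := pd j (pd i u) x.
pose Q (z : 'rV[R]_n) := - \sum_(i < n) \sum_(j < n) d i j * (z ord0 i * z ord0 j).
pose D z := sdiff u x z - Q z.
have iQ t : 0 < t -> intgr (lebn n) (fun z => gauss t z * Q z) /\
  \int[lebn n]_z (gauss t z * Q z) = 2 * t * nlap u x.
 move=> t0; have ic (i j : 'I_n) := @gauss_coord_integrable R n t i j t0.
 have id i j : intgr (lebn n) (fun z => - d i j * (gauss t z * (z ord0 i * z ord0 j))).
  by have := integrableZl measurableT (- d i j) (ic i j); apply: eq_integrable.
 have [is1 es1] := Rint_sum (index_enum 'I_n) (fun i => (Rint_sum (index_enum 'I_n) (id i)).1).
 have QE z : gauss t z * Q z = \sum_(i < n) \sum_(j < n) - d i j * (gauss t z * (z ord0 i * z ord0 j)).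
  rewrite /Q mulrN mulr_sumr -sumrN; apply: eq_bigr => i _; rewrite mulr_sumr -sumrN.
  by apply: eq_bigr => j _; ring.
 split; first by move: is1; apply: eq_integrable => // z _ /=; rewrite QE.
 under eq_Rintegral do rewrite QE.
 rewrite es1 /nlap mulrN mulr_sumr -sumrN; apply: eq_bigr => i _.
 rewrite (Rint_sum (index_enum 'I_n) (id i)).2 (bigD1 i)//= big1 => [|j ji].
  by rewrite addr0 RintegralZl// gauss_square// /d; ring.
 by rewrite RintegralZl// gauss_cross 1?eq_sym// mulr0.
have iq t (t0 : 0 < t) := (@gauss_sqn_integrable R n t t0).1.
have iD t : 0 < t -> intgr (lebn n) (fun z => gauss t z * D z) /\
  \int[lebn n]_z (gauss t z * D z) = 2 * (u x - heat t u x) - 2 * t * nlap u x.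
 move=> t0; have [i1 e1] := gauss_sdiff_int x t0 uG; have [i2 e2] := iQ t t0.
 split; last by rewrite -e1 -e2 -RintegralB//; apply: eq_Rintegral => z _; rewrite -mulrBr.
 by have := integrableB measurableT i1 i2; apply: eq_integrable => // z _ /=; rewrite -EFinB -mulrBr.
have mD : msble D.
 have m1 := msble_sdiff x mu; apply: measurable_funB => //; apply: msble_oppf.
 apply: measurable_sum => i; apply: measurable_sum => j.
 have mi := @msble_coord R n i; have mj := @msble_coord R n j; meas.
apply/cvgrPdist_le => e e0.
(* With second moment [2 * n * t], this [e1] keeps the local error below [e * t]; together with the
   far part, also below [e * t], it gives [2 * t * e]. *)
pose e1 : R := e / (2 * (n%:R + 1)).
have n1 : 0 < n%:R + 1 :> R by rewrite ltr_wpDl.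
have e10 : 0 < e1 by rewrite divr_gt0// mulr_gt0.
pose e2 : R := e1 / (n%:R * n%:R + 1).
have nn1 : 0 < n%:R * n%:R + 1 :> R by rewrite ltr_wpDl// mulr_ge0.
have e20 : 0 < e2 by rewrite divr_gt0.
have [r r0 rP] : exists2 r : R, 0 < r & forall i j y, enorm (x - y) < r -> `|d i j - pd j (pd i u) y| <= e2.
 have H (p : 'I_n * 'I_n) : exists r : R, 0 < r /\ forall y, enorm (x - y) < r -> `|d p.1 p.2 - pd p.2 (pd p.1 u) y| <= e2.
  by have [r r0 rP] := (enorm_continuousP _ x).1 (cd p.1 p.2 x) e2 e20; exists r.
 have [rr rrP] := choice H.
 exists (\big[Num.min/1]_p rr p) => [|i j y yr].
  by elim/big_ind: _ => // [a b a0 b0|p _]; [rewrite lt_min a0|have [] := rrP p].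
 have [_] := rrP (i, j); apply; apply: lt_le_trans yr _.
 by rewrite (bigD1 (i, j))//= ge_min lexx.
(* The intermediate points of [sdiff_telescope2] have norm at most [3 * enorm z], so radius [r / 4]
   keeps them within [r] of [x]. *)
have loc z : enorm z <= r / 4 -> `|D z| <= e1 * sqn z.
 move=> zr; have [xi xiz E] := sdiff_telescope2 x z du dd.
 have -> : D z = \sum_(i < n) \sum_(j < n) (z ord0 i * z ord0 j) * (d i j - pd j (pd i u) (x + xi i j)).
  rewrite /D E /Q opprK addrC -sumrB; apply: eq_bigr => i _; rewrite -sumrB.
  by apply: eq_bigr => j _; rewrite mulrBr [d i j * _]mulrC.
 apply: le_trans (ler_norm_sum _ _ _) _.
 apply: (@le_trans _ _ (\sum_(i < n) \sum_(j < n) (sqn z * e2))).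
  apply: ler_sum => i _; apply: le_trans (ler_norm_sum _ _ _) _; apply: ler_sum => j _.
  rewrite normrM; apply: ler_pM => //.
   by rewrite normrM -enorm_sqr expr2; apply: ler_pM => //; exact: coord_le_enorm.
  apply: rP; rewrite opprD addrA subrr add0r enormN.
  by apply: le_lt_trans (xiz i j) _; lra.
 have -> : \sum_(i < n) \sum_(j < n) (sqn z * e2) = n%:R * n%:R * e2 * sqn z.
  by rewrite sumr_const card_ord sumr_const card_ord -mulr_natl -mulr_natl; ring.
 apply: ler_wpM2r; first exact: sqn_ge0.
 rewrite /e2 mulrA ler_pdivrMr// mulrC; apply: ler_wpM2l; first exact: ltW.
 by rewrite lerDl.
have r40 : 0 < r / 4 by rewrite divr_gt0.
have [C C0 CP] := heat_local r40 (ltW e10) mD (iD 1 ltr01).1 iq (@sqn_ge0 R n) loc.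
near=> t; have t0 : 0 < t by near: t; exact: nbhs_right_gt.
have t1 : t <= 2^-1 by near: t; apply: nbhs_right_le; rewrite invr_gt0.
have tC : t <= e / (C + 1) by near: t; apply: nbhs_right_le; rewrite divr_gt0// ltr_wpDl.
have te : C * t <= e by move: tC; rewrite ler_pdivlMr ?ltr_wpDl//; nra.
have [_] := CP t t0 t1; have [_ ->] := iD t t0; have [_ ->] := @gauss_sqn_integrable R n t t0.
have -> : 2 * (u x - heat t u x) - 2 * t * nlap u x = (2 * t) * - (nlap u x - (u x - heat t u x) / t).
 by field; rewrite gt_eqF.
rewrite normrM normrN gtr0_norm ?mulr_gt0// => H.
rewrite -(ler_pM2l (_ : 0 < 2 * t)) ?mulr_gt0//; apply: le_trans H _.
have E1 : e1 * (2 * n%:R * t) <= e * t.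
 rewrite mulrA ler_wpM2r ?(ltW t0)// /e1 mulrAC ler_pdivrMr ?mulr_gt0//; rewrite ler_wpM2l ?(ltW e0)//; lra.
by rewrite expr2; nra.
Unshelve. all: by end_near. Qed.

End heat_generator.

(** * Functions of time with almost monotone growth *)

Section comparable.
Context {R : realType}.
Implicit Types (a b r s t u : R) (q : R -> \bar R).
Variable p : R.
Hypothesis p0 : 0 <= p.

(** Equivalently, $t^p q(t)$ is nondecreasing. Heat flows of nonnegative functions satisfy it with
    [p = n / 2] by [gauss_time]. *)
Definition tcomparable q := forall t u, 0 < t -> t <= u -> (q t <= ((u / t) `^ p)%:E * q u)%E.

Lemma J_le a f1 f2 t c : 0 < a -> 0 <= c -> msble f1 -> msble f2 ->
 (forall s, (0 <= f1 s)%E) -> (forall s, (0 <= f2 s)%E) -> forall u,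
 (forall s, 0 < s -> (f1 (t + s)%R <= c%:E * f2 (u + s)%R)%E) -> (J a f1 t <= c%:E * J a f2 u)%E.
Proof.
move=> a0 c0 m1 m2 f10 f20 u H; rewrite /J [leRHS]muleCA; apply: lee_wpmul2l.
 by rewrite lee_fin invr_ge0 ltW// Gamma_gt0.
have sh (f : R -> \bar R) r : msble f -> msble (fun s => (pw (a - 1) s)%:E * f (r + s)%R)%E.
 move=> mf; apply: emeasurable_funM; first by meas.
 have mu : msble (fun s : R => r + s) by apply: measurable_funD.
 exact: (measurableT_comp mf mu).
have pos0 (f : R -> \bar R) r s : (forall s, (0 <= f s)%E) -> (0 <= (pw (a - 1) s)%:E * f (r + s)%R)%E.
 by move=> f0; rewrite mule_ge0// lee_fin pw_ge0.
rewrite -ge0_integralZl ?lee_fin//; last 2 first.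
- exact: sh.
- by move=> s _; exact: pos0.
apply: ge0_le_integral => //.
- by move=> s _; exact: pos0.
- exact: sh.
- by apply: measurable_funeM; exact: sh.
move=> s _; have [s0|s0] := leP s 0; first by rewrite pw0// !mul0e mule0.
by rewrite muleCA lee_wpmul2l ?lee_fin ?pw_ge0// H.
Qed.

Lemma comparable_J a q : 0 < a -> msble q -> (forall s, (0 <= q s)%E) ->
 tcomparable q -> tcomparable (J a q).
Proof.
move=> a0 mq q0 cq t u t0 tu; have u0 := lt_le_trans t0 tu.
apply: J_le => // [|s s0]; first exact: powR_ge0.
apply: le_trans (cq _ (u + s) _ _) _; [by rewrite addr_gt0|by rewrite lerD2r|].
apply: lee_wpmul2r => //; rewrite lee_fin; apply: ge0_ler_powR => //.
- by rewrite nnegrE divr_ge0// ltW// addr_gt0.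
- by rewrite nnegrE divr_ge0// ltW.
(* A common translation of both times by [s] only decreases their ratio. *)
rewrite ler_pdivrMr ?addr_gt0// mulrDr divfK ?gt_eqF// lerD2l ler_peMl ?(ltW s0)//.
by rewrite ler_pdivlMr// mul1r.
Qed.

(** An infinite value at [t] forces infinite values at all later times, which contradicts the
    convergence of the weighted integral. *)
Lemma comparable_lty a q : 0 < a -> msble q -> (forall s, (0 <= q s)%E) ->
 tcomparable q -> (\int[leb1]_s ((pw (a - 1) s)%:E * q s) < +oo)%E ->
 forall t, 0 < t -> (q t < +oo)%E.
Proof.
move=> a0 mq q0 cq fin t t0; rewrite ltNge; apply: contraTN fin; rewrite leye_eq => /eqP qt.
rewrite -leNgt; pose w s : R := pw (a - 1) s * (t <= s)%R%:R.
have mw : msble w by rewrite /w; meas.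
have w0 s : 0 <= w s by rewrite mulr_ge0 ?pw_ge0.
have wpos : (0 < \int[leb1]_s (w s)%:E)%E.
 pose c : R := t `^ (a + 1); have c0 : 0 < c by rewrite powR_gt0.
 apply: (@lt_le_trans _ _ (\int[leb1]_s (c * (pw (- 1 - 1) s * (t <= s)%R%:R))%:E)%E).
  rewrite ge0_intZl ?(ltW c0)//; [|by meas|by move=> s; rewrite mulr_ge0 ?pw_ge0].
  by rewrite int_pw_tail// -EFinM lte_fin mulr_gt0// divr_gt0// powR_gt0.
 apply: le_intR => //; [by move=> s; rewrite mulr_ge0 ?(ltW c0) ?mulr_ge0 ?pw_ge0|by meas|].
 move=> s; rewrite mulrA /w; have [ts|ts] := leP t s; last by rewrite !mulr0.
 have s0 := lt_le_trans t0 ts; rewrite !mulr1.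
 rewrite [leRHS](_ : _ = pw (a + 1) s * pw (- 1 - 1) s); last by rewrite -pwD; congr (pw _ s); ring.
 rewrite ler_wpM2r ?pw_ge0// pwE//; apply: ge0_ler_powR; rewrite ?nnegrE ?(ltW t0) ?(ltW s0)//.
 by rewrite addr_ge0// ltW.
have : (\int[leb1]_s ((w s)%:E * +oo) <= \int[leb1]_s ((pw (a - 1) s)%:E * q s))%E.
 apply: ge0_le_integral => //.
 - by move=> s _; rewrite mule_ge0 ?lee_fin.
 - by apply: emeasurable_funM => //; exact: mEFin.
 - by apply: emeasurable_funM => //; meas.
 move=> s _; rewrite /w; have [ts|ts] := leP t s; last by rewrite mulr0 mul0e mule_ge0 ?lee_fin ?pw_ge0.
 rewrite mulr1; have := cq t s t0 ts; rewrite qt leye_eq => /eqP.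
 have c0 : 0 < (s / t) `^ p by rewrite powR_gt0// divr_gt0// (lt_le_trans t0).
 case: (q s) (q0 s) => [r _|_ _|]//.
rewrite ge0_integralZr//; last 2 first.
- exact: mEFin.
- by move=> s _; rewrite lee_fin.
by rewrite gt0_muley// leye_eq => /eqP ->; rewrite leey.
Qed.

(* q is harmless near 0, so that a smaller power of s only helps at infinity. *)
Lemma weight_mono a b q (B d : R) : 0 < a -> a <= b -> 0 < d -> msble q ->
 (forall s, (0 <= q s)%E) -> (forall s, 0 < s -> s <= d -> (q s <= B%:E)%E) ->
 (\int[leb1]_s ((pw (b - 1) s)%:E * q s) < +oo)%E -> (\int[leb1]_s ((pw (a - 1) s)%:E * q s) < +oo)%E.
Proof.
move=> a0 ab d0 mq q0 qB fin; pose e : R := d `^ (a - b).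
have e0 : 0 <= e by exact: powR_ge0.
have B0 : (0 <= B%:E)%E by apply: le_trans (qB d d0 (lexx d)).
have m1 : msble (fun s => (pw (b - 1) s)%:E * q s)%E by apply: emeasurable_funM => //; meas.
have m2 : msble (fun s => (pw (a - 1) s * (s <= d)%R%:R)%:E : \bar R) by meas.
apply: (@le_lt_trans _ _ (\int[leb1]_s (e%:E * ((pw (b - 1) s)%:E * q s) + B%:E * (pw (a - 1) s * (s <= d)%R%:R)%:E))%E).
 have p1 s : (0 <= (pw (b - 1) s)%:E * q s)%E by rewrite mule_ge0// lee_fin pw_ge0.
 apply: ge0_le_integral => //.
 - by move=> s _; rewrite mule_ge0// lee_fin pw_ge0.
 - by apply: emeasurable_funM => //; meas.
 - by apply: emeasurable_funD; exact: measurable_funeM.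
 move=> s _; have [s0|s0] := leP s 0; first by rewrite !pw0// !mul0e mule0 mul0r mule0 adde0.
 have [sd|sd] := leP s d.
  rewrite mulr1 -[leLHS]add0e; apply: leeD; first by rewrite mule_ge0 ?lee_fin.
  by rewrite [leRHS]muleC lee_wpmul2l ?lee_fin ?pw_ge0// qB.
 rewrite mulr0 mule0 adde0 muleA -EFinM lee_wpmul2r// lee_fin !pwE//.
 rewrite (_ : a - 1 = (a - b) + (b - 1)); last by ring.
 rewrite powRD ?(gt_eqF s0) ?implybT// ler_wpM2r ?powR_ge0// /e -opprB !powRN.
 rewrite lef_pV2 ?posrE ?powR_gt0//.
 by apply: ge0_ler_powR; rewrite ?nnegrE ?(ltW s0) ?(ltW d0) ?subr_ge0// ltW.
rewrite ge0_integralD//; last 4 first.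
- by move=> s _; rewrite !mule_ge0 ?lee_fin ?pw_ge0.
- exact: measurable_funeM.
- by move=> s _; rewrite mule_ge0// lee_fin mulr_ge0 ?pw_ge0.
- exact: measurable_funeM.
rewrite ge0_integralZl ?lee_fin//; last by move=> s _; rewrite mule_ge0// lee_fin pw_ge0.
rewrite ge0_integralZl//; last by move=> s _; rewrite lee_fin mulr_ge0 ?pw_ge0.
rewrite int_pw_head// -EFinM; apply: lte_add_pinfty; last by rewrite ltry.
by rewrite lte_mul_pinfty ?lee_fin.
Qed.

Lemma JE a (h : R -> R) t : J a (fun s => (h s)%:E) t =
 (((Gamma a)^-1)%:E * \int[leb1]_s (pw (a - 1) s * h (t + s))%:E)%E.
Proof. by []. Qed.

Lemma J0E a q : J a q 0 = (((Gamma a)^-1)%:E * \int[leb1]_s ((pw (a - 1) s)%:E * q s))%E.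
Proof. by rewrite /J; congr (_ * _)%E; apply: eq_integral => s _; rewrite add0r. Qed.

Lemma J_lty a q t : 0 < a -> (J a q t < +oo)%E = (\int[leb1]_s ((pw (a - 1) s)%:E * q (t + s)%R) < +oo)%E.
Proof.
move=> a0; have G0 : 0 < (Gamma a)^-1 by rewrite invr_gt0 Gamma_gt0.
rewrite /J; case: (\int[leb1]_s _)%E => [r||]//.
- by rewrite -EFinM !ltry.
- by rewrite gt0_muley ?lte_fin.
by rewrite gt0_muleNy ?lte_fin.
Qed.

Lemma J0_lty_int a q : 0 < a -> (J a q 0 < +oo)%E = (\int[leb1]_s ((pw (a - 1) s)%:E * q s) < +oo)%E.
Proof. by move=> a0; rewrite J_lty//; congr (_ < _)%E; apply: eq_integral => s _; rewrite add0r. Qed.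

(** The weight [pw (1 - 1)] is the indicator of the positive half-line, so the quotient is the mean
    of [f] over $(0,t]$. *)
Lemma average_cvg (f : R -> R) (l : R) : msble f -> (forall s, 0 <= f s) ->
 f t @[t --> 0^'+] --> l -> (\int[leb1]_s (pw (1 - 1) s * f s)%:E < +oo)%E ->
 (fun t : R => (\int[leb1]_s (pw (1 - 1) s * f s) - \int[leb1]_s (pw (1 - 1) s * f (t + s))) / t) @ 0^'+ --> l.
Proof.
move=> mf f0 fl fin.
have i : intgr leb1 (fun s => pw (1 - 1) s * f s).
 apply: integrableR; first by meas.
 by under eq_integral do rewrite ger0_norm ?mulr_ge0 ?pw_ge0//.
pose w t s : R := pw (1 - 1) s * (s <= t)%R%:R.
have iw t : 0 < t -> intgr leb1 (w t).
 move=> t0; apply: integrableR; first by rewrite /w; meas.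
 by under eq_integral do rewrite ger0_norm ?mulr_ge0 ?pw_ge0//; rewrite int_pw_head// ltry.
have mw t : 0 < t -> \int[leb1]_s w t s = t.
 by move=> t0; rewrite /Rintegral int_pw_head//= powRr1 ?divr1// ltW.
have iwf t : intgr leb1 (fun s => w t s * f s).
 apply: (le_integrable measurableT _ _ i); first by apply: mEFin; rewrite /w; meas.
 move=> s _ /=; rewrite lee_fin !ger0_norm ?mulr_ge0 ?pw_ge0// ler_wpM2r// ler_piMr ?pw_ge0//.
 by case: (s <= t).
have D t : 0 < t -> \int[leb1]_s (pw (1 - 1) s * f s) - \int[leb1]_s (pw (1 - 1) s * f (t + s)) = \int[leb1]_s (w t s * f s).
 move=> t0; have msh : msble (fun s => pw (1 - 1) (s - t) * f s) by meas.
 have -> : \int[leb1]_s (pw (1 - 1) s * f (t + s)) = \int[leb1]_s (pw (1 - 1) (s - t) * f s).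
  rewrite /Rintegral -(integral_shift t (mEFin msh)); congr fine; apply: eq_integral => s _.
  by rewrite addrK [s + t]addrC.
 have sp s : pw (1 - 1) s - pw (1 - 1) (s - t) = w t s.
  rewrite /w; have [s0|s0] := leP s 0; first by rewrite !pw0 ?mul0r ?subr0//; lra.
  have [st|st] := leP s t; first by rewrite [X in _ - X]pw0 ?subr_le0// subr0 mulr1.
  by rewrite !pwE ?subr_gt0// subrr !powRr0 subrr mulr0.
 rewrite -RintegralB//; first by apply: eq_Rintegral => s _; rewrite -mulrBl sp.
 have := integrableB measurableT i (iwf t); apply: eq_integrable => // s _ /=.
 by rewrite -EFinB -mulrBl -sp; congr (_ * _)%:E; ring.
apply/cvgrPdist_le => e e0.
have [d /= d0 dP] : \forall s \near 0^'+, `|l - f s| <= e by move/cvgrPdist_le : fl; exact.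
near=> t; have t0 : 0 < t by near: t; exact: nbhs_right_gt.
have td : t < d by near: t; exact: nbhs_right_lt.
have iwl : intgr leb1 (fun s => w t s * l).
 by have := integrableZr measurableT l (iw t t0); apply: eq_integrable.
have iwB : intgr leb1 (fun s => w t s * l - w t s * f s).
 by have := integrableB measurableT iwl (iwf t); apply: eq_integrable.
rewrite D//; have -> : l - (\int[leb1]_s (w t s * f s)) / t = (\int[leb1]_s (w t s * l - w t s * f s)) / t.
 rewrite RintegralB// RintegralZr ?iw// mw//; field; by rewrite gt_eqF.
rewrite normrM normfV (gtr0_norm t0) ler_pdivrMr//.
apply: le_trans (le_normr_Rintegral _ iwB) _ => //.
rewrite -[X in _ <= _ * X](mw t t0) -RintegralZl ?iw//; apply: le_Rintegral => //.
- exact: integrable_norm iwB.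
- by have := integrableZl measurableT e (iw t t0); apply: eq_integrable.
move=> s _; rewrite -mulrBr normrM; have w0 : 0 <= w t s by rewrite mulr_ge0 ?pw_ge0.
rewrite ger0_norm//; have [s0|s0] := leP s 0; first by rewrite /w pw0// !mul0r mulr0.
rewrite mulrC; have [st|st] := leP s t; last by rewrite /w (leNgt s t) st /= !mulr0.
rewrite ler_wpM2r//; apply: dP => //=.
by rewrite sub0r normrN gtr0_norm// (le_lt_trans st).
Unshelve. all: by end_near. Qed.

End comparable.

(** * Fractional time integrals of the heat flow of [F] *)

Section heat_potentials.
Context {R : realType}.
Variables (n : nat) (F : 'rV[R]_n -> R).
Implicit Types (a b r s t u : R) (x y z : 'rV[R]_n).
Hypotheses (cF : continuous F) (F0 : forall x, 0 <= F x) (FG : GI F).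

Let mF : msble F. Proof. exact: cont_rV_msble. Qed.

Definition hq x s : \bar R := (heat s F x)%:E.

Lemma hq_ge0 x s : (0 <= hq x s)%E. Proof. by rewrite lee_fin heat_ge0. Qed.

Lemma msble_heat_time x : msble (fun s => heat s F x).
Proof.
have mf : msble (fun p : R * 'rV[R]_n => gauss p.1 (x - p.2) * F p.2) by meas.
exact: (msble_Rint2 (lebn n) (f := fun s y => gauss s (x - y) * F y) mf).
Qed.

Lemma msble_hq x : msble (hq x).
Proof. by apply: mEFin; exact: msble_heat_time. Qed.

Lemma heat_time x s u : 0 < s -> s <= u -> heat s F x <= (u / s) `^ (n%:R / 2) * heat u F x.
Proof.
move=> s0 su; have u0 := lt_le_trans s0 su; have [_ i] := FG.
rewrite /heat -RintegralZl ?i//; apply: le_Rintegral => //; first exact: i.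
 by have := integrableZl measurableT ((u / s) `^ (n%:R / 2)) (i u x u0); apply: eq_integrable.
by move=> y _; rewrite mulrA ler_wpM2r// gauss_time.
Qed.

Lemma comparable_hq x : tcomparable (n%:R / 2) (hq x).
Proof. by move=> s u s0 su; rewrite -EFinM lee_fin heat_time. Qed.

Lemma heat_comp x s u : 0 < s -> s <= u -> u <= 4 * s -> heat s F x <= 4 `^ (n%:R / 2) * heat u F x.
Proof.
move=> s0 su us; apply: le_trans (heat_time x s0 su) _.
rewrite ler_wpM2r ?heat_ge0//; apply: ge0_ler_powR; rewrite ?nnegrE ?divr_ge0 ?(ltW s0)//.
 by rewrite (le_trans (ltW s0)).
by rewrite ler_pdivrMr.
Qed.

Lemma hq_near0 x : exists B : R, exists2 d : R, 0 < d & forall s, 0 < s -> s <= d -> (hq x s <= B%:E)%E.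
Proof.
have cx : {for x, continuous F} by exact: cF.
have /cvgrPdist_le/(_ 1 ltr01) [d /= d0 dP] := cvg_heat FG cx.
exists (F x + 1), (d / 2) => [|s s0 sd]; first exact: divr_gt0.
have := dP s; rewrite /= sub0r normrN gtr0_norm// => /(_ _ s0) H.
rewrite lee_fin; have /ler_normlP[] : `|F x - heat s F x| <= 1 by apply: H; lra.
lra.
Qed.

Lemma heat_semigroup s t x : 0 < s -> 0 < t -> heat s (heat t F) x = heat (s + t) F x.
Proof.
move=> s0 t0; have := cvl_psi_conv 0 0 x s0 t0 FG.
by rewrite !psi0.
Qed.

Lemma GI_heat t : 0 < t -> GI (heat t F).
Proof. by move=> t0; have := GI_psi 0 t0 FG; rewrite psi0. Qed.

Lemma int_gauss_hq t s x : 0 < t -> 0 < s ->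
 (\int[lebn n]_y (gauss t (x - y) * heat s F y)%:E = hq x (t + s))%E.
Proof. by move=> t0 s0; rewrite /hq -heat_semigroup// EFin_heat//; exact: GI_heat. Qed.

Lemma msble_heat2 : msble (fun p : 'rV[R]_n * R => heat p.2 F p.1).
Proof.
have mf : msble (fun p : ('rV[R]_n * R) * 'rV[R]_n => gauss p.1.2 (p.1.1 - p.2) * F p.2).
 have m1 : msble (fun p : ('rV[R]_n * R) * 'rV[R]_n => p.1.1) by exact: (measurableT_comp measurable_fst measurable_fst).
 have m2 : msble (fun p : ('rV[R]_n * R) * 'rV[R]_n => p.1.2) by exact: (measurableT_comp measurable_snd measurable_fst).
 apply: measurable_funM; last by meas.
 by apply: msble_gaussf => //; apply: msble_rV_sub => //; exact: measurable_snd.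
exact: (msble_Rint2 (lebn n) (f := fun (p : 'rV[R]_n * R) y => gauss p.2 (p.1 - y) * F y) mf).
Qed.

Definition pot a x t : R := fine (J a (hq x) t).

Lemma pot_ge0 a x t : 0 < a -> 0 <= pot a x t.
Proof. by move=> a0; rewrite fine_ge0// J_ge0//; exact: hq_ge0. Qed.

Lemma pwheat_ge0 a x s : 0 <= pw (a - 1) s * heat s F x. Proof. by rewrite mulr_ge0 ?pw_ge0 ?heat_ge0. Qed.

Lemma J_hq0 a x : (J a (hq x) 0 = ((Gamma a)^-1)%:E * \int[leb1]_s (pw (a - 1) s * heat s F x)%:E)%E.
Proof. exact: J0E. Qed.

Lemma msble_J0 a : msble (fun x => J a (hq x) 0).
Proof.
under eq_fun do rewrite J_hq0; apply: measurable_funeM.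
apply: (@msble_int2 _ _ _ _ _ leb1 (fun x s => (pw (a - 1) s * heat s F x)%:E)).
 by have m := msble_heat2; apply: mEFin; apply: measurable_funM => //; meas.
by move=> x s; rewrite lee_fin pwheat_ge0.
Qed.

Lemma heat_J a x t : 0 < a -> 0 < t ->
 (\int[lebn n]_y ((gauss t (x - y))%:E * J a (hq y) 0) = J a (hq x) t)%E.
Proof.
move=> a0 t0; have G0 : 0 <= (Gamma a)^-1 by rewrite invr_ge0 ltW// Gamma_gt0.
have m2 := msble_heat2.
have mf : msble (fun p : 'rV[R]_n * R => gauss t (x - p.1) * (pw (a - 1) p.2 * heat p.2 F p.1)).
 by apply: measurable_funM; [meas|apply: measurable_funM => //; meas].
have mI : msble (fun y => \int[leb1]_s (gauss t (x - y) * (pw (a - 1) s * heat s F y))%:E)%E.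
 apply: (@msble_int2 _ _ _ _ _ leb1 (fun y s => (gauss t (x - y) * (pw (a - 1) s * heat s F y))%:E)); first exact: mEFin.
 by move=> y s; rewrite lee_fin mulr_ge0 ?gauss_ge0 ?pwheat_ge0.
have I0 y : (0 <= \int[leb1]_s (gauss t (x - y) * (pw (a - 1) s * heat s F y))%:E)%E.
 by apply: int_ge0R => s; rewrite mulr_ge0 ?gauss_ge0 ?pwheat_ge0.
transitivity (\int[lebn n]_y (((Gamma a)^-1)%:E * \int[leb1]_s (gauss t (x - y) * (pw (a - 1) s * heat s F y))%:E))%E.
 apply: eq_integral => y _; rewrite J_hq0 muleCA; congr (_ * _)%E.
 rewrite ge0_intZl ?gauss_ge0//; [|by move=> s; exact: pwheat_ge0].
 by apply: measurable_funM; [meas|exact: msble_heat_time].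
rewrite ge0_integralZl ?lee_fin// /J; congr (_ * _)%E.
rewrite (@int_swapR _ _ _ _ _ (lebn n) leb1 (fun y s => gauss t (x - y) * (pw (a - 1) s * heat s F y)) mf); last first.
 by move=> y s; rewrite mulr_ge0 ?gauss_ge0 ?pwheat_ge0.
apply: eq_integral => s _; have [s0|s0] := leP s 0.
 by rewrite pw0// mul0e integral0_eq// => y _; rewrite mul0r mulr0.
rewrite -int_gauss_hq// -ge0_intZl ?pw_ge0//.
- by apply: eq_integral => y _; congr EFin; ring.
- have [mh _] := GI_heat s0; meas.
- by move=> y; rewrite mulr_ge0 ?gauss_ge0 ?heat_ge0.
Qed.

Lemma GI_pot a : 0 < a -> (forall x, (J a (hq x) 0 < +oo)%E) ->
 (forall x t, 0 < t -> (J a (hq x) t < +oo)%E) ->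
 GI (pot a ^~ 0) /\ forall x t, 0 < t -> heat t (pot a ^~ 0) x = pot a x t.
Proof.
move=> a0 f0 ft; have m : msble (pot a ^~ 0).
 exact: (measurableT_comp (fine_measurable measurableT) (msble_J0 a)).
have J0 x t : (0 <= J a (hq x) t)%E by apply: J_ge0 => // s; exact: hq_ge0.
have E x t : 0 < t -> (\int[lebn n]_y (gauss t (x - y) * pot a y 0)%:E = J a (hq x) t)%E.
 move=> t0; rewrite -heat_J//; apply: eq_integral => y _.
 by rewrite EFinM /pot fineK// ge0_fin_numE.
have G : GI (pot a ^~ 0).
 split=> // t x t0; apply: integrableR; first by meas.
 under eq_integral do rewrite ger0_norm ?mulr_ge0 ?gauss_ge0 ?pot_ge0//.
 by rewrite E// ft.
by split=> // x t t0; rewrite /heat /Rintegral E.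
Qed.

Variable s0 : R.
Hypotheses (s00 : 0 < s0) (fin : forall x, (J s0 (hq x) 0 < +oo)%E).

Lemma J0_lty a x : 0 < a -> a <= s0 -> (J a (hq x) 0 < +oo)%E.
Proof.
move=> a0 as0; have [B [d d0 dP]] := hq_near0 x.
have H := fin x; rewrite (J0_lty_int (hq x) s00) in H; rewrite (J0_lty_int (hq x) a0).
exact: (weight_mono a0 as0 d0 (msble_hq x) (hq_ge0 x) dP H).
Qed.

(** Write [J s0] as [J (s0 - a)] applied to [J a]: the inner function is comparable in time and has
    a finite weighted integral, so each of its values is finite. The strict inequality makes the
    outer order positive. *)
Lemma Jt_lty a x t : 0 < a -> a < s0 -> 0 < t -> (J a (hq x) t < +oo)%E.
Proof.
move=> a0 as0 t0; have b0 : 0 < s0 - a by rewrite subr_gt0.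
have mq := msble_hq x; have q0 := hq_ge0 x.
have p0 : 0 <= n%:R / 2 :> R by rewrite divr_ge0.
apply: (@comparable_lty _ (n%:R / 2) (s0 - a) (J a (hq x)) b0 _ _ _ _ t t0).
- exact: msble_J.
- by move=> r; exact: J_ge0.
- by apply: comparable_J => //; exact: comparable_hq.
- by have := fin x; rewrite -{1}[s0](subrK a) -(J_semigroup 0 b0 a0 mq q0) (J0_lty_int _ b0).
Qed.

Lemma pot_cvg a x : 0 < a -> a <= s0 -> pot a x t @[t --> 0^'+] --> pot a x 0.
Proof.
move=> a0 as0; have PE t : pot a x t = (Gamma a)^-1 * \int[leb1]_s (pw (a - 1) s * heat (t + s) F x).
 by rewrite /pot JE /Rintegral; case: (\int[leb1]_s _)%E => [r|/=|/=]; rewrite ?mulr0//;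
  rewrite ?gt0_muley ?gt0_muleNy ?lte_fin ?invr_gt0 ?Gamma_gt0.
have H : (\int[leb1]_s (pw (a - 1) s * heat (t + s) F x)) @[t --> 0^'+] --> \int[leb1]_s (pw (a - 1) s * heat s F x).
 apply: (@shift_cvg _ a (4 `^ (n%:R / 2)) (fun s => heat s F x)) => //.
 - exact: msble_heat_time.
 - by move=> r; exact: heat_ge0.
 - by move=> s u; exact: heat_comp.
 - by have := J0_lty x a0 as0; rewrite (J0_lty_int _ a0).
under eq_fun do rewrite PE.
have E0 : \int[leb1]_s (pw (a - 1) s * heat (0 + s) F x) = \int[leb1]_s (pw (a - 1) s * heat s F x).
 by apply: eq_Rintegral => s _; rewrite add0r.
rewrite (PE 0) E0.
by apply: cvgM; [exact: cvg_cst|exact: H].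
Qed.

End heat_potentials.

(** * The Riesz potential as a time integral *)

Section riesz.
Context {R : realType}.
Variable n : nat.
Hypothesis n0 : (0 < n)%N.
Implicit Types (x y z : 'rV[R]_n) (s t : R).

(** The indicator of the point is below [e] times a Gaussian of mass 1, with the time chosen so that
    the peak of the Gaussian is [e^-1]. *)
Lemma lebn_point x : (\int[lebn n]_y ((y == x)%:R : R)%:E = 0)%E.
Proof.
have mb : msble (fun y : 'rV[R]_n => (y == x)%:R : R).
 have -> : (fun y : 'rV[R]_n => (y == x)%:R : R) = fun y => (enorm (y - x) <= 0)%R%:R.
  by apply/funext => y; rewrite -subr_eq0 -enorm_eq0 eq_le enorm_ge0 andbT.
 by meas.
apply/eqP; rewrite eq_le; apply/andP; split; last exact: int_ge0R.
apply/lee_addgt0Pr => e e0; rewrite add0e; pose a : R := n%:R / 2.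
have a0 : 0 < a by rewrite divr_gt0// ltr0n.
pose t : R := e `^ (a^-1) / (4 * pi); have p4 : 0 < 4 * pi :> R by rewrite mulr_gt0// pi_gt0.
have t0 : 0 < t by rewrite divr_gt0// powR_gt0.
have te : (4 * pi * t) `^ a = e.
 by rewrite /t mulrCA divff ?gt_eqF// mulr1 -powRrM mulVf ?gt_eqF// powRr1// ltW.
apply: (@le_trans _ _ (\int[lebn n]_y (e * gauss t (x - y))%:E)%E).
 apply: le_intR => //; first by meas.
 move=> y; have [->|yx] := eqVneq y x; last by rewrite mulr_ge0 ?gauss_ge0// ltW.
 rewrite subrr gaussE -enorm_sqr enorm0 expr0n mul0r oppr0 expR0 mulr1 -/a powRN -te.
 by rewrite divff// gt_eqF// powR_gt0// mulr_gt0.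
rewrite ge0_intZl ?(ltW e0)//; [|by meas|by move=> y; exact: gauss_ge0].
rewrite (@integral_rV_subr _ _ x (fun z => (gauss t z)%:E)); last by meas.
by rewrite int_gauss// mule1.
Qed.

(** For the diagonal of the Riesz kernel: at [y = x] the coded kernel has the default value 0,
    whereas the time integral of Gaussians diverges there. *)
Lemma eq_int_point x (f1 f2 : 'rV[R]_n -> \bar R) : msble f1 -> msble f2 ->
 (forall y, (0 <= f1 y)%E) -> (forall y, (0 <= f2 y)%E) ->
 (forall y, y != x -> f1 y = f2 y) -> (\int[lebn n]_y f1 y = \int[lebn n]_y f2 y)%E.
Proof.
move=> m1 m2 f10 f20 E.
have mb : msble (fun y : 'rV[R]_n => (y != x)%:R : R).
 have -> : (fun y : 'rV[R]_n => (y != x)%:R : R) = fun y => (0 < enorm (y - x))%R%:R.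
  by apply/funext => y; rewrite enorm_gt0 subr_eq0.
 by meas.
have mb' : msble (fun y : 'rV[R]_n => (y == x)%:R : R).
 have -> : (fun y : 'rV[R]_n => (y == x)%:R : R) = fun y => 1 - (y != x)%:R.
  by apply/funext => y; case: eqP => _; rewrite ?subr0 ?subrr.
 by meas.
have H (f : 'rV[R]_n -> \bar R) : msble f -> (forall y, (0 <= f y)%E) ->
  (\int[lebn n]_y f y = \int[lebn n]_y (f y * ((y != x)%:R : R)%:E))%E.
 move=> mf f0; have zero : (\int[lebn n]_y (f y * ((y == x)%:R : R)%:E) = 0)%E.
  transitivity (\int[lebn n]_y (f x * ((y == x)%:R : R)%:E))%E.
   by apply: eq_integral => y _; case: eqP => [->//|_]; rewrite !mule0.
  rewrite ge0_integralZl ?lebn_point ?mule0//; try exact: mEFin.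
 rewrite -[RHS]adde0 -zero -ge0_integralD//.
 - by apply: eq_integral => y _; case: eqP => _; rewrite ?mule0 ?mule1 ?add0e ?adde0.
 - by move=> y _; rewrite mule_ge0 ?lee_fin.
 - by apply: emeasurable_funM => //; exact: mEFin.
 - by move=> y _; rewrite mule_ge0 ?lee_fin.
 - by apply: emeasurable_funM => //; exact: mEFin.
rewrite (H f1)// (H f2)//; apply: eq_integral => y _.
by have [_|yx] := eqVneq y x; [rewrite !mule0|rewrite E].
Qed.

Lemma riesz_potential s (F : 'rV[R]_n -> R) x : 0 < s -> s < n%:R / 2 -> msble F -> (forall y, 0 <= F y) ->
 ((cns n s)%:E * intRn (fun y => (F y / enorm (x - y) `^ (n%:R - 2 * s))%:E) =
  ((Gamma s)^-1)%:E * \int[leb1]_t ((pw (s - 1) t)%:E * \int[lebn n]_y (gauss t (x - y) * F y)%:E))%E.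
Proof.
move=> s0 sn mF F0; have Gs := Gamma_gt0 s0.
have Gn : 0 < Gamma (n%:R / 2 - s) by rewrite Gamma_gt0// subr_gt0.
have mr : msble (fun y => F y * rker (n%:R - 2 * s) (x - y)) by meas.
have r0 y : 0 <= F y * rker (n%:R - 2 * s) (x - y) by rewrite mulr_ge0 ?rker_ge0.
have -> : intRn (fun y => (F y / enorm (x - y) `^ (n%:R - 2 * s))%:E) = (\int[lebn n]_y (F y * rker (n%:R - 2 * s) (x - y))%:E)%E.
 by apply: intRn_ge0E; [exact: mEFin|move=> y; rewrite lee_fin].
pose c : R := Gamma (n%:R / 2 - s) * pi `^ (- (n%:R / 2)) * 4 `^ (- s).
have c0 : 0 < c by rewrite !mulr_gt0// powR_gt0// pi_gt0.
have -> : cns n s = (Gamma s)^-1 * c.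
 rewrite /cns /c !powRN (_ : 2 `^ (2 * s) = 4 `^ s); last first.
  by rewrite powRrM powR_mulrn// (_ : 2 ^+ 2 = 4 :> R)// expr2; ring.
 by field; rewrite !gt_eqF// powR_gt0// pi_gt0.
rewrite EFinM -muleA; congr (_ * _)%E; rewrite -ge0_intZl ?(ltW c0)//.
have mf : msble (fun p : R * 'rV[R]_n => pw (s - 1) p.1 * (gauss p.1 (x - p.2) * F p.2)) by meas.
transitivity (\int[leb1]_t \int[lebn n]_y (pw (s - 1) t * (gauss t (x - y) * F y))%:E)%E; last first.
 by apply: eq_integral => t _; rewrite ge0_intZl ?pw_ge0//; [meas|move=> y; rewrite mulr_ge0 ?gauss_ge0].
rewrite (@int_swapR _ _ _ _ _ leb1 (lebn n) (fun t y => pw (s - 1) t * (gauss t (x - y) * F y)) mf); last first.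
 by move=> t y; rewrite !mulr_ge0 ?pw_ge0 ?gauss_ge0.
have mf' : msble (fun p : 'rV[R]_n * R => pw (s - 1) p.2 * (gauss p.2 (x - p.1) * F p.1)) by meas.
apply: (@eq_int_point x).
- by apply: mEFin; exact: measurable_funM.
- apply: (@msble_int2 _ _ _ _ _ leb1 (fun y t => (pw (s - 1) t * (gauss t (x - y) * F y))%:E)); first exact: mEFin.
 by move=> y t; rewrite lee_fin !mulr_ge0 ?pw_ge0 ?gauss_ge0.
- by move=> y; rewrite lee_fin mulr_ge0// ltW.
- by move=> y; apply: int_ge0R => t; rewrite !mulr_ge0 ?pw_ge0 ?gauss_ge0.
move=> y yx; have xy : x - y != 0 by rewrite subr_eq0 eq_sym.
transitivity ((F y)%:E * \int[leb1]_t (pw (s - 1) t * gauss t (x - y))%:E)%E.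
 rewrite (int_gauss_time sn xy) -EFinM -/c; congr EFin.
 by rewrite /rker -powRN opprB mulrCA mulrA.
rewrite -ge0_intZl//; [|by meas|by move=> t; rewrite mulr_ge0 ?pw_ge0 ?gauss_ge0].
by apply: eq_integral => t _; congr EFin; ring.
Qed.

(** Gaussian integrability is a consequence of a finite potential: the Gaussian averages are
    comparable in time, so one infinite average would make the time integral infinite. *)
Lemma riesz_GI s (F : 'rV[R]_n -> R) : 0 < s -> msble F -> (forall y, 0 <= F y) ->
 (forall x, (\int[leb1]_t ((pw (s - 1) t)%:E * \int[lebn n]_y (gauss t (x - y) * F y)%:E) < +oo)%E) -> GI F.
Proof.
move=> s0 mF F0 fin; split=> // t x t0; pose Q r := (\int[lebn n]_y (gauss r (x - y) * F y)%:E)%E.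
have g0 r y : 0 <= gauss r (x - y) * F y by rewrite mulr_ge0 ?gauss_ge0.
apply: integrableR; first by meas.
under eq_integral do rewrite ger0_norm//.
apply: (@comparable_lty _ (n%:R / 2) s Q s0 _ _ _ _ t t0) => //.
- apply: (@msble_int2 _ _ _ _ _ (lebn n) (fun r y => (gauss r (x - y) * F y)%:E)); first by meas.
 by move=> r y; rewrite lee_fin.
- by move=> r; exact: int_ge0R.
- move=> r u r0 ru; rewrite /Q -ge0_intZl ?powR_ge0//; last by meas.
 apply: le_intR => //; [by meas|by meas|].
 by move=> y; rewrite mulrA ler_wpM2r// gauss_time.
exact: fin.
Qed.

End riesz.

(** * Integer orders: inverting the Laplacian step by step *)

Section iterated_potentials.
Context {R : realType}.
Variables (n m : nat) (F : 'rV[R]_n -> R) (s0 : R).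
Implicit Types (s t : R) (x y z : 'rV[R]_n) (k : nat).
Hypotheses (cF : continuous F) (F0 : forall x, 0 <= F x) (FG : GI F).
Hypotheses (s00 : 0 < s0) (fin : forall x, (J s0 (hq F x) 0 < +oo)%E) (ms : m%:R <= s0).
Hypothesis finT : forall k x t, (0 < k)%N -> (k <= m)%N -> 0 < t -> (J k%:R (hq F x) t < +oo)%E.

(** Order 0 is separated because [J] represents a fractional integral only for positive order; the
    convention is the identity. *)
Definition ipt k x t : R := if k is k'.+1 then pot F k'.+1%:R x t else heat t F x.
Definition ip0 k x : R := if k is k'.+1 then pot F k'.+1%:R x 0 else F x.

Lemma ip0_cvg k x : (k <= m)%N -> ipt k x t @[t --> 0^'+] --> ip0 k x.
Proof.
case: k => [_|k km] /=; first by apply: cvg_heat => //; exact: cF.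
by apply: (pot_cvg cF F0 FG s00 fin); rewrite ?ltr0n// (le_trans _ ms)// ler_nat.
Qed.

Lemma heat_ip k : (k <= m)%N -> GI (ip0 k) /\ forall x t, 0 < t -> heat t (ip0 k) x = ipt k x t.
Proof.
case: k => [_|k km] /=; first by split.
apply: (GI_pot cF F0 FG); first by rewrite ltr0n.
- by move=> x; apply: (J0_lty cF F0 FG s00 fin); rewrite ?ltr0n// (le_trans _ ms)// ler_nat.
- by move=> x t t0; exact: finT.
Qed.

Lemma ipt_ge0 k x t : 0 <= ipt k x t.
Proof. by case: k => [|k] /=; [exact: heat_ge0|apply: pot_ge0; rewrite ?ltr0n]. Qed.

Lemma msble_ipt k x : msble (ipt k x).
Proof.
case: k => [|k] /=; first exact: msble_heat_time.
apply: (measurableT_comp (fine_measurable measurableT)); apply: msble_J; rewrite ?ltr0n//.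
- exact: msble_hq.
- by move=> s; exact: hq_ge0.
Qed.

Lemma J_ipt b k x t : 0 < b -> 0 <= t -> (k <= m)%N ->
 (J (b + k%:R) (hq F x) t = ((Gamma b)^-1)%:E * \int[leb1]_s (pw (b - 1) s * ipt k x (t + s))%:E)%E.
Proof.
move=> b0 t0 km; have mq := msble_hq cF x; have q0 := hq_ge0 F0 x.
case: k km => [_|k km]; first by rewrite addr0.
have k0 : 0 < k.+1%:R :> R by rewrite ltr0n.
rewrite -(J_semigroup t b0 k0 mq q0) {1}/J; congr (_ * _)%E.
apply: eq_integral => s _; have [sn|sp] := leP s 0; first by rewrite pw0// mul0e mul0r.
rewrite EFinM; congr (_ * _)%E; rewrite /= /pot fineK// ge0_fin_numE ?J_ge0//.
by apply: finT => //; rewrite ltr_wpDl.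
Qed.

Lemma JS_ipt k x t : 0 <= t -> (k < m)%N ->
 (J k.+1%:R (hq F x) t = \int[leb1]_s (pw (1 - 1) s * ipt k x (t + s))%:E)%E.
Proof.
by move=> t0 km; rewrite -nat1r (J_ipt x ltr01 t0 (ltnW km)) Gamma1 invr1 mul1e.
Qed.

Lemma ip_step k x : (k < m)%N -> (ip0 k.+1 x - heat t (ip0 k.+1) x) / t @[t --> 0^'+] --> ip0 k x.
Proof.
move=> km; have H := average_cvg (msble_ipt k x) (ipt_ge0 k x) (@ip0_cvg k x (ltnW km)).
have E0 : (\int[leb1]_s (pw (1 - 1) s * ipt k x (0 + s))%:E = \int[leb1]_s (pw (1 - 1) s * ipt k x s)%:E)%E.
 by apply: eq_integral => s _; rewrite add0r.
have J0 := JS_ipt x (lexx 0) km; rewrite E0 in J0.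
have k0 : 0 < k.+1%:R :> R by rewrite ltr0n.
have ks : k.+1%:R <= s0 by apply: le_trans ms; rewrite ler_nat; exact: km.
have fin0 := J0_lty cF F0 FG s00 fin x k0 ks; rewrite J0 in fin0.
have P0 : ip0 k.+1 x = \int[leb1]_s (pw (1 - 1) s * ipt k x s) by rewrite /= /pot J0.
apply: cvg_trans (H fin0); apply: near_eq_cvg; near=> t.
have t0 : 0 < t by near: t; exact: nbhs_right_gt.
by rewrite ((heat_ip km).2 x t t0) P0 /= /pot (JS_ipt x (ltW t0) km).
Unshelve. all: by end_near. Qed.

(** The same difference quotient has two limits: the generator gives the Laplacian, and the time
    average of the lower potential gives that potential at time 0. *)
Lemma nlap_ip k : (k < m)%N -> Ck 2 (ip0 k.+1) -> nlap (ip0 k.+1) = ip0 k.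
Proof.
move=> km C2; apply/funext => x; have [G _] := heat_ip km.
have A := @heat_generator R n _ x G C2; have B := @ip_step k x km.
by apply: (cvg_unique _ A B).
Qed.

Lemma iter_neg_lap_ip k : (k <= m)%N -> Ck (2 * k) (ip0 k) -> iter_neg_lap k (ip0 k) F.
Proof.
elim: k => [//|k IH] km; rewrite mulnS => C /=.
have C2 : Ck 2 (ip0 k.+1) by apply: Ck_le C; rewrite leq_addr.
exists (ip0 k); split; last by apply: IH; [exact: ltnW|rewrite -(nlap_ip km C2); exact: Ck_nlap].
by rewrite -(nlap_ip km C2); exact: (Ck_neg_lap C2).
Qed.

End iterated_potentials.

(** * From the integral equation to the differential equation *)

Section integral_solutions.
Context {R : realType}.
Variables (n m : nat) (g eps : R) (f : 'rV[R]_n -> R -> R).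
Hypotheses (g0 : 0 <= g) (g1 : g < 1) (s0 : 0 < m%:R + g) (sn : m%:R + g < n%:R / 2)
 (eps0 : 0 < eps) (f0 : forall x t, 0 <= f x t) (hf : hoelder_loc_f eps f).

Lemma dim_gt0 : (0 < n)%N.
Proof. by rewrite lt0n; apply/eqP => n0; move: (lt_trans s0 sn); rewrite n0 mul0r ltxx. Qed.

Lemma cns_gt0 : 0 < cns n (m%:R + g).
Proof.
rewrite /cns divr_gt0 ?Gamma_gt0 ?subr_gt0// !mulr_gt0 ?powR_gt0 ?pi_gt0 ?Gamma_gt0//.
Qed.

Lemma regexp_gt0 : 0 < 2 * g - (Num.truncn (2 * g))%:R + eps.
Proof.
have g2 : 0 <= 2 * g by rewrite mulr_ge0.
by rewrite ltr_wpDl// subr_ge0; have /andP[] := truncn_itv g2.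
Qed.

Lemma cont_nonlinearity (v : 'rV[R]_n -> R) : continuous v -> (forall x, 0 <= v x) ->
 continuous (fun x => f x (v x)).
Proof.
move=> cv v0 x; apply/enorm_continuousP => e e0.
have r0 : 0 < enorm x + v x + 1 by rewrite ltr_wpDl// addr_ge0 ?enorm_ge0.
have [C CP] := hf r0; pose C' := `|C| + 1.
have C'0 : 0 < C' by rewrite ltr_wpDl.
pose w := (e / C') `^ (2 / eps); have w0 : 0 < w by rewrite powR_gt0// divr_gt0.
pose d := Num.min 1 (w / 2).
have d0 : 0 < d by rewrite lt_min ltr01 divr_gt0.
have [r rp rP] := (enorm_continuousP v x).1 (cv x) d d0.
exists (Num.min r d) => [|y]; first by rewrite lt_min rp.
rewrite lt_min => /andP[yr yd]; have vd := rP y yr.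
have d1 : d <= 1 by rewrite ge_min lexx.
have dw : d <= w / 2 by rewrite ge_min lexx orbT.
have yx : enorm y <= enorm x + 1.
 rewrite -[y](subrK x) addrC; apply: le_trans (enorm_triangle _ _) _.
 by rewrite lerD2l enorm_sub; lra.
have vy : v y <= v x + 1 by have /ler_normlP[] := vd; lra.
have ex := enorm_ge0 x; have vx := v0 x; have v0y := v0 y.
apply: le_trans (CP x y (v x) (v y) _ _ _ _) _; [lra|lra|apply/andP; split; lra|apply/andP; split; lra|].
have sq (a : R) : 0 <= a -> a <= d -> a ^+ 2 <= w / 2.
 move=> a0 ad; apply: le_trans dw; apply: le_trans (ad).
 by rewrite expr2 ler_piMl// (le_trans ad).
have H : (enorm (x - y) ^+ 2 + (v x - v y) ^+ 2) `^ (eps / 2) <= e / C'.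
 have -> : e / C' = w `^ (eps / 2).
  rewrite /w -powRrM (_ : 2 / eps * (eps / 2) = 1) ?powRr1// ?divr_ge0 ?(ltW e0) ?(ltW C'0)//.
  by field; rewrite gt_eqF.
 apply: ge0_ler_powR; rewrite ?nnegrE ?divr_ge0 ?(ltW eps0) ?addr_ge0 ?sqr_ge0 ?(ltW w0)//.
 rewrite [leRHS](splitr w); apply: lerD; first by apply: sq; [exact: enorm_ge0|exact: ltW].
 by rewrite -real_normK ?num_real//; exact: sq.
apply: (@le_trans _ _ (C' * (e / C'))); last by rewrite mulrC divfK// gt_eqF.
apply: (@le_trans _ _ (C' * (enorm (x - y) ^+ 2 + (v x - v y) ^+ 2) `^ (eps / 2))).
 by rewrite ler_wpM2r ?powR_ge0// /C'; have := ler_norm C; lra.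
by rewrite ler_wpM2l ?(ltW C'0).
Qed.

Lemma intRn_ge0 k (G : 'rV[R]_k -> \bar R) : (forall x, (0 <= G x)%E) -> (0 <= intRn G)%E.
Proof. by elim: k G => [|k IH] G G0 //=; apply: integral_ge0 => t _; exact: IH. Qed.

Variable v : 'rV[R]_n -> R.
Hypotheses (vL : Ls g v)
 (vC : Ckloc (2 * m + Num.truncn (2 * g))%N (2 * g - (Num.truncn (2 * g))%:R + eps) v)
 (vI : integral_eq (m%:R + g) f v).

Let F x := f x (v x).
Let F0 x : 0 <= F x. Proof. exact: f0. Qed.
Let s := m%:R + g.

Let cv : continuous v. Proof. exact: Ck_cont (Ckloc_Ck regexp_gt0 vC). Qed.
Let mv : msble v. Proof. exact: cont_rV_msble. Qed.
Let vG : GI v. Proof. exact: Ls_GI vL. Qed.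

Let v0 x : 0 <= v x.
Proof.
rewrite -lee_fin vI mule_ge0 ?lee_fin ?(ltW cns_gt0)//; apply: intRn_ge0 => y.
by rewrite lee_fin divr_ge0 ?powR_ge0.
Qed.

Let cF : continuous F. Proof. exact: cont_nonlinearity. Qed.
Let mF : msble F. Proof. exact: cont_rV_msble. Qed.

Let vR x : ((v x)%:E = ((Gamma s)^-1)%:E * \int[leb1]_t ((pw (s - 1) t)%:E * \int[lebn n]_y (gauss t (x - y) * F y)%:E))%E.
Proof. by rewrite vI (riesz_potential dim_gt0). Qed.

Let FG : GI F.
Proof.
apply: (riesz_GI s0 mF F0) => x; have Gs : 0 < (Gamma s)^-1 by rewrite invr_gt0 Gamma_gt0.
have := vR x; move: (\int[leb1]_t _)%E => [r _|/esym|_]; rewrite ?ltry ?ltNye//.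
by rewrite gt0_muley ?lte_fin.
Qed.

Let vJ x : (v x)%:E = J s (hq F x) 0.
Proof.
rewrite vR J0E; congr (_ * _)%E; apply: eq_integral => t _.
have [t0|t0] := leP t 0; first by rewrite pw0// !mul0e.
by rewrite /hq EFin_heat.
Qed.

Let fin x : (J s (hq F x) 0 < +oo)%E. Proof. by rewrite -vJ ltry. Qed.

Let vH x t : 0 < t -> J s (hq F x) t = (heat t v x)%:E.
Proof.
move=> t0; rewrite -heat_J// EFin_heat//; apply: eq_integral => y _.
by rewrite -vJ.
Qed.

Let ms : m%:R <= s. Proof. by rewrite lerDl. Qed.

(** [Jt_lty] covers orders strictly below [s]. The only other possibility is [k = s], which occurs
    for [g = 0], and there the value is the finite heat flow of [v]. *)
Let finT k x t : (0 < k)%N -> (k <= m)%N -> 0 < t -> (J k%:R (hq F x) t < +oo)%E.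
Proof.
move=> k0 km t0; have kr : 0 < k%:R :> R by rewrite ltr0n.
have [ks|sk] := ltP (k%:R : R) s; first exact: (Jt_lty cF F0 FG fin x kr ks t0).
have E : k%:R = s by apply: le_anti; rewrite sk andbT; apply: le_trans ms; rewrite ler_nat; exact: km.
by rewrite E (vH x t0); exact: ltry.
Qed.

(** Subordination expresses [Lam] by the heat flow of [v], which is the fractional integral of order
    [g] of the potential of order [m]; the Marchaud derivative at time 0 recovers that potential. *)
Let Lam_ip : 0 < g -> Lam g v = ip0 F m.
Proof.
move=> gp; apply/funext => x; have [b [gb b2 bP]] := @Ckloc_SD R n g eps gp g1 eps0.
have vSD := bP _ _ vC; have sd := sdiff_int_fin gp g1 gb b2 cv vL vSD x.
have [_ iv] := vG; have [iL ->] := Lam_heat gp g1 mv (fun t t0 => iv t x t0) sd.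
(* [heat] at time 0 is a default value, so [v x] is put in by hand; the factor [pw] makes the
   negative times irrelevant. *)
pose V t : R := if 0 < t then heat t v x else v x.
have V0 : V 0 = v x by rewrite /V ltxx.
have E t : pw (- g - 1) t * (v x - heat t v x) = pw (- g - 1) t * (V 0 - V t).
 by rewrite V0 /V; case: ltP => // t0; rewrite pw0// !mul0r.
under eq_Rintegral do rewrite E.
have Gg := Gamma_gt0 gp.
have VJ t : 0 <= t -> J s (hq F x) t = (V t)%:E.
 rewrite le_eqVlt => /predU1P[<-|t0]; first by rewrite V0 vJ.
 by rewrite vH// /V t0.
have VE t : 0 <= t -> (\int[leb1]_r (pw (g - 1) r * ipt F m x (t + r))%:E = (Gamma g * V t)%:E)%E.
 move=> t0; have := VJ t t0; rewrite /s addrC (J_ipt cF F0 finT x gp t0 (leqnn m)) => H.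
 by rewrite EFinM -H muleA -EFinM divff ?gt_eqF// mul1e.
have E0 : (\int[leb1]_r (pw (g - 1) r * ipt F m x (0 + r))%:E = \int[leb1]_r (pw (g - 1) r * ipt F m x r)%:E)%E.
 by apply: eq_integral => r _; rewrite add0r.
have fin0 := ltry (Gamma g * V 0); rewrite -(VE 0 (lexx 0)) E0 in fin0.
apply: (marchaud_at0 gp g1 (f := ipt F m x)).
- exact: msble_ipt.
- by move=> r; exact: ipt_ge0.
- exact: (ip0_cvg cF F0 FG s0 fin ms (leqnn m)).
- exact: fin0.
- have mh : msble (fun t => heat t v x).
  have mf : msble (fun p : R * 'rV[R]_n => gauss p.1 (x - p.2) * v p.2) by meas.
  exact: (msble_Rint2 (lebn n) (f := fun s y => gauss s (x - y) * v y) mf).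
 have -> : V = fun t => (0 < t)%R%:R * heat t v x + (t <= 0)%R%:R * v x.
  by apply/funext => t; rewrite /V; case: ltP => _; rewrite ?mul1r ?mul0r ?addr0 ?add0r.
 by meas.
- exact: VE.
- apply: (eq_integrable _ _ _ _ iL); first exact: measurableT.
 by move=> t _; exact: congr1 (E t).
Qed.

Lemma integral_strong : strong_sol m g v (fun x => f x (v x)).
Proof.
split=> //; split; first by exists eps.
have iter := iter_neg_lap_ip cF F0 FG s0 fin ms finT (leqnn m).
exists (ip0 F m); move: g0; rewrite le_eqVlt => /predU1P[gE|gp].
 have vE : ip0 F m = v.
  apply/funext => x; have := vJ x; rewrite /s -gE addr0 => H.
  case: m s0 H => [|k] /=; first by rewrite -gE addr0 ltxx.
  by move=> _ H; rewrite /pot -H.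
 split; first by split=> // /eqP; rewrite -gE eqxx.
 split=> //; apply: iter; rewrite vE.
 by have := Ckloc_Ck regexp_gt0 vC; apply: Ck_le; rewrite leq_addr.
have [b [gb b2 bP]] := @Ckloc_SD R n g eps gp g1 eps0.
have vSD := bP _ _ vC.
split; first by rewrite -Lam_ip//; apply: frac_lap_Lam => // x; exact: (sdiff_int_fin gp g1 gb b2 cv vL vSD).
split=> //; apply: iter; rewrite -Lam_ip//.
apply: (Lam_Ck gp g1 gb b2 cv vL vSD).
 by have := Ckloc_Ck regexp_gt0 vC; apply: Ck_le; rewrite leq_addr.
exact: (Ckloc_SDk gp eps0 regexp_gt0 bP vC).
Qed.

End integral_solutions.

(** * Integration by parts with compact support *)

Section green.
Context {R : realType}.
Variable n : nat.
Implicit Types (x y z : 'rV[R]_n) (r : R) (u v w p : 'rV[R]_n -> R).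

Definition suppd r u := forall x, r < enorm x -> u x = 0.

Lemma pd_supp r u i : suppd r u -> suppd r (pd i u).
Proof.
move=> us x xr; have [d d0] : exists2 d : R, 0 < d & r + d = enorm x by exists (enorm x - r); rewrite ?subr_gt0//; ring.
move=> dE; rewrite /pd (@near_eq_derive _ _ _ _ (cst 0)); first exact: derive_cst.
near=> y; rewrite us//; have : enorm (x - y) < d by near: y; exact: near_enorm.
by have := enorm_triangle (x - y) y; rewrite subrK; lra.
Unshelve. all: by end_near. Qed.

Lemma nlap_supp r u : suppd r u -> suppd r (nlap u).
Proof.
move=> us x xr; rewrite /nlap big1 ?oppr0// => i _.
exact: (pd_supp i (pd_supp i us)).
Qed.

Lemma ball_integrable (c r : R) : intgr (lebn n) (fun x : 'rV[R]_n => c * (enorm x <= r)%R%:R).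
Proof.
have i := integrable_gauss (0 : 'rV[R]_n) (ltr01 : 0 < 1 :> R).
(* The indicator of the ball is dominated by a unit-time Gaussian multiplied by the inverse of its
   value on the sphere of radius [r]. *)
have := integrableZl measurableT (`|c| * ((4 * pi) `^ (n%:R / 2) * expR (r ^+ 2 / 4))) i.
apply: le_integrable => //; first by apply: mEFin; meas.
move=> x _ /=; rewrite lee_fin [leRHS]ger0_norm; last by rewrite !mulr_ge0 ?powR_ge0 ?expR_ge0 ?gauss_ge0.
rewrite normrM -mulrA ler_wpM2l//; have [xr|_] := leP (enorm x) r; last first.
 by rewrite normr0 mulr_ge0 ?gauss_ge0// mulr_ge0 ?powR_ge0 ?expR_ge0.
rewrite normr1 sub0r gaussN gaussE !mulr1 powRN mulrACA divff ?mul1r; last first.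
 by rewrite gt_eqF// powR_gt0// mulr_gt0// pi_gt0.
rewrite -expRD -[leLHS]expR0 ler_expR -mulrBl divr_ge0// subr_ge0 -enorm_sqr.
by rewrite ler_sqr ?nnegrE ?enorm_ge0// (le_trans (enorm_ge0 x)).
Qed.

Lemma supp_integrable r u : continuous u -> suppd r u -> intgr (lebn n) u.
Proof.
move=> cu us; have [C C0 CP] := cont_bounded r cu.
apply: (le_integrable measurableT _ _ (ball_integrable C r)).
 by apply: mEFin; exact: cont_rV_msble.
move=> x _ /=; rewrite lee_fin [leRHS]ger0_norm ?mulr_ge0//.
by have [xr|xr] := leP (enorm x) r; [rewrite mulr1 CP|rewrite us// normr0 mulr0].
Qed.

(** Difference quotients have integral 0 by translation invariance, and they converge boundedly to
    the derivative. Steps of length at most 1 keep all supports in the ball of radius [r + 1] and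
    the intermediate points in that of radius [r + 2]. *)
Lemma int_pd0 r u i : 0 <= r -> Ck 1 u -> suppd r u -> \int[lebn n]_x pd i u x = 0.
Proof.
move=> r0 [cu [du cp]] us; have cpi j : continuous (pd j u) by have [] := cp j.
have [C C0 CP] := pd_bounded (r + 2) cpi.
pose e k : R := k.+1%:R^-1; have e0 k : 0 < e k by rewrite invr_gt0 ltr0n.
have e1 k : e k <= 1 by rewrite invf_le1 ?ltr0n// ler1n.
pose f k x := (e k)^-1 * (u (x + e k *: ebase R i) - u x).
have fc k x : exists2 c : R, `|c| <= e k & f k x = pd i u (x + c *: ebase R i).
 have [c ce E] := MVT_line x (e k) (fun y => du y i); exists c; first by rewrite (ger0_norm (ltW (e0 k))) in ce.
 by rewrite /f E mulKf// gt_eqF.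
have iu := supp_integrable cu us; have mu := integrable_meas iu.
have mf k : msble (f k).
 have ms : msble (fun x => u (x + e k *: ebase R i)).
  have mu' : msble (fun x : 'rV[R]_n => x + e k *: ebase R i) by apply: msble_rV_add.
  exact: (measurableT_comp mu mu').
 by rewrite /f; apply: measurable_funM => //; apply: measurable_funB.
have f0 k : \int[lebn n]_x f k x = 0.
 have i1 := integrable_rV_add (e k *: ebase R i) iu.
 rewrite /f RintegralZl//; last by have := integrableB measurableT i1 iu; apply: eq_integrable.
 by rewrite RintegralB// Rint_rV_add// subrr mulr0.
have [] := @dominatedR _ _ _ (lebn n) f (pd i u) (fun x => C * (enorm x <= r + 1)%R%:R) mf (ball_integrable C (r + 1)).
- move=> k x; have [c ce ->] := fc k x.
 have ec : enorm (c *: ebase R i) <= 1 by rewrite enormZ enorm_delta mulr1 (le_trans ce).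
 have [xr|xr] := leP (enorm x) (r + 1).
  by rewrite mulr1 CP//; apply: le_trans (enorm_triangle _ _) _; lra.
 rewrite mulr0 (pd_supp i us) ?normr0//.
 have := enorm_triangle (x + c *: ebase R i) (- (c *: ebase R i)); rewrite addrK enormN; lra.
- move=> x; apply/cvgrPdist_le => d d0.
 have [s sp sP] := (enorm_continuousP (pd i u) x).1 (cpi i x) d d0.
 have := @cvg_epsk R; move/cvgrPdist_lt => /(_ s sp); apply: filterS => k; rewrite sub0r normrN => ks.
 have [c ce ->] := fc k x; apply: sP; rewrite opprD addrA subrr add0r enormN enormZ enorm_delta mulr1.
 by apply: le_lt_trans ce (le_lt_trans _ ks); rewrite ler_norm.
move=> _ H; apply: (cvg_unique _ H) => //.
rewrite (_ : (fun k => \int[lebn n]_x f k x) = fun=> 0); [exact: cvg_cst|exact/funext].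
Qed.

Lemma pd_parts r u p i : 0 <= r -> Ck 1 u -> Ck 1 p -> suppd r p ->
 \int[lebn n]_x (pd i u x * p x) = - \int[lebn n]_x (u x * pd i p x).
Proof.
move=> r0 Cu Cp ps; have [cu [du cpu]] := Cu; have [cp [dp cpp]] := Cp.
have du' k x : derivable u x (ebase R k) by exact: du.
have cM (a b : 'rV[R]_n -> R) : continuous a -> continuous b -> continuous (fun x => a x * b x).
 by move=> ca cb x; apply: continuousM; [exact: ca|exact: cb].
have cu' k : continuous (pd k u) by have [] := cpu k.
have cp' k : continuous (pd k p) by have [] := cpp k.
have pE k := pdM (fun x => du x k) (fun x => dp x k).
have C1 : Ck 1 (fun x => u x * p x).
 split; first exact: cM.
 split=> [x k|k]; first exact: derivableM.
 rewrite pE; split=> //.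
 have cD (a b : 'rV[R]_n -> R) : continuous a -> continuous b -> continuous (fun x => a x + b x).
  by move=> ca cb x; apply: continuousD; [exact: ca|exact: cb].
 by apply: cD; apply: cM.
have s1 : suppd r (fun x => u x * p x) by move=> x xr; rewrite ps// mulr0.
have s2 : suppd r (fun x => pd i u x * p x) by move=> x xr; rewrite ps// mulr0.
have s3 : suppd r (fun x => u x * pd i p x) by move=> x xr; rewrite (pd_supp i ps)// mulr0.
have := int_pd0 i r0 C1 s1; rewrite pE RintegralD//.
- by move/eqP; rewrite addr_eq0 => /eqP.
- exact: supp_integrable (cM _ _ (cu' i) cp) s2.
- exact: supp_integrable (cM _ _ cu (cp' i)) s3.
Qed.

Lemma green r u p : 0 <= r -> Ck 2 u -> Ck 2 p -> suppd r p ->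
 \int[lebn n]_x (nlap u x * p x) = \int[lebn n]_x (u x * nlap p x).
Proof.
move=> r0 Cu Cp ps; have [cu [du Pu]] := Cu; have [cp [dp Pp]] := Cp.
have cM (a b : 'rV[R]_n -> R) : continuous a -> continuous b -> continuous (fun x => a x * b x).
 by move=> ca cb x; apply: continuousM; [exact: ca|exact: cb].
have cu2 i : continuous (pd i (pd i u)) by have [_ [_ /(_ i) []]] := Pu i.
have cp2 i : continuous (pd i (pd i p)) by have [_ [_ /(_ i) []]] := Pp i.
have negi (a : 'rV[R]_n -> R) : intgr (lebn n) a -> intgr (lebn n) (fun x => - a x).
 move=> ia; have := integrableZl measurableT (-1) ia; apply: eq_integrable => // x _ /=.
 by rewrite -EFinM mulN1r.
have i1 i : intgr (lebn n) (fun x => - (pd i (pd i u) x * p x)).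
 apply: negi; apply: (@supp_integrable r _ (cM _ _ (cu2 i) cp)).
 by move=> x xr; rewrite ps// mulr0.
have i2 i : intgr (lebn n) (fun x => - (u x * pd i (pd i p) x)).
 apply: negi; apply: (@supp_integrable r _ (cM _ _ cu (cp2 i))).
 by move=> x xr; rewrite (pd_supp i (pd_supp i ps))// mulr0.
transitivity (\int[lebn n]_x (\sum_(i < n) - (pd i (pd i u) x * p x))).
 by apply: eq_Rintegral => x _; rewrite /nlap mulNr mulr_suml -sumrN.
rewrite (Rint_sum (index_enum 'I_n) i1).2.
transitivity (\int[lebn n]_x (\sum_(i < n) - (u x * pd i (pd i p) x))); last first.
 by apply: eq_Rintegral => x _; rewrite /nlap mulrN mulr_sumr -sumrN.
rewrite (Rint_sum (index_enum 'I_n) i2).2; apply: eq_bigr => i _.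
have C1 : Ck 1 u := CkW Cu; have D1 : Ck 1 p := CkW Cp.
have neg (a : 'rV[R]_n -> R) : continuous a -> suppd r a -> \int[lebn n]_x (- a x) = - \int[lebn n]_x a x.
 move=> ca as'; rewrite -[RHS]mulN1r -RintegralZl//; last exact: supp_integrable as'.
 by apply: eq_Rintegral => x _; rewrite mulN1r.
rewrite (neg _ (cM _ _ (cu2 i) cp)); last by move=> x xr; rewrite ps// mulr0.
rewrite (neg _ (cM _ _ cu (cp2 i))); last by move=> x xr; rewrite (pd_supp i (pd_supp i ps))// mulr0.
rewrite (pd_parts i r0 (Pu i) D1 ps); congr (- _); apply: oppr_inj.
by rewrite opprK -(pd_parts i r0 C1 (Pp i) (pd_supp i ps)).
Qed.

Lemma green_iter r k u p : 0 <= r -> Ck (2 * k) u -> Ck (2 * k) p -> suppd r p ->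
 \int[lebn n]_x (iter k (@nlap R n) u x * p x) = \int[lebn n]_x (u x * iter k (@nlap R n) p x).
Proof.
move=> r0; elim: k u p => [//|k IH] u p; rewrite mulnS => Cu Cp ps.
have C2 w : Ck (2 + 2 * k) w -> Ck 2 w by apply: Ck_le; rewrite leq_addr.
have Ci j w : Ck (2 + 2 * j) w -> Ck 2 (iter j (@nlap R n) w).
 elim: j w => [//|j IHj] w; rewrite mulnS => Cw; rewrite iterSr; apply: IHj.
 exact: Ck_nlap.
have si j w : suppd r w -> suppd r (iter j (@nlap R n) w) by elim: j => [//|j IHj] /IHj /=; exact: nlap_supp.
have Cp' : Ck (2 * k) p by apply: Ck_le Cp; rewrite leq_addl.
rewrite iterSr (IH (nlap u) p (Ck_nlap Cu) Cp' ps).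
by rewrite (green r0 (C2 _ Cu) (Ci k p Cp) (si k p ps)).
Qed.

Lemma iter_neg_lapE k w F : iter_neg_lap k w F -> F = iter k (@nlap R n) w.
Proof.
elim: k w => [//|k IH] w /= [h [/neg_lap_unique -> /IH ->]].
by rewrite -iterSr.
Qed.

Lemma pd_reflect u x i : (forall y, derivable u y (ebase R i)) ->
 (forall y, derivable (fun y => u (x - y)) y (ebase R i)) /\
 pd i (fun y => u (x - y)) = (fun y => -1 * pd i u (x - y)).
Proof.
move=> du; have D y : is_derive y (ebase R i) (fun y => u (x - y)) (- pd i u (x - y)).
 by apply: is_derive_reflect; exact: derivable_pd.
by split=> [y|]; [have [] := D y|apply/funext => y; rewrite (pd_val (D y)) mulN1r].
Qed.

Lemma Ck_reflect k u x : Ck k u -> Ck k (fun y => u (x - y)).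
Proof.
have c (w : 'rV[R]_n -> R) : continuous w -> continuous (fun y => w (x - y)).
 move=> cw y; apply: (@continuous_comp _ _ _ (fun y => x - y) w); last exact: cw.
 by apply: continuousB; [exact: cst_continuous|exact: cvg_id].
elim: k u => [|k IH] u [cu Pu]; first by split=> //; exact: c.
case: Pu => du Pu; split; first exact: c.
split=> [y i|i]; first by have [] := pd_reflect x (fun y => du y i).
by have [_ ->] := pd_reflect x (fun y => du y i); exact: (CkZ (-1) (IH _ (Pu i))).
Qed.

Lemma nlap_reflect u x : Ck 2 u -> nlap (fun y => u (x - y)) = (fun y => nlap u (x - y)).
Proof.
move=> [_ [du Pu]].
have E i : pd i (pd i (fun y => u (x - y))) = fun y => pd i (pd i u) (x - y).
 have [_ ->] := pd_reflect x (fun y => du y i).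
 have [_ [ddu _]] := Pu i; have [d' E] := pd_reflect x (fun y => ddu y i).
 by rewrite (pdZ (-1) d') E; apply/funext => y; rewrite mulN1r mulN1r opprK.
apply/funext => y.
have S : \sum_(i < n) pd i (pd i (fun y => u (x - y))) y = \sum_(i < n) pd i (pd i u) (x - y).
 by apply: eq_bigr => i _; exact: (congr1 (fun h : 'rV[R]_n -> R => h y) (E i)).
exact: (congr1 (fun a => - a) S).
Qed.

Lemma iter_nlap_reflect k u x : Ck (2 * k) u ->
 iter k (@nlap R n) (fun y => u (x - y)) = (fun y => iter k (@nlap R n) u (x - y)).
Proof.
elim: k u => [//|k IH] u; rewrite mulnS => Cu.
have C2 : Ck 2 u by apply: Ck_le Cu; rewrite leq_addr.
rewrite iterSr (nlap_reflect x C2) (IH _ (Ck_nlap Cu)).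
by apply/funext => y; rewrite iterSr.
Qed.

(** Green's formula for the test function [y |-> p (x - y)]; the reflection does not affect an
    operator of even order. *)
Lemma green_cvl r k w p x : 0 <= r -> Ck (2 * k) w -> Ck (2 * k) p -> suppd r p ->
 cvl p (iter k (@nlap R n) w) x = cvl (iter k (@nlap R n) p) w x.
Proof.
move=> r0 Cw Cp ps; have rx : 0 <= r + enorm x by rewrite addr_ge0 ?enorm_ge0.
have sx : suppd (r + enorm x) (fun y => p (x - y)).
 move=> y yr; apply: ps; have := enorm_triangle (y - x) x; rewrite subrK enorm_sub; lra.
have E := green_iter rx Cw (Ck_reflect x Cp) sx; rewrite (iter_nlap_reflect x Cp) in E.
by rewrite /cvl; under eq_Rintegral do rewrite mulrC; rewrite E; apply: eq_Rintegral => y _; rewrite mulrC.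
Qed.

End green.

(** * The fractional Laplacian of a convolution *)

Section fractional_green.
Context {R : realType}.
Variables (n : nat) (g bt : R) (v : 'rV[R]_n -> R).
Hypotheses (g0 : 0 < g) (g1 : g < 1) (gb : 2 * g < bt) (b2 : bt <= 2)
 (cv : continuous v) (vL : Ls g v) (vSD : SD bt v).
Implicit Types (x y z : 'rV[R]_n) (r : R) (p : 'rV[R]_n -> R).
Let W : R := n%:R + 2 * g.
Let mv : msble v. Proof. exact: cont_rV_msble. Qed.
Let vb : bwint (W / 2) v. Proof. exact: Ls_bwint. Qed.

Lemma cvl_supp_integrable r p x y : continuous p -> suppd r p ->
 intgr (lebn n) (fun z => p (x - z) * v (z + y)).
Proof.
move=> cp ps; apply: (@supp_integrable _ _ (r + enorm x)).
 move=> z; apply: continuousM.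
  apply: (@continuous_comp _ _ _ (fun y => x - y) p); last exact: cp.
  by apply: continuousB; [exact: cst_continuous|exact: cvg_id].
 apply: (@continuous_comp _ _ _ (fun z => z + y) v); last exact: cv.
 by apply: continuousD; [exact: cvg_id|exact: cst_continuous].
move=> z zr; rewrite ps ?mul0r//; have := enorm_triangle (z - x) x; rewrite subrK enorm_sub; lra.
Qed.

Lemma cvl_shift p x y : msble p ->
 \int[lebn n]_z (p (x - z) * v (z + y)) = cvl p v (x + y).
Proof.
move=> mp; rewrite /cvl -[RHS](@Rint_rV_add _ _ y); last by meas.
by apply: eq_Rintegral => z _; rewrite opprD addrACA subrr addr0.
Qed.

Lemma cvl_sdiff r p x z : continuous p -> suppd r p ->
 intgr (lebn n) (fun y => p (x - y) * sdiff v y z) /\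
 \int[lebn n]_y (p (x - y) * sdiff v y z) = sdiff (cvl p v) x z.
Proof.
move=> cp ps; have mp := cont_rV_msble cp.
have i0 := cvl_supp_integrable x 0 cp ps; have i1 := cvl_supp_integrable x z cp ps.
have i2 := cvl_supp_integrable x (- z) cp ps.
have i0' := integrableZl measurableT 2 i0.
have i01 : intgr (lebn n) (fun y => 2 * (p (x - y) * v (y + 0)) - p (x - y) * v (y + z)).
 by have := integrableB measurableT i0' i1; apply: eq_integrable.
have E y : p (x - y) * sdiff v y z = 2 * (p (x - y) * v (y + 0)) - p (x - y) * v (y + z) - p (x - y) * v (y - z).
 by rewrite /sdiff addr0; ring.
have i012 : intgr (lebn n) (fun y => p (x - y) * sdiff v y z).
 by have := integrableB measurableT i01 i2; apply: eq_integrable => // y _ /=; rewrite E.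
split=> //; under eq_Rintegral do rewrite E.
rewrite RintegralB// RintegralB// RintegralZl//.
by rewrite !cvl_shift// addr0.
Qed.

(* The fractional Laplacian commutes with convolution by a compactly supported kernel. *)
Lemma Lam_cvl r p x : 0 <= r -> continuous p -> suppd r p ->
 cvl p (Lam g v) x = Lam g (cvl p v) x.
Proof.
move=> r0 cp ps; have mp := cont_rV_msble cp.
have [C C0 CP] := sdiff_int_local g0 g1 gb b2 cv vL vSD (r + enorm x).
have [A A0 AP] := cont_bounded r cp.
have sx y : r + enorm x < enorm y -> p (x - y) = 0.
 by move=> yr; apply: ps; have := enorm_triangle (y - x) x; rewrite subrK enorm_sub; lra.
have Ay y : `|p (x - y)| <= A * (enorm y <= r + enorm x)%R%:R.
 have [yr|yr] := leP (enorm y) (r + enorm x); last by rewrite sx// normr0 mulr0.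
 by rewrite mulr1; have [xr|xr] := leP (enorm (x - y)) r; [exact: AP|rewrite ps// normr0].
have msd : msble (fun q : 'rV[R]_n * 'rV[R]_n => sdiff v q.1 q.2).
 by rewrite /sdiff; meas.
pose f y z := p (x - y) * (sdiff v y z * rker W z).
have mf : msble (fun q : 'rV[R]_n * 'rV[R]_n => f q.1 q.2).
 apply: measurable_funM; first by meas.
 by apply: measurable_funM => //; meas.
have isd y := integrable_sdiff mv (sdiff_int_fin g0 g1 gb b2 cv vL vSD y).
have i2 y : intgr (lebn n) (f y).
 by have := integrableZl measurableT (p (x - y)) (isd y); apply: eq_integrable.
have i1 z : intgr (lebn n) (f ^~ z).
 have [i _] := cvl_sdiff x z cp ps; have := integrableZr measurableT (rker W z) i.
 by apply: eq_integrable => // y _ /=; rewrite -EFinM -mulrA.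
have fin : (\int[lebn n]_y \int[lebn n]_z (`|f y z|)%:E < +oo)%E.
 have [mb ball] := integrableP _ _ _ (ball_integrable n (A * C) (r + enorm x)).
 apply: le_lt_trans ball; apply: ge0_le_integral => //.
 - by move=> y _; apply: int_ge0R.
 - apply: (@msble_int2 _ _ _ _ _ (lebn n) (fun y z => (`|f y z|)%:E)); last by move=> y z; rewrite lee_fin.
  by apply: mEFin; exact: (msble_normf mf).
 - by apply: mEFin; meas.
 move=> y _ /=; rewrite (eq_integral (fun z => (`|p (x - y)| * (`|sdiff v y z| * rker W z))%:E)); last first.
  by move=> z _; rewrite /f !normrM (ger0_norm (rker_ge0 _ _)).
 have mz : msble (fun z => `|sdiff v y z| * rker W z).
  by have := msble_sdiff y mv => m; meas.
 rewrite ge0_intZl//; last by move=> z; rewrite mulr_ge0 ?rker_ge0.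
 have [yr|yr] := leP (enorm y) (r + enorm x); last by rewrite sx// normr0 mul0e mulr0 normr0.
 rewrite mulr1 (ger0_norm (mulr_ge0 A0 C0)) EFinM; apply: lee_pmul => //.
 - by apply: int_ge0R => z; rewrite mulr_ge0 ?rker_ge0.
 - by rewrite lee_fin; have := Ay y; rewrite yr mulr1.
 - exact: CP.
have [iF E] := Rint_swap mf i2 i1 fin.
have c1 : \int[lebn n]_y (Cfl n g / 2 * \int[lebn n]_z f y z) = Cfl n g / 2 * \int[lebn n]_y \int[lebn n]_z f y z.
 by apply: RintegralZl; [exact: measurableT|exact: iF].
have c2 y : \int[lebn n]_z f y z = p (x - y) * \int[lebn n]_z (sdiff v y z * rker W z).
 by apply: RintegralZl; [exact: measurableT|exact: isd].
have c3 z : \int[lebn n]_y f y z = sdiff (cvl p v) x z * rker W z.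
 have [i e] := cvl_sdiff x z cp ps; rewrite -e.
 transitivity (\int[lebn n]_y (p (x - y) * sdiff v y z * rker W z)); first by apply: eq_Rintegral => y _; rewrite /f mulrA.
 by apply: RintegralZr; [exact: measurableT|exact: i].
transitivity (\int[lebn n]_y (Cfl n g / 2 * \int[lebn n]_z f y z)).
 by apply: eq_Rintegral => y _; rewrite c2 mulrCA.
rewrite c1 E; apply: (congr1 (fun a => Cfl n g / 2 * a)).
by apply: eq_Rintegral => z _; exact: c3.
Qed.

End fractional_green.

(** * Passage to the limit in the fractional Laplacian *)

Section families_and_Lam.
Context {R : realType}.
Variables (n : nat) (g : R) (v : 'rV[R]_n -> R).
Hypotheses (g0 : 0 < g) (g1 : g < 1) (cv : continuous v) (vL : Ls g v).
Implicit Types (x y z : 'rV[R]_n).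
Let W : R := n%:R + 2 * g.
Let mv : msble v. Proof. exact: cont_rV_msble. Qed.
Let Wp : 0 < W. Proof. by rewrite ltr_wpDl// mulr_gt0. Qed.
Let W0 : 0 <= W / 2. Proof. by rewrite divr_ge0// ltW. Qed.
Let vb : bwint (W / 2) v.
Proof. by split=> //; exact: (proj2 (@Ls_bwint _ n g g0 v cv vL)). Qed.
Let WW : W / 2 <= W. Proof. by move: Wp; lra. Qed.
Let mbw b : msble (@bw R n b). Proof. exact: msble_bw. Qed.
Let vbabs : bwint (W / 2) (fun y => `|v y|).
Proof.
case: vb => _ fin; split; first by meas.
by move: fin; congr (_ < _)%E; apply: eq_integral => y _; rewrite normr_id.
Qed.

(** A common majorant for the convolutions of [v] with all kernels of weight [W]. As [bw W] decays
    twice as fast as the [Ls] weight, the majorant belongs to the same weighted space as [v]. *)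
Definition hdom x := cvl (bw W) (fun y => `|v y|) x.

Let hint x : intgr (lebn n) (fun y => bw W (x - y) * `|v y|).
Proof.
apply: (@cvl_integrable _ _ (W / 2) _ 1 _ x W0 ler01 (mbw W) _ vbabs) => z.
by rewrite mul1r ger0_norm ?bw_ge0// bw_le.
Qed.

Let hdom_ge0 x : 0 <= hdom x.
Proof. by apply: Rintegral_ge0 => y _; rewrite mulr_ge0 ?bw_ge0. Qed.

Let mhdom : msble hdom.
Proof. by apply: msble_cvl; [exact: mbw|meas]. Qed.

Let hdom_dom (K : 'rV[R]_n -> R) (C : R) x : 0 <= C -> msble K -> (forall z, `|K z| <= C * bw W z) ->
 `|cvl K v x| <= C * hdom x.
Proof.
move=> C0 mK KC.
have KC' z : `|K z| <= C * bw (W / 2) z.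
 by apply: le_trans (KC z) _; rewrite ler_wpM2l// bw_le.
have i1 := cvl_integrable x W0 C0 mK KC' vb.
have i2 := integrableZl measurableT C (hint x).
apply: le_trans (le_normr_Rintegral measurableT i1) _.
apply: (@le_trans _ _ (\int[lebn n]_y (C * (bw W (x - y) * `|v y|)))); last first.
 by apply: eq_leW; apply: RintegralZl; [exact: measurableT|exact: hint].
apply: (le_Rintegral measurableT); [exact: integrable_abse i1|exact: i2|].
by move=> y _ /=; rewrite normrM mulrA ler_wpM2r.
Qed.

(** Peetre's inequality: moving the base point of the weight from [x] to [y] costs a power of
    $1+|x-y|^2$. *)
Let peetre x y : bw (W / 2) x <= 2 `^ (W / 2) * (bw (- (W / 2)) (x - y) * bw (W / 2) y).
Proof.
rewrite /bw opprK !powRN mulrA -powRM ?(ltW (bw1_gt0 _))// ler_pdivlMr ?powR_gt0 ?bw1_gt0//.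
rewrite mulrC ler_pdivrMr ?powR_gt0 ?bw1_gt0// -powRM ?mulr_ge0 ?(ltW (bw1_gt0 _))//.
apply: (ge0_ler_powR W0); rewrite ?nnegrE ?mulr_ge0 ?(ltW (bw1_gt0 _))//.
have h := @sqnD_le R n 1 (y - x) x ltr01; rewrite subrK invr1 in h.
have e : sqn (y - x) = sqn (x - y) by rewrite -sqnN opprB.
rewrite e in h; have := sqn_ge0 (x - y); have := sqn_ge0 x => a b.
have : 0 <= sqn (x - y) * sqn x by exact: mulr_ge0.
by move: h; rewrite -[1 + 1]/(2 : R) => h; nra.
Qed.

Let bw_lty : (\int[lebn n]_y (bw (W / 2) y)%:E < +oo)%E.
Proof.
apply: (@le_int_lty _ _ _ _ _ (fun z => 2 * wt W z)).
- by move=> z; exact: bw_ge0.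
- exact: mbw.
- by meas.
- by move=> z; apply: bw_wt; exact: ltW.
rewrite (ge0_intZl (lebn n) (ler0n _ 2)); [|by meas|by move=> z; exact: wt_ge0].
by rewrite lte_mul_pinfty ?lee_fin// int_wt.
Qed.

(** Half of the decay of [bw W (x - y)] pays, by Peetre's inequality, for moving the outer weight
    from [x] to [y]; the other half is integrable in [x]. *)
Let hdom_lty : (\int[lebn n]_x (`|hdom x| * wt W x)%:E < +oo)%E.
Proof.
have mw : msble (@wt R n W) by meas.
have mf : msble (fun p : 'rV[R]_n * 'rV[R]_n => wt W p.1 * (bw W (p.1 - p.2) * `|v p.2|)).
 by have := mbw W => m1; meas.
have wnn x y : 0 <= wt W x * (bw W (x - y) * `|v y|).
 by apply: mulr_ge0; [exact: wt_ge0|apply: mulr_ge0; [exact: bw_ge0|exact: normr_ge0]].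
have E : (\int[lebn n]_x (`|hdom x| * wt W x)%:E = \int[lebn n]_x \int[lebn n]_y (wt W x * (bw W (x - y) * `|v y|))%:E)%E.
 apply: eq_integral => x _; rewrite (ge0_intZl (lebn n) (wt_ge0 W x)).
 - by rewrite EFin_int; [rewrite ger0_norm ?hdom_ge0// mulrC EFinM|exact: hint].
 - by exact: integrable_meas (hint x).
 - by move=> y; apply: mulr_ge0; [exact: bw_ge0|exact: normr_ge0].
rewrite E (int_swapR (lebn n) (lebn n) mf wnn).
have [_ vfin] := vb.
pose c : R := 2 `^ (W / 2) * 2 `^ (W / 2).
have c0 : 0 <= c by apply: mulr_ge0; exact: powR_ge0.
pose I := fine (\int[lebn n]_y (bw (W / 2) y)%:E)%E.
have I1 : (0 <= \int[lebn n]_y (bw (W / 2) y)%:E)%E by apply: int_ge0R => y; exact: bw_ge0.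
have I0 : 0 <= I by exact: fine_ge0 I1.
have IE : (\int[lebn n]_y (bw (W / 2) y)%:E)%E = I%:E.
 by rewrite /I fineK// (ge0_fin_numE I1) bw_lty.
apply: (@le_lt_trans _ _ (\int[lebn n]_y ((c * I) * (`|v y| * bw (W / 2) y))%:E)%E); last first.
 rewrite (ge0_intZl (lebn n) (mulr_ge0 c0 I0)).
 - by rewrite lte_mul_pinfty// lee_fin mulr_ge0.
 - by have := mbw (W / 2) => m1; meas.
 - by move=> y; apply: mulr_ge0; [exact: normr_ge0|exact: bw_ge0].
apply: ge0_le_integral => //.
- by move=> y _; apply: int_ge0R => x; exact: wnn.
- have mf' : msble (fun p : 'rV[R]_n * 'rV[R]_n => wt W p.2 * (bw W (p.2 - p.1) * `|v p.1|)).
  by have := mbw W => m1; meas.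
 apply: (msble_int2 (lebn n) (f := fun y x => (wt W x * (bw W (x - y) * `|v y|))%:E) (mEFin mf')).
 by move=> y x; rewrite lee_fin wnn.
- by apply: mEFin; have := mbw (W / 2) => m1; meas.
move=> y _.
have nn0 : 0 <= c * (`|v y| * bw (W / 2) y).
 by apply: mulr_ge0 => //; apply: mulr_ge0; [exact: normr_ge0|exact: bw_ge0].
have mby : msble (fun x => bw (W / 2) (x - y)).
 by have := mbw (W / 2) => m1; meas.
have -> : ((c * I) * (`|v y| * bw (W / 2) y))%:E = (\int[lebn n]_x ((c * (`|v y| * bw (W / 2) y)) * bw (W / 2) (x - y))%:E)%E.
 rewrite (ge0_intZl (lebn n) nn0 mby); last by move=> x; exact: bw_ge0.
 rewrite (@integral_rV_add _ n (- y) (fun x => (bw (W / 2) x)%:E)); last exact: mEFin.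
 by rewrite IE -EFinM; congr EFin; ring.
apply: le_intR.
- by move=> x; exact: wnn.
- by have := mbw W => m1; meas.
- by apply: measurable_funM; [exact: measurable_cst|exact: mby].
move=> x; have w1 := wt_bw x (ltW Wp); have w2 := peetre x y.
have W2 : bw W (x - y) = bw (W / 2) (x - y) * bw (W / 2) (x - y) by rewrite -bwD -splitr.
have W3 : bw (- (W / 2)) (x - y) * bw (W / 2) (x - y) = 1 by rewrite -bwD addNr bw0.
have w3 : wt W x <= c * (bw (- (W / 2)) (x - y) * bw (W / 2) y).
 by apply: le_trans w1 _; rewrite /c -mulrA ler_wpM2l// powR_ge0.
apply: le_trans (ler_wpM2r _ w3) _; first by apply: mulr_ge0; [exact: bw_ge0|exact: normr_ge0].
rewrite W2 le_eqVlt; apply/orP; left; apply/eqP.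
transitivity (c * bw (W / 2) y * `|v y| * bw (W / 2) (x - y) * (bw (- (W / 2)) (x - y) * bw (W / 2) (x - y))); first by ring.
by rewrite W3; ring.
Qed.

Lemma Fam_each l b (K : nat -> 'rV[R]_n -> R) Kl k : Fam l b K Kl -> Fam l b (fun=> K k) (K k).
Proof.
elim: l K Kl => [|l IH] K Kl [c c0 [C C0 B] L P]; split => //; try (by exists C); try (by move=> x; exact: cvg_cst).
case: P => d d0 P; split; [by move=> _; exact: d|exact: (d k)|move=> i; exact: IH (P i)].
Qed.

Let pd2_cvl (K : 'rV[R]_n -> R) : Fam 2 (W / 2) (fun=> K) K ->
 [/\ forall y i, derivable (cvl K v) y (ebase R i),
   forall y i j, derivable (pd i (cvl K v)) y (ebase R j) &
   forall i j, pd j (pd i (cvl K v)) = cvl (pd j (pd i K)) v].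
Proof.
move=> FK; have D1 := cvl_pd W0 (FamW FK) vb.
have E1 i : pd i (cvl K v) = cvl (pd i K) v by apply/funext => y; exact: pd_val (D1 y i).
have D2 i := cvl_pd W0 (Fam_pd i FK) vb.
split=> [y i|y i j|i j].
- by have [] := D1 y i.
- by rewrite E1; have [] := D2 i y j.
- by rewrite E1; apply/funext => y; exact: pd_val (D2 i y j).
Qed.

(** Dominated convergence in the singular integral. For [|z| <= 1] the second derivatives of the
    convolutions are bounded uniformly in [k], giving $|z|^2$; beyond, all of them lie below the
    majorant [hdom]. *)
Lemma Lam_Fam_cvg (K : nat -> 'rV[R]_n -> R) Kl x : Fam 2 W K Kl ->
 (sdiff_int W (cvl Kl v) x < +oo)%E /\
 (fun k => Lam g (cvl (K k) v) x) @ \oo --> Lam g (cvl Kl v) x.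
Proof.
move=> FK.
have [hd [mhd hd0 hdC hdL]] : exists hd : 'rV[R]_n -> R, [/\ msble hd, (forall y, 0 <= hd y),
  (forall (K : 'rV[R]_n -> R) (C : R) x, 0 <= C -> msble K ->
   (forall z, `|K z| <= C * bw W z) -> `|cvl K v x| <= C * hd x) &
  (\int[lebn n]_x (`|hd x| * wt W x)%:E < +oo)%E].
 by exists hdom; split; [exact: mhdom|exact: hdom_ge0|exact: hdom_dom|exact: hdom_lty].
have FK2 := Fam_weight WW FK.
have [C C0 KC] := Fam_bound FK; have cK := Fam_cont FK.
have mK k : msble (K k) by exact: cont_rV_msble (cK k).
pose U k := cvl (K k) v.
have mU k : msble (U k) by exact: msble_cvl.
have UC k y : `|U k y| <= C * hd y by apply: hdC => //; exact: KC.
have Ul y : U ^~ y @ \oo --> cvl Kl v y.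
 apply: (proj2 (@dominatedR _ _ _ (lebn n) (fun k z => K k (y - z) * v z) (fun z => Kl (y - z) * v z)
  (fun z => C * (bw W (y - z) * `|v z|)) _ _ _ _)).
 - by move=> k; have := mK k => m1; meas.
 - exact: (integrableZl measurableT C (hint y)).
 - by move=> k z; rewrite normrM mulrA ler_wpM2r.
 - by move=> z; apply: cvgMl; exact: Fam_cvg FK _.
pose r := enorm x + 3.
have H i j : exists2 c : R, 0 <= c & forall k y, enorm y <= r -> `|pd j (pd i (U k)) y| <= c.
 have F0 := Fam_pd j (Fam_pd i FK2); have [c c0 B] := Fam_bound F0.
 exists (c * (2 * (1 + r ^+ 2)) `^ (W / 2) * \int[lebn n]_y (`|v y| * bw (W / 2) y)).
  apply: mulr_ge0; first by apply: mulr_ge0 => //; exact: powR_ge0.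
  by apply: Rintegral_ge0 => y _; apply: mulr_ge0; [exact: normr_ge0|exact: bw_ge0].
 move=> k y yr; have [_ _ ->] := pd2_cvl (Fam_each k FK2).
 have cp : continuous (pd j (pd i (K k))) by exact: (@Fam_cont _ _ _ _ _ _ F0 k).
 exact: (cvl_bound W0 c0 (cont_rV_msble cp) (B k) vb yr).
pose cc i j := sval (cid2 (H i j)).
have cc0 i j : 0 <= cc i j by rewrite /cc; case: cid2.
have ccP i j k y : enorm y <= r -> `|pd j (pd i (U k)) y| <= cc i j.
 by rewrite /cc; case: cid2 => c /= _; exact.
pose A := \sum_(i < n) \sum_(j < n) cc i j.
have A0 : 0 <= A by apply: sumr_ge0 => i _; apply: sumr_ge0.
have near k z : enorm z <= 1 -> `|sdiff (U k) x z| <= A * enorm z ^+ 2.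
 move=> z1; have [d1 d2 _] := pd2_cvl (Fam_each k FK2).
 have [xi xiz ->] := sdiff_telescope2 x z d1 d2.
 rewrite normrN mulr_suml; apply: le_trans (ler_norm_sum _ _ _) _; apply: ler_sum => i _.
 rewrite mulr_suml; apply: le_trans (ler_norm_sum _ _ _) _; apply: ler_sum => j _.
 rewrite mulrC normrM; apply: ler_pM => //.
  apply: ccP; apply: le_trans (enorm_triangle _ _) _; rewrite lerD2l.
  by apply: le_trans (xiz i j) _; rewrite -[leRHS]mulr1 ler_wpM2l.
 by rewrite normrM expr2; apply: ler_pM => //; exact: coord_le_enorm.
have mw : msble (@wt R n W) by meas.
have mm : msble (fun z : 'rV[R]_n => Num.min 1 (enorm z `^ 2) * rker W z) by meas.
pose h z := A * (Num.min 1 (enorm z `^ 2) * rker W z) +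
 2 * C * (2 * hd x * wt W z + (hd (z + x) * wt W z + hd (x - z) * wt W z)).
have g22 : 2 * g < 2 by rewrite gtr_pMr.
have i1 : intgr (lebn n) (fun z : 'rV[R]_n => Num.min 1 (enorm z `^ 2) * rker W z).
 by apply: min_rker_integrable.
have i2 : intgr (lebn n) (@wt R n W).
 apply: integrableR => //; have := @int_wt R n g g0 g1; congr (_ < _)%E.
 by apply: eq_integral => z _; rewrite ger0_norm ?wt_ge0.
have shfin (f : 'rV[R]_n -> R) (c : R) : msble f -> 0 <= c -> (forall z, 0 <= f z) ->
  (\int[lebn n]_z (`|f z| * wt W z)%:E <= c%:E * \int[lebn n]_z (`|hd z| * wt W z)%:E)%E ->
  intgr (lebn n) (fun z => f z * wt W z).
 move=> mf c0 f0 le; apply: integrableR; first by meas.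
 apply: (@le_lt_trans _ _ (c%:E * \int[lebn n]_z (`|hd z| * wt W z)%:E)%E).
  apply: le_trans le; apply: eq_leW; apply: eq_integral => z _.
  by rewrite normrM (ger0_norm (wt_ge0 _ _)).
 by rewrite lte_mul_pinfty// lee_fin.
have c10 : 0 <= 2 `^ W * (1 + enorm x `^ W) by rewrite mulr_ge0 ?addr_ge0 ?powR_ge0.
have mh1 : msble (fun z => hd (z + x)) by meas.
have mh2 : msble (fun z => hd (x - z)) by meas.
have i3 := shfin _ _ mh1 c10 (fun z => hd0 (z + x)) (int_shift_wt (ltW Wp) (lexx (enorm x)) mhd).
have i4 := shfin _ _ mh2 c10 (fun z => hd0 (x - z)) (int_shift_wt_sub (ltW Wp) (lexx (enorm x)) mhd).
have ih : intgr (lebn n) h.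
 have i34 := integrableD measurableT i3 i4.
 have i234 := integrableZl measurableT (2 * C) (integrableD measurableT (integrableZl measurableT (2 * hd x) i2) i34).
 exact: (integrableD measurableT (integrableZl measurableT A i1) i234).
have msd k : msble (fun z => sdiff (U k) x z * rker W z).
 by have := msble_sdiff x (mU k) => m1; meas.
have hbd k z : `|sdiff (U k) x z * rker W z| <= h z.
 have wz := wt_ge0 W z; have rz := rker_ge0 W z.
 have m0 : 0 <= Num.min 1 (enorm z `^ 2) :> R by rewrite le_min ler01 powR_ge0.
 have t1 : 0 <= A * (Num.min 1 (enorm z `^ 2) * rker W z) by apply: mulr_ge0 => //; exact: mulr_ge0.
 have t2 : 0 <= 2 * hd x * wt W z + (hd (z + x) * wt W z + hd (x - z) * wt W z).
  by rewrite !addr_ge0// ?mulr_ge0// ?mulr_ge0.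
 have C20 : 0 <= 2 * C by rewrite mulr_ge0.
 have t3 := mulr_ge0 C20 t2.
 rewrite normrM (ger0_norm rz) /h; have [z1|z1] := leP (enorm z) 1.
  have -> : Num.min 1 (enorm z `^ 2) = enorm z ^+ 2.
   by rewrite -(powR_mulrn 2) ?enorm_ge0//; apply/min_idPr; apply: powR_le1; rewrite ?enorm_ge0.
  apply: (@le_trans _ _ (A * (enorm z ^+ 2 * rker W z))); last by rewrite lerDl.
  by rewrite mulrA ler_wpM2r// near.
 have rk := @rker_wt R n W 1 z Wp ltr01 (ltW z1); rewrite powR1 in rk.
 have a1 : `|sdiff (U k) x z| <= C * (2 * hd x + (hd (z + x) + hd (x - z))).
  rewrite /sdiff; apply: le_trans (ler_normB _ _) _.
  have := UC k x; have := UC k (x + z); have := UC k (x - z); rewrite (addrC x z) => b1 b2 b3.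
  have := ler_normB (2 * U k x) (U k (z + x)); rewrite normrM (ger0_norm (ler0n _ 2)); lra.
 apply: (@le_trans _ _ (2 * C * (2 * hd x * wt W z + (hd (z + x) * wt W z + hd (x - z) * wt W z)))); last by rewrite lerDr.
 apply: (@le_trans _ _ (C * (2 * hd x + (hd (z + x) + hd (x - z))) * ((1 + 1) * wt W z))); first by apply: ler_pM.
 by apply: eq_leW; ring.
have sl z : (fun k => sdiff (U k) x z * rker W z) @ \oo --> sdiff (cvl Kl v) x z * rker W z.
 apply: cvgMl; apply: cvgB; last exact: Ul.
 by apply: cvgB; [apply: cvgMr; exact: Ul|exact: Ul].
have [iL cL] := dominatedR msd ih hbd sl.
split; last by apply: cvgMr; exact: cL.
have := integrable_abs_lty iL; congr (_ < _)%E; apply: eq_integral => z _.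
by rewrite normrM (ger0_norm (rker_ge0 _ _)).
Qed.

End families_and_Lam.

(** * Compactly supported approximations of the heat kernel *)

Section cutoffs.
Context {R : realType}.
Variable n : nat.
Implicit Types (x y z : 'rV[R]_n) (K : nat -> 'rV[R]_n -> R).

(** The factor increases to 1 with [k], which permits monotone convergence, and it has more
    derivatives than the [N] that are used. *)
Definition cutg (N : nat) (t : R) (k : nat) x : R := pp N.+1 (1 - @epsk R k * sqn x) * gauss t x.

Lemma Fam_cutg l b t : 0 < t -> Fam l b (cutg l t) (gauss t).
Proof.
move=> t0; have := FamM (@Fam_cut R n l l.+1 (ltnSn l)) (@Fam_gauss R n l t (b + l%:R / 2) t0).
have -> : - (l%:R / 2) + (b + l%:R / 2) = b by ring.
by have -> : (fun x => 1 * gauss t x) = @gauss R n t by apply/funext => x; rewrite mul1r.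
Qed.

Lemma Fam_iter_nlap l j b K Kl : Fam (2 * j + l) b K Kl ->
 Fam l b (fun k => iter j (@nlap R n) (K k)) (iter j (@nlap R n) Kl).
Proof.
elim: j l => [|j IH] l; first by rewrite muln0.
move=> H; apply: (@Fam_nlap _ _ l _ (fun k => iter j (@nlap R n) (K k))).
have E : (2 * j + l.+2 = 2 * j.+1 + l)%N by rewrite mulnS -addnA [RHS]addnCA.
by apply: IH; rewrite E.
Qed.

Lemma suppd_iter_nlap r j (u : 'rV[R]_n -> R) : suppd r u -> suppd r (iter j (@nlap R n) u).
Proof. by move=> us; elim: j => //= j IH; exact: nlap_supp. Qed.

Lemma suppd_cutg N t k : suppd k.+1%:R (cutg N t k).
Proof.
move=> x xk; rewrite /cutg pp_neg ?mul0r// subr_le0 /epsk -ler_pdivrMl ?invr_gt0// invrK mulr1.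
have k1 : 1 <= k.+1%:R :> R by rewrite ler1n.
by rewrite -enorm_sqr expr2; nra.
Qed.

Lemma cutg_ge0 N t k x : 0 <= cutg N t k x.
Proof. by apply: mulr_ge0; [exact: pp_ge0|exact: gauss_ge0]. Qed.

Lemma cutg_nondecreasing N t x : nondecreasing_seq (fun k => cutg N t k x).
Proof.
move=> i j ij; rewrite ler_wpM2r ?gauss_ge0// /pp.
apply: lerXn2r; [by rewrite nnegrE le_max lexx|by rewrite nnegrE le_max lexx|].
have h : 1 - @epsk R i * sqn x <= 1 - @epsk R j * sqn x.
 by rewrite lerD2l lerN2 ler_wpM2r ?sqn_ge0// lef_pV2 ?posrE// ler_nat.
have mx (a b : R) : a <= b -> Num.max 0 a <= Num.max 0 b.
 by case: (leP 0 a) => a0; case: (leP 0 b) => b0 ab; lra.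
exact: mx h.
Qed.

(** No growth bound on [F] is at hand, so domination is impossible. Positivity and monotone
    convergence give both the integrability of [F] against the Gaussian and the value of the
    integral. *)
Lemma cutg_limit N (t : R) (F : 'rV[R]_n -> R) (l : R) x : 0 < t -> continuous F -> (forall y, 0 <= F y) ->
 (fun k => cvl (cutg N t k) F x) @ \oo --> l ->
 intgr (lebn n) (fun y => gauss t (x - y) * F y) /\ heat t F x = l.
Proof.
move=> t0 cF F0 cl; have FC := Fam_cutg N 0 t0; have cC := Fam_cont FC.
have mF := cont_rV_msble cF.
have mC k : msble (cutg N t k) by exact: cont_rV_msble (cC k).
have p0 k y : 0 <= cutg N t k (x - y) * F y by apply: mulr_ge0; [exact: cutg_ge0|exact: F0].
have mp k : msble (fun y => cutg N t k (x - y) * F y) by have := mC k => m1; meas.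
have ip k : intgr (lebn n) (fun y => cutg N t k (x - y) * F y).
 apply: (@supp_integrable _ _ (k.+1%:R + enorm x)).
   have cpF (p : 'rV[R]_n -> R) : continuous p -> continuous (fun y => p (x - y) * F y).
   move=> cp y; apply: continuousM; last exact: cF.
   apply: (@continuous_comp _ _ _ (fun y => x - y) p); last exact: cp.
   by apply: continuousB; [exact: cst_continuous|exact: cvg_id].
  exact: cpF (cC k).
 move=> y yr; rewrite suppd_cutg ?mul0r//; have := enorm_triangle (y - x) x; rewrite subrK enorm_sub; lra.
have mono y : nondecreasing_seq (fun k => cutg N t k (x - y) * F y).
 by move=> i j ij; rewrite ler_wpM2r//; exact: cutg_nondecreasing.
have pl y : (fun k => cutg N t k (x - y) * F y) @ \oo --> gauss t (x - y) * F y.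
 by apply: cvgMl; exact: Fam_cvg FC _.
have c1 := @mono_int_cvg _ _ _ (lebn n) _ _ mp p0 mono pl.
have c2 : (fun k => \int[lebn n]_y (cutg N t k (x - y) * F y)%:E)%E @ \oo --> l%:E.
 have -> : (fun k => \int[lebn n]_y (cutg N t k (x - y) * F y)%:E)%E = (fun k => (cvl (cutg N t k) F x)%:E).
  by apply/funext => k; rewrite EFin_int.
 by apply/fine_cvgP; split; [apply: nearW|exact: cl].
have E := cvg_unique _ c1 c2.
have ig : intgr (lebn n) (fun y => gauss t (x - y) * F y).
 apply: integrableR; first by meas.
 apply: (@le_lt_trans _ _ l%:E); last exact: ltry.
 apply: eq_leW.
 transitivity (\int[lebn n]_y (gauss t (x - y) * F y)%:E)%E; last exact: E.
 apply: eq_integral => y _; rewrite ger0_norm//.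
 by apply: mulr_ge0; [exact: gauss_ge0|exact: F0].
split=> //; apply: EFin_inj; transitivity (\int[lebn n]_y (gauss t (x - y) * F y)%:E)%E; last exact: E.
by apply/esym; exact: EFin_int.
Qed.

End cutoffs.

(** * The heat flow of the right-hand side *)

Section heat_of_solution.
Context {R : realType}.
Variables (n m : nat) (g : R) (v F : 'rV[R]_n -> R).
Hypotheses (g0 : 0 <= g) (g1 : g < 1) (cv : continuous v) (vL : Ls g v)
 (cF : continuous F) (F0 : forall x, 0 <= F x).
Implicit Types (x : 'rV[R]_n) (t : R).
Let mv : msble v. Proof. exact: cont_rV_msble. Qed.
Let vG : GI v. Proof. exact: Ls_GI g0 mv vL. Qed.
Let mF : msble F. Proof. exact: cont_rV_msble. Qed.

(** Of the [2 * m + 2] derivatives, [2 * m] are taken by Green's formula and two remain for the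
    limit in the fractional Laplacian. *)
Let phik t k := @cutg R n (2 * m + 2)%N t k.
Let Fphi b t : 0 < t -> Fam 2 b (fun k => iter m (@nlap R n) (phik t k)) (psi m t).
Proof. by move=> t0; rewrite psiE; apply: Fam_iter_nlap; exact: Fam_cutg. Qed.

Let Cphi w t k x : 0 < t -> Ck (2 * m) w -> F = iter m (@nlap R n) w ->
 cvl (phik t k) F x = cvl (iter m (@nlap R n) (phik t k)) w x.
Proof.
move=> t0 wC ->; apply: (@green_cvl _ _ k.+1%:R) => //; last exact: suppd_cutg.
have C2 := @Fam_Ck _ _ _ _ _ _ k (Fam_cutg n (2 * m + 2)%N 0 t0).
have C3 : Ck (2 * m + 2)%N (phik t k) by refine C2.
by apply: Ck_le C3; exact: leq_addr.
Qed.

Lemma heat_iter_nlap t x : g = 0 -> Ck (2 * m) v -> F = iter m (@nlap R n) v -> 0 < t ->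
 intgr (lebn n) (fun y => gauss t (x - y) * F y) /\ heat t F x = cvl (psi m t) v x.
Proof.
move=> gz vC FE t0; apply: (@cutg_limit _ _ (2 * m + 2)%N) => //.
have -> : (fun k => cvl (cutg (2 * m + 2)%N t k) F x) = (fun k => cvl (iter m (@nlap R n) (phik t k)) v x).
 by apply/funext => k; exact: Cphi.
have FK := Fphi ((n%:R + 2 * g) / 2) t0; have [C C0 B] := Fam_bound FK.
apply: (proj2 (@dominatedR _ _ _ (lebn n) (fun k z => iter m (@nlap R n) (phik t k) (x - z) * v z)
 (fun z => psi m t (x - z) * v z) (fun z => 2 * C * (`|v z| * wt (n%:R + 2 * g) (x - z))) _ _ _ _)).
- move=> k; have m1 : msble (iter m (@nlap R n) (phik t k)).
  have cp : continuous (iter m (@nlap R n) (phik t k)) by exact: (@Fam_cont _ _ _ _ _ _ FK k).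
  exact: cont_rV_msble cp.
 by meas.
- exact: (integrableZl measurableT (2 * C) (Ls_wt_integrable x g0 mv vL)).
- move=> k z; rewrite normrM; have W0 : 0 <= n%:R + 2 * g by rewrite addr_ge0// mulr_ge0.
 apply: (@le_trans _ _ (C * (2 * wt (n%:R + 2 * g) (x - z)) * `|v z|)).
  by rewrite ler_wpM2r//; apply: le_trans (B k _) _; rewrite ler_wpM2l// bw_wt.
 by apply: eq_leW; ring.
- by move=> z; apply: cvgMl; exact: Fam_cvg FK _.
Qed.

Hypothesis gp : 0 < g.
Variable bt : R.
Hypotheses (gb : 2 * g < bt) (b2 : bt <= 2) (vSD : SD bt v)
 (LC : Ck (2 * m) (Lam g v)) (FE : F = iter m (@nlap R n) (Lam g v)).

(** All derivatives and the fractional Laplacian are moved onto the cut-off kernel, where the limit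
    is legitimate. What results is [Lam] of [cvl (psi m t) v], which subordination turns into a
    Marchaud integral in time. *)
Lemma heat_iter_nlap_Lam t x : 0 < t ->
 intgr (lebn n) (fun y => gauss t (x - y) * F y) /\
 intgr leb1 (fun r => pw (- g - 1) r * (cvl (psi m t) v x - cvl (psi m (t + r)) v x)) /\
 heat t F x = kap g * \int[leb1]_r (pw (- g - 1) r * (cvl (psi m t) v x - cvl (psi m (t + r)) v x)).
Proof.
move=> t0; have FK := Fphi (n%:R + 2 * g) t0.
have [fin cL] := Lam_Fam_cvg gp g1 cv vL x FK.
have [iF hF] : intgr (lebn n) (fun y => gauss t (x - y) * F y) /\
  heat t F x = Lam g (cvl (psi m t) v) x.
 apply: (@cutg_limit _ _ (2 * m + 2)%N) => //.
 have -> : (fun k => cvl (cutg (2 * m + 2)%N t k) F x) = (fun k => Lam g (cvl (iter m (@nlap R n) (phik t k)) v) x).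
  apply/funext => k; rewrite (@Cphi (Lam g v))//.
  apply: (Lam_cvl gp g1 gb b2 cv vL vSD (r := k.+1%:R)) => //; first exact: (@Fam_cont _ _ _ _ _ _ FK k).
  by apply: suppd_iter_nlap; exact: suppd_cutg.
 exact: cL.
split; first exact: iF.
have [mU iU] := GI_psi m t0 vG.
have [iL LE] := Lam_heat gp g1 mU (fun r r0 => iU r x r0) fin.
have E r : pw (- g - 1) r * (cvl (psi m t) v x - heat r (cvl (psi m t) v) x) =
  pw (- g - 1) r * (cvl (psi m t) v x - cvl (psi m (t + r)) v x).
 have [r0|r0] := leP r 0; first by rewrite pw0// !mul0r.
 by have := cvl_psi_conv 0 m x r0 t0 vG; rewrite psi0 add0n (addrC r) => <-.
split; first by move: iL; apply: eq_integrable => // r _ /=; rewrite E.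
by rewrite hF LE; congr (_ * _); apply: eq_Rintegral => r _; exact: E.
Qed.

End heat_of_solution.

(** * The heat flow of [v] as a constant plus a fractional integral *)

Section integral_representation.
Context {R : realType}.

Lemma integral_decreasing (H G : R -> R) (t l : R) : decreasing_to H G -> 0 < t -> (forall s : R, 0 < s -> 0 <= G s) ->
 (forall e : R, 0 < e -> exists N, forall r, N < r -> `|H r - l| <= e) ->
 (\int[leb1]_s (pw (1 - 1) s * G (t + s))%:E = (H t - l)%:E)%E.
Proof.
move=> HG t0 G0 Hl; have cH := decreasing_continuous HG; have [dH cG] := HG.
pose f := shiftp G t 0.
have cf : continuous f by exact: cont_shiftp.
have mf : msble f by exact: msble_continuous_shiftp.
have f0 (x : R) : 0 <= x -> 0 <= f x by move=> x0; rewrite /f shiftpE// addr0; apply: G0; rewrite ltr_wpDr.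
pose Fn (x : R) := - shiftp H t 0 x.
have dF (x : R) : 0 <= x -> is_derive x 1 Fn (f x).
 by move=> x0; have D := is_deriveN (is_derive_shiftp 0 HG t0 x0); rewrite opprK in D.
have Fl : Fn x @[x --> +oo] --> - l.
 apply/cvgrPdist_le => e e0; have [N NP] := Hl e e0; exists (Num.max N 0); split; first exact: num_real.
 move=> r; rewrite gt_max => /andP[Nr r0]; rewrite /Fn shiftpE ?(ltW r0)// addr0 opprK addrC.
 by apply: NP; apply: lt_trans Nr _; rewrite ltrDr.
have E : (\int[leb1]_x (f x * (0 <= x)%R%:R)%:E = (H t - l)%:E)%E.
 have := FTC_infty f0 dF (fun x _ => cf x) Fl.
 rewrite /Fn shiftpE// !addr0 opprK addrC => <-; rewrite [RHS]integral_mkcond.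
 apply: eq_integral => x _; rewrite patchE mem_setE in_itv/= andbT.
 by case: (0 <= x); rewrite ?mulr1 ?mulr0.
rewrite -E.
transitivity (\int[leb1]_s (pw (1 - 1) s * f s)%:E)%E.
 apply: eq_integral => s _; have [s0|s0] := leP s 0; first by rewrite pw0// !mul0r.
 by rewrite /f shiftpE ?(ltW s0)// addr0.
apply: (@int_point _ 0); [by meas|by meas|].
move=> x x0; have [x1|x1] := leP x 0.
 by rewrite pw0// mul0r leNgt lt_neqAle x0 x1 mulr0.
by rewrite pwE// subrr powRr0 (ltW x1) mul1r mulr1.
Qed.

Variables (n m : nat) (g : R) (v F : 'rV[R]_n -> R).
Hypotheses (g0 : 0 <= g) (g1 : g < 1) (s0 : 0 < m%:R + g) (mv : msble v) (vL : Ls g v)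
 (v0 : forall x, 0 <= v x) (cF : continuous F) (F0 : forall x, 0 <= F x) (FG : GI F)
 (hz : g = 0 -> forall t x, 0 < t -> heat t F x = cvl (psi m t) v x)
 (hp : 0 < g -> forall x, marchaud_pair g (fun t => cvl (psi m t) v x) (fun t => heat t F x)).
Implicit Types (x : 'rV[R]_n) (t e : R) (j : nat).

Let H j x t := cvl (psi j t) v x.
Let vG : GI v. Proof. exact: Ls_GI g0 mv vL. Qed.

Let decH j x : decreasing_to (H j x) (H j.+1 x).
Proof.
split=> t t0; first exact: is_derive_cvl_psi.
have D : is_derive t 1 (H j.+1 x) (- H j.+2 x t) by exact: is_derive_cvl_psi.
exact: is_derive_continuous D.
Qed.

Let small j x : (0 < j)%N -> forall e, 0 < e -> exists N, forall r, N < r -> `|H j x r| <= e.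
Proof.
move=> j0 e e0; have [C C0 CP] := cvl_psi_decay x j g0 ltr01 mv vL.
have a0 : 0 < 1 - g by rewrite subr_gt0.
have C1 : 0 < C + 1 by rewrite ltr_wpDl.
have Ce : 0 <= (C + 1) / e by rewrite divr_ge0// ltW.
exists (Num.max 1 (((C + 1) / e) `^ (1 - g)^-1)) => r; rewrite gt_max => /andP[r1 rN].
have r0 : 0 < r by exact: lt_trans ltr01 r1.
apply: le_trans (CP r (ltW r1)) _.
apply: (@le_trans _ _ ((C + 1) * r `^ (- (1 - g)))).
 apply: ler_pM; rewrite ?powR_ge0//; first by rewrite lerDl.
 apply: ler_powR; first exact: ltW.
 by rewrite opprB lerD2l lerN2 (ler_nat _ 1).
rewrite powRN ler_pdivrMr ?powR_gt0// mulrC -ler_pdivrMr//.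
have -> : (C + 1) / e = (((C + 1) / e) `^ (1 - g)^-1) `^ (1 - g).
 by rewrite -powRrM mulVf ?gt_eqF// powRr1.
by apply: ge0_ler_powR; rewrite ?nnegrE ?powR_ge0 ?(ltW r0) ?(ltW rN) ?(ltW a0).
Qed.

Let bdd j x t : (0 < j)%N -> 0 < t -> exists2 c, 0 <= c & forall r, 0 <= r -> 0 <= H j x (t + r) + c.
Proof.
move=> j0 t0; have [C C0 CP] := cvl_psi_decay x j g0 t0 mv vL.
exists (C * t `^ (g - j%:R)) => [|r r0]; first by apply: mulr_ge0 => //; exact: powR_ge0.
have tr : t <= t + r by rewrite lerDl.
have := CP _ tr; rewrite ler_norml => /andP[h _].
suff : C * (t + r) `^ (g - j%:R) <= C * t `^ (g - j%:R) by rewrite /H; lra.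
apply: ler_wpM2l => //.
have jg : 0 <= j%:R - g by rewrite subr_ge0; apply: le_trans (ltW g1) _; rewrite (ler_nat _ 1).
rewrite -(opprB j%:R) !powRN lef_pV2 ?posrE ?powR_gt0 ?(lt_le_trans t0)//.
by apply: (ge0_ler_powR jg); rewrite ?nnegrE ?(ltW t0) ?(le_trans (ltW t0)).
Qed.

Let mvt j x (a b : R) : 0 < a -> a < b -> exists2 c, a < c & H j x b - H j x a = - H j.+1 x c * (b - a).
Proof.
move=> a0 ab; have [dH _] := decH j x.
have dM s : s \in `]a, b[ -> is_derive s 1 (H j x) (- H j.+1 x s).
 by rewrite in_itv /= => /andP[sa _]; apply: dH; exact: lt_trans sa.
have cM : {within `[a, b], continuous (H j x)}.
 apply: derivable_within_continuous => s; rewrite in_itv /= => /andP[sa _].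
 by have [] := dH s (lt_le_trans a0 sa).
have [c cab E] := MVT ab dM cM; exists c; last exact: E.
by move: cab; rewrite in_itv /= => /andP[].
Qed.

Let hq0 x s : (0 <= hq F x s)%E.
Proof. by rewrite lee_fin; exact: heat_ge0. Qed.

Let mq x : msble (hq F x).
Proof. exact: msble_hq. Qed.

(** Order 0 stands for the identity, so that integer [m] (the case [g = 0]) follows the same
    recursion. *)
Definition Jz (a : R) (f : R -> \bar R) t := if a == 0 then f t else J a f t.

Let Jz_ge0 a x t : 0 <= a -> (0 <= Jz a (hq F x) t)%E.
Proof.
move=> a0; rewrite /Jz; case: eqP => [_|/eqP an]; first exact: hq0.
by apply: J_ge0 => //; rewrite lt_neqAle eq_sym an.
Qed.

Let J1Jz a x t : 0 <= a -> J 1 (Jz a (hq F x)) t = J (1 + a) (hq F x) t.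
Proof.
move=> a0; have [az|an] := eqVneq a 0.
 have -> : Jz a (hq F x) = hq F x by apply/funext => s; rewrite /Jz az eqxx.
 by rewrite az addr0.
have -> : Jz a (hq F x) = J a (hq F x) by apply/funext => s; rewrite /Jz (negbTE an).
by apply: J_semigroup => //; rewrite lt_neqAle eq_sym an.
Qed.

(** Integrating the derivative from [t] to infinity raises the order of the fractional integral by
    one and leaves the limit [l] at infinity. That limit is 0 for every level above 0. *)
Let stepJ j x t l a : 0 < t -> 0 <= a -> (forall s, 0 < s -> (H j.+1 x s)%:E = Jz a (hq F x) s) ->
 (forall e, 0 < e -> exists N, forall r, N < r -> `|H j x r - l| <= e) ->
 (H j x t)%:E = (l%:E + J (1 + a) (hq F x) t)%E.
Proof.
move=> t0 a0 E Hl.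
have G0 s : 0 < s -> 0 <= H j.+1 x s by move=> sp; rewrite -lee_fin E// Jz_ge0.
have Q := integral_decreasing (decH j x) t0 G0 Hl.
rewrite -J1Jz//.
have -> : J 1 (Jz a (hq F x)) t = (H j x t - l)%:E.
 rewrite /J Gamma1 invr1 mul1e -Q; apply: eq_integral => s _.
 have [sp|sp] := leP s 0; first by rewrite pw0// mul0r mul0e.
 by rewrite EFinM E// addr_gt0.
by rewrite -EFinD addrC subrK.
Qed.

(** Comparison with the zero pair, admissible because the function decays at infinity for [m >= 1].
    For [g = 0] there is nothing to invert. *)
Let base x t : (0 < m)%N -> 0 < t -> (H m x t)%:E = Jz g (hq F x) t.
Proof.
move=> mp t0; rewrite /Jz; case: eqP => [gz|/eqP gn]; first by rewrite /hq (hz gz).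
have gp : 0 < g by rewrite lt_neqAle eq_sym gn.
have [c c0 h0] := bdd x mp t0; have P0 := @marchaud_pair0 R g gp.
have lim e : 0 < e -> exists N, forall r, N < r -> `|H m x (t + r) - (fun=> 0) (t + r)| <= e.
 move=> e0; have [N NP] := small x mp e0; exists N => r Nr; rewrite subr0; apply: NP.
 by apply: lt_trans Nr _; rewrite ltrDr.
have h00 r : 0 <= r -> 0 <= (fun=> 0 : R) (t + r) + c by rewrite add0r.
have [k [k' [Ek Ek' D]]] := marchaud_compare gp g1 (hp gp x) P0 t0 t0 h0 h00 lim.
have h000 r : 0 <= r -> 0 <= (fun=> 0 : R) (t + r) + 0 by rewrite add0r.
have := marchaud_bound gp g1 P0 t0 h000; rewrite Ek' !lee_fin addr0 => /andP[k1 k2].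
have -> : hq F x = EFin \o (fun t => heat t F x) by [].
rewrite Ek; congr EFin; move: D; rewrite -/(H m x t); lra.
Qed.

Let Q j x t : (0 < m - j)%N -> 0 < t -> (H (m - j) x t)%:E = Jz (j%:R + g) (hq F x) t.
Proof.
elim: j t => [|j IH] t; first by rewrite subn0 add0r; exact: base.
move=> mj t0; have mj' : (0 < m - j)%N by apply: leq_trans mj _; rewrite leq_sub2l.
have Sm : (m - j = (m - j.+1).+1)%N by rewrite -subSn// -subn_gt0.
have a0 : 0 <= j%:R + g by rewrite addr_ge0.
have IH' s : 0 < s -> (H (m - j.+1).+1 x s)%:E = Jz (j%:R + g) (hq F x) s by move=> sp; rewrite -Sm IH.
have sm e : 0 < e -> exists N, forall r, N < r -> `|H (m - j.+1) x r - 0| <= e.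
 by move=> e0; have [N NP] := small x mj e0; exists N => r /NP; rewrite subr0.
rewrite (stepJ t0 a0 IH' sm) add0e /Jz.
have -> : 1 + (j%:R + g) = j.+1%:R + g by rewrite addrA -natr1 (addrC 1).
by rewrite gt_eqF// ltr_wpDr.
Qed.

Let H0_ge0 x t : 0 <= H 0 x t.
Proof. by rewrite /H psi0; exact: heat_ge0. Qed.

Let diff1 x (a b e N : R) : (forall r, N < r -> `|H 1 x r| <= e / (`|b - a| + 1)) -> 0 < e -> N < a -> 0 < a -> a < b ->
 `|H 0 x b - H 0 x a| <= e.
Proof.
move=> NP e0 Na a0 ab; have [c ac ->] := @mvt 0%N x a b a0 ab.
have w0 := normr_ge0 (b - a); have w1 : 0 < `|b - a| + 1 by rewrite ltr_wpDl.
rewrite normrM normrN; apply: le_trans (ler_wpM2r w0 (NP c (lt_trans Na ac))) _.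
rewrite mulrAC ler_pdivrMr//; apply: ler_wpM2l; first exact: ltW.
by rewrite lerDl ler01.
Qed.

(** Level 0 need not decay, but its derivative does; hence the values at two times a fixed distance
    apart become equal at infinity. *)
Let diff0 x t : 0 < t -> forall e, 0 < e -> exists N, forall r, N < r -> `|H 0 x (t + r) - H 0 x (1 + r)| <= e.
Proof.
move=> t0 e e0; have w1 : 0 < `|t - 1| + 1 by rewrite ltr_wpDl.
have e1 : 0 < e / (`|t - 1| + 1) by rewrite divr_gt0.
have [N NP] := @small 1%N x isT _ e1; exists (Num.max 0 N) => r; rewrite gt_max => /andP[r0 Nr].
have p1 : 0 < t + r by rewrite addr_gt0.
have p2 : 0 < 1 + r by rewrite addr_gt0.
have N1 : N < t + r by apply: lt_trans Nr _; rewrite ltrDr.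
have N2 : N < 1 + r by apply: lt_trans Nr _; rewrite ltrDr ltr01.
have [t1|t1|->] := ltgtP t 1; last by rewrite subrr normr0 ltW.
- rewrite distrC; apply: (@diff1 x (t + r) (1 + r) e N) => //; last by rewrite ltrD2r.
 by rewrite (_ : 1 + r - (t + r) = - (t - 1)) ?normrN//; ring.
- apply: (@diff1 x (1 + r) (t + r) e N) => //; last by rewrite ltrD2r.
 by rewrite (_ : t + r - (1 + r) = t - 1)//; ring.
Qed.

Theorem heat_representation x : exists2 K : R, 0 <= K &
 forall t, 0 < t -> (heat t v x)%:E = (K%:E + J (m%:R + g) (hq F x) t)%E.
Proof.
have HE t : heat t v x = H 0 x t by rewrite /H psi0.
have [mz|mp] := posnP m.
 have gp : 0 < g by move: s0; rewrite mz add0r.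
 have HP := hp gp x; have h0 t r : 0 <= r -> 0 <= H 0 x (t + r) + 0 by rewrite addr0 H0_ge0.
 have HP0 : marchaud_pair g (H 0 x) (fun t => heat t F x) by move: HP; rewrite /H mz.
 (* For [m = 0] the defect at time 1 is the constant: comparing the pair with itself shows that the
    defect at any other time is the same. *)
 pose K := H 0 x 1 - fine (J g (hq F x) 1).
 have qE : hq F x = EFin \o (fun t => heat t F x) by [].
 have cmp t : 0 < t -> (H 0 x t)%:E = (K%:E + J g (hq F x) t)%E.
  move=> t0.
  have [k [k' [Ek Ek' D]]] := marchaud_compare gp g1 HP0 HP0 t0 ltr01 (h0 t) (h0 1) (diff0 x t0).
  by rewrite qE Ek -EFinD; congr EFin; rewrite /K qE Ek' -D subrK.
 exists K.
  have := marchaud_bound gp g1 HP0 ltr01 (h0 1); rewrite addr0 -qE => /andP[j0 j1].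
  have jf : J g (hq F x) 1 \is a fin_num.
   by rewrite (ge0_fin_numE j0); exact: (le_lt_trans j1 (ltry _)).
  by rewrite /K subr_ge0 -lee_fin (fineK jf).
 have Sg : m%:R + g = g by rewrite mz add0r.
 move=> t t0; rewrite HE Sg; exact: cmp.
have m1 : (m - m.-1 = 1)%N by rewrite -subn1 subKn.
have a0 : 0 <= m.-1%:R + g by rewrite addr_ge0.
have QE s : 0 < s -> (H 1 x s)%:E = Jz (m.-1%:R + g) (hq F x) s.
 by move=> sp; have := @Q m.-1 x s; rewrite m1; apply.
have G0 s : 0 < s -> 0 <= H 1 x s by move=> sp; rewrite -lee_fin QE// Jz_ge0.
(* For [m >= 1] level 0 is nonincreasing and nonnegative, and [K] is its limit. The sign and the
   maximum with 1 produce a nondecreasing function on the whole line, bounded above. *)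
pose f (r : R) := - H 0 x (Num.max 1 r).
have fm : {homo f : a b / a <= b}.
 move=> a b ab; rewrite /f lerN2.
 have [->//|ne] := eqVneq (Num.max 1 a) (Num.max 1 b).
 have mab : Num.max 1 a <= Num.max 1 b.
  by case: (leP 1 a) => h1; case: (leP 1 b) => h2; lra.
 have p1 : 0 < Num.max 1 a by rewrite lt_max ltr01.
 have [|c ac E] := @mvt 0%N x _ _ p1 (_ : Num.max 1 a < Num.max 1 b); first by rewrite lt_neqAle ne.
 rewrite -subr_le0 E mulNr oppr_le0; apply: mulr_ge0; last by rewrite subr_ge0.
 by apply: G0; exact: lt_trans p1 ac.
have fub : has_ubound (range f) by exists 0 => _ [r _ <-]; rewrite oppr_le0 H0_ge0.
have fl := nondecreasing_cvgr fm fub.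
pose K := - sup (range f).
have K0 : 0 <= K.
 rewrite oppr_ge0; apply: ge_sup; first by exists (f 0), 0.
 by move=> _ [r _ <-]; rewrite oppr_le0 H0_ge0.
exists K => // t t0.
have lim e : 0 < e -> exists N, forall r, N < r -> `|H 0 x r - K| <= e.
 move=> e0; move/cvgrPdist_le: fl => /(_ e e0) [N [_ NP]].
 exists (Num.max N 1) => r; rewrite gt_max => /andP[Nr r1].
 by have := NP r Nr; rewrite /f (max_r (ltW r1)) /K !opprK addrC.
rewrite HE (stepJ t0 a0 QE lim); congr (_ + J _ _ _)%E.
have em : m%:R = m.-1%:R + 1 :> R by rewrite natr1 prednK.
by rewrite em; ring.
Qed.

End integral_representation.

(** * From the differential equation to the integral equation *)

Section strong_solutions.
Context {R : realType}.
Variables (n m : nat) (g : R) (f : 'rV[R]_n -> R -> R) (v : 'rV[R]_n -> R).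
Hypotheses (g0 : 0 <= g) (g1 : g < 1) (s0 : 0 < m%:R + g) (sn : m%:R + g < n%:R / 2)
 (f0 : forall x t, 0 <= f x t) (vL : Ls g v) (v0 : forall x, 0 <= v x)
 (vS : strong_sol m g v (fun x => f x (v x))).
Implicit Types (x y : 'rV[R]_n) (t : R).
Let F x := f x (v x).
Let F0 x : 0 <= F x. Proof. exact: f0. Qed.
Let S := m%:R + g.

Let cF : continuous F. Proof. by case: vS => _ [_ [w [_ [_]]]]. Qed.
Let mF : msble F. Proof. exact: cont_rV_msble. Qed.
Let cv : continuous v.
Proof. by case: vS => _ [[e [e0 vC]] _]; exact: Ck_cont (Ckloc_Ck (regexp_gt0 g0 e0) vC). Qed.
Let mv : msble v. Proof. exact: cont_rV_msble. Qed.
Let vG : GI v. Proof. exact: Ls_GI g0 mv vL. Qed.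

Let setup : [/\ GI F, g = 0 -> forall t x, 0 < t -> heat t F x = cvl (psi m t) v x &
 0 < g -> forall x, marchaud_pair g (fun t => cvl (psi m t) v x) (fun t => heat t F x)].
Proof.
have [_ [[e [e0 vC]] [w [wL [wI _]]]]] := vS.
have FE : F = iter m (@nlap R n) w by exact: iter_neg_lapE wI.
have rg := regexp_gt0 g0 e0.
have vk : Ck (2 * m) v by have := Ckloc_Ck rg vC; apply: Ck_le; rewrite leq_addr.
move: (g0); rewrite le_eqVlt => /predU1P[gE|gp].
 have gz : g = 0 by rewrite -gE.
 have wv : w = v by case: wL => h _; exact: h.
 rewrite wv in FE.
 have h t x (t0 : 0 < t) := heat_iter_nlap g0 cv vL cF F0 x gz vk FE t0.
 split; first by split=> // t x t0; have [] := h t x t0.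
  by move=> _ t x t0; have [] := h t x t0.
 by rewrite gz ltxx.
have [b [gb b2 bP]] := @Ckloc_SD R n g e gp g1 e0; have vSD := bP _ _ vC.
have wE : w = Lam g v.
 apply: (frac_lap_unique wL); apply: frac_lap_Lam => // x; exact: (sdiff_int_fin gp g1 gb b2 cv vL vSD).
have LC := Lam_Ck gp g1 gb b2 cv vL vSD vk (Ckloc_SDk gp e0 rg bP vC).
rewrite wE in FE.
have h t x (t0 : 0 < t) := heat_iter_nlap_Lam g0 g1 cv vL cF F0 gp gb b2 vSD LC FE x t0.
split; first by split=> // t x t0; have [] := h t x t0.
 by move=> gz; move: gp; rewrite gz ltxx.
move=> _ x; split.
- exists (fun t => cvl (psi m.+1 t) v x); split=> t t0; first exact: is_derive_cvl_psi.
 have D : is_derive t 1 (fun t => cvl (psi m.+1 t) v x) (- cvl (psi m.+2 t) v x) by exact: is_derive_cvl_psi.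
 exact: is_derive_continuous D.
- exact: msble_heat_time cF x.
- by move=> t _; exact: heat_ge0.
- by move=> t t0; have [_ []] := h t x t0.
- by move=> t t0; have [_ []] := h t x t0.
Qed.

Let FG : GI F. Proof. by case: setup. Qed.

Let rep x : exists2 K : R, 0 <= K & forall t, 0 < t -> (heat t v x)%:E = (K%:E + J S (hq F x) t)%E.
Proof. by have [_ hz hp] := setup; apply: (@heat_representation R n m g v F); assumption. Qed.

(** Close to time 0 the heat flow is near [v x]; on the rest of $(0,1]$ the comparison in time
    bounds it by its value at 1. *)
Let bound x : exists B : R, forall t, 0 < t -> t <= 1 -> heat t v x <= B.
Proof.
have := cvg_heat vG (@cv x); move/cvgrPdist_le => /(_ 1 ltr01) [d /= d0 dP].
have h1 : 0 <= heat 1 v x by exact: heat_ge0.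
have p0 : 0 <= (1 / d) `^ (n%:R / 2) * heat 1 v x by apply: mulr_ge0 => //; exact: powR_ge0.
exists (v x + 1 + (1 / d) `^ (n%:R / 2) * heat 1 v x) => t t0 t1.
have [td|dt] := ltP t d.
 have tb : ball (0 : R) d t by rewrite -ball_normE /= sub0r normrN gtr0_norm.
 have := dP t tb t0; rewrite ler_norml => /andP[h _].
 apply: (@le_trans _ _ (v x + 1)); first by move: h; rewrite lerBrDr addrC lerBlDr.
 by rewrite lerDl.
apply: (@le_trans _ _ ((1 / d) `^ (n%:R / 2) * heat 1 v x)); last by rewrite lerDr addr_ge0.
apply: le_trans (heat_time v0 vG x t0 t1) _; apply: ler_wpM2r => //.
apply: ge0_ler_powR; rewrite ?nnegrE ?divr_ge0 ?(ltW t0) ?(ltW d0)//.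
by rewrite !div1r lef_pV2 ?posrE.
Qed.

Let JT x t : 0 < t -> (J S (hq F x) t <= (heat t v x)%:E)%E.
Proof. by move=> t0; have [K K0 KE] := rep x; rewrite (KE t t0); apply: leeDr; rewrite lee_fin. Qed.

Let FT x t : 0 < t -> (J S (hq F x) t < +oo)%E.
Proof. by move=> t0; exact: (le_lt_trans (JT x t0) (ltry _)). Qed.

(** The representation bounds [J S] at every positive time by the heat flow, hence uniformly on
    $(0,1]$; [finite_of_shift] carries this to time 0. *)
Let fin x : (J S (hq F x) 0 < +oo)%E.
Proof.
rewrite (J0_lty_int _ s0); have [B BP] := bound x; have GS := Gamma_gt0 s0.
apply: (@finite_of_shift R S (fun s => heat s F x) (msble_heat_time cF x) (fun s => heat_ge0 s x F0) (Gamma S * B)).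
move=> t t0 t1; have e := JE S (fun s => heat s F x) t.
have le1 : (J S (hq F x) t <= B%:E)%E by apply: le_trans (JT x t0) _; rewrite lee_fin BP.
have GS0 : (0 <= (Gamma S)%:E)%E by rewrite lee_fin ltW.
have := lee_wpmul2l GS0 le1; rewrite (_ : hq F x = (fun s => (heat s F x)%:E))// e muleA -EFinM.
by rewrite divff ?gt_eqF// mul1e EFinM.
Qed.

Let P x := pot F S x 0.

Let GPh : GI P /\ forall x t, 0 < t -> heat t P x = pot F S x t.
Proof. exact: (GI_pot cF F0 FG s0 fin FT). Qed.

Let K x := v x - P x.

(** The constant of the representation is identified by letting [t] tend to 0: the heat flow of [v]
    tends to [v x] and the potential to its value at time 0. *)
Let KE x : 0 <= K x /\ forall t, 0 < t -> heat t v x = K x + pot F S x t.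
Proof.
have [k k0 kE] := rep x.
have E t : 0 < t -> heat t v x = k + pot F S x t.
 move=> t0; apply: EFin_inj; rewrite kE// EFinD /pot fineK// ge0_fin_numE; first exact: FT.
 by apply: J_ge0 => // s; rewrite lee_fin; exact: heat_ge0.
have c1 := cvg_heat vG (@cv x).
have c2 : heat t v x @[t --> 0^'+] --> k + P x.
 apply: (@cvg_trans _ (k + pot F S x t @[t --> 0^'+])).
  by apply: near_eq_cvg; near=> t; rewrite E.
 by apply: cvgD; [exact: cvg_cst|exact: (pot_cvg cF F0 FG s0 fin s0 (lexx _))].
have E0 : v x = k + P x by apply: (cvg_unique _ c1 c2); exact: Rhausdorff.
have -> : K x = k by rewrite /K E0 addrK.
by [].
Unshelve. all: by end_near.
Qed.

Let K0 x : 0 <= K x. Proof. by have [] := KE x. Qed.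

Let GK : GI K.
Proof.
have [[mP iP] _] := GPh; have [_ iv] := vG; split; first by rewrite /K; meas.
move=> t x t0; have := integrableB measurableT (iv t x t0) (iP t x t0).
by apply: eq_integrable => // y _ /=; rewrite -EFinB -mulrBr.
Qed.

(** The heat flow of [v] exceeds that of [P] by [K x] at every positive time, because the flow of
    [P] is the same potential at time [t]. *)
Let heatK x t : 0 < t -> heat t K x = K x.
Proof.
move=> t0; have [[_ iP] hP] := GPh; have [_ iv] := vG.
transitivity (heat t v x - heat t P x).
 rewrite /heat -(RintegralB measurableT (iv t x t0) (iP t x t0)).
 by apply: eq_Rintegral => y _; rewrite /K mulrBr.
have e1 := (KE x).2 t t0; have e2 := hP x t t0; rewrite e1 e2; exact: addrK.
Qed.

(** The constant of [gauss_harnack] for [d = 1] when $t \ge |x-x'|^2/4$, in which case the exponent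
    there is at most 1. *)
Let C : R := 2 `^ (n%:R / 2) * expR 1.

(* u = P_t u with u >= 0 for arbitrarily large t makes the constant in the
  Harnack inequality for the Gaussian kernel independent of the points. *)
Let harnack x x' : K x <= C * K x'.
Proof.
pose t : R := Num.max 1 (sqn (x - x') / 4).
have t0 : 0 < t by rewrite lt_max ltr01.
have t4 : sqn (x - x') / 4 <= t by rewrite le_max lexx orbT.
have t20 : 0 < (1 + 1) * t by rewrite mulr_gt0.
rewrite -(heatK x t0) -(heatK x' t20).
have [_ iK] := GK; have i1 := iK t x t0; have i2 := iK _ x' t20.
have i3 : intgr (lebn n) (fun y => C * (gauss ((1 + 1) * t) (x' - y) * K y)).
 exact: (integrableZl measurableT C i2).
have <- : \int[lebn n]_y (C * (gauss ((1 + 1) * t) (x' - y) * K y)) = C * heat ((1 + 1) * t) K x'.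
 by apply: RintegralZl; [exact: measurableT|exact: i2].
apply: (le_Rintegral measurableT i1 i3) => y _; rewrite mulrA; apply: ler_wpM2r; first exact: K0.
apply: le_trans (gauss_harnack x x' y t0 ltr01) _; apply: ler_wpM2r; first exact: gauss_ge0.
rewrite /C; apply: ler_wpM2l; first exact: powR_ge0.
rewrite ler_expR mulr1 ler_pdivrMr ?mulr_gt0// mul1r; lra.
Qed.

Let C0 : 0 < C. Proof. by rewrite mulr_gt0 ?powR_gt0 ?expR_gt0. Qed.

Let P_ge0 x : 0 <= P x. Proof. by apply: pot_ge0. Qed.

(** A positive lower bound on [F] passes to its heat flow, and $s^{S-1}$ is not integrable at
    infinity. The interval of length [c] is chosen so that its contribution is [I + 1], more than
    the whole integral [I]. *)
Let unbounded x d : 0 < d -> ~ (forall y, d <= F y).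
Proof.
move=> d0 Fd; have hd s : 0 < s -> d <= heat s F x.
 move=> sp; have i1 := integrableZl measurableT d (integrable_gauss x sp).
 have [_ iF] := FG; have i2 := iF s x sp.
 have <- : \int[lebn n]_y (d * gauss s (x - y)) = d.
  have -> : \int[lebn n]_y (d * gauss s (x - y)) = d * \int[lebn n]_y gauss s (x - y).
   by apply: RintegralZl; [exact: measurableT|exact: integrable_gauss].
  have <- : heat s (fun=> 1) x = \int[lebn n]_y gauss s (x - y).
   by apply: eq_Rintegral => y _; rewrite mulr1.
  by rewrite heat_one// mulr1.
 apply: (le_Rintegral measurableT i1 i2) => y _; rewrite mulrC; apply: ler_wpM2l => //; exact: gauss_ge0.
have := fin x; rewrite (J0_lty_int _ s0) => fi.
have p0 s : 0 <= pw (S - 1) s * heat s F x by apply: mulr_ge0; [exact: pw_ge0|exact: heat_ge0].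
pose I := fine (\int[leb1]_s (pw (S - 1) s * heat s F x)%:E)%E.
have I0 : (0 <= \int[leb1]_s (pw (S - 1) s * heat s F x)%:E)%E by exact: int_ge0R.
have IE : (\int[leb1]_s (pw (S - 1) s * heat s F x)%:E)%E = I%:E by rewrite /I fineK// (ge0_fin_numE I0).
have i0 : 0 <= I by exact: fine_ge0.
pose b : R := (I + 1) * S / d.
have b0 : 0 < b by rewrite divr_gt0// mulr_gt0// ltr_wpDl.
pose c : R := b `^ S^-1.
have c0 : 0 < c by rewrite powR_gt0.
have cS : c `^ S = b by rewrite /c -powRrM mulVf ?gt_eqF// powRr1 ?ltW.
have mh := msble_heat_time cF x.
have : (\int[leb1]_s (d * (pw (S - 1) s * (s <= c)%R%:R))%:E <= I%:E)%E.
 rewrite -IE; apply: le_intR.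
 - move=> s; apply: mulr_ge0; first exact: ltW.
  by apply: mulr_ge0; [exact: pw_ge0|exact: ler0n].
 - by meas.
 - by meas.
 move=> s; have [sp|sp] := leP s 0; first by rewrite pw0// !mul0r mulr0.
 rewrite mulrCA; apply: ler_wpM2l; first exact: pw_ge0.
 apply: le_trans (hd s sp); rewrite ler_piMr ?(ltW d0)//; by case: (s <= c).
rewrite (ge0_intZl leb1 (ltW d0)); [|by meas|by move=> s; apply: mulr_ge0; [exact: pw_ge0|exact: ler0n]].
rewrite (int_pw_head s0 c0) -EFinM lee_fin cS /b.
have -> : d * ((I + 1) * S / d / S) = I + 1 by field; rewrite !gt_eqF.
lra.
Qed.

Lemma strong_integral :
 ((forall x t1 t2, 0 <= t1 -> t1 <= t2 -> f x t1 <= f x t2) /\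
  (forall t, 0 < t -> exists d : R, 0 < d /\ forall x, d <= f x t)
  \/
  (forall e : R, 0 < e -> exists r : R, forall x, r < enorm x -> `|v x| < e)) ->
 integral_eq (m%:R + g) f v.
Proof.
move=> alt.
have Kz x : K x = 0.
 (* If [K] were positive at one point, Harnack would bound it below by some [k > 0] everywhere, and
    [v] dominates [K]. Decay of [v] then fails at once; under the other alternative, [F] would be
    bounded below by a positive constant. *)
 apply/eqP; rewrite eq_le K0 andbT leNgt; apply/negP => Kx.
 pose k := K x / C; have k0 : 0 < k by rewrite divr_gt0.
 have Kk y : k <= K y by rewrite ler_pdivrMr// mulrC harnack.
 have vk y : k <= v y by apply: le_trans (Kk y) _; rewrite /K gerBl.
 case: alt => [[mono pos]|dec].
  have [d [d0 dP]] := pos k k0; apply: (unbounded x d0) => y.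
  by apply: le_trans (dP y) _; apply: mono; [exact: ltW|exact: vk].
 have [r rP] := dec k k0; have np := dim_gt0 s0 sn.
 have := rP ((`|r| + 1) *: ebase R (Ordinal np)).
 rewrite enormZ enorm_delta mulr1 ger0_norm ?addr_ge0// => /(_ _).
 have rr : r < `|r| + 1 by have := ler_norm r; lra.
 by move=> /(_ rr); rewrite ger0_norm// ltNge vk.
have vJ x : (v x)%:E = J S (hq F x) 0.
 have -> : v x = P x by have := Kz x; rewrite /K => /eqP; rewrite subr_eq0 => /eqP.
 rewrite /P /pot fineK// ge0_fin_numE; first exact: fin.
 by apply: J_ge0 => // s; rewrite lee_fin; exact: heat_ge0.
move=> x; rewrite (riesz_potential (dim_gt0 s0 sn) x s0 sn mF F0) vJ J0E; congr (_ * _)%E.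
apply: eq_integral => t _; have [t0|t0] := leP t 0; first by rewrite pw0// !mul0e.
by rewrite /hq EFin_heat.
Qed.

End strong_solutions.

Theorem theorem3p2 (R : realType) (n m : nat) (g eps : R)
  (f : 'rV[R]_n -> R -> R) :
  0 <= g -> g < 1 ->
  0 < m%:R + g -> m%:R + g < n%:R / 2 ->
  0 < eps -> eps < 1 ->
  (forall x t, 0 <= f x t) ->
  hoelder_loc_f eps f ->
  (* (i) *)
  (forall v : 'rV[R]_n -> R,
     Ls g v ->
     Ckloc (2 * m + Num.truncn (2 * g))%N (2 * g - (Num.truncn (2 * g))%:R + eps) v ->
     integral_eq (m%:R + g) f v ->
     strong_sol m g v (fun x => f x (v x))) /\
  (* (ii) *)
  (forall v : 'rV[R]_n -> R,
     Ls g v ->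
     (forall x, 0 <= v x) ->
     strong_sol m g v (fun x => f x (v x)) ->
     ((forall x t1 t2, 0 <= t1 -> t1 <= t2 -> f x t1 <= f x t2) /\
      (forall t, 0 < t -> exists d : R, 0 < d /\ forall x, d <= f x t)
      \/
      (forall e : R, 0 < e -> exists r : R, forall x, r < enorm x -> `|v x| < e)) ->
     (forall x, 0 <= v x) /\ integral_eq (m%:R + g) f v).
Proof.
move=> g0 g1 s0 sn eps0 _ f0 hf; split=> [v vL vC vI|v vL v0 vS alt].
  exact: (integral_strong g0 g1 s0 sn eps0 f0 hf vL vC vI).
by split=> //; exact: (strong_integral g0 g1 s0 sn f0 vL v0 vS alt).
Qed.
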